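(* Let $G_0\in\mathcal{G}\mathcal{H}_\mu(\overline{\mathbb{R}})^{n\times n}$ have a right factorization $G_0=G_0^-\Lambda G_0^+$ with partial indices $\varkappa_1\ge\dots\ge\varkappa_n$, and let $G_\varepsilon=G_0+\varepsilon N_\varepsilon$, where $N_\varepsilon\in\mathcal{H}_\mu(\overline{\mathbb{R}})^{n\times n}$ is bounded in the $\mathcal{H}_\mu$-norm uniformly for $\varepsilon\in(0,\varepsilon_0)$. Put $M_0=(m_{lj})_{l,j=1}^n:=(G_0^-)^{-1}N_\varepsilon(G_0^+)^{-1}$. Fix $\varepsilon$. Then the boundary value problem $$N^-_{1,\varepsilon}(x)\Lambda^-(x)G_0^+(x)+G_0^-(x)\Lambda^+(x)N^+_{1,\varepsilon}(x)=N_\varepsilon(x),\qquad x\in\mathbb{R},$$ has a solution with $N^\pm_{1,\varepsilon}$ continuous and bounded on $\overline{\Pi^\pm}$ and analytic in $\Pi^\pm$ if and only if all of the following hold: (a) for every $l\le p$ with $\varkappa_l\ge2$ and every $j$: $\int_{-\infty}^{\infty}\frac{m_{lj}(\tau)\,d\tau}{(\tau-i)^{r+1}}=0$ for $r=1,\dots,\varkappa_l-1$; (b) for every $j\ge q+1$ with $\varkappa_j\le-2$ and every $l$: $\int_{-\infty}^{\infty}\frac{m_{lj}(\tau)\,d\tau}{(\tau+i)^{r+1}}=0$ for $r=1,\dots,-\varkappa_j-1$; (c) for every $l\le p$ and $j\ge q+1$: $\int_{-\infty}^{\infty}\frac{m_{lj}(\tau)\,d\tau}{\tau^2+1}=0$.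 Moreover, if (a)–(c) hold for all $\varepsilon\in(0,\varepsilon_0)$, then such solutions $N^\pm_{1,\varepsilon}$ can be chosen bounded uniformly in $\varepsilon$, and there is $\varepsilon_1>0$ such that for $\varepsilon\in(0,\varepsilon_1)$ the matrices $F^-_\varepsilon:=G_0^-+\varepsilon N^-_{1,\varepsilon}(\Lambda^+)^{-1}$ and $F^+_\varepsilon:=G_0^++\varepsilon(\Lambda^-)^{-1}N^+_{1,\varepsilon}$ are analytic in $\Pi^\mp$… more precisely $F^\pm_\varepsilon$ are analytic in $\Pi^\pm$, continuous, bounded and invertible with bounded inverses on $\overline{\Pi^\pm}$, and $\sup_{x\in\mathbb{R}}\|G_\varepsilon(x)-F^-_\varepsilon(x)\Lambda(x)F^+_\varepsilon(x)\|=O(\varepsilon^2)$ as $\varepsilon\to0$; in particular $F^-_\varepsilon\Lambda F^+_\varepsilon$ has the same partial indices as $G_0$.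
   Context: $\Pi^+=\{\operatorname{Im}z>0\}$, $\Pi^-=\{\operatorname{Im}z<0\}$, $b(x)=\frac{x-i}{x+i}$. $\mathcal{H}_\mu(\overline{\mathbb{R}})^{n\times n}$ denotes $n\times n$ matrix functions whose entries are bounded and Hölder continuous with exponent $\mu\in(0,1)$ on $\mathbb{R}\cup\{\infty\}$; $\mathcal{G}$ indicates pointwise invertibility with inverse in the same class. A right factorization of $G_0$ is $G_0=G_0^-\Lambda G_0^+$ on $\mathbb{R}$, with $G_0^\pm,(G_0^\pm)^{-1}$ continuous and bounded on $\overline{\Pi^\pm}$ and analytic in $\Pi^\pm$, and $\Lambda=\operatorname{diag}(b^{\varkappa_1},\dots,b^{\varkappa_n})$, $\varkappa_1\ge\dots\ge\varkappa_n$ integers. Here $p$ is the number of indices with $\varkappa_j>0$ (so $\varkappa_j>0$ iff $j\le p$) and $q$ the number with $\varkappa_j\ge0$ (so $\varkappa_j<0$ iff $j\ge q+1$). $\Lambda^+:=\operatorname{diag}(b^{\max(\varkappa_1,0)},\dots,b^{\max(\varkappa_n,0)})$ and $\Lambda^-:=\operatorname{diag}(b^{\min(\varkappa_1,0)},\dots,b^{\min(\varkappa_n,0)})$, so $\Lambda=\Lambda^+\Lambda^-$. *)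

(* Defs.v *)
From Stdlib Require Import Reals ZArith.
Open Scope R_scope.

Definition Cx := (R * R)%type.
Definition Re (z : Cx) : R := fst z.
Definition Im (z : Cx) : R := snd z.
Definition RtoC (x : R) : Cx := (x, 0).
Definition C0 : Cx := (0, 0).
Definition C1 : Cx := (1, 0).
Definition Ci : Cx := (0, 1).
Definition Cadd (a b : Cx) : Cx := (fst a + fst b, snd a + snd b).
Definition Cneg (a : Cx) : Cx := (- fst a, - snd a).
Definition Csub (a b : Cx) : Cx := Cadd a (Cneg b).
Definition Cmul (a b : Cx) : Cx :=
  (fst a * fst b - snd a * snd b, fst a * snd b + snd a * fst b).
Definition Cscal (r : R) (a : Cx) : Cx := (r * fst a, r * snd a).
Definition Cnorm2 (a : Cx) : R := fst a * fst a + snd a * snd a.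
Definition Cinv (a : Cx) : Cx := (fst a / Cnorm2 a, - snd a / Cnorm2 a).
Definition Cdiv (a b : Cx) : Cx := Cmul a (Cinv b).
Definition Cmod (a : Cx) : R := sqrt (Cnorm2 a).
Fixpoint Cpow (z : Cx) (k : nat) : Cx :=
  match k with O => C1 | S k' => Cmul z (Cpow z k') end.

Definition bfun (z : Cx) : Cx := Cdiv (Csub z Ci) (Cadd z Ci).
Definition bpow (k : Z) (z : Cx) : Cx :=
  if (0 <=? k)%Z then Cpow (bfun z) (Z.to_nat k)
  else Cpow (Cdiv (Cadd z Ci) (Csub z Ci)) (Z.to_nat (- k)).

Definition CMat := nat -> nat -> Cx.
Fixpoint csum (f : nat -> Cx) (n : nat) : Cx :=
  match n with O => C0 | S m => Cadd (csum f m) (f m) end.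
Definition mmul (n : nat) (A B : CMat) : CMat :=
  fun i j => csum (fun k => Cmul (A i k) (B k j)) n.
Definition madd (A B : CMat) : CMat := fun i j => Cadd (A i j) (B i j).
Definition msub (A B : CMat) : CMat := fun i j => Csub (A i j) (B i j).
Definition mscal (r : R) (A : CMat) : CMat := fun i j => Cscal r (A i j).
Definition mdiag (d : nat -> Cx) : CMat :=
  fun i j => if Nat.eqb i j then d i else C0.
Definition mid : CMat := mdiag (fun _ => C1).
Definition meq (n : nat) (A B : CMat) : Prop :=
  forall i j, (i < n)%nat -> (j < n)%nat -> A i j = B i j.
Definition mnorm_le (n : nat) (A : CMat) (K : R) : Prop :=
  forall i j, (i < n)%nat -> (j < n)%nat -> Cmod (A i j) <= K.

Definition Lam (kappa : nat -> Z) (z : Cx) : CMat := mdiag (fun j => bpow (kappa j) z).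
Definition Lamp (kappa : nat -> Z) (z : Cx) : CMat :=
  mdiag (fun j => bpow (Z.max (kappa j) 0) z).
Definition Lamm (kappa : nat -> Z) (z : Cx) : CMat :=
  mdiag (fun j => bpow (Z.min (kappa j) 0) z).
Definition Lamp_inv (kappa : nat -> Z) (z : Cx) : CMat :=
  mdiag (fun j => bpow (- Z.max (kappa j) 0) z).
Definition Lamm_inv (kappa : nat -> Z) (z : Cx) : CMat :=
  mdiag (fun j => bpow (- Z.min (kappa j) 0) z).

Definition UHP (z : Cx) : Prop := 0 < Im z.
Definition LHP (z : Cx) : Prop := Im z < 0.
Definition CUHP (z : Cx) : Prop := 0 <= Im z.
Definition CLHP (z : Cx) : Prop := Im z <= 0.

Definition Cdiff_at (f : Cx -> Cx) (z : Cx) : Prop :=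
  exists d : Cx, forall eps, 0 < eps -> exists delta, 0 < delta /\
    forall h, h <> C0 -> Cmod h < delta ->
      Cmod (Csub (Cdiv (Csub (f (Cadd z h)) (f z)) h) d) < eps.
Definition analytic_on (S : Cx -> Prop) (f : Cx -> Cx) : Prop :=
  forall z, S z -> Cdiff_at f z.
Definition cont_on (S : Cx -> Prop) (f : Cx -> Cx) : Prop :=
  forall z, S z -> forall eps, 0 < eps -> exists delta, 0 < delta /\
    forall w, S w -> Cmod (Csub w z) < delta -> Cmod (Csub (f w) (f z)) < eps.

Definition mat_analytic_on (n : nat) (S : Cx -> Prop) (F : Cx -> CMat) : Prop :=
  forall i j, (i < n)%nat -> (j < n)%nat -> analytic_on S (fun z => F z i j).
Definition mat_cont_on (n : nat) (S : Cx -> Prop) (F : Cx -> CMat) : Prop :=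
  forall i j, (i < n)%nat -> (j < n)%nat -> cont_on S (fun z => F z i j).
Definition mat_bdd_on (n : nat) (S : Cx -> Prop) (F : Cx -> CMat) : Prop :=
  exists K, forall z, S z -> mnorm_le n (F z) K.

Definition plus_class (n : nat) (F : Cx -> CMat) : Prop :=
  mat_cont_on n CUHP F /\ mat_bdd_on n CUHP F /\ mat_analytic_on n UHP F.
Definition minus_class (n : nat) (F : Cx -> CMat) : Prop :=
  mat_cont_on n CLHP F /\ mat_bdd_on n CLHP F /\ mat_analytic_on n LHP F.

Definition inverse_on (n : nat) (S : Cx -> Prop) (F Finv : Cx -> CMat) : Prop :=
  forall z, S z -> meq n (mmul n (F z) (Finv z)) mid /\ meq n (mmul n (Finv z) (F z)) mid.

(* ---------- Hoelder classes on the one-point compactified line ----------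
   Hoelder continuity on R u {oo} is measured in the chordal metric |b(x)-b(y)|. *)
Definition holder_bound (mu K : R) (f : R -> Cx) : Prop :=
  (forall x, Cmod (f x) <= K) /\
  (forall x y, x <> y ->
     Cmod (Csub (f x) (f y)) <= K * Rpower (Cmod (Csub (bfun (RtoC x)) (bfun (RtoC y)))) mu).
Definition Hmu (mu : R) (f : R -> Cx) : Prop := exists K, holder_bound mu K f.
Definition mat_Hmu (n : nat) (mu : R) (F : R -> CMat) : Prop :=
  forall i j, (i < n)%nat -> (j < n)%nat -> Hmu mu (fun x => F x i j).
Definition mat_GHmu (n : nat) (mu : R) (F : R -> CMat) : Prop :=
  mat_Hmu n mu F /\
  exists Finv, mat_Hmu n mu Finv /\
    forall x, meq n (mmul n (F x) (Finv x)) mid /\ meq n (mmul n (Finv x) (F x)) mid.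

Definition right_factorization_with (n : nat) (G : R -> CMat)
    (Gm Gmi Gp Gpi : Cx -> CMat) (kappa : nat -> Z) : Prop :=
  (forall j, (S j < n)%nat -> (kappa (S j) <= kappa j)%Z) /\
  minus_class n Gm /\ minus_class n Gmi /\ inverse_on n CLHP Gm Gmi /\
  plus_class n Gp /\ plus_class n Gpi /\ inverse_on n CUHP Gp Gpi /\
  forall x : R, meq n (G x)
    (mmul n (mmul n (Gm (RtoC x)) (Lam kappa (RtoC x))) (Gp (RtoC x))).

Definition has_right_factorization (n : nat) (G : R -> CMat) (kappa : nat -> Z) : Prop :=
  exists Gm Gmi Gp Gpi, right_factorization_with n G Gm Gmi Gp Gpi kappa.

Definition improper_int_R (f : R -> R) (L : R) : Prop :=
  (forall a b, inhabited (Riemann_integrable f a b)) /\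
  forall eps, 0 < eps -> exists A, forall a b (pr : Riemann_integrable f a b),
    a <= - A -> A <= b -> Rabs (RiemannInt pr - L) < eps.
Definition improper_int (f : R -> Cx) (L : Cx) : Prop :=
  improper_int_R (fun t => fst (f t)) (fst L) /\
  improper_int_R (fun t => snd (f t)) (snd L).

Definition M0 (n : nat) (Gmi Gpi : Cx -> CMat) (Nx : R -> CMat) : R -> CMat :=
  fun x => mmul n (mmul n (Gmi (RtoC x)) (Nx x)) (Gpi (RtoC x)).

(* conditions (a),(b),(c); with 0-based indices, "l <= p" is "kappa l > 0" and
   "j >= q+1" is "kappa j < 0" *)
Definition conds_abc (n : nat) (kappa : nat -> Z) (M : R -> CMat) : Prop :=
  (forall l j, (l < n)%nat -> (j < n)%nat -> (0 < kappa l)%Z -> (2 <= kappa l)%Z ->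
     forall r : nat, (1 <= r)%nat -> (Z.of_nat r <= kappa l - 1)%Z ->
       improper_int (fun t => Cdiv (M t l j) (Cpow (Csub (RtoC t) Ci) (r + 1))) C0) /\
  (forall l j, (l < n)%nat -> (j < n)%nat -> (kappa j < 0)%Z -> (kappa j <= -2)%Z ->
     forall r : nat, (1 <= r)%nat -> (Z.of_nat r <= - kappa j - 1)%Z ->
       improper_int (fun t => Cdiv (M t l j) (Cpow (Cadd (RtoC t) Ci) (r + 1))) C0) /\
  (forall l j, (l < n)%nat -> (j < n)%nat -> (0 < kappa l)%Z -> (kappa j < 0)%Z ->
       improper_int (fun t => Cdiv (M t l j) (RtoC (t * t + 1))) C0).

Definition bvp_solution (n : nat) (kappa : nat -> Z) (Gm Gp : Cx -> CMat)
    (Nx : R -> CMat) (N1m N1p : Cx -> CMat) : Prop :=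
  minus_class n N1m /\ plus_class n N1p /\
  forall x : R, meq n
    (madd (mmul n (mmul n (N1m (RtoC x)) (Lamm kappa (RtoC x))) (Gp (RtoC x)))
          (mmul n (mmul n (Gm (RtoC x)) (Lamp kappa (RtoC x))) (N1p (RtoC x))))
    (Nx x).

Definition Fminus (n : nat) (kappa : nat -> Z) (Gm N1m : Cx -> CMat) (eps : R) : Cx -> CMat :=
  fun z => madd (Gm z) (mscal eps (mmul n (N1m z) (Lamp_inv kappa z))).
Definition Fplus (n : nat) (kappa : nat -> Z) (Gp N1p : Cx -> CMat) (eps : R) : Cx -> CMat :=
  fun z => madd (Gp z) (mscal eps (mmul n (Lamm_inv kappa z) (N1p z))).

Definition Geps (G0 : R -> CMat) (N : R -> R -> CMat) (eps : R) : R -> CMat :=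
  fun x => madd (G0 x) (mscal eps (N eps x)).

(* Main.v *)
From Stdlib Require Import Reals ZArith Lra Lia ClassicalEpsilon FunctionalExtensionality Morphisms.
From Pilot Require Import Defs.
From Coquelicot Require Import Coquelicot.
Open Scope R_scope.

(* Multiplying the boundary value problem by [(G_0^-)^-1] and [(G_0^+)^-1]
   decouples it into the scalar problems [y^- b^-s + b^t y^+ = m_lj], with
   [t = max(kappa_l, 0)] and [s = max(- kappa_j, 0)]. Necessity of the moment
   conditions is Cauchy's theorem: divided by a suitable power, each term on the
   left extends analytically to its half plane and decays quadratically there.
   For sufficiency the Plemelj formula splits [b^-t m_lj] into boundary values
   of a Cauchy integral, and the moment conditions say that multiplication by
   [b^(t+s)] commutes with this splitting up to a constant.

   The Plemelj formula needs [m_lj] to be Hoelder continuous, although the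
   factors [G_0^+-] are only assumed continuous. On the real line
   [(G_0^+)^-1 = G_0^-1 G_0^- Lambda], a combination of Hoelder functions and of
   boundary values from the opposite half plane. In the Cauchy formula for the
   derivative of [(G_0^+)^-1] the latter integrate to zero against
   [1 / (t - z)^2], so constants may be subtracted from the Hoelder functions;
   the resulting bound [O(y^(nu - 1))] on the derivative gives Hoelder
   continuity. The same works for [(G_0^-)^-1].

   Finally [G_eps - F^- Lambda F^+ = - eps^2 N_1^- N_1^+] exactly, and [F^+-]
   are inverted by Neumann series. *)

(** Uniformity in [eps] dictates the form of the estimates: each is linear in the Hoelder constant
    of the datum, with a factor that depends only on the factorization and the exponents and is
    fixed before the datum. For a density that is merely bounded on the line, [m(t) / (t - z)] is
    not integrable. Hence analytic functions are recovered through the Cauchy formula for the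
    derivative, whose kernel decays quadratically, and Cauchy integrals use a kernel normalised at
    [- i]. Bounds at large height also need a rate of convergence of the density at infinity;
    carrying this rate along is what lowers the exponent from [mu] to [mu / 8]. No residue calculus
    occurs: a singularity is removed by a comparison function whose integral is a Poisson integral,
    hence an arctangent. The number of conditions on one entry has a direct meaning. Of the [t + s]
    multiplications by [b], all but the last must commute with the Cauchy integral, each up to one
    moment; the last may leave a constant, since constants are analytic in both half planes. So
    [t + s - 1] moments must vanish: [t - 1] from (a), [s - 1] from (b), and one from (c) when [t]
    and [s] are both positive. *)

Lemma Defs_Cmod z : Defs.Cmod z = Cmod z.
Proof. unfold Defs.Cmod, Cmod, Cnorm2. f_equal. simpl. ring. Qed.

Lemma Defs_Cinv z : Defs.Cinv z = (/ z)%C.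
Proof.
unfold Defs.Cinv, Cinv, Cnorm2.
replace (fst z ^ 2 + snd z ^ 2) with (fst z * fst z + snd z * snd z) by ring.
reflexivity.
Qed.

Lemma Defs_Cdiv z w : Defs.Cdiv z w = (z / w)%C.
Proof. unfold Defs.Cdiv. rewrite Defs_Cinv. reflexivity. Qed.

Lemma Defs_Cpow z n : Defs.Cpow z n = (z ^ n)%C.
Proof.
induction n as [|n IH]; [reflexivity|].
rewrite Cpow_S, <- IH. reflexivity.
Qed.

Lemma half_pos e : 0 < e -> 0 < e / 2.
Proof. lra. Qed.

Lemma Cplus_minus_r (z w : C) : (z + (w - z))%C = w.
Proof. ring. Qed.

Lemma Cmod_sub_sym (z w : C) : Cmod (z - w) = Cmod (w - z).
Proof. rewrite <- Cmod_opp. f_equal. ring. Qed.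

Lemma Cmod_triangle_sub (z w u : C) : Cmod (z - u) <= Cmod (z - w) + Cmod (w - u).
Proof. replace (z - u)%C with ((z - w) + (w - u))%C by ring. apply Cmod_triangle. Qed.

Lemma Cmod_triangle_minus (z w : C) : Cmod (z - w) <= Cmod z + Cmod w.
Proof. unfold Cminus. rewrite <- (Cmod_opp w). apply Cmod_triangle. Qed.

Lemma Cmod_triangle_rev (z w : C) : Cmod z - Cmod w <= Cmod (z - w).
Proof.
assert (H := Cmod_triangle (z - w) w).
replace (z - w + w)%C with z in H by ring. lra.
Qed.

Lemma fst_le_Cmod (z : C) : Rabs (fst z) <= Cmod z.
Proof. exact (Rle_trans _ _ _ (Rmax_l _ _) (Rmax_Cmod z)). Qed.

Lemma snd_le_Cmod (z : C) : Rabs (snd z) <= Cmod z.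
Proof. exact (Rle_trans _ _ _ (Rmax_r _ _) (Rmax_Cmod z)). Qed.

Lemma Cmod_le_sum (z : C) : Cmod z <= Rabs (fst z) + Rabs (snd z).
Proof.
unfold Cmod. apply Rsqr_incr_0_var.
2: generalize (Rabs_pos (fst z)) (Rabs_pos (snd z)); lra.
rewrite Rsqr_sqrt by nra.
unfold Rsqr. rewrite <- !Rsqr_pow2, (Rsqr_abs (fst z)), (Rsqr_abs (snd z)).
unfold Rsqr. generalize (Rabs_pos (fst z)) (Rabs_pos (snd z)); nra.
Qed.

Lemma Cmod_sq (z : C) : Cmod z * Cmod z = fst z ^ 2 + snd z ^ 2.
Proof. unfold Cmod. apply sqrt_sqrt. nra. Qed.

Lemma Cmod_small_0 (z : C) : (forall eps, 0 < eps -> Cmod z <= eps) -> z = RtoC 0.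
Proof.
intros H. apply Cmod_eq_0. destruct (Rle_lt_dec (Cmod z) 0) as [h|h].
- generalize (Cmod_ge_0 z); lra.
- specialize (H (Cmod z / 2)). lra.
Qed.

(** * Limits and complex derivatives *)

(** One notion serves relative neighbourhoods in the plane ([nb]), neighbourhoods on the line
    ([locally]) and growing intervals ([ends]), so the algebra of limits is proved once. *)
Definition tends {T : Type} (F : (T -> Prop) -> Prop) (f : T -> C) (l : C) : Prop :=
  forall eps, 0 < eps -> F (fun x => Cmod (f x - l) < eps).

(** The centre is not removed: for [z] in [S], a limit along [nb S z] equals the value at [z], which
    matches the shape of [cont_on]. *)
Definition nb (S : C -> Prop) (z : C) (P : C -> Prop) : Prop :=
  exists delta, 0 < delta /\ forall w, S w -> Cmod (w - z) < delta -> P w.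

Definition everywhere (z : C) : Prop := True.

Global Instance nb_filter S z : Filter (nb S z).
Proof.
split.
- exists 1. split; [lra|auto].
- intros P Q [d1 [h1 H1]] [d2 [h2 H2]]. exists (Rmin d1 d2). split.
  + apply Rmin_pos; auto.
  + intros w hS hw. split; [apply H1|apply H2]; auto.
    * eapply Rlt_le_trans; [exact hw|apply Rmin_l].
    * eapply Rlt_le_trans; [exact hw|apply Rmin_r].
- intros P Q H [d [h H1]]. exists d. split; auto.
Qed.

Section Tends.
Context {T : Type} (F : (T -> Prop) -> Prop) {FF : Filter F}.

Lemma tends_const c : tends F (fun _ => c) c.
Proof.
intros e he. apply filter_forall. intros x.
replace (c - c)%C with (RtoC 0) by ring. rewrite Cmod_0. exact he.
Qed.

Lemma tends_ext f g l : F (fun x => f x = g x) -> tends F f l -> tends F g l.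
Proof.
intros H Hf e he. generalize (filter_and _ _ H (Hf e he)).
apply filter_imp. intros x [E h]. rewrite <- E. exact h.
Qed.

Lemma tends_eq f l m : l = m -> tends F f l -> tends F f m.
Proof. intros <-. trivial. Qed.

Lemma tends_plus f g l m : tends F f l -> tends F g m -> tends F (fun x => f x + g x)%C (l + m)%C.
Proof.
intros Hf Hg e he.
generalize (filter_and _ _ (Hf _ (half_pos _ he)) (Hg _ (half_pos _ he))).
apply filter_imp. intros x [h1 h2].
replace (f x + g x - (l + m))%C with ((f x - l) + (g x - m))%C by ring.
eapply Rle_lt_trans; [apply Cmod_triangle|lra].
Qed.

Lemma tends_mult f g l m : tends F f l -> tends F g m -> tends F (fun x => f x * g x)%C (l * m)%C.
Proof.
intros Hf Hg e he.
(* With radius [d], the three terms of the expansion add up to at most [d M <= e / 2]; [d <= 1]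
   absorbs the quadratic one. *)
set (M := Cmod l + Cmod m + 1).
assert (hM : 1 <= M) by (unfold M; generalize (Cmod_ge_0 l) (Cmod_ge_0 m); lra).
assert (hd : 0 < Rmin 1 (e / (2 * M))).
{ apply Rmin_pos; [lra|]. apply Rdiv_lt_0_compat; lra. }
generalize (filter_and _ _ (Hf _ hd) (Hg _ hd)).
apply filter_imp. intros x [h1 h2].
replace (f x * g x - l * m)%C with ((f x - l) * (g x - m) + ((f x - l) * m + l * (g x - m)))%C by ring.
assert (hm := Rmin_l 1 (e / (2 * M))). assert (hm' := Rmin_r 1 (e / (2 * M))).
set (d := Rmin 1 (e / (2 * M))) in *.
assert (hdM : d * (2 * M) <= e).
{ apply (Rmult_le_compat_r (2 * M)) in hm'; [|lra].
  unfold Rdiv in hm'. rewrite Rmult_assoc, Rinv_l in hm' by lra. lra. }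
eapply Rle_lt_trans; [apply Cmod_triangle|].
eapply Rle_lt_trans; [apply Rplus_le_compat_l, Cmod_triangle|].
rewrite !Cmod_mult.
assert (k1 := Cmod_ge_0 l). assert (k2 := Cmod_ge_0 m).
assert (k3 := Cmod_ge_0 (f x - l)). assert (k4 := Cmod_ge_0 (g x - m)).
apply Rle_lt_trans with (d * M); [|nra].
apply Rle_trans with (d * 1 + (d * Cmod m + Cmod l * d)); [|unfold M; nra].
repeat apply Rplus_le_compat; apply Rmult_le_compat; lra.
Qed.

Lemma tends_opp f l : tends F f l -> tends F (fun x => - f x)%C (- l)%C.
Proof.
intros Hf e he. generalize (Hf e he). apply filter_imp. intros x h.
replace (- f x - - l)%C with (- (f x - l))%C by ring. rewrite Cmod_opp. exact h.
Qed.

Lemma tends_minus f g l m : tends F f l -> tends F g m -> tends F (fun x => f x - g x)%C (l - m)%C.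
Proof. intros Hf Hg. apply tends_plus; [exact Hf|]. apply tends_opp; exact Hg. Qed.

Lemma tends_inv f l : l <> RtoC 0 -> tends F f l -> tends F (fun x => / f x)%C (/ l)%C.
Proof.
intros hl Hf e he.
assert (hl' := proj1 (Cmod_gt_0 l) hl). set (L := Cmod l) in *.
assert (hd : 0 < Rmin (L / 2) (e * L * L / 2)).
{ apply Rmin_pos; [lra|]. assert (0 < e * L * L) by (repeat apply Rmult_lt_0_compat; lra). lra. }
generalize (Hf _ hd). apply filter_imp. intros x h.
assert (h1 := Rlt_le_trans _ _ _ h (Rmin_l _ _)).
assert (h2 := Rlt_le_trans _ _ _ h (Rmin_r _ _)).
assert (h3 : L / 2 < Cmod (f x)).
{ assert (H := Cmod_triangle_rev l (f x)). rewrite Cmod_sub_sym in H. fold L in H. lra. }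
assert (hf : f x <> RtoC 0) by (apply Cmod_gt_0; lra).
replace (/ f x - / l)%C with (- (f x - l) * / (f x * l))%C by (field; auto).
rewrite Cmod_mult, Cmod_opp, Cmod_inv, Cmod_mult by (apply Cmult_neq_0; auto).
fold L. apply Rlt_div_l.
{ apply Rmult_lt_0_compat; lra. }
eapply Rlt_le_trans; [exact h2|]. assert (0 < e * L) by nra.
replace (e * (Cmod (f x) * L)) with (e * L * Cmod (f x)) by ring. nra.
Qed.

Lemma tends_div f g l m : m <> RtoC 0 -> tends F f l -> tends F g m -> tends F (fun x => f x / g x)%C (l / m)%C.
Proof. intros hm Hf Hg. apply tends_mult; [exact Hf|]. apply tends_inv; auto. Qed.

Lemma tends_pow f l n : tends F f l -> tends F (fun x => f x ^ n)%C (l ^ n)%C.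
Proof.
intros Hf. induction n as [|n IH].
- exact (tends_const (RtoC 1)).
- apply tends_ext with (fun x => f x * f x ^ n)%C.
  + apply filter_forall. intros x. now rewrite Cpow_S.
  + rewrite Cpow_S. apply tends_mult; auto.
Qed.

End Tends.

Lemma tends_unique {T : Type} (F : (T -> Prop) -> Prop) {FF : ProperFilter F} f l m :
  tends F f l -> tends F f m -> l = m.
Proof.
intros Hl Hm. apply Ceq_minus. apply Cmod_small_0. intros e he.
destruct (filter_ex _ (filter_and _ _ (Hl _ (half_pos _ he)) (Hm _ (half_pos _ he)))) as [x [h1 h2]].
rewrite Cmod_sub_sym in h1. assert (H := Cmod_triangle_sub l (f x) m). lra.
Qed.

Lemma tends_bound {T : Type} (F : (T -> Prop) -> Prop) {FF : ProperFilter F} f l K :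
  tends F f l -> F (fun x => Cmod (f x) <= K) -> Cmod l <= K.
Proof.
intros Hl HK. apply Rnot_lt_le. intros h.
assert (h' : 0 < Cmod l - K) by lra.
destruct (filter_ex _ (filter_and _ _ (Hl _ h') HK)) as [x [h1 h2]].
rewrite Cmod_sub_sym in h1. assert (H := Cmod_triangle_rev l (f x)). lra.
Qed.

Lemma tends_nb_id S z : tends (nb S z) (fun w => w) z.
Proof. intros e he. exists e. auto. Qed.

Lemma cont_on_tends S f : cont_on S f <-> forall z, S z -> tends (nb S z) f (f z).
Proof.
split; intros H z hz e he; destruct (H z hz e he) as [d [h1 h2]]; exists d; split; auto;
  intros w hw1 hw2; generalize (h2 w hw1); rewrite ?Defs_Cmod in *; auto.
Qed.

(** Caratheodory's form of the derivative: a slope function continuous at [z]. It avoids division,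
    so the rules of differentiation become identities between slope functions. *)
Definition Cder (f : C -> C) (z d : C) : Prop :=
  exists phi, tends (nb everywhere z) phi d /\
    nb everywhere z (fun w => f w - f z = phi w * (w - z))%C.

Lemma Cder_ext f g z d :
  nb everywhere z (fun w => f w = g w) -> Cder f z d -> Cder g z d.
Proof.
intros H [phi [h1 h2]]. exists phi. split; [exact h1|].
assert (Hz : f z = g z).
{ destruct H as [e [he H]]. apply H; [exact I|].
  replace (z - z)%C with (RtoC 0) by ring. rewrite Cmod_0; exact he. }
generalize (filter_and _ _ H h2). apply filter_imp.
intros w [E1 E2]. rewrite <- E1, <- Hz. exact E2.
Qed.

Lemma Cder_tends f z d : Cder f z d -> tends (nb everywhere z) f (f z).
Proof.
intros [phi [h1 h2]].
apply (tends_ext _ (fun w => f z + phi w * (w - z))%C).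
- revert h2. apply filter_imp. intros w E. rewrite <- E. ring.
- apply (tends_eq _ _ (f z + d * (z - z))%C); [ring|].
  apply tends_plus; [apply nb_filter|apply tends_const, nb_filter|].
  apply tends_mult; [apply nb_filter|exact h1|].
  apply tends_minus; [apply nb_filter|apply tends_nb_id|apply tends_const, nb_filter].
Qed.

Lemma Cder_const c z : Cder (fun _ => c) z (RtoC 0).
Proof.
exists (fun _ => RtoC 0). split; [apply tends_const, nb_filter|].
apply filter_forall. intros w. ring.
Qed.

Lemma Cder_id z : Cder (fun w => w) z (RtoC 1).
Proof.
exists (fun _ => RtoC 1). split; [apply tends_const, nb_filter|].
apply filter_forall. intros w. ring.
Qed.

Lemma Cder_plus f g z d e : Cder f z d -> Cder g z e -> Cder (fun w => f w + g w)%C z (d + e)%C.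
Proof.
intros [p [h1 h2]] [q [h3 h4]]. exists (fun w => p w + q w)%C. split.
- apply tends_plus; auto. apply nb_filter.
- generalize (filter_and _ _ h2 h4). apply filter_imp. intros w [E1 E2].
  replace (f w + g w - (f z + g z))%C with ((f w - f z) + (g w - g z))%C by ring.
  rewrite E1, E2. ring.
Qed.

Lemma Cder_mult f g z d e :
  Cder f z d -> Cder g z e -> Cder (fun w => f w * g w)%C z (d * g z + f z * e)%C.
Proof.
intros Hf Hg. generalize (Cder_tends _ _ _ Hg). intros Hc.
destruct Hf as [p [h1 h2]]. destruct Hg as [q [h3 h4]].
exists (fun w => p w * g w + f z * q w)%C. split.
- apply tends_plus; [apply nb_filter| |]; (apply tends_mult; [apply nb_filter| |]); auto.
  apply tends_const, nb_filter.
- generalize (filter_and _ _ h2 h4). apply filter_imp. intros w [E1 E2].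
  replace (f w * g w - f z * g z)%C with ((f w - f z) * g w + f z * (g w - g z))%C by ring.
  rewrite E1, E2. ring.
Qed.

Lemma tends_neq_0 {T : Type} (F : (T -> Prop) -> Prop) {FF : Filter F} f l :
  l <> RtoC 0 -> tends F f l -> F (fun x => f x <> RtoC 0).
Proof.
intros hl Hf. generalize (Hf (Cmod l) (proj1 (Cmod_gt_0 l) hl)).
apply filter_imp. intros x h E. rewrite E in h.
replace (0 - l)%C with (- l)%C in h by ring. rewrite Cmod_opp in h. lra.
Qed.

Lemma Cder_inv f z d : f z <> RtoC 0 -> Cder f z d -> Cder (fun w => / f w)%C z (- d / (f z * f z))%C.
Proof.
intros hz Hf. generalize (Cder_tends _ _ _ Hf). intros Hc.
destruct Hf as [p [h1 h2]].
exists (fun w => - p w / (f w * f z))%C. split.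
- apply tends_div; [apply nb_filter|apply Cmult_neq_0; auto|apply tends_opp; auto; apply nb_filter|].
  apply tends_mult; [apply nb_filter|exact Hc|]. apply tends_const, nb_filter.
- generalize (filter_and _ _ h2 (tends_neq_0 _ _ _ hz Hc)). apply filter_imp. intros w [E1 E2].
  replace (/ f w - / f z)%C with (- (f w - f z) / (f w * f z))%C by (field; auto).
  rewrite E1. field; auto.
Qed.

Lemma Cder_opp f z d : Cder f z d -> Cder (fun w => - f w)%C z (- d)%C.
Proof.
intros [p [h1 h2]]. exists (fun w => - p w)%C. split.
- apply tends_opp; [apply nb_filter|exact h1].
- revert h2. apply filter_imp. intros w E.
  replace (- f w - - f z)%C with (- (f w - f z))%C by ring. rewrite E. ring.
Qed.

Lemma Cder_minus f g z d e : Cder f z d -> Cder g z e -> Cder (fun w => f w - g w)%C z (d - e)%C.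
Proof. intros Hf Hg. apply Cder_plus; [exact Hf|]. apply Cder_opp; exact Hg. Qed.

Lemma Cder_comp_opp f z d : Cder f (- z)%C d -> Cder (fun w => f (- w)%C) z (- d)%C.
Proof.
intros [p [h1 h2]]. exists (fun w => - p (- w))%C. split.
- intros e he. destruct (h1 e he) as [r [hr H]]. exists r. split; auto. intros w _ hw.
  replace (- p (- w) - - d)%C with (- (p (- w) - d))%C by ring. rewrite Cmod_opp. apply H; [exact I|].
  replace (- w - - z)%C with (- (w - z))%C by ring. rewrite Cmod_opp. exact hw.
- destruct h2 as [r [hr H]]. exists r. split; auto. intros w _ hw.
  rewrite H; [ring|exact I|].
  replace (- w - - z)%C with (- (w - z))%C by ring. rewrite Cmod_opp. exact hw.
Qed.

Lemma Cdiff_at_Cder (f : C -> C) (z : C) : Cdiff_at f z <-> exists d, Cder f z d.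
Proof.
split.
- intros [d H]. exists d.
  (* The slope function is the difference quotient, completed at the centre by the derivative
     itself. *)
  exists (fun w => if Ceq_dec w z then d else (f w - f z) / (w - z))%C. split.
  + intros e he. destruct (H e he) as [r [hr H']]. exists r. split; auto. intros w _ hw.
    destruct (Ceq_dec w z) as [E|E].
    * replace (d - d)%C with (RtoC 0) by ring. rewrite Cmod_0. exact he.
    * generalize (H' (w - z)%C). rewrite !Defs_Cmod, Defs_Cdiv.
      replace (Cadd z (w - z)%C) with w.
      2: { exact (eq_sym (Cplus_minus_r z w)). }
      intros K. apply K; [|exact hw]. apply Cminus_eq_contra. exact E.
  + apply filter_forall. intros w. destruct (Ceq_dec w z) as [E|E].
    * rewrite E. ring.
    * field. apply Cminus_eq_contra. exact E.
- intros [d [p [h1 h2]]]. exists d. intros e he.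
  destruct (filter_and _ _ (h1 e he) h2) as [r [hr H]]. exists r. split; auto.
  cut (forall h : C, h <> RtoC 0 -> Cmod h < r -> Cmod ((f (z + h) - f z) / h - d)%C < e).
  { intros K h hh. rewrite !Defs_Cmod, Defs_Cdiv. exact (K h hh). }
  intros h hh hm. destruct (H (z + h)%C I) as [K1 K2].
  { replace (z + h - z)%C with h by ring. exact hm. }
  rewrite K2. replace (p (z + h) * (z + h - z) / h)%C with (p (z + h))%C; [exact K1|].
  field. exact hh.
Qed.

Lemma Cder_unique f z d e : Cder f z d -> Cder f z e -> d = e.
Proof.
intros [p [h1 h2]] [q [h3 h4]]. apply Ceq_minus, Cmod_small_0. intros r hr.
destruct (filter_and _ _ (filter_and _ _ (h1 _ (half_pos _ hr)) (h3 _ (half_pos _ hr))) (filter_and _ _ h2 h4))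
  as [s [hs H]].
destruct (H (z + RtoC (s / 2))%C I) as [[k1 k2] [k3 k4]].
{ replace (z + RtoC (s / 2) - z)%C with (RtoC (s / 2)) by ring. rewrite Cmod_R, Rabs_pos_eq; lra. }
rewrite k3 in k4.
assert (E : p (z + RtoC (s / 2))%C = q (z + RtoC (s / 2))%C).
{ assert (hz : RtoC (s / 2) <> RtoC 0) by (intros E; apply RtoC_inj in E; lra).
  replace (z + RtoC (s / 2) - z)%C with (RtoC (s / 2)) in k4 by ring.
  replace (p (z + RtoC (s / 2)))%C with (p (z + RtoC (s / 2)) * RtoC (s / 2) / RtoC (s / 2))%C by (field; auto).
  rewrite k4. field; auto. }
rewrite E in k1. rewrite Cmod_sub_sym in k1.
assert (K := Cmod_triangle_sub d (q (z + RtoC (s / 2)))%C e). lra.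
Qed.

(** * Goursat's theorem on rectangles *)

Lemma pair_eq (a b c d : R) : a = c -> b = d -> (a, b) = (c, d).
Proof. intros; f_equal; auto. Qed.

Definition CInt (f : R -> C) (a b : R) : C :=
  (RInt (fun t => fst (f t)) a b, RInt (fun t => snd (f t)) a b).

Definition contI (f : R -> C) (a b : R) : Prop :=
  forall t, a <= t <= b -> tends (locally t) f (f t).

Lemma tends_continuous_fst (f : R -> C) t :
  tends (locally t) f (f t) -> continuous (fun t => fst (f t)) t.
Proof.
intros H. apply filterlim_locally. intros e. generalize (H e (cond_pos e)).
apply filter_imp. intros x h. change (Rabs (fst (f x) - fst (f t)) < e).
exact (Rle_lt_trans _ _ _ (fst_le_Cmod (f x - f t)%C) h).
Qed.

Lemma tends_continuous_snd (f : R -> C) t :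
  tends (locally t) f (f t) -> continuous (fun t => snd (f t)) t.
Proof.
intros H. apply filterlim_locally. intros e. generalize (H e (cond_pos e)).
apply filter_imp. intros x h. change (Rabs (snd (f x) - snd (f t)) < e).
exact (Rle_lt_trans _ _ _ (snd_le_Cmod (f x - f t)%C) h).
Qed.

Lemma tends_RtoC (f : R -> R) t : continuous f t -> tends (locally t) (fun x => RtoC (f x)) (RtoC (f t)).
Proof.
intros H e he. apply filterlim_locally with (eps := mkposreal e he) in H.
revert H. apply filter_imp. intros x h. rewrite <- RtoC_minus, Cmod_R. exact h.
Qed.

Lemma contI_fst f a b : a <= b -> contI f a b -> ex_RInt (fun t => fst (f t)) a b.
Proof.
intros hab H. apply (ex_RInt_continuous (V := R_CompleteNormedModule)).
intros t. rewrite Rmin_left, Rmax_right by auto. intros ht.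
apply tends_continuous_fst, H, ht.
Qed.

Lemma contI_snd f a b : a <= b -> contI f a b -> ex_RInt (fun t => snd (f t)) a b.
Proof.
intros hab H. apply (ex_RInt_continuous (V := R_CompleteNormedModule)).
intros t. rewrite Rmin_left, Rmax_right by auto. intros ht.
apply tends_continuous_snd, H, ht.
Qed.

Lemma contI_sub f a b c d : a <= c -> d <= b -> contI f a b -> contI f c d.
Proof. intros h1 h2 H t ht. apply H. lra. Qed.

Lemma contI_mult f g a b : contI f a b -> contI g a b -> contI (fun t => f t * g t)%C a b.
Proof. intros Hf Hg t ht. apply tends_mult; auto. apply locally_filter. Qed.

Lemma contI_const c a b : contI (fun _ => c) a b.
Proof. intros t ht. apply tends_const, locally_filter. Qed.

Lemma RInt_plus_R (f g : R -> R) a b : ex_RInt f a b -> ex_RInt g a b ->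
  RInt (fun t => f t + g t) a b = RInt f a b + RInt g a b.
Proof. exact (RInt_plus (V := R_CompleteNormedModule) f g a b). Qed.

Lemma RInt_scal_R (f : R -> R) k a b : ex_RInt f a b ->
  RInt (fun t => k * f t) a b = k * RInt f a b.
Proof. exact (RInt_scal (V := R_CompleteNormedModule) f a b k). Qed.

Lemma ex_RInt_scal_R (f : R -> R) k a b : ex_RInt f a b -> ex_RInt (fun t => k * f t) a b.
Proof. exact (ex_RInt_scal (V := R_NormedModule) f a b k). Qed.

Lemma CInt_ext f g a b : a <= b -> (forall t, a <= t <= b -> f t = g t) -> CInt f a b = CInt g a b.
Proof.
intros hab H. unfold CInt. f_equal; apply RInt_ext; intros t; rewrite Rmin_left, Rmax_right by auto;
  intros ht; now rewrite H by lra.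
Qed.

Lemma CInt_plus f g a b : a <= b -> contI f a b -> contI g a b ->
  CInt (fun t => f t + g t)%C a b = (CInt f a b + CInt g a b)%C.
Proof.
intros hab Hf Hg. unfold CInt, Cplus. simpl. f_equal; apply RInt_plus_R; auto using contI_fst, contI_snd.
Qed.

Lemma CInt_scal f c a b : a <= b -> contI f a b ->
  CInt (fun t => c * f t)%C a b = (c * CInt f a b)%C.
Proof.
intros hab Hf. assert (h1 := contI_fst _ _ _ hab Hf). assert (h2 := contI_snd _ _ _ hab Hf).
unfold CInt, Cmult. simpl. apply pair_eq.
- transitivity (RInt (fun t => fst c * fst (f t) + (- snd c) * snd (f t)) a b).
  + apply RInt_ext. intros t _. simpl. lra.
  + rewrite RInt_plus_R by (apply ex_RInt_scal_R; auto). rewrite !RInt_scal_R by auto. ring.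
- rewrite RInt_plus_R by (apply ex_RInt_scal_R; auto). rewrite !RInt_scal_R by auto. ring.
Qed.

Lemma CInt_opp f a b : a <= b -> contI f a b -> CInt (fun t => - f t)%C a b = (- CInt f a b)%C.
Proof.
intros hab Hf. rewrite (CInt_ext _ (fun t => (- (1)) * f t)%C) by (auto; intros; ring).
rewrite CInt_scal by auto. ring.
Qed.

Lemma CInt_minus f g a b : a <= b -> contI f a b -> contI g a b ->
  CInt (fun t => f t - g t)%C a b = (CInt f a b - CInt g a b)%C.
Proof.
intros hab Hf Hg. unfold Cminus. rewrite <- (CInt_opp g) by auto.
apply CInt_plus; auto. intros t ht. apply tends_opp; auto. apply locally_filter.
Qed.

Lemma CInt_Chasles f a b c : a <= b -> b <= c -> contI f a c ->
  (CInt f a b + CInt f b c)%C = CInt f a c.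
Proof.
intros h1 h2 H.
assert (H1 : contI f a b) by (apply (contI_sub f a c); auto; lra).
assert (H2 : contI f b c) by (apply (contI_sub f a c); auto; lra).
unfold CInt, Cplus. simpl. f_equal;
  apply (RInt_Chasles (V := R_CompleteNormedModule)); auto using contI_fst, contI_snd.
Qed.

Lemma CInt_const c a b : CInt (fun _ => c) a b = (RtoC (b - a) * c)%C.
Proof.
unfold CInt. rewrite !RInt_const. unfold Cmult, RtoC, scal; simpl. unfold mult; simpl. f_equal; ring.
Qed.

(* Rotating the value of the integral onto the positive axis reduces the
   bound to real integrands. *)
Lemma CInt_bound f phi a b : a <= b -> contI f a b -> ex_RInt phi a b ->
  (forall t, a <= t <= b -> Cmod (f t) <= phi t) -> Cmod (CInt f a b) <= RInt phi a b.
Proof.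
intros hab Hf Hphi H. set (L := CInt f a b).
destruct (Req_dec (Cmod L) 0) as [E|E].
- rewrite E. apply RInt_ge_0; auto. intros t ht. eapply Rle_trans; [apply Cmod_ge_0|]. apply H. lra.
- assert (hL : 0 < Cmod L) by (generalize (Cmod_ge_0 L); lra).
  apply (Rmult_le_reg_l (Cmod L)); auto.
  assert (E1 : Cmod L * Cmod L = fst (CInt (fun t => Cconj L * f t)%C a b)).
  { rewrite CInt_scal by auto. fold L. rewrite Cmod_sq. unfold Cconj, Cmult. simpl. ring. }
  rewrite E1, <- RInt_scal_R by auto. unfold CInt, fst at 1.
  apply RInt_le; auto.
  + apply (contI_fst (fun t => Cconj L * f t)%C); auto. apply contI_mult; auto. apply contI_const.
  + apply ex_RInt_scal_R; auto.
  + intros t ht. eapply Rle_trans; [apply Rle_abs|]. eapply Rle_trans; [apply fst_le_Cmod|].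
    rewrite Cmod_mult, Cmod_conj. apply Rmult_le_compat_l; [lra|]. apply H. lra.
Qed.

Lemma CInt_bound_const f M a b : a <= b -> contI f a b ->
  (forall t, a <= t <= b -> Cmod (f t) <= M) -> Cmod (CInt f a b) <= M * (b - a).
Proof.
intros hab Hf H. replace (M * (b - a)) with (RInt (fun _ => M) a b).
- apply CInt_bound; auto. apply (ex_RInt_const (V := R_NormedModule)).
- rewrite RInt_const. unfold scal; simpl; unfold mult; simpl. ring.
Qed.

Lemma tends_path_h (f : C -> C) x y :
  tends (nb everywhere (x, y)) f (f (x, y)) -> tends (locally x) (fun t => f (t, y)) (f (x, y)).
Proof.
intros H e he. destruct (H e he) as [d [hd K]]. exists (mkposreal d hd). intros t ht.
apply K; [exact I|]. replace ((t, y) - (x, y))%C with (RtoC (t - x)).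
- rewrite Cmod_R. exact ht.
- unfold RtoC, Cminus, Cplus, Copp. simpl. f_equal; ring.
Qed.

Lemma tends_path_v (f : C -> C) x y :
  tends (nb everywhere (x, y)) f (f (x, y)) -> tends (locally y) (fun t => f (x, t)) (f (x, y)).
Proof.
intros H e he. destruct (H e he) as [d [hd K]]. exists (mkposreal d hd). intros t ht.
apply K; [exact I|]. replace ((x, t) - (x, y))%C with (Ci * RtoC (t - y))%C.
- rewrite Cmod_mult, Cmod_R, Cmod_Ci, Rmult_1_l. exact ht.
- unfold RtoC, Ci, Cmult, Cminus, Cplus, Copp. simpl. f_equal; ring.
Qed.

(** The counterclockwise contour integral over the boundary of the rectangle; [Ci] is the velocity
    on the vertical sides. *)
Definition rect_int (f : C -> C) (a b c d : R) : C :=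
  (CInt (fun t => f (t, c)) a b + Ci * CInt (fun t => f (b, t)) c d
   - CInt (fun t => f (t, d)) a b - Ci * CInt (fun t => f (a, t)) c d)%C.

Definition cont_rect (f : C -> C) (a b c d : R) : Prop :=
  forall x y, a <= x <= b -> c <= y <= d -> tends (nb everywhere (x, y)) f (f (x, y)).

Lemma cont_rect_h f a b c d y : cont_rect f a b c d -> c <= y <= d -> contI (fun t => f (t, y)) a b.
Proof. intros H hy t ht. apply (tends_path_h f t y). apply H; auto. Qed.

Lemma cont_rect_v f a b c d x : cont_rect f a b c d -> a <= x <= b -> contI (fun t => f (x, t)) c d.
Proof. intros H hx t ht. apply (tends_path_v f x t). apply H; auto. Qed.

Lemma cont_rect_sub f a b c d a' b' c' d' :
  a <= a' -> b' <= b -> c <= c' -> d' <= d -> cont_rect f a b c d -> cont_rect f a' b' c' d'.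
Proof. intros h1 h2 h3 h4 H x y hx hy. apply H; lra. Qed.

Lemma rect_int_plus f g a b c d : a <= b -> c <= d -> cont_rect f a b c d -> cont_rect g a b c d ->
  rect_int (fun z => f z + g z)%C a b c d = (rect_int f a b c d + rect_int g a b c d)%C.
Proof.
intros hab hcd Hf Hg. unfold rect_int.
rewrite !(CInt_plus (fun t => f (t, _)) (fun t => g (t, _)))
  by (auto; eapply cont_rect_h; eauto; lra).
rewrite !(CInt_plus (fun t => f (_, t)) (fun t => g (_, t)))
  by (auto; eapply cont_rect_v; eauto; lra).
ring.
Qed.

Lemma rect_int_split_h f a m b c d : a <= m -> m <= b -> c <= d ->
  contI (fun t => f (t, c)) a b -> contI (fun t => f (t, d)) a b ->
  rect_int f a b c d = (rect_int f a m c d + rect_int f m b c d)%C.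
Proof.
intros h1 h2 h3 H1 H2. unfold rect_int.
rewrite <- (CInt_Chasles (fun t => f (t, c)) a m b), <- (CInt_Chasles (fun t => f (t, d)) a m b) by auto.
ring.
Qed.

Lemma rect_int_split_v f a b c m d : a <= b -> c <= m -> m <= d ->
  contI (fun t => f (a, t)) c d -> contI (fun t => f (b, t)) c d ->
  rect_int f a b c d = (rect_int f a b c m + rect_int f a b m d)%C.
Proof.
intros h1 h2 h3 H1 H2. unfold rect_int.
rewrite <- (CInt_Chasles (fun t => f (a, t)) c m d), <- (CInt_Chasles (fun t => f (b, t)) c m d) by auto.
ring.
Qed.

Lemma RInt_id a b : RInt (fun t => t) a b = (b * b - a * a) / 2.
Proof.
apply (is_RInt_unique (V := R_CompleteNormedModule)).
replace ((b * b - a * a) / 2) with (minus (b * b / 2) (a * a / 2)).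
- apply (is_RInt_derive (V := R_CompleteNormedModule) (fun t => t * t / 2) (fun t => t)).
  + intros x _. auto_derive; auto. field.
  + intros x _. apply continuous_id.
- unfold minus, plus, opp; simpl. field.
Qed.

(** Together with the constant case this disposes of affine functions, the part subtracted from [f]
    in Goursat's argument. *)
Lemma rect_int_id a b c d : a <= b -> c <= d -> rect_int (fun z => z) a b c d = RtoC 0.
Proof.
intros hab hcd. unfold rect_int, CInt. simpl.
rewrite !RInt_id, !RInt_const.
unfold scal; simpl; unfold mult; simpl.
unfold Cplus, Cminus, Cmult, Copp, Ci, Cplus, RtoC; simpl. apply pair_eq; field.
Qed.

Lemma rect_int_const k a b c d : rect_int (fun z => k) a b c d = RtoC 0.
Proof. unfold rect_int. rewrite !CInt_const. ring. Qed.

Lemma rect_int_scal f k a b c d : a <= b -> c <= d -> cont_rect f a b c d ->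
  rect_int (fun z => k * f z)%C a b c d = (k * rect_int f a b c d)%C.
Proof.
intros hab hcd Hf. unfold rect_int.
rewrite !(CInt_scal (fun t => f (t, _))) by (auto; eapply cont_rect_h; eauto; lra).
rewrite !(CInt_scal (fun t => f (_, t))) by (auto; eapply cont_rect_v; eauto; lra).
ring.
Qed.

Lemma rect_int_bound f M a b c d : a <= b -> c <= d -> cont_rect f a b c d ->
  (forall x y, a <= x <= b -> c <= y <= d -> Cmod (f (x, y)) <= M) ->
  Cmod (rect_int f a b c d) <= M * (2 * (b - a) + 2 * (d - c)).
Proof.
intros hab hcd Hf H. unfold rect_int.
assert (k1 : Cmod (CInt (fun t => f (t, c)) a b) <= M * (b - a)).
{ apply CInt_bound_const; auto; [eapply cont_rect_h; eauto; lra|]. intros; apply H; lra. }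
assert (k2 : Cmod (CInt (fun t => f (t, d)) a b) <= M * (b - a)).
{ apply CInt_bound_const; auto; [eapply cont_rect_h; eauto; lra|]. intros; apply H; lra. }
assert (k3 : Cmod (CInt (fun t => f (a, t)) c d) <= M * (d - c)).
{ apply CInt_bound_const; auto; [eapply cont_rect_v; eauto; lra|]. intros; apply H; lra. }
assert (k4 : Cmod (CInt (fun t => f (b, t)) c d) <= M * (d - c)).
{ apply CInt_bound_const; auto; [eapply cont_rect_v; eauto; lra|]. intros; apply H; lra. }
eapply Rle_trans; [apply Cmod_triangle_minus|].
rewrite Cmod_mult, Cmod_Ci.
eapply Rle_trans; [apply Rplus_le_compat_r, Cmod_triangle_minus|].
eapply Rle_trans; [apply Rplus_le_compat_r, Rplus_le_compat_r, Cmod_triangle|].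
rewrite Cmod_mult, Cmod_Ci. lra.
Qed.

Lemma nested_intervals (X W : nat -> R) :
  (forall k, 0 <= W k) -> (forall k, X k <= X (S k)) -> (forall k, X (S k) + W (S k) <= X k + W k) ->
  exists l, forall k, X k <= l <= X k + W k.
Proof.
intros H0 H1 H2.
assert (A : forall j k, X k <= X (k + j)%nat /\ X (k + j)%nat + W (k + j)%nat <= X k + W k).
{ induction j as [|j IH]; intros k.
  - rewrite Nat.add_0_r. lra.
  - rewrite Nat.add_succ_r. destruct (IH k). generalize (H1 (k + j)%nat) (H2 (k + j)%nat). lra. }
assert (B : forall j k, X j <= X k + W k).
{ intros j k. destruct (Nat.le_gt_cases j k) as [h|h].
  - destruct (A (k - j)%nat j) as [h1 _]. replace (j + (k - j))%nat with k in h1 by lia.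
    generalize (H0 k). lra.
  - destruct (A (j - k)%nat k) as [_ h1]. replace (k + (j - k))%nat with j in h1 by lia.
    generalize (H0 j). lra. }
destruct (completeness (fun r => exists j, r = X j)) as [l [l1 l2]].
- exists (X 0%nat + W 0%nat). intros r [j ->]. apply B.
- exists (X 0%nat), 0%nat. reflexivity.
- exists l. intros k. split.
  + apply l1. exists k. reflexivity.
  + apply l2. intros r [j ->]. apply B.
Qed.

Lemma pow2_half_bound (k : nat) : / 2 ^ k <= / INR (S k).
Proof.
apply Rinv_le_contravar; [apply lt_0_INR; lia|].
induction k as [|k IH]; [simpl; lra|]. rewrite S_INR. simpl pow.
assert (h : 1 <= INR (S k)) by (rewrite S_INR; generalize (pos_INR k); lra). lra.
Qed.

(** Lower left corner of a quarter that carries at least a fourth of the contour integral, found by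
    testing three quarters in turn. The last branch is a default, justified only in
    [quarter_spec]. *)
Definition quarter (f : C -> C) (w h : R) (p : R * R) : R * R :=
  let J x y := Cmod (rect_int f x (x + w / 2) y (y + h / 2)) in
  let M := Cmod (rect_int f (fst p) (fst p + w) (snd p) (snd p + h)) in
  if Rle_dec M (4 * J (fst p) (snd p)) then p
  else if Rle_dec M (4 * J (fst p + w / 2) (snd p)) then (fst p + w / 2, snd p)
  else if Rle_dec M (4 * J (fst p) (snd p + h / 2)) then (fst p, snd p + h / 2)
  else (fst p + w / 2, snd p + h / 2).

Lemma quarter_spec f w h p : 0 <= w -> 0 <= h ->
  cont_rect f (fst p) (fst p + w) (snd p) (snd p + h) ->
  let q := quarter f w h p in
  fst p <= fst q /\ fst q + w / 2 <= fst p + w /\ snd p <= snd q /\ snd q + h / 2 <= snd p + h /\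
  Cmod (rect_int f (fst p) (fst p + w) (snd p) (snd p + h)) <=
    4 * Cmod (rect_int f (fst q) (fst q + w / 2) (snd q) (snd q + h / 2)).
Proof.
intros hw hh Hc. destruct p as [x y]. unfold quarter. simpl in *.
assert (E : rect_int f x (x + w) y (y + h) =
  (rect_int f x (x + w / 2) y (y + h / 2) + rect_int f (x + w / 2) (x + w / 2 + w / 2) y (y + h / 2)
  + (rect_int f x (x + w / 2) (y + h / 2) (y + h / 2 + h / 2)
  + rect_int f (x + w / 2) (x + w / 2 + w / 2) (y + h / 2) (y + h / 2 + h / 2)))%C).
{ replace (x + w / 2 + w / 2) with (x + w) by field. replace (y + h / 2 + h / 2) with (y + h) by field.
  rewrite (rect_int_split_v f x (x + w) y (y + h / 2) (y + h)); try lra.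
  2, 3 : eapply cont_rect_v; eauto; lra.
  rewrite (rect_int_split_h f x (x + w / 2) (x + w) y (y + h / 2)); try lra.
  2, 3 : eapply cont_rect_h; eauto; lra.
  rewrite (rect_int_split_h f x (x + w / 2) (x + w) (y + h / 2) (y + h)); try lra.
  2, 3 : eapply cont_rect_h; eauto; lra.
  reflexivity. }
destruct Rle_dec as [k1|k1]; [simpl; repeat split; lra|].
destruct Rle_dec as [k2|k2]; [simpl; repeat split; lra|].
destruct Rle_dec as [k3|k3]; [simpl; repeat split; lra|].
simpl. repeat split; try lra.
rewrite E in *.
eapply Rle_trans; [apply Cmod_triangle|].
eapply Rle_trans; [apply Rplus_le_compat; apply Cmod_triangle|].
(* If each of the first three quarters carries less than a fourth of the total, the triangle
   inequality leaves more than a fourth to the last. *)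
assert (k0 : forall a b c d : C, ~ Cmod (a + b + (c + d)) <= 4 * Cmod a -> ~ Cmod (a + b + (c + d)) <= 4 * Cmod b ->
  ~ Cmod (a + b + (c + d)) <= 4 * Cmod c -> Cmod a + Cmod b + (Cmod c + Cmod d) <= 4 * Cmod d).
{ intros a b c d i1 i2 i3.
  assert (h1 := Cmod_triangle (a + b) (c + d)).
  assert (h2 := Cmod_triangle a b). assert (h3 := Cmod_triangle c d). lra. }
apply k0; auto.
Qed.

Fixpoint corner (f : C -> C) (x y w h : R) (k : nat) : R * R :=
  match k with
  | O => (x, y)
  | S k' => quarter f (w / 2 ^ k') (h / 2 ^ k') (corner f x y w h k')
  end.

Lemma corner_spec f x y w h k : 0 <= w -> 0 <= h -> cont_rect f x (x + w) y (y + h) ->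
  let p := corner f x y w h k in
  x <= fst p /\ fst p + w / 2 ^ k <= x + w /\ y <= snd p /\ snd p + h / 2 ^ k <= y + h /\
  Cmod (rect_int f x (x + w) y (y + h)) <=
    4 ^ k * Cmod (rect_int f (fst p) (fst p + w / 2 ^ k) (snd p) (snd p + h / 2 ^ k)).
Proof.
intros hw hh Hc. simpl. induction k as [|k IH].
- simpl. replace (w / 1) with w by field. replace (h / 1) with h by field. repeat split; lra.
- destruct IH as (i1 & i2 & i3 & i4 & i5).
  assert (hk : 0 < 2 ^ k) by (apply pow_lt; lra).
  assert (hwk : 0 <= w / 2 ^ k) by (apply Rdiv_le_0_compat; auto).
  assert (hhk : 0 <= h / 2 ^ k) by (apply Rdiv_le_0_compat; auto).
  destruct (quarter_spec f (w / 2 ^ k) (h / 2 ^ k) (corner f x y w h k)) as (j1 & j2 & j3 & j4 & j5); auto.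
  { eapply cont_rect_sub; [| | | |exact Hc]; lra. }
  simpl corner.
  replace (w / 2 ^ S k) with (w / 2 ^ k / 2) by (simpl; field; lra).
  replace (h / 2 ^ S k) with (h / 2 ^ k / 2) by (simpl; field; lra).
  repeat split; try lra.
  eapply Rle_trans; [exact i5|]. simpl pow. rewrite (Rmult_comm 4), Rmult_assoc.
  apply Rmult_le_compat_l; [apply pow_le; lra|exact j5].
Qed.

Lemma Cder_cont_rect f a b c d :
  (forall x y, a <= x <= b -> c <= y <= d -> exists l, Cder f (x, y) l) -> cont_rect f a b c d.
Proof. intros H x y hx hy. destruct (H x y hx hy) as [l hl]. exact (Cder_tends _ _ _ hl). Qed.

(** Bisection loses a factor 4 per step, while diameter times perimeter shrinks by the same factor
    4. At the common point of the nested rectangles [f] differs from an affine function by at most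
    [e] times the diameter, so the original integral is at most a fixed multiple of [e]. *)
Lemma goursat_aux f x y w h : 0 <= w -> 0 <= h ->
  (forall u v, x <= u <= x + w -> y <= v <= y + h -> exists l, Cder f (u, v) l) ->
  rect_int f x (x + w) y (y + h) = RtoC 0.
Proof.
intros hw hh Hd. assert (Hc := Cder_cont_rect _ _ _ _ _ Hd).
set (p := corner f x y w h).
assert (Hp := fun k => corner_spec f x y w h k hw hh Hc). fold p in Hp. simpl in Hp.
assert (h2 : forall k, 0 < 2 ^ k) by (intros; apply pow_lt; lra).
assert (Hq : forall k, fst (p k) <= fst (p (S k)) /\ fst (p (S k)) + w / 2 ^ S k <= fst (p k) + w / 2 ^ k /\
  snd (p k) <= snd (p (S k)) /\ snd (p (S k)) + h / 2 ^ S k <= snd (p k) + h / 2 ^ k).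
{ intros k. destruct (Hp k) as (i1 & i2 & i3 & i4 & _).
  assert (k2 := h2 k).
  assert (hwk : 0 <= w / 2 ^ k) by (apply Rdiv_le_0_compat; auto).
  assert (hhk : 0 <= h / 2 ^ k) by (apply Rdiv_le_0_compat; auto).
  destruct (quarter_spec f (w / 2 ^ k) (h / 2 ^ k) (p k)) as (j1 & j2 & j3 & j4 & _); auto.
  { eapply cont_rect_sub; [| | | |exact Hc]; lra. }
  unfold p in *. simpl corner.
  replace (w / 2 ^ S k) with (w / 2 ^ k / 2) by (simpl; field; lra).
  replace (h / 2 ^ S k) with (h / 2 ^ k / 2) by (simpl; field; lra).
  auto. }
destruct (nested_intervals (fun k => fst (p k)) (fun k => w / 2 ^ k)) as [u hu].
{ intros k. apply Rdiv_le_0_compat; auto. }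
1, 2 : intros k; apply Hq.
destruct (nested_intervals (fun k => snd (p k)) (fun k => h / 2 ^ k)) as [v hv].
{ intros k. apply Rdiv_le_0_compat; auto. }
1, 2 : intros k; apply Hq.
destruct (Hd u v) as [d Hder].
{ generalize (hu 0%nat); unfold p; simpl; lra. }
{ generalize (hv 0%nat); unfold p; simpl; lra. }
set (S := w + h).
cut (forall e, 0 < e -> Cmod (rect_int f x (x + w) y (y + h)) <= e * (2 * S * S)).
{ intros K. apply Cmod_small_0. intros e he.
  assert (hS : 0 < 2 * S * S + 1) by (unfold S; nra).
  eapply Rle_trans; [apply (K (e / (2 * S * S + 1)))|].
  - apply Rdiv_lt_0_compat; auto.
  - unfold Rdiv. rewrite Rmult_assoc. rewrite <- (Rmult_1_r e) at 2. apply Rmult_le_compat_l; [lra|].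
    apply (Rmult_le_reg_l (2 * S * S + 1)); auto. rewrite <- Rmult_assoc, Rinv_r by lra. lra. }
intros e he. destruct Hder as [phi [t1 t2]].
destruct (filter_and _ _ (t1 e he) t2) as [dl [hdl K]].
destruct (INR_archimed dl S hdl) as [k hk].
destruct (Hp k) as (i1 & i2 & i3 & i4 & i5).
assert (k2 := h2 k).
set (wk := w / 2 ^ k) in *. set (hk' := h / 2 ^ k) in *.
assert (hwk : 0 <= wk) by (apply Rdiv_le_0_compat; auto).
assert (hhk : 0 <= hk') by (apply Rdiv_le_0_compat; auto).
set (r := fun z => (f z + - (d * z + (f (u, v) - d * (u, v))))%C).
assert (Hck : cont_rect f (fst (p k)) (fst (p k) + wk) (snd (p k)) (snd (p k) + hk')).
{ eapply cont_rect_sub; [| | | |exact Hc]; lra. }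
set (a := fst (p k)) in *. set (b := a + wk) in *. set (c := snd (p k)) in *. set (g := c + hk') in *.
assert (hab : a <= b) by (unfold b; lra). assert (hcg : c <= g) by (unfold g; lra).
assert (Hid : cont_rect (fun z => z) a b c g) by (intros s t _ _; apply tends_nb_id).
assert (Hcst : forall q, cont_rect (fun _ => q) a b c g) by (intros q s t _ _; apply tends_const, nb_filter).
assert (Hdid : cont_rect (fun z => d * z)%C a b c g).
{ intros s t _ _. apply tends_mult; [apply nb_filter|apply tends_const, nb_filter|apply tends_nb_id]. }
assert (Haff : cont_rect (fun z => - (1) * (d * z + (f (u, v) - d * (u, v))))%C a b c g).
{ intros s t hs ht. apply tends_mult; [apply nb_filter|apply tends_const, nb_filter|].
  apply tends_plus; [apply nb_filter|apply Hdid; auto|apply tends_const, nb_filter]. }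
(* The affine part of [f] at [(u, v)] integrates to zero, so only the remainder of the linearisation
   counts. *)
assert (Er : rect_int f a b c g = rect_int (fun z => f z + - (1) * (d * z + (f (u, v) - d * (u, v))))%C a b c g).
{ rewrite (rect_int_plus f) by auto. rewrite (rect_int_scal (fun z => d * z + (f (u, v) - d * (u, v)))%C); auto.
  2: { intros s t hs ht. apply tends_plus; [apply nb_filter|apply Hdid; auto|apply tends_const, nb_filter]. }
  rewrite (rect_int_plus (fun z => d * z)%C) by auto.
  rewrite (rect_int_scal (fun z => z)) by auto. rewrite rect_int_id, rect_int_const by auto. ring. }
assert (HS : (wk + hk') * 2 ^ k = S) by (unfold wk, hk', S; field; lra).
assert (hsmall : wk + hk' < dl).
{ apply (Rmult_lt_reg_r (2 ^ k)); auto. rewrite HS.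
  assert (q := pow2_half_bound k). apply Rinv_le_contravar in q.
  2: { apply Rinv_0_lt_compat; auto. }
  rewrite !Rinv_inv, S_INR in q. nra. }
assert (B : Cmod (rect_int f a b c g) <= e * (wk + hk') * (2 * (b - a) + 2 * (g - c))).
{ rewrite Er. apply rect_int_bound; auto.
  { intros s t hs ht. apply tends_plus; [apply nb_filter|apply Hck; auto|apply Haff; auto]. }
  intros s t hs ht.
  assert (hd : Cmod ((s, t) - (u, v))%C <= wk + hk').
  { eapply Rle_trans; [apply Cmod_le_sum|].
    assert (q1 := hu k). assert (q2 := hv k). cbv beta in q1, q2. fold a wk b in q1. fold c hk' g in q2.
    apply Rplus_le_compat; simpl; apply Rabs_le; unfold b, g in *; lra. }
  destruct (K (s, t) I) as [K1 K2]; [lra|].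
  replace (f (s, t) + - (1) * (d * (s, t) + (f (u, v) - d * (u, v))))%C
    with ((phi (s, t) - d) * ((s, t) - (u, v)))%C.
  - rewrite Cmod_mult. apply Rmult_le_compat; auto using Cmod_ge_0. lra.
  - transitivity ((f (s, t) - f (u, v)) - d * ((s, t) - (u, v)))%C; [rewrite K2|]; ring. }
eapply Rle_trans; [exact i5|].
apply Rle_trans with (4 ^ k * (e * (wk + hk') * (2 * (wk + hk')))).
- apply Rmult_le_compat_l; [apply pow_le; lra|]. unfold b, g in *.
  replace (2 * (wk + hk')) with (2 * (a + wk - a) + 2 * (c + hk' - c)) by ring. exact B.
- replace (4 ^ k) with (2 ^ k * 2 ^ k) by (rewrite <- Rpow_mult_distr; f_equal; ring).
  rewrite <- HS. right. ring.
Qed.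

Lemma goursat f a b c d : a <= b -> c <= d ->
  (forall x y, a <= x <= b -> c <= y <= d -> exists l, Cder f (x, y) l) ->
  rect_int f a b c d = RtoC 0.
Proof.
intros hab hcd H. assert (K := goursat_aux f a c (b - a) (d - c)).
replace (a + (b - a)) with b in K by ring. replace (c + (d - c)) with d in K by ring.
apply K; auto; lra.
Qed.

(** Around [p] a square of half side [s] is cut out; the four rectangles around it fall under
    Goursat. On its boundary [|f| <= e / (8 s)], and each side has length [2 s], which gives [e / 4]
    per side. The value of [f] at [p] is irrelevant, as it must be for quotients that are singular
    there. *)
Lemma goursat_except f a b c d (p : C) :
  a < fst p < b -> c < snd p < d ->
  (forall x y, a <= x <= b -> c <= y <= d -> (x, y) <> p -> exists l, Cder f (x, y) l) ->
  (forall e, 0 < e -> nb everywhere p (fun z => Cmod (f z) * Cmod (z - p) <= e)) ->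
  rect_int f a b c d = RtoC 0.
Proof.
intros hp1 hp2 Hd Hs. destruct p as [u v]. simpl in hp1, hp2.
apply Cmod_small_0. intros e he.
destruct (Hs (e / 8)) as [r [hr K]]; [lra|].
set (m := Rmin (Rmin (u - a) (b - u)) (Rmin (v - c) (d - v))).
assert (hm : 0 < m) by (unfold m; repeat apply Rmin_pos; lra).
assert (hm1 : m <= u - a /\ m <= b - u /\ m <= v - c /\ m <= d - v).
{ unfold m. generalize (Rmin_l (u - a) (b - u)) (Rmin_r (u - a) (b - u)) (Rmin_l (v - c) (d - v)) (Rmin_r (v - c) (d - v))
   (Rmin_l (Rmin (u - a) (b - u)) (Rmin (v - c) (d - v))) (Rmin_r (Rmin (u - a) (b - u)) (Rmin (v - c) (d - v))). lra. }
(* The first bound keeps the square inside the rectangle. Points of the square lie within [2 s] of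
   [p], so the second keeps them in the neighbourhood where [|f| |z - p|] is small. *)
set (s := Rmin (m / 2) (r / 4)).
assert (hs : 0 < s) by (unfold s; apply Rmin_pos; lra).
assert (hs1 : s <= m / 2) by apply Rmin_l. assert (hs2 : s <= r / 4) by apply Rmin_r.
assert (Hne : forall x y, x <> u \/ y <> v -> ((x, y) : C) <> (u, v)) by (intros x y [q|q] E; injection E; auto).
assert (Hcont : forall x y, a <= x <= b -> c <= y <= d -> x <> u \/ y <> v -> tends (nb everywhere (x, y)) f (f (x, y))).
{ intros x y hx hy q. destruct (Hd x y hx hy (Hne _ _ q)) as [l hl]. exact (Cder_tends _ _ _ hl). }
rewrite (rect_int_split_h f a (u - s) b); try lra.
2, 3 : intros t ht; apply (tends_path_h f t); apply Hcont; try lra; right; lra.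
rewrite (rect_int_split_h f (u - s) (u + s) b); try lra.
2, 3 : intros t ht; apply (tends_path_h f t); apply Hcont; try lra; right; lra.
rewrite (rect_int_split_v f (u - s) (u + s) c (v - s) d); try lra.
2, 3 : intros t ht; apply (tends_path_v f); apply Hcont; try lra; left; lra.
rewrite (rect_int_split_v f (u - s) (u + s) (v - s) (v + s) d); try lra.
2, 3 : intros t ht; apply (tends_path_v f); apply Hcont; try lra; left; lra.
rewrite (goursat f a (u - s)); try lra.
2 : intros x y hx hy; apply Hd; try lra; apply Hne; left; lra.
rewrite (goursat f (u + s) b); try lra.
2 : intros x y hx hy; apply Hd; try lra; apply Hne; left; lra.
rewrite (goursat f (u - s) (u + s) c (v - s)); try lra.
2 : intros x y hx hy; apply Hd; try lra; apply Hne; right; lra.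
rewrite (goursat f (u - s) (u + s) (v + s) d); try lra.
2 : intros x y hx hy; apply Hd; try lra; apply Hne; right; lra.
rewrite !Cplus_0_l, !Cplus_0_r.
assert (Hb : forall x y, u - s <= x <= u + s -> v - s <= y <= v + s -> (x = u - s \/ x = u + s) \/ (y = v - s \/ y = v + s) ->
  Cmod (f (x, y)) <= e / (8 * s)).
{ intros x y hx hy hxy.
  assert (q1 : s <= Cmod ((x, y) - (u, v))%C).
  { destruct hxy as [hxy|hxy].
    - eapply Rle_trans; [|apply fst_le_Cmod]. simpl. unfold Rabs. destruct Rcase_abs; lra.
    - eapply Rle_trans; [|apply snd_le_Cmod]. simpl. unfold Rabs. destruct Rcase_abs; lra. }
  assert (q2 : Cmod ((x, y) - (u, v))%C < r).
  { eapply Rle_lt_trans; [apply Cmod_le_sum|]. simpl.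
    assert (Rabs (x + - u) <= s) by (apply Rabs_le; lra).
    assert (Rabs (y + - v) <= s) by (apply Rabs_le; lra). lra. }
  apply Rle_div_r; [lra|]. generalize (K (x, y) I q2) (Cmod_ge_0 (f (x, y))). intros; nra. }
assert (Hc : forall x y, u - s <= x <= u + s -> v - s <= y <= v + s -> (x = u - s \/ x = u + s) \/ (y = v - s \/ y = v + s) ->
  tends (nb everywhere (x, y)) f (f (x, y))).
{ intros x y hx hy hxy. apply Hcont; lra. }
assert (E : forall t1 t2 t3 t4 : C, Cmod t1 <= e / 4 -> Cmod t2 <= e / 4 -> Cmod t3 <= e / 4 -> Cmod t4 <= e / 4 ->
  Cmod (t1 + Ci * t2 - t3 - Ci * t4) <= e).
{ intros t1 t2 t3 t4 i1 i2 i3 i4.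
  eapply Rle_trans; [apply Cmod_triangle_minus|]. rewrite Cmod_mult, Cmod_Ci.
  eapply Rle_trans; [apply Rplus_le_compat_r, Cmod_triangle_minus|].
  eapply Rle_trans; [apply Rplus_le_compat_r, Rplus_le_compat_r, Cmod_triangle|].
  rewrite Cmod_mult, Cmod_Ci. lra. }
assert (E8 : e / 4 = e / (8 * s) * (u + s - (u - s))) by (field; lra).
assert (E9 : e / 4 = e / (8 * s) * (v + s - (v - s))) by (field; lra).
unfold rect_int. apply E; [rewrite E8|rewrite E9|rewrite E8|rewrite E9];
  apply CInt_bound_const; try lra; intros t ht.
1, 5 : apply (tends_path_h f t); apply Hc; lra.
2, 5 : apply (tends_path_v f _ t); apply Hc; lra.
all : apply Hb; lra.
Qed.

(** * Improper integrals over the real line *)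

Lemma Rpower_pos a c : 0 < Rpower a c.
Proof. apply exp_pos. Qed.

Lemma Rpower_le_neg a b c : 0 < a <= b -> c <= 0 -> Rpower b c <= Rpower a c.
Proof.
intros h hc. replace c with (- - c) by ring. rewrite !(Rpower_Ropp _ (- c)).
apply Rinv_le_contravar; [apply Rpower_pos|]. apply Rle_Rpower_l; lra.
Qed.

Lemma Rpower_sub a c d : Rpower a c = Rpower a (c - d) * Rpower a d.
Proof. rewrite <- Rpower_plus. f_equal. ring. Qed.

Lemma is_derive_Rpower a c : 0 < a -> is_derive (fun x => Rpower x c) a (c * Rpower a (c - 1)).
Proof. intros h. apply is_derive_Reals. apply derivable_pt_lim_power. exact h. Qed.

Lemma continuous_Rpower_comp (f : R -> R) c t : 0 < f t -> continuous f t -> continuous (fun x => Rpower (f x) c) t.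
Proof.
intros h Hf. apply (continuous_comp f (fun x => Rpower x c)); auto.
apply (ex_derive_continuous (K := R_AbsRing) (V := R_NormedModule)).
exists (c * Rpower (f t) (c - 1)). apply is_derive_Rpower. exact h.
Qed.

(** Up to a constant this dominates [|t - z|^(- 1 - s)] for [z = x + i y]. All integral estimates
    reduce to it, since its integral is at most [(2 / s) y^(- s)] whatever [x] is. *)
Definition bump (s y x t : R) : R := Rpower (y + Rabs (t - x)) (- 1 - s).

Lemma bump_arg_pos y x t : 0 < y -> 0 < y + Rabs (t - x).
Proof. generalize (Rabs_pos (t - x)); lra. Qed.

Lemma continuous_abs_shift x t : continuous (fun t => Rabs (t - x)) t.
Proof.
apply (continuous_comp (fun t => t - x) Rabs); [|apply continuous_Rabs].
apply (continuous_minus (V := R_NormedModule)); [apply continuous_id|apply continuous_const].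
Qed.

Lemma continuous_bump s y x t : 0 < y -> continuous (bump s y x) t.
Proof.
intros hy. apply continuous_Rpower_comp; [apply bump_arg_pos; auto|].
apply (continuous_plus (V := R_NormedModule)); [apply continuous_const|apply continuous_abs_shift].
Qed.

Lemma ex_RInt_cont (f : R -> R) a b : (forall t, continuous f t) -> ex_RInt f a b.
Proof. intros H. apply (ex_RInt_continuous (V := R_CompleteNormedModule)). intros; apply H. Qed.

Lemma RInt_bump_right s y x a b : 0 < s -> 0 < y -> x <= a -> a <= b -> RInt (bump s y x) a b <= Rpower y (- s) / s.
Proof.
intros hs hy hxa hab.
assert (E : RInt (bump s y x) a b = - Rpower (y + (b - x)) (- s) / s - - Rpower (y + (a - x)) (- s) / s).
{ rewrite (RInt_ext _ (fun t => Rpower (y + (t - x)) (- 1 - s))).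
  2: { intros t ht. rewrite Rmin_left, Rmax_right in ht by auto. unfold bump. rewrite Rabs_pos_eq by lra. reflexivity. }
  apply (is_RInt_unique (V := R_CompleteNormedModule)).
  apply (is_RInt_derive (V := R_CompleteNormedModule) (fun t => - Rpower (y + (t - x)) (- s) / s)).
  - intros t ht. rewrite Rmin_left, Rmax_right in ht by auto.
    assert (H := is_derive_Rpower (y + (t + - x)) (- s) ltac:(lra)).
    auto_derive.
    + eexists. exact H.
    + change (fun x0 : R => Rpower x0 (- s)) with (fun x0 : R_AbsRing => Rpower x0 (- s)).
      rewrite (is_derive_unique _ _ _ H).
      replace (- s - 1) with (- 1 - s) by ring. replace (t + - x) with (t - x) by ring. field. lra.
  - intros t ht. rewrite Rmin_left, Rmax_right in ht by auto.
    apply (continuous_Rpower_comp (fun t => y + (t - x))); [lra|].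
    apply (continuous_plus (V := R_NormedModule)); [apply continuous_const|].
    apply (continuous_minus (V := R_NormedModule)); [apply continuous_id|apply continuous_const]. }
rewrite E.
assert (h1 := Rpower_pos (y + (b - x)) (- s)).
assert (h2 : Rpower (y + (a - x)) (- s) <= Rpower y (- s)) by (apply Rpower_le_neg; lra).
unfold Rdiv. assert (hi : 0 < / s) by (apply Rinv_0_lt_compat; auto). nra.
Qed.

Lemma RInt_bump_left s y x a b : 0 < s -> 0 < y -> b <= x -> a <= b -> RInt (bump s y x) a b <= Rpower y (- s) / s.
Proof.
intros hs hy hxa hab.
assert (E : RInt (bump s y x) a b = Rpower (y + (x - b)) (- s) / s - Rpower (y + (x - a)) (- s) / s).
{ rewrite (RInt_ext _ (fun t => Rpower (y + (x - t)) (- 1 - s))).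
  2: { intros t ht. rewrite Rmin_left, Rmax_right in ht by auto. unfold bump.
       rewrite Rabs_minus_sym, Rabs_pos_eq by lra. reflexivity. }
  apply (is_RInt_unique (V := R_CompleteNormedModule)).
  apply (is_RInt_derive (V := R_CompleteNormedModule) (fun t => Rpower (y + (x - t)) (- s) / s)).
  - intros t ht. rewrite Rmin_left, Rmax_right in ht by auto.
    assert (H := is_derive_Rpower (y + (x + - t)) (- s) ltac:(lra)).
    auto_derive.
    + eexists. exact H.
    + change (fun x0 : R => Rpower x0 (- s)) with (fun x0 : R_AbsRing => Rpower x0 (- s)).
      rewrite (is_derive_unique _ _ _ H).
      replace (- s - 1) with (- 1 - s) by ring. replace (x + - t) with (x - t) by ring. field. lra.
  - intros t ht. rewrite Rmin_left, Rmax_right in ht by auto.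
    apply (continuous_Rpower_comp (fun t => y + (x - t))); [lra|].
    apply (continuous_plus (V := R_NormedModule)); [apply continuous_const|].
    apply (continuous_minus (V := R_NormedModule)); [apply continuous_const|apply continuous_id]. }
rewrite E.
assert (h1 := Rpower_pos (y + (x - a)) (- s)).
assert (h2 : Rpower (y + (x - b)) (- s) <= Rpower y (- s)) by (apply Rpower_le_neg; lra).
unfold Rdiv. assert (hi : 0 < / s) by (apply Rinv_0_lt_compat; auto). nra.
Qed.

Lemma RInt_bump s y x a b : 0 < s -> 0 < y -> a <= b -> RInt (bump s y x) a b <= 2 / s * Rpower y (- s).
Proof.
intros hs hy hab. replace (2 / s * Rpower y (- s)) with (Rpower y (- s) / s + Rpower y (- s) / s) by (field; lra).
assert (h0 : 0 < Rpower y (- s) / s) by (apply Rdiv_lt_0_compat; auto; apply Rpower_pos).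
destruct (Rle_lt_dec x a) as [h|h]; [generalize (RInt_bump_right s y x a b hs hy h hab); lra|].
destruct (Rle_lt_dec b x) as [h'|h']; [generalize (RInt_bump_left s y x a b hs hy h' hab); lra|].
assert (E : RInt (bump s y x) a b = RInt (bump s y x) a x + RInt (bump s y x) x b).
{ symmetry. apply (RInt_Chasles (V := R_CompleteNormedModule)); apply ex_RInt_cont; intros; apply continuous_bump; auto. }
rewrite E. apply Rplus_le_compat; [apply RInt_bump_left|apply RInt_bump_right]; lra.
Qed.

(** An integrable majorant, with a bound uniform over bounded intervals in place of the value of an
    improper integral. *)
Definition dom (phi : R -> R) (B : R) : Prop :=
  (forall t, continuous phi t) /\ forall a b, a <= b -> RInt phi a b <= B.

Lemma dom_bump s y x : 0 < s -> 0 < y -> dom (bump s y x) (2 / s * Rpower y (- s)).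
Proof. intros hs hy. split; [intros; apply continuous_bump; auto|intros; apply RInt_bump; auto]. Qed.

Lemma dom_plus f g A B : dom f A -> dom g B -> dom (fun t => f t + g t) (A + B).
Proof.
intros [f1 f2] [g1 g2]. split.
- intros t. apply (continuous_plus (V := R_NormedModule)); auto.
- intros a b hab. rewrite RInt_plus_R by (apply ex_RInt_cont; auto). apply Rplus_le_compat; auto.
Qed.

Lemma dom_scal f k A : 0 <= k -> dom f A -> dom (fun t => k * f t) (k * A).
Proof.
intros hk [f1 f2]. split.
- intros t. apply (continuous_mult (K := R_AbsRing)); auto. apply continuous_const.
- intros a b hab. rewrite RInt_scal_R by (apply ex_RInt_cont; auto). apply Rmult_le_compat_l; auto.
Qed.

Definition contR (f : R -> C) : Prop := forall t, tends (locally t) f (f t).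

Lemma contR_contI f a b : contR f -> contI f a b.
Proof. intros H t _. apply H. Qed.

Lemma contR_const c : contR (fun _ => c).
Proof. intros t. apply tends_const, locally_filter. Qed.

Lemma contR_plus f g : contR f -> contR g -> contR (fun t => f t + g t)%C.
Proof. intros Hf Hg t. apply tends_plus; auto. apply locally_filter. Qed.

Lemma contR_minus f g : contR f -> contR g -> contR (fun t => f t - g t)%C.
Proof. intros Hf Hg t. apply tends_minus; auto. apply locally_filter. Qed.

Lemma contR_mult f g : contR f -> contR g -> contR (fun t => f t * g t)%C.
Proof. intros Hf Hg t. apply tends_mult; auto. apply locally_filter. Qed.

Lemma contR_div f g : (forall t, g t <> RtoC 0) -> contR f -> contR g -> contR (fun t => f t / g t)%C.
Proof. intros H Hf Hg t. apply tends_div; auto. apply locally_filter. Qed.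

Lemma contR_pow f n : contR f -> contR (fun t => f t ^ n)%C.
Proof. intros Hf t. apply tends_pow; auto. apply locally_filter. Qed.

Lemma contR_RtoC : contR RtoC.
Proof. intros t. apply (tends_RtoC (fun x => x)). apply continuous_id. Qed.

Lemma contR_opp_arg f : contR f -> contR (fun t => f (- t)).
Proof.
intros H t e he. destruct (H (- t) e he) as [d K]. exists d. intros u hu. apply K.
change (Rabs (- u - - t) < d). change (Rabs (u - t) < d) in hu.
replace (- u - - t) with (- (u - t)) by ring. rewrite Rabs_Ropp. exact hu.
Qed.

Lemma contR_ext f g : (forall t, f t = g t) -> contR f -> contR g.
Proof.
intros E H t. rewrite <- E. apply (tends_ext _ f); [|apply H].
apply filter_forall. exact E.
Qed.

(** Both ends go to infinity independently, as in [improper_int_R]. The requirement [0 <= A] ensures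
    [a <= b], on which the rules for [CInt] depend. *)
Definition ends (P : R * R -> Prop) : Prop :=
  exists A, 0 <= A /\ forall a b, a <= - A -> A <= b -> P (a, b).

Global Instance ends_filter : ProperFilter ends.
Proof.
constructor; [|split].
- intros P [A [hA H]]. exists (- A, A). apply H; lra.
- exists 0. split; [lra|auto].
- intros P Q [A [hA H]] [B [hB K]]. exists (Rmax A B).
  generalize (Rmax_l A B) (Rmax_r A B). intros. split; [lra|]. intros a b ha hb. split; [apply H|apply K]; lra.
- intros P Q H [A [hA K]]. exists A. auto.
Qed.

Lemma ends_order : ends (fun p => fst p <= snd p).
Proof. exists 0. split; [lra|]. simpl. intros; lra. Qed.

Definition IR (f : R -> C) (L : C) : Prop := tends ends (fun p => CInt f (fst p) (snd p)) L.

Lemma IR_unique f L M : IR f L -> IR f M -> L = M.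
Proof. apply tends_unique. typeclasses eauto. Qed.

Lemma IR_ext f g L : (forall t, f t = g t) -> IR f L -> IR g L.
Proof.
intros E. apply tends_ext; [typeclasses eauto|].
generalize ends_order. apply filter_imp. intros [a b] h. apply CInt_ext; auto.
Qed.

Lemma IR_plus f g L M : contR f -> contR g -> IR f L -> IR g M -> IR (fun t => f t + g t)%C (L + M)%C.
Proof.
intros Hf Hg HL HM.
apply (tends_ext _ (fun p => CInt f (fst p) (snd p) + CInt g (fst p) (snd p))%C).
- generalize ends_order. apply filter_imp. intros [a b] h. symmetry.
  apply CInt_plus; auto using contR_contI.
- apply tends_plus; auto. typeclasses eauto.
Qed.

Lemma IR_scal f c L : contR f -> IR f L -> IR (fun t => c * f t)%C (c * L)%C.
Proof.
intros Hf HL.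
apply (tends_ext _ (fun p => c * CInt f (fst p) (snd p))%C).
- generalize ends_order. apply filter_imp. intros [a b] h. symmetry.
  apply CInt_scal; auto using contR_contI.
- apply tends_mult; auto; [typeclasses eauto|apply tends_const; typeclasses eauto].
Qed.

Lemma IR_minus f g L M : contR f -> contR g -> IR f L -> IR g M -> IR (fun t => f t - g t)%C (L - M)%C.
Proof.
intros Hf Hg HL HM.
apply (IR_ext (fun t => f t + - (1) * g t)%C); [intros; ring|].
replace (L - M)%C with (L + - (1) * M)%C by ring.
apply IR_plus; auto.
- apply (contR_mult (fun _ => - (1))%C g); auto. apply contR_const.
- apply IR_scal; auto.
Qed.

Lemma IR_zero : IR (fun _ => RtoC 0) (RtoC 0).
Proof.
intros e he. generalize ends_order. apply filter_imp. intros [a b] _. simpl.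
rewrite CInt_const, Cmult_0_r. replace (0 - 0)%C with (RtoC 0) by ring. rewrite Cmod_0. exact he.
Qed.

Lemma RInt_opp_arg (g : R -> R) a b : (forall t, continuous g t) ->
  RInt (fun t => g (- t)) a b = RInt g (- b) (- a).
Proof.
intros Hg.
assert (H := is_RInt_comp_opp (V := R_NormedModule) g a b (RInt g (- a) (- b))).
assert (H1 := H (RInt_correct (V := R_CompleteNormedModule) g _ _ (ex_RInt_cont _ _ _ Hg))).
apply (is_RInt_opp (V := R_NormedModule)) in H1.
transitivity (opp (RInt g (- a) (- b))).
- apply (is_RInt_unique (V := R_CompleteNormedModule)).
  revert H1. apply is_RInt_ext. intros t _. unfold opp; simpl. ring.
- apply (opp_RInt_swap (V := R_CompleteNormedModule)). apply ex_RInt_cont; auto.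
Qed.

Lemma CInt_opp_arg f a b : contR f -> CInt (fun t => f (- t)) a b = CInt f (- b) (- a).
Proof.
intros Hf. unfold CInt. apply pair_eq.
- apply (RInt_opp_arg (fun t => fst (f t))). intros t. apply tends_continuous_fst, Hf.
- apply (RInt_opp_arg (fun t => snd (f t))). intros t. apply tends_continuous_snd, Hf.
Qed.

Lemma IR_opp_arg f L : contR f -> IR f L -> IR (fun t => f (- t)) L.
Proof.
intros Hf H e he. destruct (H e he) as [A [hA K]]. exists A. split; auto. intros a b ha hb. simpl.
rewrite CInt_opp_arg by auto. apply (K (- b) (- a)); lra.
Qed.

Lemma IR_bound f phi B L : contR f -> (forall t, Cmod (f t) <= phi t) -> dom phi B -> IR f L -> Cmod L <= B.
Proof.
intros Hf H [D1 D2] HL. apply (tends_bound ends _ _ _ HL).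
generalize ends_order. apply filter_imp. intros [a b] h. simpl in *.
eapply Rle_trans; [|apply D2; exact h].
apply CInt_bound; auto using contR_contI, ex_RInt_cont.
Qed.

Lemma C_complete (u : nat -> C) :
  (forall e, 0 < e -> exists N, forall n m, (N <= n)%nat -> (N <= m)%nat -> Cmod (u n - u m) < e) ->
  exists l, forall e, 0 < e -> exists N, forall n, (N <= n)%nat -> Cmod (u n - l) < e.
Proof.
intros H.
destruct (Rcomplete.R_complete (fun n => fst (u n))) as [x hx].
{ intros e he. destruct (H e he) as [N K]. exists N. intros n m hn hm.
  exact (Rle_lt_trans _ _ _ (fst_le_Cmod (u n - u m)%C) (K n m hn hm)). }
destruct (Rcomplete.R_complete (fun n => snd (u n))) as [y hy].
{ intros e he. destruct (H e he) as [N K]. exists N. intros n m hn hm.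
  exact (Rle_lt_trans _ _ _ (snd_le_Cmod (u n - u m)%C) (K n m hn hm)). }
exists (x, y). intros e he.
destruct (hx (e / 2)) as [N1 K1]; [lra|]. destruct (hy (e / 2)) as [N2 K2]; [lra|].
exists (Nat.max N1 N2). intros n hn.
eapply Rle_lt_trans; [apply Cmod_le_sum|].
specialize (K1 n ltac:(lia)). specialize (K2 n ltac:(lia)).
unfold R_dist in *. simpl. unfold Rminus in *. lra.
Qed.

(** Dominated tails: once [[- A, A]] nearly exhausts the supremum [M] of the symmetric integrals of
    [phi], enlarging the interval changes the integral of [f] by little. This is the Cauchy
    criterion. *)
Lemma IR_exists f phi B : contR f -> (forall t, Cmod (f t) <= phi t) -> dom phi B -> exists L, IR f L.
Proof.
intros Hf H [D1 D2].
assert (ex : forall a b, ex_RInt phi a b) by (intros; apply ex_RInt_cont; auto).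
assert (pos : forall t, 0 <= phi t) by (intros t; generalize (Cmod_ge_0 (f t)) (H t); lra).
assert (ch : forall a b c, RInt phi a b + RInt phi b c = RInt phi a c).
{ intros a b c. apply (RInt_Chasles (V := R_CompleteNormedModule)); auto. }
assert (rp : forall a b, a <= b -> 0 <= RInt phi a b) by (intros; apply RInt_ge_0; auto).
destruct (completeness (fun r => exists A, 0 <= A /\ r = RInt phi (- A) A)) as [M [M1 M2]].
{ exists B. intros r [A [hA ->]]. apply D2. lra. }
{ exists (RInt phi (- 0) 0), 0. split; [lra|reflexivity]. }
assert (tail : forall e, 0 < e -> exists A, 0 <= A /\ forall a b c d, a <= - A -> A <= b -> c <= - A -> A <= d ->
  Cmod (CInt f a b - CInt f c d) < e).
{ intros e he.
  assert (h : exists A, 0 <= A /\ M - e / 2 < RInt phi (- A) A).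
  { apply NNPP. intros h. assert (M <= M - e / 2); [|lra]. apply M2. intros r [A [hA ->]].
    apply Rnot_lt_le. intros h'. apply h. exists A. auto. }
  destruct h as [A [hA h]]. exists A. split; auto.
  assert (one : forall a b, a <= - A -> A <= b -> Cmod (CInt f a b - CInt f (- A) A) < e / 2).
  { intros a b ha hb.
    rewrite <- (CInt_Chasles f a (- A) b), <- (CInt_Chasles f (- A) A b) by (try lra; apply contR_contI; auto).
    replace (CInt f a (- A) + (CInt f (- A) A + CInt f A b) - CInt f (- A) A)%C
      with (CInt f a (- A) + CInt f A b)%C by ring.
    eapply Rle_lt_trans; [apply Cmod_triangle|].
    assert (b1 : Cmod (CInt f a (- A)) <= RInt phi a (- A)) by (apply CInt_bound; auto using contR_contI).
    assert (b2 : Cmod (CInt f A b) <= RInt phi A b) by (apply CInt_bound; auto using contR_contI).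
    (* [M] controls symmetric intervals only, so [[a, b]] is first enlarged to [[- c, c]]. *)
    set (c := Rmax (- a) b). assert (c1 : - a <= c) by apply Rmax_l. assert (c2 : b <= c) by apply Rmax_r.
    assert (E : RInt phi (- c) c <= M) by (apply M1; exists c; split; [lra|reflexivity]).
    rewrite <- (ch (- c) a c), <- (ch a (- A) c), <- (ch (- A) A c), <- (ch A b c) in E.
    generalize (rp (- c) a) (rp b c). lra. }
  intros a b c d h1 h2 h3 h4.
  assert (q1 := one a b h1 h2). assert (q2 := one c d h3 h4). rewrite Cmod_sub_sym in q2.
  assert (q3 := Cmod_triangle_sub (CInt f a b) (CInt f (- A) A) (CInt f c d)). lra. }
destruct (C_complete (fun n => CInt f (- INR n) (INR n))) as [L HL].
{ intros e he. destruct (tail e he) as [A [hA K]]. destruct (INR_unbounded A) as [N hN]. exists N.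
  intros n m hn hm. apply le_INR in hn, hm. apply K; lra. }
exists L. intros e he. destruct (tail (e / 2)) as [A [hA K]]; [lra|]. exists A. split; auto. intros a b ha hb. simpl.
destruct (HL (e / 2)) as [N hN]; [lra|]. destruct (INR_unbounded A) as [N' hN'].
set (n := Nat.max N N').
assert (h1 := hN n ltac:(lia)). assert (h2 : INR N' <= INR n) by (apply le_INR; lia).
assert (h3 := K a b (- INR n) (INR n) ha hb ltac:(lra) ltac:(lra)).
assert (h4 := Cmod_triangle_sub (CInt f a b) (CInt f (- INR n) (INR n)) L). lra.
Qed.

(** * Integral formulas in the half plane *)

(** Compactness of the segment makes the approach to the real line uniform, so that the bottom side
    of a contour can be shifted to small positive height. *)
Lemma uniform_on_segment (g : C -> C) a b :
  (forall t, a <= t <= b -> tends (nb everywhere (t, 0)) g (g (t, 0))) ->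
  forall e, 0 < e -> exists d, 0 < d /\ forall t y, a <= t <= b -> 0 <= y <= d -> Cmod (g (t, y) - g (t, 0)) < e.
Proof.
intros H e he.
assert (K : forall (pr : C -> R), (forall z w, Rabs (pr z - pr w) <= Cmod (z - w)) ->
  exists d : posreal, forall t y, a <= t <= b -> 0 <= y <= d -> Rabs (pr (g (t, y)) - pr (g (t, 0))) < e / 2).
{ intros pr Hpr.
  destruct (uniform_continuity_2d_1d (fun x y => pr (g (x, y))) a b 0) with (eps := mkposreal (e / 2) (half_pos e he)) as [d hd].
  - intros x hx eps. destruct (H x hx eps (cond_pos eps)) as [r [hr K]].
    exists (mkposreal (r / 2) (half_pos r hr)). intros u v hu hv. simpl in hu, hv.
    eapply Rle_lt_trans; [apply Hpr|]. apply K; [exact I|].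
    eapply Rle_lt_trans; [apply Cmod_le_sum|]. simpl. unfold Rminus in *. lra.
  - exists d. intros t y ht hy. apply (hd t 0 t y); try lra.
    rewrite Rminus_diag, Rabs_R0. apply cond_pos. }
destruct (K fst) as [d1 h1]; [intros z w; apply (fst_le_Cmod (z - w)%C)|].
destruct (K snd) as [d2 h2]; [intros z w; apply (snd_le_Cmod (z - w)%C)|].
exists (Rmin d1 d2). split; [apply Rmin_pos; apply cond_pos|]. intros t y ht hy.
generalize (Rmin_l d1 d2) (Rmin_r d1 d2). intros.
eapply Rle_lt_trans; [apply Cmod_le_sum|].
specialize (h1 t y ht ltac:(lra)). specialize (h2 t y ht ltac:(lra)).
simpl. unfold Rminus in *. lra.
Qed.

Lemma Cmod_le_comp (z w : C) : Rabs (fst z) <= Rabs (fst w) -> Rabs (snd z) <= Rabs (snd w) -> Cmod z <= Cmod w.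
Proof.
intros h1 h2. unfold Cmod. apply sqrt_le_1_alt.
rewrite <- (pow2_abs (fst z)), <- (pow2_abs (snd z)), <- (pow2_abs (fst w)), <- (pow2_abs (snd w)).
apply Rplus_le_compat; apply pow_incr; split; auto; apply Rabs_pos.
Qed.

(** Projection onto the closed upper half plane. Composing with it turns continuity relative to the
    closed half plane into continuity in the full plane, which the rectangle integrals require,
    without changing the function above the line. *)
Definition clamp (z : C) : C := (fst z, Rmax (snd z) 0).

Lemma clamp_Lipschitz z w : Cmod (clamp z - clamp w)%C <= Cmod (z - w)%C.
Proof.
apply Cmod_le_comp; simpl; [lra|].
unfold Rmax. repeat destruct Rle_dec; unfold Rabs; repeat destruct Rcase_abs; lra.
Qed.

Lemma tends_clamp f z : tends (nb CUHP (clamp z)) f (f (clamp z)) ->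
  tends (nb everywhere z) (fun w => f (clamp w)) (f (clamp z)).
Proof.
intros H e he. destruct (H e he) as [d [hd K]]. exists d. split; auto. intros w _ hw.
apply K.
- unfold CUHP, Defs.Im, clamp. simpl. apply Rmax_r.
- eapply Rle_lt_trans; [apply clamp_Lipschitz|exact hw].
Qed.

Lemma clamp_id z : 0 <= snd z -> clamp z = z.
Proof. intros h. destruct z as [x y]. unfold clamp. simpl in *. rewrite Rmax_left; auto. Qed.

Lemma nb_UHP (z : C) : 0 < snd z -> nb everywhere z (fun w => 0 < snd w).
Proof.
intros h. exists (snd z). split; auto. intros w _ hw.
assert (q := Rle_lt_trans _ _ _ (snd_le_Cmod (w - z)%C) hw). simpl in q.
apply Rabs_def2 in q. lra.
Qed.

Lemma Cder_clamp f z l : 0 < snd z -> Cder f z l -> Cder (fun w => f (clamp w)) z l.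
Proof.
intros h. apply Cder_ext. generalize (nb_UHP z h). apply filter_imp. intros w hw.
rewrite clamp_id; auto; lra.
Qed.

Section HalfPlane.
Variables (f : C -> C) (p : C) (K R0 : R).
Hypothesis p_UHP : 0 < snd p.
Hypothesis f_cont : forall z : C, 0 <= snd z -> z <> p -> tends (nb CUHP z) f (f z).
Hypothesis f_der : forall z : C, 0 < snd z -> z <> p -> exists l, Cder f z l.
Hypothesis f_sing : forall e, 0 < e -> nb everywhere p (fun z => Cmod (f z) * Cmod (z - p) <= e).
Hypothesis K_pos : 0 <= K.
Hypothesis f_decay : forall z : C, 0 <= snd z -> R0 <= Cmod z -> Cmod (f z) <= K / Cmod z ^ 2.

Let g (z : C) : C := f (clamp z).

Lemma clamp_cont z : clamp z <> p -> tends (nb everywhere z) g (g z).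
Proof. intros h. apply tends_clamp. apply f_cont; auto. simpl. apply Rmax_r. Qed.

(** The bottom side lies on the real line, where [f] is only continuous. Goursat removes everything
    above height [c], and the remaining strip has a small integral: its long sides nearly cancel and
    its short sides have length [c]. *)
Lemma half_rect a b d : a < fst p < b -> snd p < d -> rect_int g a b 0 d = RtoC 0.
Proof.
intros hab hd.
assert (hne : forall x y, x <> fst p \/ (y < snd p \/ snd p < y) -> clamp (x, y) <> p).
{ intros x y h E. rewrite <- E in h, p_UHP. simpl in h, p_UHP. revert h p_UHP. unfold Rmax. destruct Rle_dec; lra. }
assert (step : forall c, 0 < c < snd p -> rect_int g a b 0 d = rect_int g a b 0 c).
{ intros c hc. rewrite (rect_int_split_v g a b 0 c d); try lra.
  2, 3 : intros t ht; apply (tends_path_v g); apply clamp_cont, hne; left; lra.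
  rewrite (goursat_except g a b c d p); try lra.
  - ring.
  - intros x y hx hy hxy. destruct (f_der (x, y)) as [l hl]; auto; [simpl; lra|].
    exists l. apply Cder_clamp; auto. simpl; lra.
  - intros e he. generalize (filter_and _ _ (f_sing e he) (nb_UHP p p_UHP)).
    apply filter_imp. intros w [k1 k2]. unfold g. rewrite clamp_id; auto; lra. }
assert (hp2 : 0 < snd p / 2) by lra.
apply Cmod_small_0. intros e he.
(* With [c <= e'], the two long sides contribute at most [e' (b - a)] and each short side at most
   [e'] times its boundary value plus 1; [M] collects these factors. *)
set (M := 2 * (b - a) + Cmod (g (a, 0)) + Cmod (g (b, 0)) + 2).
assert (hM : 0 < M) by (unfold M; generalize (Cmod_ge_0 (g (a, 0))) (Cmod_ge_0 (g (b, 0))); lra).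
set (e' := Rmin 1 (e / M)).
assert (he' : 0 < e') by (apply Rmin_pos; [lra|apply Rdiv_lt_0_compat; auto]).
assert (he1 : e' <= 1) by apply Rmin_l.
assert (he2 : e' * M <= e). { apply Rle_div_r; [lra|]. apply Rmin_r. }
destruct (uniform_on_segment g a b) with (e := e') as [dl [hdl U]]; auto.
{ intros t ht. apply clamp_cont, hne. right. left. exact p_UHP. }
set (c := Rmin (Rmin dl (snd p / 2)) e').
assert (hc : 0 < c) by (unfold c; apply Rmin_pos; [apply Rmin_pos|]; auto).
assert (hc1 : c <= dl) by (eapply Rle_trans; apply Rmin_l).
assert (hc2 : c <= snd p / 2) by (eapply Rle_trans; [apply Rmin_l|apply Rmin_r]).
assert (hc3 : c <= e') by apply Rmin_r.
rewrite (step c) by lra.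
assert (ch : forall y, 0 <= y <= c -> contI (fun t => g (t, y)) a b).
{ intros y hy t ht. apply (tends_path_h g t). apply clamp_cont, hne. right. left. lra. }
assert (cv : forall x, a <= x <= b -> contI (fun t => g (x, t)) 0 c).
{ intros x hx t ht. apply (tends_path_v g x). apply clamp_cont, hne. right. left. lra. }
assert (side : forall x, a <= x <= b -> Cmod (CInt (fun t => g (x, t)) 0 c) <= (Cmod (g (x, 0)) + 1) * c).
{ intros x hx. replace ((Cmod (g (x, 0)) + 1) * c) with ((Cmod (g (x, 0)) + 1) * (c - 0)) by ring.
  apply CInt_bound_const; auto; [lra|]. intros t ht.
  assert (q := U x t hx ltac:(lra)). assert (q' := Cmod_triangle_rev (g (x, t)) (g (x, 0))). lra. }
assert (hor : Cmod (CInt (fun t => g (t, 0) - g (t, c))%C a b) <= e' * (b - a)).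
{ apply CInt_bound_const; try lra.
  - intros t ht. apply tends_minus; [apply locally_filter|apply ch|apply ch]; auto; lra.
  - intros t ht. rewrite Cmod_sub_sym. left. apply U; auto. lra. }
rewrite (CInt_minus (fun t => g (t, 0)) (fun t => g (t, c))) in hor by (try apply ch; lra).
unfold rect_int.
replace (CInt (fun t => g (t, 0)) a b + Ci * CInt (fun t => g (b, t)) 0 c -
   CInt (fun t => g (t, c)) a b - Ci * CInt (fun t => g (a, t)) 0 c)%C
 with ((CInt (fun t => g (t, 0)) a b - CInt (fun t => g (t, c)) a b) +
   (Ci * CInt (fun t => g (b, t)) 0 c - Ci * CInt (fun t => g (a, t)) 0 c))%C by ring.
eapply Rle_trans; [apply Cmod_triangle|].
eapply Rle_trans; [apply Rplus_le_compat_l, Cmod_triangle_minus|].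
rewrite !Cmod_mult, Cmod_Ci.
assert (s1 := side a ltac:(lra)). assert (s2 := side b ltac:(lra)).
assert (q1 := Cmod_ge_0 (g (a, 0))). assert (q2 := Cmod_ge_0 (g (b, 0))).
eapply Rle_trans; [|exact he2]. unfold M.
assert (s3 : (Cmod (g (a, 0)) + 1) * c <= (Cmod (g (a, 0)) + 1) * e') by (apply Rmult_le_compat_l; lra).
assert (s4 : (Cmod (g (b, 0)) + 1) * c <= (Cmod (g (b, 0)) + 1) * e') by (apply Rmult_le_compat_l; lra).
assert (s5 : 0 <= e' * (b - a)) by (apply Rmult_le_pos; lra).
lra.
Qed.

(** On the side, [|z|^2 = x^2 + t^2 >= (|x| + t)^2 / 2], so [2 K] times a [bump] of height [|x|]
    dominates. The bound does not depend on the height [d] of the rectangle. *)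
Lemma half_side x d : R0 <= Rabs x -> fst p <> x -> 0 < Rabs x -> 0 < d ->
  Cmod (CInt (fun t => g (x, t)) 0 d) <= 4 * K / Rabs x.
Proof.
intros hx hxp hx0 hd.
assert (D := dom_scal _ (2 * K) _ ltac:(lra) (dom_bump 1 (Rabs x) 0 Rlt_0_1 hx0)).
replace (2 * K * (2 / 1 * Rpower (Rabs x) (- (1)))) with (4 * K / Rabs x) in D.
2: { rewrite Rpower_Ropp, Rpower_1 by auto. field. lra. }
eapply Rle_trans; [|apply (proj2 D 0 d); lra].
apply CInt_bound; try lra.
- intros t ht. apply (tends_path_v g x t). apply clamp_cont. intros E. apply hxp. rewrite <- E. reflexivity.
- apply ex_RInt_cont. apply D.
- intros t ht. unfold g. rewrite clamp_id by (simpl; lra).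
  assert (hc : Rabs x <= Cmod (x, t)) by (apply (fst_le_Cmod (x, t))).
  eapply Rle_trans; [apply f_decay; simpl; lra|].
  unfold bump, Rdiv. rewrite (Rmult_comm 2 K), Rmult_assoc. apply Rmult_le_compat_l; auto.
  rewrite Rminus_0_r, (Rabs_pos_eq t) by lra.
  replace (- 1 - 1) with (- INR 2) by (simpl; ring). rewrite Rpower_Ropp, Rpower_pow by lra.
  replace (Cmod (x, t) ^ 2) with (x ^ 2 + t ^ 2) by (assert (q := Cmod_sq (x, t)); simpl fst in q; simpl snd in q; rewrite <- q; ring).
  rewrite <- (pow2_abs x).
  replace (2 * / (Rabs x + t) ^ 2) with (/ ((Rabs x + t) ^ 2 / 2)) by (field; lra).
  apply Rinv_le_contravar.
  + assert (0 < (Rabs x + t) ^ 2) by (apply pow_lt; lra). lra.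
  + generalize (pow2_ge_0 (Rabs x - t)). lra.
Qed.

(** The contour is closed by a rectangle, since Goursat is available there. Quadratic decay makes
    the vertical sides small whatever the height, so the height can be as large as the top side
    demands. *)
Lemma half_plane_integral : IR (fun t => f (RtoC t)) (RtoC 0).
Proof.
intros e he.
(* [32 K / e] makes each vertical side at most [4 K / A <= e / 8]; the other terms put the sides
   beyond [p] and beyond the radius [R0]. *)
set (A := Rabs R0 + Cmod p + 1 + 32 * K / e).
assert (hK : 0 <= 32 * K / e) by (apply Rdiv_le_0_compat; lra).
assert (hA : 1 <= A) by (unfold A; generalize (Rabs_pos R0) (Cmod_ge_0 p); lra).
exists A. split; [lra|]. intros a b ha hb. simpl.
assert (hpa : Rabs (fst p) < A) by (unfold A; generalize (fst_le_Cmod p) (Rabs_pos R0); lra).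
assert (hps : Rabs (snd p) < A) by (unfold A; generalize (snd_le_Cmod p) (Rabs_pos R0); lra).
apply Rabs_def2 in hpa. apply Rabs_def2 in hps.
assert (hR : R0 <= A) by (unfold A; generalize (Rle_abs R0) (Cmod_ge_0 p); lra).
(* The height is chosen after the interval: the top side is at most [K (b - a) / d^2 <= K (b - a) /
   d <= e / 4]. *)
set (d := A + 4 * K * (b - a) / e).
assert (hd1 : 0 <= 4 * K * (b - a) / e) by (apply Rdiv_le_0_compat; auto; apply Rmult_le_pos; lra).
assert (hd : A <= d) by (unfold d; lra).
assert (J := half_rect a b d ltac:(lra) ltac:(lra)).
unfold rect_int in J.
assert (Eb : CInt (fun t => f (RtoC t)) a b = CInt (fun t => g (t, 0)) a b).
{ apply CInt_ext; [lra|]. intros t ht. unfold g. rewrite clamp_id by (simpl; lra). reflexivity. }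
rewrite Eb. clear Eb.
assert (top : Cmod (CInt (fun t => g (t, d)) a b) <= e / 4).
{ apply Rle_trans with (K / (d * d) * (b - a)).
  - apply CInt_bound_const; [lra| |].
    + intros t ht. apply (tends_path_h g t). apply clamp_cont. intros E. rewrite <- E in hps. simpl in hps.
      unfold Rmax in hps. destruct Rle_dec; lra.
    + intros t ht. unfold g. rewrite clamp_id by (simpl; lra).
      assert (q : d <= Cmod (t, d)).
      { eapply Rle_trans; [|apply snd_le_Cmod]. simpl. apply Rle_abs. }
      eapply Rle_trans; [apply f_decay; simpl; lra|]. apply Rmult_le_compat_l; auto.
      apply Rinv_le_contravar; nra.
  - apply Rle_trans with (K * (b - a) / d).
    + replace (K / (d * d) * (b - a)) with (K * (b - a) / d * / d) by (field; lra).
      rewrite <- (Rmult_1_r (K * (b - a) / d)) at 2. apply Rmult_le_compat_l.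
      * apply Rdiv_le_0_compat; [|lra]. apply Rmult_le_pos; lra.
      * rewrite <- Rinv_1. apply Rinv_le_contravar; lra.
    + apply Rle_div_l; [lra|]. unfold d.
      replace (e / 4 * (A + 4 * K * (b - a) / e)) with (e * A / 4 + K * (b - a)) by (field; lra). nra. }
assert (hAb : 4 * K / A <= e / 8).
{ apply Rle_div_l; [lra|]. unfold A.
  replace (e / 8 * (Rabs R0 + Cmod p + 1 + 32 * K / e)) with (e / 8 * (Rabs R0 + Cmod p + 1) + 4 * K) by (field; lra).
  assert (0 <= e / 8 * (Rabs R0 + Cmod p + 1)); [|lra]. apply Rmult_le_pos; [lra|]. generalize (Rabs_pos R0) (Cmod_ge_0 p); lra. }
assert (side : forall x, A <= Rabs x -> fst p <> x -> Cmod (CInt (fun t => g (x, t)) 0 d) <= e / 8).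
{ intros x hx hpx. eapply Rle_trans; [apply half_side; lra|]. eapply Rle_trans; [|exact hAb].
  unfold Rdiv. apply Rmult_le_compat_l; [lra|]. apply Rinv_le_contravar; lra. }
assert (s1 := side a). assert (s2 := side b).
rewrite Rabs_left in s1 by lra. rewrite Rabs_pos_eq in s2 by lra.
specialize (s1 ltac:(lra) ltac:(lra)). specialize (s2 ltac:(lra) ltac:(lra)).
replace (CInt (fun t => g (t, 0)) a b - 0)%C
  with (CInt (fun t => g (t, d)) a b + (Ci * CInt (fun t => g (a, t)) 0 d - Ci * CInt (fun t => g (b, t)) 0 d))%C.
2: { set (X := CInt (fun t => g (t, 0)) a b) in *.
     replace (X - 0)%C with (X - RtoC 0)%C by ring. rewrite <- J. ring. }
eapply Rle_lt_trans; [apply Cmod_triangle|].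
eapply Rle_lt_trans; [apply Rplus_le_compat_l, Cmod_triangle_minus|].
rewrite !Cmod_mult, Cmod_Ci. lra.
Qed.

End HalfPlane.

(** * Bounded analytic functions on a half plane and the Cauchy formula for the derivative *)

Definition plus_fn (f : C -> C) : Prop :=
  (forall z : C, 0 <= snd z -> tends (nb CUHP z) f (f z)) /\
  (exists K, forall z : C, 0 <= snd z -> Cmod (f z) <= K) /\
  (forall z : C, 0 < snd z -> exists l, Cder f z l).

(* [z |-> - z] exchanges the half planes, so that every fact about the lower
   half plane is a reflection of one about the upper half plane. *)
Definition minus_fn (f : C -> C) : Prop := plus_fn (fun z => f (- z)%C).

Lemma plus_fn_const c : plus_fn (fun _ => c).
Proof.
split; [|split].
- intros z _. apply tends_const, nb_filter.
- exists (Cmod c). intros; lra.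
- intros z _. exists (RtoC 0). apply Cder_const.
Qed.

Lemma plus_fn_plus f g : plus_fn f -> plus_fn g -> plus_fn (fun z => f z + g z)%C.
Proof.
intros (f1 & [K f2] & f3) (g1 & [L g2] & g3). split; [|split].
- intros z hz. apply tends_plus; auto. apply nb_filter.
- exists (K + L). intros z hz. eapply Rle_trans; [apply Cmod_triangle|]. apply Rplus_le_compat; auto.
- intros z hz. destruct (f3 z hz) as [l hl]. destruct (g3 z hz) as [m hm]. eexists. apply Cder_plus; eauto.
Qed.

Lemma plus_fn_mult f g : plus_fn f -> plus_fn g -> plus_fn (fun z => f z * g z)%C.
Proof.
intros (f1 & [K f2] & f3) (g1 & [L g2] & g3). split; [|split].
- intros z hz. apply tends_mult; auto. apply nb_filter.
- exists (K * L). intros z hz. rewrite Cmod_mult. apply Rmult_le_compat; auto using Cmod_ge_0.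
- intros z hz. destruct (f3 z hz) as [l hl]. destruct (g3 z hz) as [m hm]. eexists. apply Cder_mult; eauto.
Qed.

Lemma plus_fn_ext f g : (forall z, f z = g z) -> plus_fn f -> plus_fn g.
Proof.
intros E (f1 & [K f2] & f3). split; [|split].
- intros z hz. rewrite <- E. apply (tends_ext _ f); [apply filter_forall, E|auto].
- exists K. intros z hz. rewrite <- E. auto.
- intros z hz. destruct (f3 z hz) as [l hl]. exists l. apply (Cder_ext f); [apply filter_forall, E|auto].
Qed.

Lemma minus_fn_const c : minus_fn (fun _ => c).
Proof. apply (plus_fn_const c). Qed.

Lemma minus_fn_plus f g : minus_fn f -> minus_fn g -> minus_fn (fun z => f z + g z)%C.
Proof. apply plus_fn_plus. Qed.

Lemma minus_fn_mult f g : minus_fn f -> minus_fn g -> minus_fn (fun z => f z * g z)%C.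
Proof. apply plus_fn_mult. Qed.

Lemma minus_fn_opp_arg f : plus_fn f <-> minus_fn (fun z => f (- z)%C).
Proof.
unfold minus_fn. split; apply plus_fn_ext; intros z; f_equal; ring.
Qed.

Lemma contR_trace f : (forall z : C, 0 <= snd z -> tends (nb CUHP z) f (f z)) -> contR (fun t => f (RtoC t)).
Proof.
intros H t e he. destruct (H (RtoC t) ltac:(simpl; lra) e he) as [d [hd K]].
exists (mkposreal d hd). intros u hu. apply K.
- unfold CUHP, Defs.Im. simpl. lra.
- rewrite <- RtoC_minus, Cmod_R. exact hu.
Qed.

Lemma plus_fn_contR f : plus_fn f -> contR (fun t => f (RtoC t)).
Proof. intros H. apply contR_trace, H. Qed.

Lemma minus_fn_contR f : minus_fn f -> contR (fun t => f (RtoC t)).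
Proof.
intros H. apply plus_fn_contR in H. apply contR_opp_arg in H.
revert H. apply contR_ext. intros t. f_equal. rewrite RtoC_opp. ring.
Qed.

Lemma real_minus_neq (t : R) (z : C) : snd z <> 0 -> (RtoC t - z)%C <> RtoC 0.
Proof. intros h E. apply h. apply (f_equal snd) in E. simpl in E. lra. Qed.

Lemma contR_sub_const z : contR (fun t => RtoC t - z)%C.
Proof. apply contR_minus; [apply contR_RtoC|apply contR_const]. Qed.

(** The general result has an exceptional point. [Ci] is an arbitrary choice: [f] is continuous
    there, hence bounded nearby, which makes the singularity condition automatic. *)
Lemma half_plane_integral_regular f K R0 :
  (forall z : C, 0 <= snd z -> tends (nb CUHP z) f (f z)) ->
  (forall z : C, 0 < snd z -> exists l, Cder f z l) ->
  0 <= K -> (forall z : C, 0 <= snd z -> R0 <= Cmod z -> Cmod (f z) <= K / Cmod z ^ 2) ->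
  IR (fun t => f (RtoC t)) (RtoC 0).
Proof.
intros h1 h2 hK h3. apply (half_plane_integral f Ci K R0); auto.
- simpl. lra.
- intros e he. destruct (h2 Ci) as [l hl]; [simpl; lra|]. apply Cder_tends in hl.
  destruct (hl 1 Rlt_0_1) as [d [hd H]].
  set (M := Cmod (f Ci) + 1). assert (hM : 0 < M) by (unfold M; generalize (Cmod_ge_0 (f Ci)); lra).
  exists (Rmin d (e / M)). split; [apply Rmin_pos; auto; apply Rdiv_lt_0_compat; auto|].
  intros w _ hw. assert (q1 := Rlt_le_trans _ _ _ hw (Rmin_l _ _)). assert (q2 := Rlt_le_trans _ _ _ hw (Rmin_r _ _)).
  specialize (H w I q1). assert (q3 := Cmod_triangle_rev (f w) (f Ci)).
  apply Rlt_div_r in q2; auto.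
  apply Rle_trans with (Cmod (w - Ci) * M)%R; [|lra]. rewrite Rmult_comm.
  apply Rmult_le_compat_l; [apply Cmod_ge_0|unfold M; lra].
Qed.

(** Kernel of the Cauchy formula for the derivative. Being squared, it is absolutely integrable
    against boundary values that are merely bounded. *)
Definition sqinv (z : C) (t : R) : C := (/ ((RtoC t - z) * (RtoC t - z)))%C.

Lemma contR_sqinv z : snd z <> 0 -> contR (sqinv z).
Proof.
intros h. apply (contR_ext (fun t => RtoC 1 / ((RtoC t - z) * (RtoC t - z)))%C).
{ intros t. unfold sqinv, Cdiv. ring. }
apply contR_div.
- intros t. apply Cmult_neq_0; apply real_minus_neq; auto.
- apply contR_const.
- apply contR_mult; apply contR_sub_const.
Qed.

Lemma Cmod_sub_far (z w : C) : 2 * Cmod w <= Cmod z -> Cmod z / 2 <= Cmod (z - w).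
Proof. generalize (Cmod_triangle_rev z w). lra. Qed.

Lemma Cinv_sq_far (z w : C) : 0 < Cmod z -> 2 * Cmod w <= Cmod z ->
  / (Cmod (z - w) * Cmod (z - w)) <= 4 / Cmod z ^ 2.
Proof.
intros h0 h. assert (q := Cmod_sub_far z w h).
replace (4 / Cmod z ^ 2) with (/ (Cmod z / 2 * (Cmod z / 2))) by (field; lra).
apply Rinv_le_contravar; [|apply Rmult_le_compat]; try lra. apply Rmult_lt_0_compat; lra.
Qed.

Lemma Cder_sub_const z w : Cder (fun u => u - w)%C z (RtoC 1).
Proof.
apply (Cder_ext (fun u => u + - w)%C); [apply filter_forall; intros; ring|].
replace (RtoC 1) with (RtoC 1 + RtoC 0)%C by ring.
apply Cder_plus; [apply Cder_id|apply Cder_const].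
Qed.

Lemma UHP_minus_neq (z w : C) : 0 <= snd z -> snd w < 0 -> (z - w)%C <> RtoC 0.
Proof. intros h1 h2 E. apply (f_equal snd) in E. simpl in E. lra. Qed.

(** The pole lies in the other half plane, and the square supplies the decay that a merely bounded
    [f] lacks. *)
Lemma plus_fn_sqinv_lower f w : plus_fn f -> snd w < 0 -> IR (fun t => f (RtoC t) * sqinv w t)%C (RtoC 0).
Proof.
intros (f1 & [K f2] & f3) hw.
assert (hK : 0 <= K). { eapply Rle_trans; [apply Cmod_ge_0|apply (f2 (RtoC 0)); simpl; lra]. }
apply (half_plane_integral_regular (fun z => f z * / ((z - w) * (z - w)))%C (4 * K) (2 * Cmod w + 1)).
- intros z hz. assert (hne := UHP_minus_neq z w hz hw).
  apply tends_mult; auto using nb_filter. apply tends_inv; [apply nb_filter|apply Cmult_neq_0; auto|].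
  apply tends_mult; [apply nb_filter| |]; (apply tends_minus; [apply nb_filter|apply tends_nb_id|apply tends_const, nb_filter]).
- intros z hz. assert (hne := UHP_minus_neq z w ltac:(lra) hw).
  destruct (f3 z hz) as [l hl]. eexists. apply Cder_mult; [exact hl|].
  apply Cder_inv; [apply Cmult_neq_0; auto|]. apply Cder_mult; apply Cder_sub_const.
- lra.
- intros z hz hR. assert (hne := UHP_minus_neq z w hz hw).
  assert (q := Cmod_ge_0 w).
  rewrite Cmod_mult, Cmod_inv, Cmod_mult by (apply Cmult_neq_0; auto).
  replace (4 * K / Cmod z ^ 2) with (K * (4 / Cmod z ^ 2)) by (field; lra).
  apply Rmult_le_compat; auto using Cmod_ge_0.
  + left. apply Rinv_0_lt_compat. apply Rmult_lt_0_compat; apply Cmod_gt_0; auto.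
  + apply Cinv_sq_far; lra.
Qed.

Lemma sqinv_opp z t : sqinv (- z) (- t) = sqinv z t.
Proof. unfold sqinv. f_equal. rewrite RtoC_opp. ring. Qed.

Lemma minus_fn_sqinv_upper f z : minus_fn f -> 0 < snd z -> IR (fun t => f (RtoC t) * sqinv z t)%C (RtoC 0).
Proof.
intros Hf hz. assert (Hc := contR_sqinv (- z)%C ltac:(simpl; lra)).
assert (Hcf := plus_fn_contR _ Hf).
assert (H := plus_fn_sqinv_lower _ (- z)%C Hf ltac:(simpl; lra)).
apply IR_opp_arg in H; [|apply contR_mult; auto].
revert H. apply IR_ext. intros t. rewrite sqinv_opp. f_equal. f_equal. rewrite RtoC_opp. ring.
Qed.

(** The Poisson kernel without the factor [1 / PI]. The nonzero values of the Cauchy integrals below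
    all go back to its arctangent primitive. *)
Definition poisson (x y t : R) : R := y / ((t - x) ^ 2 + y ^ 2).

Lemma poisson_den x y t : 0 < y -> 0 < (t - x) ^ 2 + y ^ 2.
Proof. intros h. assert (0 < y ^ 2) by (apply pow_lt; auto). generalize (pow2_ge_0 (t - x)). lra. Qed.

Lemma poisson_pos x y t : 0 < y -> 0 < poisson x y t.
Proof. intros h. apply Rdiv_lt_0_compat; auto. apply poisson_den; auto. Qed.

Lemma continuous_poisson x y t : 0 < y -> continuous (poisson x y) t.
Proof.
intros h. apply (ex_derive_continuous (K := R_AbsRing) (V := R_NormedModule)).
unfold poisson. auto_derive. assert (q := poisson_den x y t h). simpl in q. unfold Rminus in q. lra.
Qed.

Lemma RInt_poisson x y a b : 0 < y -> RInt (poisson x y) a b = atan ((b - x) / y) - atan ((a - x) / y).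
Proof.
intros h. apply (is_RInt_unique (V := R_CompleteNormedModule)).
apply (is_RInt_derive (V := R_CompleteNormedModule) (fun t => atan ((t - x) / y))).
- intros t _. assert (q := poisson_den x y t h). unfold poisson. auto_derive; auto.
  unfold Rsqr. field. split; [lra|]. simpl in q. unfold Rminus in q. nra.
- intros t _. apply continuous_poisson; auto.
Qed.

Lemma atan_near_PI2 e : 0 < e -> exists M, 0 <= M /\ forall u, M <= u -> PI / 2 - e < atan u.
Proof.
intros he. assert (hpi := PI_RGT_0).
set (d := Rmin (e / 2) (PI / 4)). assert (hd : 0 < d) by (apply Rmin_pos; lra).
assert (hd1 : d <= e / 2) by apply Rmin_l. assert (hd2 : d <= PI / 4) by apply Rmin_r.
exists (Rmax 0 (tan (PI / 2 - d))). split; [apply Rmax_l|]. intros u hu.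
assert (hu' : tan (PI / 2 - d) <= u) by (eapply Rle_trans; [apply Rmax_r|exact hu]).
assert (E : atan (tan (PI / 2 - d)) = PI / 2 - d) by (apply atan_tan; lra).
destruct (Rle_lt_or_eq_dec _ _ hu') as [h|h].
- apply atan_increasing in h. lra.
- rewrite <- h. lra.
Qed.

Lemma IR_poisson x y : 0 < y -> IR (fun t => RtoC (poisson x y t)) (RtoC PI).
Proof.
intros h e he. destruct (atan_near_PI2 (e / 2)) as [M [hM H]]; [lra|].
exists (Rabs x + M * y). split.
{ assert (0 <= M * y) by (apply Rmult_le_pos; lra). generalize (Rabs_pos x); lra. }
intros a b ha hb. simpl.
assert (E : CInt (fun t => RtoC (poisson x y t)) a b = RtoC (atan ((b - x) / y) - atan ((a - x) / y))).
{ unfold CInt, RtoC. apply pair_eq.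
  - exact (RInt_poisson x y a b h).
  - simpl. rewrite RInt_const. unfold scal; simpl; unfold mult; simpl. ring. }
rewrite E, <- RtoC_minus, Cmod_R.
assert (h1 : PI / 2 - e / 2 < atan ((b - x) / y)).
{ apply H. apply Rle_div_r; auto. generalize (Rle_abs x). lra. }
assert (h2 : PI / 2 - e / 2 < atan ((x - a) / y)).
{ apply H. apply Rle_div_r; auto. generalize (Rle_abs (- x)). rewrite Rabs_Ropp. lra. }
replace ((x - a) / y) with (- ((a - x) / y)) in h2 by (field; lra). rewrite atan_opp in h2.
generalize (atan_bound ((b - x) / y)) (atan_bound ((a - x) / y)). intros.
apply Rabs_def1; lra.
Qed.

Lemma contR_poisson x y : 0 < y -> contR (fun t => RtoC (poisson x y t)).
Proof. intros h t. apply tends_RtoC. apply continuous_poisson; auto. Qed.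

Lemma IR_sqinv z : 0 < snd z -> IR (sqinv z) (RtoC 0).
Proof.
intros hz. apply (IR_ext (fun t => RtoC 1 * sqinv z t)%C); [intros; ring|].
apply (minus_fn_sqinv_upper (fun _ => RtoC 1)); auto. apply minus_fn_const.
Qed.

Lemma poisson_kernel (x y t : R) : 0 < y ->
  (/ ((RtoC t - (x, y)) * (RtoC t - (x, (- y)%R))))%C = RtoC (/ y * poisson x y t).
Proof.
intros h. unfold poisson. replace (/ y * (y / ((t - x) ^ 2 + y ^ 2))) with (/ ((t - x) ^ 2 + y ^ 2)).
2: { field. assert (q := poisson_den x y t h). simpl in q |- *. lra. }
assert (q := poisson_den x y t h).
rewrite RtoC_inv by lra. f_equal.
unfold RtoC, Cminus, Cplus, Copp, Cmult. simpl. apply pair_eq; ring.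
Qed.

(** Besides [f z], the function [l (w - z) (z - zc) / (w - zc)] is subtracted, where [zc] is the
    conjugate of [z]. It is bounded in the half plane and has derivative [l] at [z], so the quotient
    [h] has an integrable singularity and integral 0. Integrating the subtracted terms, [f z] gives
    0 and the other gives [l (z - zc) / y] times the Poisson integral, that is [2 PI i l]. *)
Lemma plus_fn_sqinv_upper f z l : plus_fn f -> 0 < snd z -> Cder f z l ->
  IR (fun t => f (RtoC t) * sqinv z t)%C (RtoC (2 * PI) * Ci * l)%C.
Proof.
intros Hf hz Hl. assert (Hc := plus_fn_contR f Hf). destruct Hf as (f1 & [K f2] & f3).
set (x := fst z). set (y := snd z). set (zc := ((x, - y) : C)).
assert (Ez : z = (x, y)) by apply surjective_pairing.
assert (hz' : 0 < snd z) by exact hz. change (0 < y) in hz.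
assert (hzc : snd zc < 0) by (simpl; lra).
assert (hzy : snd z = y) by reflexivity.
assert (hK : 0 <= K). { eapply Rle_trans; [apply Cmod_ge_0|apply (f2 (RtoC 0)); simpl; lra]. }
set (num := fun w => (f w - f z - l * (w - z) * (z - zc) / (w - zc))%C).
set (h := fun w => (num w * / ((w - z) * (w - z)))%C).
assert (hcz : forall w : C, 0 <= snd w -> (w - zc)%C <> RtoC 0) by (intros; apply UHP_minus_neq; auto).
assert (hne : forall w : C, w <> z -> (w - z)%C <> RtoC 0) by (intros; apply Cminus_eq_contra; auto).
set (B := Cmod l * Cmod (z - zc)).
assert (hB : 0 <= B) by (apply Rmult_le_pos; apply Cmod_ge_0).
assert (Hzero : IR (fun t => h (RtoC t)) (RtoC 0)).
{ apply (half_plane_integral h z (4 * (2 * K + 4 * B)) (2 * Cmod z + 2 * Cmod zc + 1)); auto.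
  - intros w hw hwz. assert (q := hcz w hw). assert (q' := hne w hwz).
    apply tends_mult; [apply nb_filter| |].
    + apply tends_minus; [apply nb_filter| |].
      * apply tends_minus; [apply nb_filter|auto|apply tends_const, nb_filter].
      * apply tends_div; [apply nb_filter|auto| |].
        -- apply tends_mult; [apply nb_filter| |apply tends_const, nb_filter].
           apply tends_mult; [apply nb_filter|apply tends_const, nb_filter|].
           apply tends_minus; [apply nb_filter|apply tends_nb_id|apply tends_const, nb_filter].
        -- apply tends_minus; [apply nb_filter|apply tends_nb_id|apply tends_const, nb_filter].
    + apply tends_inv; [apply nb_filter|apply Cmult_neq_0; auto|].
      apply tends_mult; [apply nb_filter| |];
        (apply tends_minus; [apply nb_filter|apply tends_nb_id|apply tends_const, nb_filter]).
  - intros w hw hwz. destruct (f3 w hw) as [m hm]. assert (q := hcz w ltac:(lra)). assert (q' := hne w hwz).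
    eexists. apply Cder_mult.
    + apply Cder_minus.
      * apply Cder_minus; [exact hm|apply Cder_const].
      * apply Cder_mult.
        -- apply Cder_mult; [|apply Cder_const]. apply Cder_mult; [apply Cder_const|apply Cder_sub_const].
        -- apply Cder_inv; [auto|apply Cder_sub_const].
    + apply Cder_inv; [apply Cmult_neq_0; auto|]. apply Cder_mult; apply Cder_sub_const.
  - destruct Hl as [phi [p1 p2]].
    (* [(w - z) h w] equals this difference of slopes, which vanishes in the limit because
       [(z - zc) / (w - zc)] tends to 1. *)
    assert (T : tends (nb everywhere z) (fun w => phi w - l * (z - zc) / (w - zc))%C (RtoC 0)).
    { apply (tends_eq _ _ (l - l * (z - zc) / (z - zc))%C).
      { field. apply hcz. lra. }
      apply tends_minus; [apply nb_filter|exact p1|].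
      apply tends_div; [apply nb_filter|apply hcz; lra|apply tends_const, nb_filter|].
      apply tends_minus; [apply nb_filter|apply tends_nb_id|apply tends_const, nb_filter]. }
    intros e he. generalize (filter_and _ _ (filter_and _ _ (T e he) p2) (nb_UHP z hz')).
    apply filter_imp. intros w [[k1 k2] k3].
    destruct (Ceq_dec w z) as [E|E].
    + rewrite E. replace (z - z)%C with (RtoC 0) by ring. rewrite Cmod_0. lra.
    + rewrite <- Cmod_mult. left. eapply Rle_lt_trans; [|exact k1]. right. f_equal.
      unfold h, num. rewrite k2. field. split; [apply hcz; lra|apply hne; auto].
  - lra.
  - intros w hw hR.
    assert (q1 := Cmod_ge_0 z). assert (q2 := Cmod_ge_0 zc).
    assert (hw0 : w <> z) by (intros E; rewrite E in hR; lra).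
    assert (n1 := hne w hw0). assert (n2 := hcz w hw).
    unfold h. rewrite Cmod_mult, Cmod_inv, Cmod_mult by (apply Cmult_neq_0; auto).
    replace (4 * (2 * K + 4 * B) / Cmod w ^ 2) with ((2 * K + 4 * B) * (4 / Cmod w ^ 2)) by (field; lra).
    apply Rmult_le_compat; auto using Cmod_ge_0.
    + left. apply Rinv_0_lt_compat. apply Rmult_lt_0_compat; apply Cmod_gt_0; auto.
    + unfold num. eapply Rle_trans; [apply Cmod_triangle_minus|].
      apply Rplus_le_compat.
      * eapply Rle_trans; [apply Cmod_triangle_minus|]. generalize (f2 w hw) (f2 z ltac:(lra)). lra.
      * rewrite Cmod_div, !Cmod_mult by auto. fold B.
        apply Rle_div_l; [apply Cmod_gt_0; auto|].
        assert (u1 := Cmod_triangle_minus w z). assert (u2 := Cmod_sub_far w zc ltac:(lra)).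
        replace (Cmod l * Cmod (w - z) * Cmod (z - zc)) with (B * Cmod (w - z)) by (unfold B; ring).
        rewrite Rmult_assoc, (Rmult_comm 4), Rmult_assoc. apply Rmult_le_compat_l; auto. lra.
    + apply Cinv_sq_far; lra. }
assert (Hp := IR_scal _ (l * (z - zc) * RtoC (/ y))%C _ (contR_poisson x y hz) (IR_poisson x y hz)).
assert (Hs := IR_scal _ (f z) _ (contR_sqinv z ltac:(lra)) (IR_sqinv z hz')).
assert (Ch : contR (fun t => h (RtoC t))).
{ unfold h, num. apply contR_mult.
  - apply contR_minus.
    + apply contR_minus; [exact Hc|apply contR_const].
    + apply contR_div; [intros; apply hcz; simpl; lra| |apply contR_sub_const].
      apply contR_mult; [|apply contR_const]. apply contR_mult; [apply contR_const|apply contR_sub_const].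
  - apply (contR_sqinv z). lra. }
assert (C1 : contR (fun t => f z * sqinv z t)%C) by (apply contR_mult; [apply contR_const|apply contR_sqinv; lra]).
assert (C2 : contR (fun t => l * (z - zc) * RtoC (/ y) * RtoC (poisson x y t))%C).
{ apply contR_mult; [apply contR_const|apply contR_poisson; auto]. }
assert (HH := IR_plus _ _ _ _ (contR_plus _ _ Ch C1) C2 (IR_plus _ _ _ _ Ch C1 Hzero Hs) Hp).
replace (RtoC (2 * PI) * Ci * l)%C with (0 + f z * 0 + l * (z - zc) * RtoC (/ y) * RtoC PI)%C.
2: { replace (z - zc)%C with (RtoC (2 * y) * Ci)%C.
     - rewrite !RtoC_mult, RtoC_inv by lra. field. intros E. apply RtoC_inj in E. lra.
     - rewrite Ez. unfold zc, RtoC, Ci, Cminus, Cplus, Copp, Cmult. simpl. apply pair_eq; ring. }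
revert HH. apply IR_ext. intros t.
assert (n1 : (RtoC t - z)%C <> RtoC 0) by (apply real_minus_neq; lra).
assert (n2 : (RtoC t - zc)%C <> RtoC 0) by (apply real_minus_neq; lra).
rewrite <- Cmult_assoc, <- RtoC_mult, <- poisson_kernel by auto.
fold zc. rewrite <- Ez. unfold h, num, sqinv. field. auto.
Qed.

(** * Hoelder functions on the real line *)

(* Replaces the chordal metric of [holder_bound] by Hoelder continuity in
   [|s - t|] together with a rate of convergence to the value at infinity. *)
Definition LH (nu K : R) (g : R -> C) : Prop :=
  0 <= K /\ (forall t, Cmod (g t) <= K) /\
  (forall s t, Cmod (g s - g t) <= K * Rpower (Rabs (s - t)) nu) /\
  exists c, forall t, Cmod (g t - c) <= K * Rpower (1 + Rabs t) (- nu).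

Lemma Rpower_1_base c : Rpower 1 c = 1.
Proof. unfold Rpower. rewrite ln_1, Rmult_0_r. apply exp_0. Qed.

Lemma Rpower_le_exp a b c : 1 <= a -> b <= c -> Rpower a b <= Rpower a c.
Proof.
intros ha hbc. unfold Rpower. destruct (Rle_lt_or_eq_dec _ _ ha) as [h|h].
- assert (hl : 0 < ln a) by (rewrite <- ln_1; apply ln_increasing; lra).
  destruct (Rle_lt_or_eq_dec _ _ hbc) as [h'|h'].
  + left. apply exp_increasing. nra.
  + right. congruence.
- rewrite <- h, ln_1, !Rmult_0_r. lra.
Qed.

Lemma Rpower_le_exp_small a b c : 0 < a <= 1 -> b <= c -> Rpower a c <= Rpower a b.
Proof.
intros ha hbc. replace a with (/ / a) by (field; lra).
unfold Rpower. rewrite (ln_Rinv (/ a)) by (apply Rinv_0_lt_compat; lra).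
replace (c * - ln (/ a)) with (- c * ln (/ a)) by ring.
replace (b * - ln (/ a)) with (- b * ln (/ a)) by ring.
apply (Rpower_le_exp (/ a)); [|lra].
rewrite <- Rinv_1. apply Rinv_le_contravar; lra.
Qed.

Lemma LH_weaken nu K K' g : K <= K' -> LH nu K g -> LH nu K' g.
Proof.
intros hK (h0 & h1 & h2 & c & h3). split; [lra|split; [|split]].
- intros t. eapply Rle_trans; [apply h1|auto].
- intros s t. eapply Rle_trans; [apply h2|]. apply Rmult_le_compat_r; auto. left; apply Rpower_pos.
- exists c. intros t. eapply Rle_trans; [apply h3|]. apply Rmult_le_compat_r; auto. left; apply Rpower_pos.
Qed.

(** Lowering the exponent weakens the modulus only up to distance 1. Beyond that the supremum bound
    takes over, which costs the factor 2. *)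
Lemma LH_weaken_exp nu nu' K g : 0 < nu' <= nu -> LH nu K g -> LH nu' (2 * K) g.
Proof.
intros hn (h0 & h1 & h2 & c & h3). split; [lra|split; [|split]].
- intros t. specialize (h1 t). lra.
(* [Rpower] at base 0 is positive rather than 0, so the diagonal [s = t] is always treated
   separately. *)
- intros s t. destruct (Req_dec s t) as [->|E].
  { replace (g t - g t)%C with (RtoC 0) by ring. rewrite Cmod_0.
    apply Rmult_le_pos; [lra|left; apply Rpower_pos]. }
  assert (hst : 0 < Rabs (s - t)) by (apply Rabs_pos_lt; lra).
  destruct (Rle_lt_dec (Rabs (s - t)) 1) as [q|q].
  + eapply Rle_trans; [apply h2|]. apply Rmult_le_compat; [lra|left; apply Rpower_pos|lra|].
    apply Rpower_le_exp_small; lra.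
  + eapply Rle_trans; [apply Cmod_triangle_minus|].
    assert (q1 := h1 s). assert (q2 := h1 t).
    assert (1 <= Rpower (Rabs (s - t)) nu').
    { rewrite <- (Rpower_1_base nu'). apply Rle_Rpower_l; lra. }
    nra.
- exists c. intros t. eapply Rle_trans; [apply h3|]. apply Rmult_le_compat; [lra|left; apply Rpower_pos|lra|].
  apply Rpower_le_exp; [generalize (Rabs_pos t)|]; lra.
Qed.

Lemma LH_const nu c : LH nu (Cmod c) (fun _ => c).
Proof.
assert (h := Cmod_ge_0 c).
split; [auto|split; [|split]].
- intros; lra.
- intros s t. replace (c - c)%C with (RtoC 0) by ring. rewrite Cmod_0.
  apply Rmult_le_pos; [auto|left; apply Rpower_pos].
- exists c. intros t. replace (c - c)%C with (RtoC 0) by ring. rewrite Cmod_0.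
  apply Rmult_le_pos; [auto|left; apply Rpower_pos].
Qed.

Lemma LH_plus nu K L f g : LH nu K f -> LH nu L g -> LH nu (K + L) (fun t => f t + g t)%C.
Proof.
intros (f0 & f1 & f2 & c & f3) (g0 & g1 & g2 & d & g3). split; [lra|split; [|split]].
- intros t. eapply Rle_trans; [apply Cmod_triangle|]. apply Rplus_le_compat; auto.
- intros s t. replace (f s + g s - (f t + g t))%C with ((f s - f t) + (g s - g t))%C by ring.
  eapply Rle_trans; [apply Cmod_triangle|]. rewrite Rmult_plus_distr_r. apply Rplus_le_compat; auto.
- exists (c + d)%C. intros t. replace (f t + g t - (c + d))%C with ((f t - c) + (g t - d))%C by ring.
  eapply Rle_trans; [apply Cmod_triangle|]. rewrite Rmult_plus_distr_r. apply Rplus_le_compat; auto.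
Qed.

Lemma Cmod_mult_le (z w : C) a b : Cmod z <= a -> Cmod w <= b -> Cmod (z * w) <= a * b.
Proof. intros h1 h2. rewrite Cmod_mult. apply Rmult_le_compat; auto using Cmod_ge_0. Qed.

(** The factor 3 comes from the decay: the limit [d] of [g] is bounded by [2 L], as seen by
    comparing with [g 0], so the two terms give 1 and 2. *)
Lemma LH_mult nu K L f g : LH nu K f -> LH nu L g -> LH nu (3 * K * L) (fun t => f t * g t)%C.
Proof.
intros (f0 & f1 & f2 & c & f3) (g0 & g1 & g2 & d & g3).
assert (KL : 0 <= K * L) by (apply Rmult_le_pos; auto).
split; [lra|split; [|split]].
- intros t. apply Rle_trans with (K * L); [|lra]. apply Cmod_mult_le; auto.
- intros s t. replace (f s * g s - f t * g t)%C with (f s * (g s - g t) + (f s - f t) * g t)%C by ring.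
  assert (hp := Rpower_pos (Rabs (s - t)) nu). set (P := Rpower (Rabs (s - t)) nu) in *.
  apply Rle_trans with (K * (L * P) + K * P * L).
  + eapply Rle_trans; [apply Cmod_triangle|]. apply Rplus_le_compat; apply Cmod_mult_le; auto.
  + assert (0 <= K * L * P) by (apply Rmult_le_pos; lra). lra.
- exists (c * d)%C. intros t. replace (f t * g t - c * d)%C with (f t * (g t - d) + (f t - c) * d)%C by ring.
  assert (hp := Rpower_pos (1 + Rabs t) (- nu)). set (P := Rpower (1 + Rabs t) (- nu)) in *.
  assert (hd : Cmod d <= 2 * L).
  { assert (q := g3 0). rewrite Rabs_R0, Rplus_0_r, Rpower_1_base, Rmult_1_r in q.
    assert (q' := g1 0). rewrite Cmod_sub_sym in q. generalize (Cmod_triangle_rev d (g 0)). lra. }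
  apply Rle_trans with (K * (L * P) + K * P * (2 * L)).
  + eapply Rle_trans; [apply Cmod_triangle|]. apply Rplus_le_compat; apply Cmod_mult_le; auto.
  + lra.
Qed.

Lemma LH_opp_arg nu K g : LH nu K g -> LH nu K (fun t => g (- t)).
Proof.
intros (h0 & h1 & h2 & c & h3). split; [auto|split; [|split]]; auto.
- intros s t. replace (Rabs (s - t)) with (Rabs (- s - - t)); auto.
  rewrite <- Rabs_Ropp. f_equal. ring.
- exists c. intros t. rewrite <- (Rabs_Ropp t). auto.
Qed.

Lemma LH_ext nu K f g : (forall t, f t = g t) -> LH nu K f -> LH nu K g.
Proof.
intros E (h0 & h1 & h2 & c & h3). split; [auto|split; [|split]].
- intros t. rewrite <- E. auto.
- intros s t. rewrite <- !E. auto.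
- exists c. intros t. rewrite <- E. auto.
Qed.

Lemma LH_contR nu K g : 0 < nu -> LH nu K g -> contR g.
Proof.
intros hn (h0 & h1 & h2 & _) t e he.
set (r := e / (K + 1)). assert (hr : 0 < r) by (apply Rdiv_lt_0_compat; lra).
exists (mkposreal (Rpower r (/ nu)) (Rpower_pos _ _)). intros s hs. change (Rabs (s - t) < Rpower r (/ nu)) in hs.
destruct (Req_dec s t) as [->|E].
{ replace (g t - g t)%C with (RtoC 0) by ring. rewrite Cmod_0. auto. }
assert (hst : 0 < Rabs (s - t)) by (apply Rabs_pos_lt; lra).
eapply Rle_lt_trans; [apply h2|].
assert (q : Rpower (Rabs (s - t)) nu <= r).
{ rewrite <- (Rpower_1 r) by auto. rewrite <- (Rinv_l nu) by lra. rewrite <- Rpower_mult.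
  apply Rle_Rpower_l; lra. }
apply Rle_lt_trans with (K * r); [apply Rmult_le_compat_l; auto|].
unfold r, Rdiv. replace (K * (e * / (K + 1))) with (e * (K * / (K + 1))) by ring.
rewrite <- (Rmult_1_r e) at 2. apply Rmult_lt_compat_l; auto. apply Rlt_div_l; lra.
Qed.

Lemma chord_eq (x y : R) :
  (bfun (RtoC x) - bfun (RtoC y))%C = (RtoC 2 * Ci * RtoC (x - y) / ((RtoC x + Ci) * (RtoC y + Ci)))%C.
Proof.
unfold bfun. rewrite !Defs_Cdiv.
change ((RtoC x - Ci) / (RtoC x + Ci) - (RtoC y - Ci) / (RtoC y + Ci) =
  RtoC 2 * Ci * RtoC (x - y) / ((RtoC x + Ci) * (RtoC y + Ci)))%C.
rewrite RtoC_minus. field.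
split; intros E; apply (f_equal snd) in E; simpl in E; lra.
Qed.

Lemma Cmod_plus_Ci (x : R) : 1 <= Cmod (RtoC x + Ci) /\ (1 + Rabs x) / 2 <= Cmod (RtoC x + Ci).
Proof.
assert (h1 := fst_le_Cmod (RtoC x + Ci)%C). assert (h2 := snd_le_Cmod (RtoC x + Ci)%C).
simpl in h1, h2. rewrite Rplus_0_r in h1. rewrite Rplus_0_l, Rabs_R1 in h2. lra.
Qed.

Lemma plus_Ci_neq (x : R) : (RtoC x + Ci)%C <> RtoC 0.
Proof. apply Cmod_gt_0. generalize (Cmod_plus_Ci x). lra. Qed.

Lemma Cmod_two_Ci (z : C) : Cmod (RtoC 2 * Ci * z) = 2 * Cmod z.
Proof. rewrite !Cmod_mult, Cmod_Ci, Cmod_R, Rabs_pos_eq by lra. ring. Qed.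

Lemma chord_le (x y : R) : Cmod (bfun (RtoC x) - bfun (RtoC y)) <= 2 * Rabs (x - y).
Proof.
rewrite chord_eq, Cmod_div by (apply Cmult_neq_0; apply plus_Ci_neq).
rewrite Cmod_two_Ci, Cmod_mult, Cmod_R.
destruct (Cmod_plus_Ci x) as [h1 _]. destruct (Cmod_plus_Ci y) as [h2 _].
apply Rle_div_l; [nra|].
assert (1 <= Cmod (RtoC x + Ci) * Cmod (RtoC y + Ci)) by nra.
generalize (Rabs_pos (x - y)). nra.
Qed.

Lemma b_near_1 (x : R) : Cmod (bfun (RtoC x) - RtoC 1) <= 4 * / (1 + Rabs x).
Proof.
assert (E : (bfun (RtoC x) - RtoC 1 = RtoC 2 * Ci * (- / (RtoC x + Ci)))%C).
{ unfold bfun. rewrite Defs_Cdiv. change ((RtoC x - Ci) / (RtoC x + Ci) - 1 = RtoC 2 * Ci * (- / (RtoC x + Ci)))%C.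
  field. apply plus_Ci_neq. }
rewrite E, Cmod_two_Ci, Cmod_opp, Cmod_inv by apply plus_Ci_neq.
destruct (Cmod_plus_Ci x) as [_ h]. assert (q := Rabs_pos x).
replace (4 * / (1 + Rabs x)) with (2 * / ((1 + Rabs x) / 2)) by (field; lra).
apply Rmult_le_compat_l; [lra|]. apply Rinv_le_contravar; lra.
Qed.

Lemma Cmod_b (x : R) : Cmod (bfun (RtoC x)) = 1.
Proof.
unfold bfun. rewrite Defs_Cdiv. change (Cmod ((RtoC x - Ci) / (RtoC x + Ci)) = 1).
rewrite Cmod_div by apply plus_Ci_neq.
replace (Cmod (RtoC x - Ci)) with (Cmod (RtoC x + Ci)).
- field. generalize (Cmod_plus_Ci x). lra.
- unfold Cmod. f_equal. simpl. ring.
Qed.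

Lemma LH_b nu : 0 < nu < 1 -> LH nu 8 (fun t => bfun (RtoC t)).
Proof.
intros hn. replace 8 with (2 * 4) by ring. apply (LH_weaken_exp 1); [lra|].
split; [lra|split; [|split]].
- intros t. rewrite Cmod_b. lra.
- intros s t. destruct (Req_dec s t) as [->|E].
  { replace (bfun (RtoC t) - bfun (RtoC t))%C with (RtoC 0) by ring. rewrite Cmod_0.
    apply Rmult_le_pos; [lra|left; apply Rpower_pos]. }
  rewrite Rpower_1 by (apply Rabs_pos_lt; lra).
  eapply Rle_trans; [apply chord_le|]. generalize (Rabs_pos (s - t)); lra.
- exists (RtoC 1). intros t. assert (q := Rabs_pos t). rewrite Rpower_Ropp, Rpower_1 by lra. apply b_near_1.
Qed.

(** The chordal distance is at most [2 |s - t|], which gives the modulus, and [b] is close to its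
    value 1 at infinity, which gives the decay. The value of [f] at infinity exists by completeness
    along the integers. *)
Lemma holder_bound_LH mu K f : 0 < mu < 1 -> holder_bound mu K f -> LH mu (8 * K) f.
Proof.
intros hm [h1 h2].
assert (hK : 0 <= K). { specialize (h1 0). rewrite Defs_Cmod in h1. generalize (Cmod_ge_0 (f 0)); lra. }
assert (h2' : forall x y, x <> y -> Cmod (f x - f y) <= K * Rpower (Cmod (bfun (RtoC x) - bfun (RtoC y))) mu).
{ intros x y hxy. generalize (h2 x y hxy). rewrite !Defs_Cmod. auto. }
assert (hb : forall x y, x <> y -> bfun (RtoC x) <> bfun (RtoC y)).
{ intros x y hxy E. apply Ceq_minus in E. rewrite chord_eq in E. revert E. unfold Cdiv.
  repeat apply Cmult_neq_0.
  - intros E. apply RtoC_inj in E. lra.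
  - apply Ci_nz.
  - intros E. apply RtoC_inj in E. lra.
  - apply Cmod_gt_0. rewrite Cmod_inv by (apply Cmult_neq_0; apply plus_Ci_neq).
    apply Rinv_0_lt_compat, Cmod_gt_0. apply Cmult_neq_0; apply plus_Ci_neq. }
assert (hb' : forall x y, x <> y -> 0 < Cmod (bfun (RtoC x) - bfun (RtoC y))).
{ intros x y hxy. apply Cmod_gt_0, Cminus_eq_contra, hb, hxy. }
split; [lra|split; [|split]].
- intros t. specialize (h1 t). rewrite Defs_Cmod in h1. lra.
- intros s t. destruct (Req_dec s t) as [->|E].
  { replace (f t - f t)%C with (RtoC 0) by ring. rewrite Cmod_0.
    apply Rmult_le_pos; [lra|left; apply Rpower_pos]. }
  assert (hst : 0 < Rabs (s - t)) by (apply Rabs_pos_lt; lra).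
  eapply Rle_trans; [apply h2'; auto|]. rewrite (Rmult_comm 8), Rmult_assoc. apply Rmult_le_compat_l; auto.
  apply Rle_trans with (Rpower (2 * Rabs (s - t)) mu).
  + apply Rle_Rpower_l; [lra|]. split; [apply hb'; auto|apply chord_le].
  + rewrite <- Rpower_mult_distr by lra. apply Rmult_le_compat_r; [left; apply Rpower_pos|].
    apply Rle_trans with (Rpower 2 1); [apply Rpower_le_exp; lra|rewrite Rpower_1; lra].
(* Both [b(x)] and [b(n)] lie within [4 / (1 + |x|)] of 1; this is where the constant 8 comes
   from. *)
- assert (far : forall x n, Rabs x < n -> Cmod (f x - f n) <= 8 * K * Rpower (1 + Rabs x) (- mu)).
  { intros x n hn. assert (q := Rabs_pos x). assert (hxn : x <> n) by (generalize (Rle_abs x); lra).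
    eapply Rle_trans; [apply h2'; auto|]. rewrite (Rmult_comm 8), Rmult_assoc. apply Rmult_le_compat_l; auto.
    apply Rle_trans with (Rpower (8 * / (1 + Rabs x)) mu).
    - apply Rle_Rpower_l; [lra|]. split; [apply hb'; auto|].
      eapply Rle_trans; [apply (Cmod_triangle_sub _ (RtoC 1))|].
      rewrite (Cmod_sub_sym (RtoC 1)).
      assert (b1 := b_near_1 x). assert (b2 := b_near_1 n).
      assert (b3 : / (1 + Rabs n) <= / (1 + Rabs x)).
      { apply Rinv_le_contravar; [lra|]. generalize (Rle_abs n). lra. }
      lra.
    - assert (qi : 0 < / (1 + Rabs x)) by (apply Rinv_0_lt_compat; lra).
      rewrite <- Rpower_mult_distr by lra. apply Rmult_le_compat; try (left; apply Rpower_pos).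
      + apply Rle_trans with (Rpower 8 1); [apply Rpower_le_exp; lra|rewrite Rpower_1; lra].
      + right. unfold Rpower. rewrite ln_Rinv by lra. f_equal. ring. }
  assert (small : forall e, 0 < e -> exists N : nat, 8 * K * Rpower (1 + Rabs (INR N)) (- mu) < e).
  { intros e he. set (r := e / (8 * K + 1)). assert (hr : 0 < r) by (apply Rdiv_lt_0_compat; lra).
    destruct (INR_unbounded (Rpower r (- / mu))) as [N hN]. exists N.
    assert (hp := Rpower_pos r (- / mu)).
    apply Rle_lt_trans with (8 * K * r).
    - apply Rmult_le_compat_l; [lra|].
      replace r with (Rpower (Rpower r (- / mu)) (- mu)).
      + apply Rpower_le_neg; [|lra]. split; [auto|]. generalize (Rle_abs (INR N)). lra.
      + rewrite Rpower_mult. replace (- / mu * - mu) with 1 by (field; lra). apply Rpower_1; auto.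
    - unfold r. apply (Rmult_lt_reg_r (8 * K + 1)); [lra|]. unfold Rdiv.
      replace (8 * K * (e * / (8 * K + 1)) * (8 * K + 1)) with (8 * K * e) by (field; lra). nra. }
  destruct (C_complete (fun n => f (INR n + 1))) as [c hc].
  { intros e he. destruct (small (e / 2)) as [N hN]; [lra|]. exists N. intros n m hn hm'.
    apply le_INR in hn, hm'. assert (q := pos_INR N).
    eapply Rle_lt_trans; [apply (Cmod_triangle_sub _ (f (INR N)))|]. rewrite Cmod_sub_sym.
    assert (q1 := far (INR N) (INR n + 1)). assert (q2 := far (INR N) (INR m + 1)).
    rewrite (Rabs_pos_eq (INR N)) in * by auto.
    specialize (q1 ltac:(lra)). specialize (q2 ltac:(lra)). lra. }
  exists c. intros t. apply Rnot_lt_le. intros hlt.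
  set (B := 8 * K * Rpower (1 + Rabs t) (- mu)) in *.
  destruct (hc (Cmod (f t - c) - B)) as [N hN]; [lra|].
  destruct (INR_unbounded (Rabs t)) as [N' hN'].
  set (n := Nat.max N N'). assert (hn : INR N' <= INR n) by (apply le_INR; lia).
  assert (q1 := far t (INR n + 1) ltac:(lra)). fold B in q1.
  assert (q2 := hN n ltac:(lia)). cbv beta in q2.
  assert (q3 := Cmod_triangle_sub (f t) (f (INR n + 1)) c). lra.
Qed.

Lemma Rpower_ge_1 a c : 1 <= a -> 0 <= c -> 1 <= Rpower a c.
Proof. intros ha hc. rewrite <- (Rpower_1_base c). apply Rle_Rpower_l; lra. Qed.

Lemma LH_near nu K g x y t : 0 < nu -> 0 < y -> LH nu K g ->
  Cmod (g t - g x) <= K * Rpower (y + Rabs (t - x)) nu.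
Proof.
intros hn hy (h0 & h1 & h2 & _).
destruct (Req_dec t x) as [->|E].
{ replace (g x - g x)%C with (RtoC 0) by ring. rewrite Cmod_0.
  apply Rmult_le_pos; [lra|left; apply Rpower_pos]. }
assert (hst : 0 < Rabs (t - x)) by (apply Rabs_pos_lt; lra).
eapply Rle_trans; [apply h2|]. apply Rmult_le_compat_l; auto. apply Rle_Rpower_l; lra.
Qed.

Lemma Rpower_1_plus v c : 0 < v -> 0 <= c <= 1 -> Rpower (1 + v) c <= 2 * (1 + Rpower v c).
Proof.
intros hv hc. assert (hp := Rpower_pos v c).
assert (h2 : Rpower 2 c <= 2). { rewrite <- (Rpower_1 2) at 2 by lra. apply Rpower_le_exp; lra. }
destruct (Rle_lt_dec v 1) as [h|h].
- apply Rle_trans with (Rpower 2 c); [apply Rle_Rpower_l; lra|lra].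
- apply Rle_trans with (Rpower (2 * v) c); [apply Rle_Rpower_l; lra|].
  rewrite <- Rpower_mult_distr by lra. nra.
Qed.

Lemma Rpower_half a c : Rpower a c = Rpower a (c / 2) * Rpower a (c / 2).
Proof. rewrite <- Rpower_plus. f_equal. field. Qed.

(* Geometric mean of the Hoelder bound for [g t - g x] and of the bound coming
   from the decay of [g - g(oo)]. *)
Lemma LH_far nu K g x y t : 0 < nu < 1 -> 0 < y -> LH nu K g ->
  Cmod (g t - g x) <= 4 * K * Rpower (1 + Rabs x) (- (nu / 2)) *
    (Rpower (y + Rabs (t - x)) (nu / 2) + Rpower (y + Rabs (t - x)) nu).
Proof.
intros hn hy Hg. assert (A := LH_near nu K g x y t ltac:(lra) hy Hg).
destruct Hg as (h0 & h1 & h2 & c & h3).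
set (v := y + Rabs (t - x)) in *. set (X := 1 + Rabs x).
assert (hu := Rabs_pos (t - x)). assert (hx := Rabs_pos x). assert (ht := Rabs_pos t).
assert (hv : 0 < v) by (unfold v; lra). assert (hX : 1 <= X) by (unfold X; lra).
assert (B : Cmod (g t - g x) <= 2 * K * Rpower X (- nu) * Rpower (1 + v) nu).
{ assert (p1 := Rpower_pos X (- nu)).
  assert (p2 : 1 <= Rpower (1 + v) nu) by (apply Rpower_ge_1; lra).
  (* The inequality [1 + |x| <= (1 + |t|) (1 + v)] converts decay in [t] into decay in [x], at the
     price of a power of [1 + v]. *)
  assert (q1 : Rpower (1 + Rabs t) (- nu) <= Rpower X (- nu) * Rpower (1 + v) nu).
  { rewrite !Rpower_Ropp. apply (Rmult_le_reg_l (Rpower (1 + Rabs t) nu)); [apply Rpower_pos|].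
    rewrite Rinv_r by (apply Rgt_not_eq, Rpower_pos).
    apply (Rmult_le_reg_l (Rpower X nu)); [apply Rpower_pos|]. rewrite Rmult_1_r.
    replace (Rpower X nu * (Rpower (1 + Rabs t) nu * (/ Rpower X nu * Rpower (1 + v) nu)))
      with (Rpower (1 + Rabs t) nu * Rpower (1 + v) nu) by (field; apply Rgt_not_eq, Rpower_pos).
    rewrite Rpower_mult_distr by lra. apply Rle_Rpower_l; [lra|]. split; [lra|].
    assert (Rabs x <= Rabs t + Rabs (t - x)).
    { rewrite (Rabs_minus_sym t). replace x with (t + (x - t)) at 1 by ring. apply Rabs_triang. }
    unfold X, v. nra. }
  eapply Rle_trans; [apply (Cmod_triangle_sub _ c)|]. rewrite (Cmod_sub_sym c).
  assert (q2 := h3 t). assert (q3 := h3 x). fold X in q3.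
  assert (q4 : K * Rpower (1 + Rabs t) (- nu) <= K * (Rpower X (- nu) * Rpower (1 + v) nu)) by (apply Rmult_le_compat_l; auto).
  assert (q5 : K * Rpower X (- nu) <= K * (Rpower X (- nu) * Rpower (1 + v) nu)) by (apply Rmult_le_compat_l; auto; nra).
  lra. }
set (a := Cmod (g t - g x)) in *. assert (ha : 0 <= a) by apply Cmod_ge_0.
set (P := Rpower v (nu / 2)). set (Q := Rpower X (- (nu / 2))). set (S := Rpower (1 + v) (nu / 2)).
rewrite (Rpower_half v nu) in A. rewrite (Rpower_half X (- nu)), (Rpower_half (1 + v) nu) in B.
replace (- nu / 2) with (- (nu / 2)) in B by field. fold P in A. fold Q S in B.
assert (p1 : 0 < P) by apply Rpower_pos. assert (p2 : 0 < Q) by apply Rpower_pos. assert (p3 : 0 < S) by apply Rpower_pos.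
assert (hS : S <= 2 * (1 + P)) by (apply Rpower_1_plus; lra).
assert (M : a <= 2 * K * P * Q * S).
{ apply Rsqr_incr_0_var.
  - unfold Rsqr. apply Rle_trans with (K * (P * P) * (2 * K * (Q * Q) * (S * S))).
    + apply Rmult_le_compat; auto.
    + assert (0 <= (K * P * Q * S) * (K * P * Q * S)) by apply Rle_0_sqr. lra.
  - repeat apply Rmult_le_pos; lra. }
eapply Rle_trans; [exact M|]. rewrite (Rpower_half v nu). fold P.
replace (4 * K * Q * (P + P * P)) with (2 * K * P * Q * (2 * (1 + P))) by ring.
apply Rmult_le_compat_l; auto. repeat apply Rmult_le_pos; lra.
Qed.

(** Both exponents are negative, so the product is dominated by the full power of the smaller
    base. *)
Lemma Rpower_mix a b p q : 0 < a -> 0 < b -> 0 <= p -> 0 <= q ->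
  Rpower a (- p) * Rpower b (- q) <= Rpower a (- p - q) + Rpower b (- p - q).
Proof.
intros ha hb hp hq.
assert (h1 := Rpower_pos a (- p)). assert (h2 := Rpower_pos b (- q)).
assert (h3 := Rpower_pos a (- p - q)). assert (h4 := Rpower_pos b (- p - q)).
destruct (Rle_lt_dec a b) as [h|h].
- assert (Rpower b (- q) <= Rpower a (- q)) by (apply Rpower_le_neg; lra).
  assert (Rpower a (- p - q) = Rpower a (- p) * Rpower a (- q)) by (rewrite <- Rpower_plus; f_equal; ring). nra.
- assert (Rpower a (- p) <= Rpower b (- p)) by (apply Rpower_le_neg; lra).
  assert (Rpower b (- p - q) = Rpower b (- p) * Rpower b (- q)) by (rewrite <- Rpower_plus; f_equal; ring). nra.
Qed.

(** The exponent of the kernel is split as [- 2 = (- 1 - h) - (1 - h)]. The first part becomes decay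
    in [y]; the second, combined with the decay [2 h] of the density, yields the integrable exponent
    [- 1 - h]. *)
Lemma kernel_mix h x y t : 0 < h < 1 -> 1 <= y ->
  Rpower (1 + Rabs t) (- (2 * h)) * bump 1 y x t <= Rpower y (- 1 - h) * (bump h 1 0 t + bump h 1 x t).
Proof.
intros hh hy. unfold bump. rewrite Rminus_0_r.
assert (hu := Rabs_pos (t - x)). assert (ht := Rabs_pos t).
set (u := Rabs (t - x)) in *.
assert (q1 : Rpower (y + u) (- 1 - 1) <= Rpower y (- 1 - h) * Rpower (1 + u) (- (1 - h))).
{ replace (- 1 - 1) with ((- 1 - h) + - (1 - h)) by ring. rewrite Rpower_plus.
  apply Rmult_le_compat; try (left; apply Rpower_pos); apply Rpower_le_neg; lra. }
assert (q2 := Rpower_mix (1 + Rabs t) (1 + u) (2 * h) (1 - h) ltac:(lra) ltac:(lra) ltac:(lra) ltac:(lra)).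
replace (- (2 * h) - (1 - h)) with (- 1 - h) in q2 by ring.
assert (p1 := Rpower_pos (1 + Rabs t) (- (2 * h))). assert (p2 := Rpower_pos y (- 1 - h)).
eapply Rle_trans; [apply Rmult_le_compat_l; [lra|exact q1]|].
replace (Rpower (1 + Rabs t) (- (2 * h)) * (Rpower y (-1 - h) * Rpower (1 + u) (- (1 - h))))
 with (Rpower y (-1 - h) * (Rpower (1 + Rabs t) (- (2 * h)) * Rpower (1 + u) (- (1 - h)))) by ring.
apply Rmult_le_compat_l; lra.
Qed.

Lemma Rpower_bump x y t c : 0 < y -> Rpower (y + Rabs (t - x)) c * bump 1 y x t = bump (1 - c) y x t.
Proof. intros hy. unfold bump. rewrite <- Rpower_plus. f_equal. ring. Qed.

Lemma Cmod_kernel_lower (t : R) (z : C) : (Rabs (snd z) + Rabs (t - fst z)) / 2 <= Cmod (RtoC t - z).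
Proof.
assert (h1 := fst_le_Cmod (RtoC t - z)%C). assert (h2 := snd_le_Cmod (RtoC t - z)%C).
simpl in h1, h2. rewrite Rplus_0_l, Rabs_Ropp in h2. unfold Rminus in *. lra.
Qed.

Lemma Cmod_sqinv z t : 0 < snd z -> Cmod (sqinv z t) <= 4 * bump 1 (snd z) (fst z) t.
Proof.
intros hz. assert (h := Cmod_kernel_lower t z). rewrite (Rabs_pos_eq (snd z)) in h by lra.
assert (hu := Rabs_pos (t - fst z)).
assert (n : (RtoC t - z)%C <> RtoC 0) by (apply real_minus_neq; lra).
unfold sqinv, bump. rewrite Cmod_inv, Cmod_mult by (apply Cmult_neq_0; auto).
replace (- 1 - 1) with (- INR 2) by (simpl; ring). rewrite Rpower_Ropp, Rpower_pow by lra.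
set (v := snd z + Rabs (t - fst z)) in *. assert (hv : 0 < v) by (unfold v; lra).
replace (4 * / v ^ 2) with (/ (v / 2 * (v / 2))) by (field; lra).
apply Rinv_le_contravar; [|apply Rmult_le_compat]; try lra. apply Rmult_lt_0_compat; lra.
Qed.

(** * Boundary regularity *)

Lemma csum_S (f : nat -> C) n : csum f (S n) = (csum f n + f n)%C :> C.
Proof. reflexivity. Qed.

Lemma csum_ext (f g : nat -> C) n : (forall k, (k < n)%nat -> f k = g k) -> csum f n = csum g n.
Proof.
induction n as [|n IH]; intros H; [reflexivity|]. rewrite !csum_S, IH, H by auto. reflexivity.
Qed.

Lemma csum_bound (f : nat -> C) n B : (forall k, (k < n)%nat -> Cmod (f k) <= B) -> Cmod (csum f n) <= INR n * B.
Proof.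
induction n as [|n IH]; intros H.
- simpl. change (Cmod (RtoC 0) <= 0 * B). rewrite Cmod_0. lra.
- rewrite csum_S, S_INR. eapply Rle_trans; [apply Cmod_triangle|].
  specialize (IH ltac:(auto)). specialize (H n ltac:(lia)). lra.
Qed.

Lemma csum_mult_r (f : nat -> C) c n : (csum f n * c)%C = csum (fun k => f k * c)%C n.
Proof.
induction n as [|n IH]; [apply Cmult_0_l|]. rewrite !csum_S, <- IH. ring.
Qed.

Lemma csum_mult_l (f : nat -> C) c n : (c * csum f n)%C = csum (fun k => c * f k)%C n.
Proof.
induction n as [|n IH]; [apply Cmult_0_r|]. rewrite !csum_S, <- IH. ring.
Qed.

Lemma csum_plus (f g : nat -> C) n : csum (fun k => f k + g k)%C n = (csum f n + csum g n)%C :> C.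
Proof.
induction n as [|n IH]; [symmetry; apply Cplus_0_l|]. rewrite !csum_S, IH. ring.
Qed.

Lemma contR_csum (f : nat -> R -> C) n : (forall k, (k < n)%nat -> contR (f k)) -> contR (fun t => csum (fun k => f k t) n).
Proof.
induction n as [|n IH]; intros H; [exact (contR_const (RtoC 0))|].
apply (contR_ext (fun t => csum (fun k => f k t) n + f n t)%C); [reflexivity|].
apply contR_plus; auto.
Qed.

Lemma IR_csum_0 (f : nat -> R -> C) n : (forall k, (k < n)%nat -> contR (f k)) ->
  (forall k, (k < n)%nat -> IR (f k) (RtoC 0)) -> IR (fun t => csum (fun k => f k t) n) (RtoC 0).
Proof.
induction n as [|n IH]; intros H1 H2; [apply IR_zero|].
apply (IR_ext (fun t => csum (fun k => f k t) n + f n t)%C); [reflexivity|].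
replace (RtoC 0) with (RtoC 0 + RtoC 0)%C by ring.
apply IR_plus; auto. apply contR_csum; auto.
Qed.

Section CauchyRepresentation.
Variables (f : C -> C) (n : nat) (h g : nat -> R -> C) (nu K H : R).
Hypothesis nu_range : 0 < nu < 1.
Hypothesis K_pos : 0 <= K.
Hypothesis H_pos : 0 <= H.
Hypothesis h_cont : forall m, (m < n)%nat -> contR (h m).
Hypothesis h_bound : forall m t, (m < n)%nat -> Cmod (h m t) <= H.
Hypothesis h_lower : forall m z, (m < n)%nat -> 0 < snd z -> IR (fun t => h m t * sqinv z t)%C (RtoC 0).
Hypothesis g_LH : forall m, (m < n)%nat -> LH nu K (g m).
Hypothesis rep : forall z l, 0 < snd z -> Cder f z l ->
  IR (fun t => csum (fun m => h m t * g m t)%C n * sqinv z t)%C (RtoC (2 * PI) * Ci * l)%C.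

(* Since the integrals of [h m / (t - z)^2] vanish, constants can be subtracted
   from the [g m] in the Cauchy formula for [f']. *)
Lemma derivative_bound z l (c : nat -> C) phi B : 0 < snd z -> Cder f z l -> dom phi B ->
  (forall m t, (m < n)%nat -> Cmod (g m t - c m) * (4 * bump 1 (snd z) (fst z) t) <= phi t) ->
  Cmod l <= INR n * H * B.
Proof.
intros hz Hl Hd Hphi.
assert (Hs := contR_sqinv z ltac:(lra)).
assert (Cg : forall m, (m < n)%nat -> contR (g m)) by (intros m hm; eapply LH_contR; [|apply g_LH; auto]; lra).
assert (C1 : contR (fun t => csum (fun m => h m t * g m t)%C n * sqinv z t)%C).
{ apply contR_mult; auto. apply contR_csum. intros. apply contR_mult; auto. }
assert (C2 : contR (fun t => csum (fun m => c m * (h m t * sqinv z t))%C n)).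
{ apply contR_csum. intros. apply contR_mult; [apply contR_const|apply contR_mult; auto]. }
assert (I2 : IR (fun t => csum (fun m => c m * (h m t * sqinv z t))%C n) (RtoC 0)).
{ apply (IR_csum_0 (fun m t => c m * (h m t * sqinv z t))%C); intros m hm.
  - apply contR_mult; [apply contR_const|apply contR_mult; auto].
  - replace (RtoC 0) with (c m * RtoC 0)%C by ring. apply IR_scal; auto. apply contR_mult; auto. }
assert (I3 := IR_minus _ _ _ _ C1 C2 (rep z l hz Hl) I2).
assert (E : forall t, (csum (fun m => h m t * g m t)%C n * sqinv z t - csum (fun m => c m * (h m t * sqinv z t))%C n)%C
  = csum (fun m => h m t * (g m t - c m) * sqinv z t)%C n).
{ intros t. rewrite csum_mult_r. unfold Cminus at 1.
  replace (- csum (fun m => c m * (h m t * sqinv z t)) n)%C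
    with (- (1) * csum (fun m => c m * (h m t * sqinv z t)) n)%C by ring.
  rewrite csum_mult_l, <- csum_plus. apply csum_ext. intros; ring. }
assert (D := dom_scal phi (INR n * H) B ltac:(apply Rmult_le_pos; auto using pos_INR) Hd).
assert (Q' : Cmod (RtoC (2 * PI) * Ci * l - 0) <= INR n * H * B).
{ refine (IR_bound _ _ _ _ (contR_minus _ _ C1 C2) _ D I3). intros t. cbv beta. rewrite E. rewrite Rmult_assoc. apply csum_bound. intros m hm.
  rewrite <- Cmult_assoc. apply Cmod_mult_le; auto. rewrite Cmod_mult.
  eapply Rle_trans; [|apply (Hphi m t hm)]. apply Rmult_le_compat_l; [apply Cmod_ge_0|]. apply Cmod_sqinv; auto. }
replace (RtoC (2 * PI) * Ci * l - 0)%C with (RtoC (2 * PI) * Ci * l)%C in Q' by ring.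
rewrite !Cmod_mult, Cmod_Ci, Cmod_R in Q'. assert (P1 : 3 < PI) by (generalize PI2_3_2; lra).
rewrite Rabs_pos_eq in Q' by lra. generalize (Cmod_ge_0 l). nra.
Qed.

(** The value of [g m] at the real part of [z] is subtracted. The modulus then cancels [nu] powers
    of the kernel, leaving a [bump] with parameter [1 - nu], whose integral produces
    [y^(nu - 1)]. *)
Lemma derivative_bound_near z l : 0 < snd z -> Cder f z l ->
  Cmod l <= (8 * INR n * H * K / (1 - nu)) * Rpower (snd z) (nu - 1).
Proof.
intros hz Hl.
assert (D := dom_scal _ (4 * K) _ ltac:(lra) (dom_bump (1 - nu) (snd z) (fst z) ltac:(lra) hz)).
assert (Q := derivative_bound z l (fun m => g m (fst z)) _ _ hz Hl D).
eapply Rle_trans; [apply Q|].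
- intros m t hm. rewrite <- Rpower_bump by auto.
  assert (q := LH_near nu K (g m) (fst z) (snd z) t ltac:(lra) hz (g_LH m hm)).
  assert (q' : 0 < bump 1 (snd z) (fst z) t) by apply Rpower_pos. nra.
- right. replace (- (1 - nu)) with (nu - 1) by ring. field. lra.
Qed.

(** The same cancellation with [LH_far] in place of the plain modulus: half of the exponent is spent
    on decay in [|x|], hence the two powers of the height. *)
Lemma derivative_bound_mixed z l : 0 < snd z -> Cder f z l ->
  Cmod l <= (32 * INR n * H * K / (1 - nu)) * Rpower (1 + Rabs (fst z)) (- (nu / 2)) *
    (Rpower (snd z) (nu / 2 - 1) + Rpower (snd z) (nu - 1)).
Proof.
intros hz Hl. set (X := Rpower (1 + Rabs (fst z)) (- (nu / 2))). assert (hX : 0 < X) by apply Rpower_pos.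
assert (D := dom_scal _ (16 * K * X) _ ltac:(repeat apply Rmult_le_pos; lra)
   (dom_plus _ _ _ _ (dom_bump (1 - nu / 2) (snd z) (fst z) ltac:(lra) hz) (dom_bump (1 - nu) (snd z) (fst z) ltac:(lra) hz))).
assert (Q := derivative_bound z l (fun m => g m (fst z)) _ _ hz Hl D).
eapply Rle_trans; [apply Q|].
- intros m t hm. rewrite <- !Rpower_bump by auto.
  assert (q := LH_far nu K (g m) (fst z) (snd z) t ltac:(lra) hz (g_LH m hm)). fold X in q.
  assert (q' : 0 < bump 1 (snd z) (fst z) t) by apply Rpower_pos. nra.
- replace (- (1 - nu)) with (nu - 1) by ring. replace (- (1 - nu / 2)) with (nu / 2 - 1) by ring.
  set (P := Rpower (snd z) (nu / 2 - 1)). set (P' := Rpower (snd z) (nu - 1)).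
  assert (hP : 0 < P) by apply Rpower_pos. assert (hP' : 0 < P') by apply Rpower_pos.
  assert (hi : 2 / (1 - nu / 2) <= 2 / (1 - nu)).
  { unfold Rdiv. apply Rmult_le_compat_l; [lra|]. apply Rinv_le_contravar; lra. }
  apply Rle_trans with (INR n * H * (16 * K * X * (2 / (1 - nu) * P + 2 / (1 - nu) * P'))).
  + apply Rmult_le_compat_l; [apply Rmult_le_pos; auto using pos_INR|].
    apply Rmult_le_compat_l; [repeat apply Rmult_le_pos; lra|]. nra.
  + right. field. lra.
Qed.

(** Here the values at infinity are subtracted. The result is integrable as the height grows, so
    that [f] has a limit at infinity along vertical lines. *)
Lemma derivative_bound_high z l : 1 <= snd z -> Cder f z l ->
  Cmod l <= (32 * INR n * H * K / nu) * Rpower (snd z) (- 1 - nu / 2).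
Proof.
intros hz Hl. set (Y := Rpower (snd z) (- 1 - nu / 2)). assert (hY : 0 < Y) by apply Rpower_pos.
assert (D := dom_scal _ (4 * K * Y) _ ltac:(repeat apply Rmult_le_pos; lra)
   (dom_plus _ _ _ _ (dom_bump (nu / 2) 1 0 ltac:(lra) Rlt_0_1) (dom_bump (nu / 2) 1 (fst z) ltac:(lra) Rlt_0_1))).
assert (ex : forall m, exists c, (m < n)%nat -> forall t, Cmod (g m t - c) <= K * Rpower (1 + Rabs t) (- nu)).
{ intros m. destruct (Nat.lt_ge_cases m n) as [hm|hm].
  - destruct (g_LH m hm) as (_ & _ & _ & c & hc). exists c. auto.
  - exists (RtoC 0). lia. }
set (c := fun m => proj1_sig (constructive_indefinite_description _ (ex m))).
assert (hc : forall m, (m < n)%nat -> forall t, Cmod (g m t - c m) <= K * Rpower (1 + Rabs t) (- nu)).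
{ intros m. unfold c. apply proj2_sig. }
assert (Q := derivative_bound z l c _ _ ltac:(lra) Hl D).
eapply Rle_trans; [apply Q|].
- intros m t hm. assert (q := hc m hm t).
  assert (q1 := kernel_mix (nu / 2) (fst z) (snd z) t ltac:(lra) hz). fold Y in q1.
  replace (2 * (nu / 2)) with nu in q1 by field.
  assert (q' : 0 < bump 1 (snd z) (fst z) t) by apply Rpower_pos.
  apply Rle_trans with (4 * K * (Rpower (1 + Rabs t) (- nu) * bump 1 (snd z) (fst z) t)).
  + nra.
  + rewrite Rmult_assoc.
    replace (4 * K * Y * (bump (nu / 2) 1 0 t + bump (nu / 2) 1 (fst z) t))
      with (4 * K * (Y * (bump (nu / 2) 1 0 t + bump (nu / 2) 1 (fst z) t))) by ring.
    rewrite <- Rmult_assoc. apply Rmult_le_compat_l; lra.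
- rewrite !Rpower_1_base. right. field. lra.
Qed.

End CauchyRepresentation.

(** * From bounds on the derivative to Hoelder continuity and decay at the boundary *)

Lemma is_derive_path f (z0 dir k : C) s l : Cder f (z0 + RtoC s * dir)%C l ->
  is_derive (fun s => fst (k * f (z0 + RtoC s * dir)%C)%C) s (fst (k * (l * dir))%C).
Proof.
intros [phi [h1 h2]]. apply is_derive_Reals. intros e he.
set (M := Cmod k * Cmod dir + 1).
assert (hM : 0 < M) by (unfold M; generalize (Rmult_le_pos _ _ (Cmod_ge_0 k) (Cmod_ge_0 dir)); lra).
assert (heM : 0 < e / M) by (apply Rdiv_lt_0_compat; auto).
destruct (filter_and _ _ (h1 _ heM) h2) as [d [hd H]].
assert (hN : 0 < Cmod dir + 1) by (generalize (Cmod_ge_0 dir); lra).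
assert (hdN : 0 < d / (Cmod dir + 1)) by (apply Rdiv_lt_0_compat; auto).
exists (mkposreal _ hdN). intros u hu hud. simpl in hud.
set (w := (z0 + RtoC (s + u) * dir)%C).
assert (E : (w - (z0 + RtoC s * dir))%C = (RtoC u * dir)%C) by (unfold w; rewrite RtoC_plus; ring).
destruct (H w I) as [H1 H2].
{ rewrite E, Cmod_mult, Cmod_R. apply Rlt_div_r in hud; auto.
  generalize (Cmod_ge_0 dir) (Rabs_pos u). intros. nra. }
fold w. rewrite E in H2.
assert (E2 : (fst (k * f w)%C - fst (k * f (z0 + RtoC s * dir))%C) / u - fst (k * (l * dir))%C
   = fst (k * ((phi w - l) * dir))%C).
{ replace (k * ((phi w - l) * dir))%C with (k * (phi w * dir) - k * (l * dir))%C by ring.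
  assert (E3 : fst (k * f w)%C - fst (k * f (z0 + RtoC s * dir))%C = u * fst (k * (phi w * dir))%C).
  { rewrite <- (re_scal_l u). unfold Re. replace (RtoC u * (k * (phi w * dir)))%C with (k * (phi w * (RtoC u * dir)))%C by ring.
    rewrite <- H2. replace (k * (f w - f (z0 + RtoC s * dir)))%C with (k * f w - k * f (z0 + RtoC s * dir))%C by ring.
    reflexivity. }
  rewrite E3. change (fst (k * (phi w * dir) - k * (l * dir))%C) with (fst (k * (phi w * dir))%C + - fst (k * (l * dir))%C).
  field. exact hu. }
rewrite E2. eapply Rle_lt_trans; [apply fst_le_Cmod|]. rewrite !Cmod_mult.
apply Rlt_div_r in H1; auto. unfold M in H1.
generalize (Cmod_ge_0 (phi w - l)%C) (Cmod_ge_0 k) (Cmod_ge_0 dir). intros. nra.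
Qed.

(** For the increment [D] of [f], the real function [Re (conj D f) - |D| v] is nonincreasing along
    the segment. Its increment is [|D|^2 - |D| (v b - v a)], and dividing by [|D|] finishes. *)
Lemma mean_value_path f (z0 dir : C) (v dv : R -> R) a b : a <= b ->
  (forall s, a <= s <= b -> is_derive v s (dv s)) ->
  (forall s, a <= s <= b -> exists l, Cder f (z0 + RtoC s * dir)%C l /\ Cmod l * Cmod dir <= dv s) ->
  Cmod (f (z0 + RtoC b * dir)%C - f (z0 + RtoC a * dir)%C) <= v b - v a.
Proof.
intros hab Hv Hf.
set (D := (f (z0 + RtoC b * dir) - f (z0 + RtoC a * dir))%C).
destruct (Req_dec (Cmod D) 0) as [E0|E0].
{ rewrite E0. destruct (MVT_gen v a b dv) as [c [hc Ec]]; rewrite ?Rmin_left, ?Rmax_right in * by auto.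
  - intros; apply Hv; lra.
  - intros x hx. apply derivable_continuous_pt. exists (dv x). apply is_derive_Reals, Hv. lra.
  - rewrite Ec. apply Rmult_le_pos; [|lra]. destruct (Hf c hc) as [l [_ hl]].
    eapply Rle_trans; [|exact hl]. apply Rmult_le_pos; apply Cmod_ge_0. }
assert (hD : 0 < Cmod D) by (generalize (Cmod_ge_0 D); lra).
set (u := fun s => fst (Cconj D * f (z0 + RtoC s * dir))%C - Cmod D * v s).
assert (Hu : forall s, a <= s <= b -> exists d, is_derive u s d /\ d <= 0).
{ intros s hs. destruct (Hf s hs) as [l [h1 h2]].
  exists (fst (Cconj D * (l * dir))%C - Cmod D * dv s). split.
  - apply (is_derive_minus (K := R_AbsRing) (V := R_NormedModule) (fun s => fst (Cconj D * f (z0 + RtoC s * dir))%C) (fun s => Cmod D * v s)).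
    + apply is_derive_path; auto.
    + apply is_derive_scal. apply Hv; auto.
  - assert (q := Rle_trans _ _ _ (Rle_abs _) (fst_le_Cmod (Cconj D * (l * dir))%C)).
    rewrite !Cmod_mult, Cmod_conj in q. nra. }
assert (Hmon : u b <= u a).
{ destruct (MVT_gen u a b (Derive u)) as [c [hc Ec]]; rewrite ?Rmin_left, ?Rmax_right in * by auto.
  - intros x hx. destruct (Hu x ltac:(lra)) as [d [h1 _]]. rewrite (is_derive_unique _ _ _ h1). exact h1.
  - intros x hx. destruct (Hu x hx) as [d [h1 _]]. apply derivable_continuous_pt. exists d. apply is_derive_Reals; auto.
  - destruct (Hu c hc) as [d [h1 h2]]. rewrite (is_derive_unique _ _ _ h1) in Ec. nra. }
unfold u in Hmon.
assert (E : fst (Cconj D * f (z0 + RtoC b * dir))%C - fst (Cconj D * f (z0 + RtoC a * dir))%C = Cmod D * Cmod D).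
{ rewrite Cmod_sq. change (fst (Cconj D * f (z0 + RtoC b * dir))%C - fst (Cconj D * f (z0 + RtoC a * dir))%C)
    with (fst (Cconj D * f (z0 + RtoC b * dir) - Cconj D * f (z0 + RtoC a * dir))%C).
  replace (Cconj D * f (z0 + RtoC b * dir) - Cconj D * f (z0 + RtoC a * dir))%C with (Cconj D * D)%C by (unfold D; ring).
  unfold Cconj, Cmult. simpl. ring. }
nra.
Qed.

(** Continuity along the vertical from above. It is the only link to the boundary in the estimates
    below, so they apply before joint continuity there is known. *)
Definition vcont (f : C -> C) (z : C) : Prop :=
  forall e, 0 < e -> exists d0, 0 < d0 /\ forall d, 0 < d < d0 -> Cmod (f (fst z, snd z + d) - f z) < e.

Lemma path_v (x y s : R) : ((x, y) + RtoC s * Ci)%C = (x, y + s).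
Proof. unfold Cplus, Cmult, RtoC, Ci. simpl. apply pair_eq; ring. Qed.

Lemma path_h (x y s : R) : ((x, y) + RtoC s * RtoC 1)%C = (x + s, y).
Proof. unfold Cplus, Cmult, RtoC. simpl. apply pair_eq; ring. Qed.

Section UpperHalfPlane.
Variable f : C -> C.
Hypothesis f_der : forall z : C, 0 < snd z -> exists l, Cder f z l.

(** [v] is a primitive of a bound that may blow up at height 0. The mean value estimate starts at
    [s0 > 0]; since [v s0 >= 0] and [f] is vertically continuous, [s0] may tend to 0. *)
Lemma vertical_bound z (v dv : R -> R) d : 0 <= snd z -> vcont f z -> 0 < d ->
  (forall s, 0 < s <= d -> is_derive v s (dv s)) -> (forall s, 0 < s <= d -> 0 <= v s) ->
  (forall s l, 0 < s <= d -> Cder f (fst z, snd z + s) l -> Cmod l <= dv s) ->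
  Cmod (f (fst z, snd z + d) - f z) <= v d.
Proof.
intros hz Hc hd Hv Hv0 Hl. apply Rnot_lt_le. intros hlt.
destruct (Hc (Cmod (f (fst z, snd z + d) - f z) - v d)) as [d0 [hd0 H]]; [lra|].
set (s0 := Rmin (d0 / 2) d). assert (hs0 : 0 < s0) by (apply Rmin_pos; lra).
assert (q1 : s0 <= d0 / 2) by apply Rmin_l. assert (q2 : s0 <= d) by apply Rmin_r.
specialize (H s0 ltac:(lra)).
assert (Q : Cmod (f (fst z, snd z + d) - f (fst z, snd z + s0)) <= v d - v s0).
{ rewrite <- !path_v. apply (mean_value_path f _ Ci v dv); auto.
  - intros s hs. apply Hv. lra.
  - intros s hs. rewrite path_v. destruct (f_der (fst z, snd z + s)) as [l hl]; [simpl; lra|].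
    exists l. split; auto. rewrite Cmod_Ci, Rmult_1_r. apply (Hl s); auto; lra. }
assert (q3 := Cmod_triangle_sub (f (fst z, snd z + d)) (f (fst z, snd z + s0)) (f z)).
generalize (Hv0 s0 ltac:(lra)). lra.
Qed.

Lemma segment_bound_h x x' y M : 0 < y -> x <= x' ->
  (forall s l, x <= s <= x' -> Cder f (s, y) l -> Cmod l <= M) ->
  Cmod (f (x', y) - f (x, y)) <= M * (x' - x).
Proof.
intros hy hx H.
assert (Q := mean_value_path f (x, y) (RtoC 1) (fun s => M * s) (fun _ => M) 0 (x' - x) ltac:(lra)).
rewrite !path_h in Q. replace (x + (x' - x)) with x' in Q by ring. rewrite Rplus_0_r, Rmult_0_r, Rminus_0_r in Q.
apply Q.
- intros s _. auto_derive; auto. ring.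
- intros s hs. rewrite path_h. destruct (f_der (x + s, y)) as [l hl]; [simpl; auto|]. exists l. split; auto.
  rewrite Cmod_1, Rmult_1_r. apply (H (x + s)); auto. lra.
Qed.

Lemma segment_bound_v x y y' M : 0 < y -> y <= y' ->
  (forall s l, y <= s <= y' -> Cder f (x, s) l -> Cmod l <= M) ->
  Cmod (f (x, y') - f (x, y)) <= M * (y' - y).
Proof.
intros hy hx H.
assert (Q := mean_value_path f (x, y) Ci (fun s => M * s) (fun _ => M) 0 (y' - y) ltac:(lra)).
rewrite !path_v in Q. replace (y + (y' - y)) with y' in Q by ring. rewrite Rplus_0_r, Rmult_0_r, Rminus_0_r in Q.
apply Q.
- intros s _. auto_derive; auto. ring.
- intros s hs. rewrite path_v. destruct (f_der (x, y + s)) as [l hl]; [simpl; lra|]. exists l. split; auto.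
  rewrite Cmod_Ci, Rmult_1_r. apply (H (y + s)); auto. lra.
Qed.

Lemma segment_bound_h_abs x x' y M : 0 < y ->
  (forall s l, Cder f (s, y) l -> Cmod l <= M) ->
  Cmod (f (x', y) - f (x, y)) <= M * Rabs (x' - x).
Proof.
intros hy H. destruct (Rle_lt_dec x x') as [h|h].
- rewrite Rabs_pos_eq by lra. apply segment_bound_h; auto. intros s l _. apply H.
- rewrite Cmod_sub_sym, Rabs_left by lra. replace (- (x' - x)) with (x - x') by ring.
  apply segment_bound_h; auto; [lra|]. intros s l _. apply H.
Qed.

(** The Hardy-Littlewood argument: rise by [d] from both points, where the derivative is at most
    [D d^(nu - 1)], and connect there. The vertical legs cost [D / nu] each and the two connecting
    segments [D] each, in units of [d^nu]. *)
Lemma holder_of_derivative nu D z w d : 0 < nu < 1 -> 0 <= D ->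
  (forall u l, 0 < snd u -> Cder f u l -> Cmod l <= D * Rpower (snd u) (nu - 1)) ->
  0 <= snd z -> 0 <= snd w -> vcont f z -> vcont f w -> 0 < d ->
  Rabs (fst z - fst w) <= d -> Rabs (snd z - snd w) <= d ->
  Cmod (f z - f w) <= (2 / nu + 2) * D * Rpower d nu.
Proof.
intros hn hD Hl hz hw Cz Cw hd hx hy.
assert (V : forall u, 0 <= snd u -> vcont f u -> Cmod (f (fst u, snd u + d) - f u) <= D / nu * Rpower d nu).
{ intros u hu Cu.
  apply (vertical_bound u (fun s => D / nu * Rpower s nu) (fun s => D * Rpower s (nu - 1))); auto.
  - intros s hs. replace (D * Rpower s (nu - 1)) with (D / nu * (nu * Rpower s (nu - 1))) by (field; lra).
    apply is_derive_scal. apply is_derive_Rpower. lra.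
  - intros s hs. apply Rmult_le_pos; [|left; apply Rpower_pos]. apply Rdiv_le_0_compat; lra.
  - intros s l hs hl. eapply Rle_trans; [apply (Hl (fst u, snd u + s) l); [simpl; lra|exact hl]|]. simpl.
    apply Rmult_le_compat_l; auto. apply Rpower_le_neg; lra. }
assert (M : forall u l, d <= snd u -> Cder f u l -> Cmod l <= D * Rpower d (nu - 1)).
{ intros u l hu hl. eapply Rle_trans; [apply (Hl u l); [lra|exact hl]|].
  apply Rmult_le_compat_l; auto. apply Rpower_le_neg; lra. }
assert (hp : 0 <= D * Rpower d (nu - 1)) by (apply Rmult_le_pos; auto; left; apply Rpower_pos).
assert (Ed : Rpower d nu = Rpower d (nu - 1) * d).
{ rewrite (Rpower_sub d nu 1), Rpower_1 by auto. reflexivity. }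
assert (S1 : Cmod (f (fst w, snd z + d) - f (fst z, snd z + d)) <= D * Rpower d nu).
{ eapply Rle_trans; [apply (segment_bound_h_abs _ _ _ (D * Rpower d (nu - 1))); [lra|]|].
  - intros s l. apply M. simpl. lra.
  - rewrite Ed, <- Rmult_assoc. apply Rmult_le_compat_l; auto. rewrite Rabs_minus_sym. auto. }
assert (S2 : Cmod (f (fst w, snd z + d) - f (fst w, snd w + d)) <= D * Rpower d nu).
{ rewrite Ed, <- Rmult_assoc.
  destruct (Rle_lt_dec (snd w) (snd z)) as [h|h].
  - eapply Rle_trans; [apply (segment_bound_v _ _ _ (D * Rpower d (nu - 1))); try lra|].
    + intros s l hs. apply M. simpl. lra.
    + apply Rmult_le_compat_l; auto. rewrite Rabs_pos_eq in hy; lra.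
  - rewrite Cmod_sub_sym. eapply Rle_trans; [apply (segment_bound_v _ _ _ (D * Rpower d (nu - 1))); try lra|].
    + intros s l hs. apply M. simpl. lra.
    + apply Rmult_le_compat_l; auto. rewrite Rabs_left in hy; lra. }
assert (V1 := V z hz Cz). assert (V2 := V w hw Cw).
rewrite Cmod_sub_sym in V1.
assert (T1 := Cmod_triangle_sub (f z) (f (fst z, snd z + d)) (f w)).
assert (T2 := Cmod_triangle_sub (f (fst z, snd z + d)) (f (fst w, snd z + d)) (f w)).
assert (T3 := Cmod_triangle_sub (f (fst w, snd z + d)) (f (fst w, snd w + d)) (f w)).
rewrite Cmod_sub_sym in S1.
replace ((2 / nu + 2) * D * Rpower d nu) with (2 * (D / nu * Rpower d nu) + 2 * (D * Rpower d nu)) by (field; lra).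
lra.
Qed.

(* Travel from [x] up to height [(1 + |x|)^(1/4)], where the first bound is
   effective, then up to height [1 + |x|] and across to the imaginary axis,
   using the second bound. *)
Lemma decay_of_derivative nu D :
  0 < nu < 1 -> 0 <= D ->
  (forall z l, 0 < snd z -> Cder f z l -> Cmod l <= D * Rpower (1 + Rabs (fst z)) (- (nu / 2)) *
    (Rpower (snd z) (nu / 2 - 1) + Rpower (snd z) (nu - 1))) ->
  (forall z l, 1 <= snd z -> Cder f z l -> Cmod l <= D * Rpower (snd z) (- 1 - nu / 2)) ->
  (forall x, vcont f (x, 0)) ->
  exists c, forall x, Cmod (f (x, 0) - c) <= (12 / nu) * D * Rpower (1 + Rabs x) (- (nu / 8)).
Proof.
intros hn hD E1 E2 Hc.
set (h := nu / 2) in *. assert (hh : 0 < h) by (unfold h; lra).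
assert (Eh : nu = 2 * h) by (unfold h; field).
assert (hDh : 0 <= D / h) by (apply Rdiv_le_0_compat; auto).
(* Above height 1 the derivative bound has the primitive [- (D / h) s^(- h)], so the values on a
   vertical line converge; the limit along the imaginary axis will be [c]. *)
assert (V2 : forall x y y', 1 <= y -> y <= y' -> Cmod (f (x, y') - f (x, y)) <= D / h * Rpower y (- h)).
{ intros x y y' hy hy'.
  assert (Q := mean_value_path f (x, 0) Ci (fun s => - (D / h) * Rpower s (- h)) (fun s => D * Rpower s (- 1 - h)) y y' hy').
  rewrite !path_v, !Rplus_0_l in Q.
  assert (p := Rpower_pos y' (- h)).
  eapply Rle_trans; [apply Q|].
  - intros s hs. replace (D * Rpower s (- 1 - h)) with (- (D / h) * (- h * Rpower s (- h - 1))).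
    + apply is_derive_scal. apply is_derive_Rpower. lra.
    + replace (- 1 - h) with (- h - 1) by ring. field. lra.
  - intros s hs. rewrite path_v, Rplus_0_l. destruct (f_der (x, s)) as [l hl]; [simpl; lra|]. exists l. split; auto.
    rewrite Cmod_Ci, Rmult_1_r. apply (E2 (x, s)); auto. simpl; lra.
  - assert (0 <= D / h * Rpower y' (- h)) by (apply Rmult_le_pos; lra). lra. }
assert (small : forall e, 0 < e -> exists N : nat, D / h * Rpower (1 + INR N) (- h) < e).
{ intros e he. set (r := e / (D / h + 1)). assert (hr : 0 < r) by (apply Rdiv_lt_0_compat; lra).
  destruct (INR_unbounded (Rpower r (- / h))) as [N hN]. exists N.
  assert (hp := Rpower_pos r (- / h)).
  apply Rle_lt_trans with (D / h * r).
  - apply Rmult_le_compat_l; [lra|].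
    replace r with (Rpower (Rpower r (- / h)) (- h)).
    + apply Rpower_le_neg; [|lra]. split; [auto|]. lra.
    + rewrite Rpower_mult. replace (- / h * - h) with 1 by (field; lra). apply Rpower_1; auto.
  - unfold r. apply (Rmult_lt_reg_r (D / h + 1)); [lra|]. unfold Rdiv at 2.
    rewrite Rmult_assoc, Rmult_assoc, Rinv_l by lra. nra. }
destruct (C_complete (fun n => f (0, 1 + INR n))) as [c hc].
{ intros e he. destruct (small (e / 2)) as [N hN]; [lra|]. exists N. intros n m hn' hm.
  apply le_INR in hn', hm. assert (q := pos_INR N).
  eapply Rle_lt_trans; [apply (Cmod_triangle_sub _ (f (0, 1 + INR N)))|].
  rewrite (Cmod_sub_sym (f (0, 1 + INR N))).
  assert (q1 := V2 0 (1 + INR N) (1 + INR n) ltac:(lra) ltac:(lra)).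
  assert (q2 := V2 0 (1 + INR N) (1 + INR m) ltac:(lra) ltac:(lra)). lra. }
assert (V3 : forall y, 1 <= y -> Cmod (f (0, y) - c) <= D / h * Rpower y (- h)).
{ intros y hy. apply Rnot_lt_le. intros hlt.
  set (B := D / h * Rpower y (- h)) in *.
  destruct (hc (Cmod (f (0, y) - c) - B)) as [N hN]; [lra|].
  destruct (INR_unbounded y) as [N' hN'].
  set (n := Nat.max N N'). assert (hn' : INR N' <= INR n) by (apply le_INR; lia).
  assert (q1 := V2 0 y (1 + INR n) hy ltac:(lra)). fold B in q1. rewrite Cmod_sub_sym in q1.
  assert (q2 := hN n ltac:(lia)). cbv beta in q2.
  assert (q3 := Cmod_triangle_sub (f (0, y)) (f (0, 1 + INR n)) c). lra. }
exists c. intros x. set (X := 1 + Rabs x). assert (hX : 1 <= X) by (unfold X; generalize (Rabs_pos x); lra).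
(* The power [1 / 4] balances two legs. Climbing to [Y] costs [X^(- nu / 2) Y^nu = X^(- nu / 4)],
   and the rest of the climb costs [Y^(- nu / 2) = X^(- nu / 8)]. The latter is the exponent of the
   conclusion. *)
set (Y := Rpower X (/ 4)). assert (hY1 : 1 <= Y) by (apply Rpower_ge_1; lra).
assert (hYX : Y <= X). { rewrite <- (Rpower_1 X) by lra. apply Rpower_le_exp; lra. }
set (G := Rpower X (- (nu / 8))). assert (hG : 0 < G) by apply Rpower_pos.
assert (HG1 : Rpower X (- h) <= G) by (apply Rpower_le_exp; unfold h; lra).
assert (S1 : Cmod (f (x, Y) - f (x, 0)) <= 2 * (D / h) * G).
{ set (Q := Rpower X (- h)) in *. assert (hQ : 0 < Q) by apply Rpower_pos.
  apply Rle_trans with (D * Q / h * Rpower Y h + D * Q / nu * Rpower Y nu).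
  - replace (f (x, Y)) with (f (fst ((x, 0) : C), snd ((x, 0) : C) + Y)) by (simpl; rewrite Rplus_0_l; reflexivity).
    apply (vertical_bound (x, 0) (fun s => D * Q / h * Rpower s h + D * Q / nu * Rpower s nu)
      (fun s => D * Q * (Rpower s (h - 1) + Rpower s (nu - 1)))).
    + simpl; lra.
    + apply Hc.
    + lra.
    + intros s hs.
      replace (D * Q * (Rpower s (h - 1) + Rpower s (nu - 1))) with
        (plus (D * Q / h * (h * Rpower s (h - 1))) (D * Q / nu * (nu * Rpower s (nu - 1)))).
      * apply (is_derive_plus (K := R_AbsRing) (V := R_NormedModule)
          (fun s => D * Q / h * Rpower s h) (fun s => D * Q / nu * Rpower s nu));
          apply is_derive_scal; apply is_derive_Rpower; lra.
      * unfold plus; simpl. field. split; lra.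
    + intros s hs. apply Rplus_le_le_0_compat; (apply Rmult_le_pos; [|left; apply Rpower_pos]);
        (apply Rdiv_le_0_compat; [apply Rmult_le_pos|]; lra).
    + intros s l hs hl. simpl in hl. apply (E1 (x, s)); [simpl; lra|].
      rewrite Rplus_0_l in hl. exact hl.
  - assert (hYh : Rpower Y h <= Rpower Y nu) by (apply Rpower_le_exp; unfold h in *; lra).
    assert (EQ : Q * Rpower Y nu <= G).
    { unfold Q, Y, G. rewrite Rpower_mult, <- Rpower_plus. apply Rpower_le_exp; auto. unfold h. lra. }
    assert (hYp := Rpower_pos Y h).
    apply Rle_trans with (2 * (D / h) * (Q * Rpower Y nu)).
    + replace (2 * (D / h) * (Q * Rpower Y nu)) with (D / h * Q * Rpower Y nu + D / h * Q * Rpower Y nu) by ring.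
      apply Rplus_le_compat.
      * replace (D * Q / h * Rpower Y h) with (D / h * Q * Rpower Y h) by (field; lra).
        apply Rmult_le_compat_l; auto. apply Rmult_le_pos; lra.
      * replace (D * Q / nu * Rpower Y nu) with (D / nu * Q * Rpower Y nu) by (field; lra).
        apply Rmult_le_compat_r; [lra|]. apply Rmult_le_compat_r; [lra|].
        unfold Rdiv. apply Rmult_le_compat_l; auto. apply Rinv_le_contravar; unfold h; lra.
    + apply Rmult_le_compat_l; lra. }
assert (S2 : Cmod (f (x, X) - f (x, Y)) <= D / h * G).
{ eapply Rle_trans; [apply V2; auto|]. apply Rmult_le_compat_l; auto.
  unfold Y, G. rewrite Rpower_mult. right. f_equal. unfold h. field. }
assert (S3 : Cmod (f (x, X) - f (0, X)) <= D * G).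
{ eapply Rle_trans; [apply (segment_bound_h_abs 0 x X (D * Rpower X (- 1 - h))); [lra|]|].
  - intros s l hl. apply (E2 (s, X)); auto.
  - rewrite Rminus_0_r. apply Rle_trans with (D * Rpower X (- 1 - h) * X).
    + apply Rmult_le_compat_l; [apply Rmult_le_pos; auto; left; apply Rpower_pos|]. unfold X; lra.
    + rewrite Rmult_assoc. apply Rmult_le_compat_l; auto.
      rewrite <- (Rpower_1 X) at 2 by lra. rewrite <- Rpower_plus.
      replace (- 1 - h + 1) with (- h) by ring. exact HG1. }
assert (S4 : Cmod (f (0, X) - c) <= D / h * G).
{ eapply Rle_trans; [apply V3; auto|]. apply Rmult_le_compat_l; auto. }
rewrite Cmod_sub_sym in S1, S2.
assert (T1 := Cmod_triangle_sub (f (x, 0)) (f (x, Y)) c).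
assert (T2 := Cmod_triangle_sub (f (x, Y)) (f (x, X)) c).
assert (T3 := Cmod_triangle_sub (f (x, X)) (f (0, X)) c).
assert (DG : D * G <= 1 / 2 * (D / h) * G).
{ apply Rmult_le_compat_r; [lra|]. apply Rle_trans with (D / (2 * h)).
  - apply Rle_div_r; [lra|]. unfold h in *. nra.
  - right. field. lra. }
(* The legs cost [2], [1], [1 / 2] and [1] times [(D / h) G]; 6 is a generous total, and
   [6 / h = 12 / nu]. *)
replace (12 / nu * D * G) with (6 * (D / h) * G) by (rewrite Eh; field; lra).
assert (0 <= D / h * G) by (apply Rmult_le_pos; lra).
lra.
Qed.

End UpperHalfPlane.

Lemma plus_fn_vcont f z : plus_fn f -> 0 <= snd z -> vcont f z.
Proof.
intros (h1 & _) hz e he. destruct (h1 z hz e he) as [d [hd H]]. exists d. split; auto. intros s hs.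
apply H.
- unfold CUHP, Defs.Im. simpl. lra.
- replace ((fst z, (snd z + s)%R) - z)%C with (RtoC s * Ci)%C.
  + rewrite Cmod_mult, Cmod_Ci, Cmod_R, Rabs_pos_eq; lra.
  + destruct z as [x y]. unfold Cminus, Copp, Cplus, Cmult, RtoC, Ci. simpl. apply pair_eq; ring.
Qed.

Lemma minus_fn_bound_real h : minus_fn h -> exists H, 0 <= H /\ forall t, Cmod (h (RtoC t)) <= H.
Proof.
intros (_ & [H h2] & _). exists H.
assert (Q : forall t, Cmod (h (RtoC t)) <= H).
{ intros t. assert (q := h2 (RtoC (- t)) ltac:(simpl; lra)). cbv beta in q.
  rewrite RtoC_opp in q. replace (- - RtoC t)%C with (RtoC t) in q by ring. auto. }
split; auto. generalize (Q 0) (Cmod_ge_0 (h (RtoC 0))). lra.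
Qed.

Lemma finite_bound (P : nat -> R -> Prop) n :
  (forall m a b, P m a -> a <= b -> P m b) -> (forall m, (m < n)%nat -> exists a, P m a) ->
  exists a, 0 <= a /\ forall m, (m < n)%nat -> P m a.
Proof.
intros Hm. induction n as [|n IH]; intros H.
- exists 0. split; [lra|]. lia.
- destruct IH as [a [ha Ha]]; auto. destruct (H n) as [b Hb]; auto.
  exists (Rmax a b). split; [eapply Rle_trans; [exact ha|apply Rmax_l]|].
  intros m hm. destruct (Nat.eq_dec m n) as [->|E].
  + eapply Hm; [exact Hb|apply Rmax_r].
  + eapply Hm; [apply Ha; lia|apply Rmax_l].
Qed.

Lemma plus_fn_regularity f n (h : nat -> C -> C) (g : nat -> R -> C) nu :
  0 < nu < 1 -> plus_fn f -> (forall m, (m < n)%nat -> minus_fn (h m)) ->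
  (forall m, (m < n)%nat -> exists K, LH nu K (g m)) ->
  (forall t, f (RtoC t) = csum (fun m => h m (RtoC t) * g m t)%C n) ->
  exists C, LH (nu / 8) C (fun t => f (RtoC t)).
Proof.
intros hn Hf Hh Hg E.
destruct (finite_bound (fun m K => LH nu K (g m)) n) as [K [hK HK]]; auto.
{ intros m a b Ha hab. eapply LH_weaken; eauto. }
destruct (finite_bound (fun m H => forall t, Cmod (h m (RtoC t)) <= H) n) as [H [hH HH]].
{ intros m a b Ha hab t. eapply Rle_trans; [apply Ha|auto]. }
{ intros m hm. destruct (minus_fn_bound_real _ (Hh m hm)) as [H [_ q]]. exists H; auto. }
assert (rep : forall (z : R * R) l, 0 < snd z -> Cder f z l ->
  IR (fun t => csum (fun m => h m (RtoC t) * g m t)%C n * sqinv z t)%C (RtoC (2 * PI) * Ci * l)%C).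
{ intros z l hz hl. apply (IR_ext (fun t => f (RtoC t) * sqinv z t)%C).
  - intros t. rewrite E. reflexivity.
  - apply plus_fn_sqinv_upper; auto. }
assert (hc : forall m, (m < n)%nat -> contR (fun t => h m (RtoC t))) by (intros; apply minus_fn_contR; auto).
assert (hl : forall m (z : R * R), (m < n)%nat -> 0 < snd z -> IR (fun t => h m (RtoC t) * sqinv z t)%C (RtoC 0)).
{ intros; apply minus_fn_sqinv_upper; auto. }
assert (hb : forall m t, (m < n)%nat -> Cmod (h m (RtoC t)) <= H) by auto.
assert (hnu : 0 < 1 - nu) by lra.
set (B := 32 * INR n * H * K).
assert (hB : 0 <= B) by (unfold B; repeat apply Rmult_le_pos; auto using pos_INR; lra).
(* One constant for all three derivative bounds: [1 / (1 - nu)] occurs in the first two and [1 / nu]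
   in the third. *)
set (D := B / (1 - nu) + B / nu).
assert (hD1 : 0 <= B / (1 - nu)) by (apply Rdiv_le_0_compat; auto).
assert (hD2 : 0 <= B / nu) by (apply Rdiv_le_0_compat; lra).
assert (F0 : forall u l, 0 < snd u -> Cder f u l -> Cmod l <= D * Rpower (snd u) (nu - 1)).
{ intros u l hu hul. eapply Rle_trans; [apply (derivative_bound_near f n (fun m t => h m (RtoC t)) g nu K H) with (z := u); auto|].
  apply Rmult_le_compat_r; [left; apply Rpower_pos|].
  replace (8 * INR n * H * K / (1 - nu)) with (B / (1 - nu) / 4) by (unfold B; field; lra). unfold D; lra. }
assert (F1 : forall z l, 0 < snd z -> Cder f z l -> Cmod l <= D * Rpower (1 + Rabs (fst z)) (- (nu / 2)) *
    (Rpower (snd z) (nu / 2 - 1) + Rpower (snd z) (nu - 1))).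
{ intros u l hu hul. eapply Rle_trans; [apply (derivative_bound_mixed f n (fun m t => h m (RtoC t)) g nu K H) with (z := u); auto|].
  fold B. apply Rmult_le_compat_r.
  - generalize (Rpower_pos (snd u) (nu / 2 - 1)) (Rpower_pos (snd u) (nu - 1)); lra.
  - apply Rmult_le_compat_r; [left; apply Rpower_pos|]. unfold D; lra. }
assert (F2 : forall z l, 1 <= snd z -> Cder f z l -> Cmod l <= D * Rpower (snd z) (- 1 - nu / 2)).
{ intros u l hu hul. eapply Rle_trans; [apply (derivative_bound_high f n (fun m t => h m (RtoC t)) g nu K H) with (z := u); auto|].
  fold B. apply Rmult_le_compat_r; [left; apply Rpower_pos|]. unfold D; lra. }
assert (hD : 0 <= D) by (unfold D; lra).
assert (Hd : forall z : C, 0 < snd z -> exists l, Cder f z l) by apply Hf.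
assert (Hv : forall z : C, 0 <= snd z -> vcont f z) by (intros; apply plus_fn_vcont; auto).
destruct (decay_of_derivative f Hd nu D hn hD F1 F2) as [c hcx]; [intros; apply Hv; simpl; lra|].
destruct Hf as (f1 & [M f2] & f3).
assert (fM : forall t, Cmod (f (RtoC t)) <= M) by (intros; apply f2; simpl; lra).
assert (hM : 0 <= M) by (generalize (fM 0) (Cmod_ge_0 (f (RtoC 0))); lra).
(* Locally the exponent [nu] survives; it is lowered to [nu / 8] below because [LH] uses one
   exponent for modulus and decay. *)
assert (HL : forall s t, Cmod (f (RtoC s) - f (RtoC t)) <= (2 / nu + 2) * D * Rpower (Rabs (s - t)) nu).
{ intros s t. destruct (Req_dec s t) as [->|Est].
  { replace (f (RtoC t) - f (RtoC t))%C with (RtoC 0) by ring. rewrite Cmod_0.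
    assert (0 <= 2 / nu) by (apply Rdiv_le_0_compat; lra).
    apply Rmult_le_pos; [|left; apply Rpower_pos]. apply Rmult_le_pos; lra. }
  apply (holder_of_derivative f Hd nu D); auto; try (simpl; lra).
  - apply Hv; simpl; lra.
  - apply Hv; simpl; lra.
  - apply Rabs_pos_lt; lra.
  - simpl. rewrite Rminus_diag, Rabs_R0. apply Rabs_pos. }
set (A := M + (2 / nu + 2) * D + 12 / nu * D).
assert (hA1 : 0 <= (2 / nu + 2) * D).
{ assert (0 <= 2 / nu) by (apply Rdiv_le_0_compat; lra). apply Rmult_le_pos; lra. }
assert (hA2 : 0 <= 12 / nu * D).
{ assert (0 <= 12 / nu) by (apply Rdiv_le_0_compat; lra). apply Rmult_le_pos; lra. }
exists (2 * A). split; [unfold A; lra|split; [|split]].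
- intros t. generalize (fM t). unfold A. lra.
- intros s t. destruct (Req_dec s t) as [->|Est].
  { replace (f (RtoC t) - f (RtoC t))%C with (RtoC 0) by ring. rewrite Cmod_0.
    apply Rmult_le_pos; [unfold A; lra|left; apply Rpower_pos]. }
  assert (hst : 0 < Rabs (s - t)) by (apply Rabs_pos_lt; lra).
  destruct (Rle_lt_dec (Rabs (s - t)) 1) as [q|q].
  + eapply Rle_trans; [apply HL|]. apply Rmult_le_compat; [auto|left; apply Rpower_pos|unfold A; lra|].
    apply Rpower_le_exp_small; lra.
  + eapply Rle_trans; [apply Cmod_triangle_minus|].
    assert (1 <= Rpower (Rabs (s - t)) (nu / 8)) by (apply Rpower_ge_1; lra).
    generalize (fM s) (fM t). intros. apply Rle_trans with (2 * A * 1); [unfold A; lra|].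
    apply Rmult_le_compat_l; auto. unfold A; lra.
- exists c. intros t. eapply Rle_trans; [apply hcx|]. apply Rmult_le_compat_r; [left; apply Rpower_pos|]. unfold A; lra.
Qed.

Lemma minus_fn_regularity f n (h : nat -> C -> C) (g : nat -> R -> C) nu :
  0 < nu < 1 -> minus_fn f -> (forall m, (m < n)%nat -> plus_fn (h m)) ->
  (forall m, (m < n)%nat -> exists K, LH nu K (g m)) ->
  (forall t, f (RtoC t) = csum (fun m => h m (RtoC t) * g m t)%C n) ->
  exists C, LH (nu / 8) C (fun t => f (RtoC t)).
Proof.
intros hn Hf Hh Hg E.
destruct (plus_fn_regularity (fun z => f (- z)%C) n (fun m z => h m (- z)%C) (fun m t => g m (- t)) nu) as [K HK]; auto.
- intros m hm. apply (proj1 (minus_fn_opp_arg (h m))). auto.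
- intros m hm. destruct (Hg m hm) as [K HK]. exists K. apply LH_opp_arg; auto.
- intros t. rewrite <- RtoC_opp. apply E.
- exists K. apply LH_opp_arg in HK. revert HK. apply LH_ext. intros t. cbv beta. f_equal.
  rewrite RtoC_opp. ring.
Qed.

(** * Cauchy integrals and the Plemelj formula *)

(* Arbitrary when the integral diverges. *)
Definition Ival (f : R -> C) : C := epsilon (inhabits (RtoC 0)) (IR f).

Lemma Ival_correct f : (exists L, IR f L) -> IR f (Ival f).
Proof. apply epsilon_spec. Qed.

Lemma Ival_unique f L : IR f L -> Ival f = L.
Proof. intros H. apply (IR_unique f); auto. apply Ival_correct. exists L; auto. Qed.

(* The Cauchy kernel minus its value at [z = - i]: this makes it integrable
   against densities that are only bounded. *)
Definition kern (z : C) (t : R) : C := ((z + Ci) / ((RtoC t + Ci) * (RtoC t - z)))%C.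

Lemma kern_split z t : snd z <> 0 -> kern z t = (/ (RtoC t - z) - / (RtoC t + Ci))%C.
Proof.
intros h. assert (n1 := real_minus_neq t z h). assert (n2 := plus_Ci_neq t).
unfold kern. field. auto.
Qed.

Lemma contR_inv_sub z : snd z <> 0 -> contR (fun t => / (RtoC t - z))%C.
Proof.
intros h. apply (contR_ext (fun t => RtoC 1 / (RtoC t - z))%C).
{ intros t. unfold Cdiv. ring. }
apply contR_div; [intros; apply real_minus_neq; auto|apply contR_const|apply contR_sub_const].
Qed.

Lemma inv_plus_Ci t : (/ (RtoC t + Ci) = / (RtoC t - (- Ci)))%C.
Proof. f_equal. ring. Qed.

Lemma contR_kern z : snd z <> 0 -> contR (kern z).
Proof.
intros h. apply (contR_ext (fun t => / (RtoC t - z) - / (RtoC t - (- Ci)))%C).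
{ intros t. rewrite kern_split by auto. rewrite <- inv_plus_Ci. reflexivity. }
apply contR_minus; apply contR_inv_sub; auto. simpl. lra.
Qed.

Lemma Cmod_inv_sub z t : snd z <> 0 -> Cmod (/ (RtoC t - z)) <= 2 * Rpower (Rabs (snd z) + Rabs (t - fst z)) (- 1).
Proof.
intros h. assert (n1 := real_minus_neq t z h). assert (q := Cmod_kernel_lower t z).
assert (h0 := Rabs_pos_lt _ h). assert (h1 := Rabs_pos (t - fst z)).
rewrite Cmod_inv by auto. replace (-1) with (- (1)) by ring. rewrite Rpower_Ropp, Rpower_1 by lra.
replace (2 * / (Rabs (snd z) + Rabs (t - fst z))) with (/ ((Rabs (snd z) + Rabs (t - fst z)) / 2)) by (field; lra).
apply Rinv_le_contravar; lra.
Qed.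

Lemma Rpower_m1_sq a : Rpower a (- 1) * Rpower a (- 1) = Rpower a (- 1 - 1).
Proof. rewrite <- Rpower_plus. f_equal. Qed.

Lemma Cmod_inv_inv z w t : snd z <> 0 -> snd w <> 0 ->
  Cmod (/ (RtoC t - z) * / (RtoC t - w)) <= 4 * (bump 1 (Rabs (snd z)) (fst z) t + bump 1 (Rabs (snd w)) (fst w) t).
Proof.
intros hz hw. assert (a := Cmod_inv_sub z t hz). assert (b := Cmod_inv_sub w t hw).
rewrite Cmod_mult. unfold bump. rewrite <- !Rpower_m1_sq.
set (A := Rpower (Rabs (snd z) + Rabs (t - fst z)) (- 1)) in *.
set (B := Rpower (Rabs (snd w) + Rabs (t - fst w)) (- 1)) in *.
assert (hA : 0 < A) by apply Rpower_pos. assert (hB : 0 < B) by apply Rpower_pos.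
apply Rle_trans with (2 * A * (2 * B)); [apply Rmult_le_compat; auto using Cmod_ge_0|].
assert (0 <= (A - B) * (A - B)) by apply Rle_0_sqr. nra.
Qed.

Lemma dom_two_poles M z w : 0 <= M -> snd z <> 0 -> snd w <> 0 ->
  exists B, dom (fun t => M * (4 * (bump 1 (Rabs (snd z)) (fst z) t + bump 1 (Rabs (snd w)) (fst w) t))) B.
Proof.
intros hM hz hw. eexists. apply dom_scal; auto. apply dom_scal; [lra|].
apply dom_plus; apply dom_bump; try lra; apply Rabs_pos_lt; auto.
Qed.

Lemma IR_exists_two_poles m M z w : contR m -> (forall t, Cmod (m t) <= M) -> snd z <> 0 -> snd w <> 0 ->
  IR (fun t => m t * (/ (RtoC t - z) * / (RtoC t - w)))%C (Ival (fun t => m t * (/ (RtoC t - z) * / (RtoC t - w)))%C).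
Proof.
intros Hm HM hz hw.
assert (hM : 0 <= M) by (generalize (HM 0) (Cmod_ge_0 (m 0)); lra).
destruct (dom_two_poles M z w hM hz hw) as [B HB].
apply Ival_correct. refine (IR_exists _ _ B _ _ HB).
- apply contR_mult; auto. apply contR_mult; apply contR_inv_sub; auto.
- intros t. apply Cmod_mult_le; auto. apply Cmod_inv_inv; auto.
Qed.

Lemma kern_two_poles z t : snd z <> 0 -> kern z t = ((z + Ci) * (/ (RtoC t - z) * / (RtoC t - (- Ci))))%C.
Proof.
intros h. rewrite <- inv_plus_Ci. assert (n1 := real_minus_neq t z h). assert (n2 := plus_Ci_neq t).
unfold kern. field. auto.
Qed.

Definition Phi (m : R -> C) (z : C) : C := (Ival (fun t => m t * kern z t) / (RtoC (2 * PI) * Ci))%C.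

Lemma two_pi_i_neq : (RtoC (2 * PI) * Ci)%C <> RtoC 0.
Proof.
apply Cmult_neq_0; [|apply Ci_nz]. intros E. apply RtoC_inj in E. generalize PI_RGT_0; lra.
Qed.

Section BoundedDensity.
Variables (m : R -> C) (M : R).
Hypothesis m_cont : contR m.
Hypothesis m_bound : forall t, Cmod (m t) <= M.

Lemma M_pos : 0 <= M.
Proof. generalize (m_bound 0) (Cmod_ge_0 (m 0)); lra. Qed.

Lemma IR_kern z : snd z <> 0 -> IR (fun t => m t * kern z t)%C (Ival (fun t => m t * kern z t)%C).
Proof.
intros h. apply Ival_correct.
assert (hi : snd (- Ci)%C <> 0) by (simpl; lra).
assert (H := IR_exists_two_poles m M z (- Ci)%C m_cont m_bound h hi).
eexists. apply IR_scal with (c := (z + Ci)%C) in H.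
- revert H. apply IR_ext. intros t. rewrite kern_two_poles by auto. ring.
- apply contR_mult; auto. apply contR_mult; apply contR_inv_sub; auto.
Qed.

Lemma sqinv_two_poles z t : snd z <> 0 -> sqinv z t = (/ (RtoC t - z) * / (RtoC t - z))%C.
Proof. intros h. assert (n1 := real_minus_neq t z h). unfold sqinv. field. auto. Qed.

Lemma IR_sqinv_density z : snd z <> 0 -> IR (fun t => m t * sqinv z t)%C (Ival (fun t => m t * sqinv z t)%C).
Proof.
intros h. apply Ival_correct. eexists. generalize (IR_exists_two_poles m M z z m_cont m_bound h h).
apply IR_ext. intros t. rewrite sqinv_two_poles; auto.
Qed.

Lemma near_real_bound z w : snd z <> 0 -> Cmod (w - z) < Rabs (snd z) / 2 -> snd w <> 0 /\ Rabs (snd z) / 2 <= Rabs (snd w).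
Proof.
intros h hw. assert (q := snd_le_Cmod (w - z)%C). simpl in q.
assert (h0 := Rabs_pos_lt _ h).
assert (k : Rabs (snd z) <= Rabs (snd w) + Rabs (snd w + - snd z)).
{ replace (snd z) with (snd w + - (snd w + - snd z)) at 1 by ring. eapply Rle_trans; [apply Rabs_triang|].
  rewrite Rabs_Ropp. lra. }
assert (k' : Rabs (snd z) / 2 <= Rabs (snd w)) by lra.
split; auto. intros E. rewrite E, Rabs_R0 in k'. lra.
Qed.

(** The difference [kern w t - kern z t] is exactly [(w - z) / ((t - z) (t - w))], so the slope
    function is known in closed form and only its continuity at [z] needs an estimate. *)
Lemma Cder_Phi z : snd z <> 0 -> Cder (Phi m) z (Ival (fun t => m t * sqinv z t)%C / (RtoC (2 * PI) * Ci))%C.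
Proof.
intros h. assert (h0 := Rabs_pos_lt _ h). assert (hM := M_pos).
exists (fun w => (Ival (fun t => m t * (/ (RtoC t - z) * / (RtoC t - w)))%C / (RtoC (2 * PI) * Ci))%C).
split.
- apply tends_div; [apply nb_filter|apply two_pi_i_neq| |apply tends_const, nb_filter].
  destruct (dom_two_poles M z z hM h h) as [B HB].
  assert (hB : 0 <= B).
  { eapply Rle_trans; [|apply (proj2 HB 0 0); lra]. rewrite RInt_point. simpl. right. reflexivity. }
  (* Within distance [r] of [z], the point [w] keeps distance at least [r] from the real line, which
     bounds the factor [1 / (t - w)] in the difference of the integrands. *)
  intros e he. set (r := Rabs (snd z) / 2). assert (hr : 0 < r) by (unfold r; lra).
  set (dl := Rmin r (e * r / (B + 1))).
  assert (hdl : 0 < dl). { apply Rmin_pos; auto. apply Rdiv_lt_0_compat; [apply Rmult_lt_0_compat; auto|lra]. }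
  exists dl. split; auto. intros w _ hw.
  assert (w1 := Rlt_le_trans _ _ _ hw (Rmin_l _ _)). assert (w2 := Rlt_le_trans _ _ _ hw (Rmin_r _ _)).
  destruct (near_real_bound z w h w1) as [hw0 hw1].
  assert (I1 := IR_exists_two_poles m M z w m_cont m_bound h hw0).
  assert (I2 := IR_sqinv_density z h).
  assert (C1 : contR (fun t => m t * (/ (RtoC t - z) * / (RtoC t - w)))%C).
  { apply contR_mult; auto. apply contR_mult; apply contR_inv_sub; auto. }
  assert (C2 : contR (fun t => m t * sqinv z t)%C) by (apply contR_mult; auto; apply contR_sqinv; auto).
  assert (I3 := IR_minus _ _ _ _ C1 C2 I1 I2).
  apply Rle_lt_trans with (Cmod (w - z) / r * B).
  + refine (IR_bound _ _ _ _ (contR_minus _ _ C1 C2) _ (dom_scal _ (Cmod (w - z) / r) _ _ HB) I3).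
    * intros t. assert (n1 := real_minus_neq t z h). assert (n2 := real_minus_neq t w hw0).
      replace (m t * (/ (RtoC t - z) * / (RtoC t - w)) - m t * sqinv z t)%C
        with ((w - z) * / (RtoC t - w) * (m t * (/ (RtoC t - z) * / (RtoC t - z))))%C.
      2: { unfold sqinv. field. auto. }
      apply Cmod_mult_le.
      -- rewrite Cmod_mult, Cmod_inv by auto. unfold Rdiv. apply Rmult_le_compat_l; [apply Cmod_ge_0|].
         apply Rinv_le_contravar; auto. eapply Rle_trans; [exact hw1|].
         assert (q := snd_le_Cmod (RtoC t - w)%C). simpl in q. rewrite Rplus_0_l, Rabs_Ropp in q. auto.
      -- apply Cmod_mult_le; auto. apply Cmod_inv_inv; auto.
    * apply Rdiv_le_0_compat; auto. apply Cmod_ge_0.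
  + apply Rlt_div_r in w2; [|lra].
    replace (Cmod (w - z) / r * B) with (Cmod (w - z) * B / r) by (field; lra).
    apply Rlt_div_l; auto. generalize (Cmod_ge_0 (w - z)%C). nra.
- exists (Rabs (snd z) / 2). split; [lra|]. intros w _ hw.
  destruct (near_real_bound z w h hw) as [hw0 hw1].
  assert (I1 := IR_exists_two_poles m M z w m_cont m_bound h hw0).
  assert (C1 : contR (fun t => m t * (/ (RtoC t - z) * / (RtoC t - w)))%C).
  { apply contR_mult; auto. apply contR_mult; apply contR_inv_sub; auto. }
  apply IR_scal with (c := (w - z)%C) in I1; auto.
  assert (Ck : forall u, snd u <> 0 -> contR (fun t => m t * kern u t)%C).
  { intros u hu. apply contR_mult; auto. apply contR_kern; auto. }
  assert (I2 := IR_minus _ _ _ _ (Ck w hw0) (Ck z h) (IR_kern w hw0) (IR_kern z h)).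
  assert (E : (Ival (fun t => m t * kern w t) - Ival (fun t => m t * kern z t))%C =
     ((w - z) * Ival (fun t => m t * (/ (RtoC t - z) * / (RtoC t - w))))%C).
  { apply (IR_unique _ _ _ I2). revert I1. apply IR_ext. intros t.
    assert (n1 := real_minus_neq t z h). assert (n2 := real_minus_neq t w hw0). assert (n3 := plus_Ci_neq t).
    unfold kern. field. auto. }
  unfold Phi. generalize two_pi_i_neq. intros n.
  transitivity ((Ival (fun t => m t * kern w t) - Ival (fun t => m t * kern z t)) / (RtoC (2 * PI) * Ci))%C.
  + field. split; [apply Ci_nz|]. intros E'. apply n. rewrite E'. ring.
  + rewrite E. field. split; [apply Ci_nz|]. intros E'. apply n. rewrite E'. ring.
Qed.

End BoundedDensity.

Lemma IR_two_poles_lower z w : snd z < 0 -> snd w < 0 -> IR (fun t => / (RtoC t - z) * / (RtoC t - w))%C (RtoC 0).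
Proof.
intros hz hw.
apply (half_plane_integral_regular (fun u => / (u - z) * / (u - w))%C 4 (2 * Cmod z + 2 * Cmod w + 1)).
- intros u hu. apply tends_mult; [apply nb_filter| |]; (apply tends_inv; [apply nb_filter|apply UHP_minus_neq; auto|]);
    (apply tends_minus; [apply nb_filter|apply tends_nb_id|apply tends_const, nb_filter]).
- intros u hu. eexists. apply Cder_mult; (apply Cder_inv; [apply UHP_minus_neq; auto; lra|apply Cder_sub_const]).
- lra.
- intros u hu hR. assert (q1 := Cmod_ge_0 z). assert (q2 := Cmod_ge_0 w).
  assert (n1 := UHP_minus_neq u z hu hz). assert (n2 := UHP_minus_neq u w hu hw).
  rewrite Cmod_mult, !Cmod_inv by auto.
  assert (s1 := Cmod_sub_far u z ltac:(lra)). assert (s2 := Cmod_sub_far u w ltac:(lra)).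
  replace (4 / Cmod u ^ 2) with (/ (Cmod u / 2) * / (Cmod u / 2)) by (field; lra).
  apply Rmult_le_compat; try (left; apply Rinv_0_lt_compat; apply Cmod_gt_0; auto); apply Rinv_le_contravar; lra.
Qed.

Lemma IR_kern_lower z : snd z < 0 -> IR (kern z) (RtoC 0).
Proof.
intros hz. assert (hi : snd (- Ci)%C < 0) by (simpl; lra).
assert (H := IR_two_poles_lower z (- Ci)%C hz hi).
apply IR_scal with (c := (z + Ci)%C) in H.
- replace ((z + Ci) * RtoC 0)%C with (RtoC 0) in H by ring. revert H. apply IR_ext. intros t.
  rewrite kern_two_poles by lra. reflexivity.
- apply contR_mult; apply contR_inv_sub; lra.
Qed.

(** The normalising terms cancel, and what remains between conjugate points is a Poisson kernel.
    Both the value of the constant density above the line and the jump relation come from here. *)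
Lemma kern_jump x y t : 0 < y -> (kern (x, y) t - kern (x, (- y)%R) t)%C = (RtoC 2 * Ci * RtoC (poisson x y t))%C.
Proof.
intros hy. rewrite !kern_split by (simpl; lra).
assert (K := poisson_kernel x y t hy).
assert (n1 := real_minus_neq t (x, y) ltac:(simpl; lra)). assert (n2 := real_minus_neq t (x, - y) ltac:(simpl; lra)).
assert (n3 := plus_Ci_neq t).
replace (RtoC (poisson x y t)) with (RtoC y * RtoC (/ y * poisson x y t))%C.
2: { rewrite <- RtoC_mult. f_equal. field. lra. }
rewrite <- K.
replace (RtoC 2 * Ci * (RtoC y * / ((RtoC t - (x, y)) * (RtoC t - (x, (- y)%R)))))%C
  with (((x, y) - (x, (- y)%R)) * / ((RtoC t - (x, y)) * (RtoC t - (x, (- y)%R))))%C.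
- field. auto.
- rewrite (Cmult_assoc _ (RtoC y)). f_equal. unfold RtoC, Ci, Cminus, Cplus, Copp, Cmult. simpl. apply pair_eq; ring.
Qed.

Lemma IR_kern_upper z : 0 < snd z -> IR (kern z) (RtoC (2 * PI) * Ci)%C.
Proof.
destruct z as [x y]. simpl. intros hy.
assert (Hp := IR_scal _ (RtoC 2 * Ci)%C _ (contR_poisson x y hy) (IR_poisson x y hy)).
assert (Hl := IR_kern_lower (x, - y) ltac:(simpl; lra)).
assert (H := IR_plus _ _ _ _ (contR_kern (x, - y) ltac:(simpl; lra)) (contR_mult _ _ (contR_const (RtoC 2 * Ci)%C) (contR_poisson x y hy)) Hl Hp).
replace (RtoC (2 * PI) * Ci)%C with (RtoC 0 + RtoC 2 * Ci * RtoC PI)%C by (rewrite RtoC_mult; ring).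
revert H. apply IR_ext. intros t. cbv beta. rewrite <- kern_jump by auto. ring.
Qed.

Lemma tends_vcont f z : tends (nb everywhere z) f (f z) -> vcont f z.
Proof.
intros H e he. destruct (H e he) as [d [hd K]]. exists d. split; auto. intros s hs. apply K; [exact I|].
replace ((fst z, (snd z + s)%R) - z)%C with (RtoC s * Ci)%C.
- rewrite Cmod_mult, Cmod_Ci, Cmod_R, Rabs_pos_eq; lra.
- destruct z as [x y]. unfold Cminus, Copp, Cplus, Cmult, RtoC, Ci. simpl. apply pair_eq; ring.
Qed.

Lemma Rpower_to_0 nu C : 0 < nu -> 0 <= C -> forall e, 0 < e -> exists d, 0 < d /\ forall s, 0 < s <= d -> C * Rpower s nu < e.
Proof.
intros hn hC e he. set (r := e / (C + 1)). assert (hr : 0 < r) by (apply Rdiv_lt_0_compat; lra).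
exists (Rpower r (/ nu)). split; [apply Rpower_pos|]. intros s hs.
apply Rle_lt_trans with (C * r).
- apply Rmult_le_compat_l; auto. rewrite <- (Rpower_1 r) by auto. rewrite <- (Rinv_l nu) by lra.
  rewrite <- Rpower_mult. apply Rle_Rpower_l; lra.
- unfold r. apply (Rmult_lt_reg_r (C + 1)); [lra|]. unfold Rdiv. rewrite Rmult_assoc, Rmult_assoc, Rinv_l by lra. nra.
Qed.

Section Extension.
Variables (F : C -> C) (nu D B : R).
Hypothesis nu_range : 0 < nu < 1.
Hypothesis D_pos : 0 <= D.
Hypothesis F_der : forall z : C, 0 < snd z -> exists l, Cder F z l.
Hypothesis F_der_bound : forall z l, 0 < snd z -> Cder F z l -> Cmod l <= D * Rpower (snd z) (nu - 1).
Hypothesis F_bound : forall z : C, 0 < snd z -> Cmod (F z) <= B.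

Let A := (2 / nu + 2) * D.

Lemma A_pos : 0 <= A.
Proof. unfold A. assert (0 <= 2 / nu) by (apply Rdiv_le_0_compat; lra). apply Rmult_le_pos; lra. Qed.

Lemma F_vcont z : 0 < snd z -> vcont F z.
Proof. intros hz. destruct (F_der z hz) as [l hl]. apply tends_vcont. exact (Cder_tends _ _ _ hl). Qed.

Lemma F_vertical x s u d : 0 < s <= d -> 0 < u <= d -> Cmod (F (x, s) - F (x, u)) <= A * Rpower d nu.
Proof.
intros hs hu. apply (holder_of_derivative F F_der nu D); simpl; auto; try lra.
- apply F_vcont. simpl; lra.
- apply F_vcont. simpl; lra.
- rewrite Rminus_diag, Rabs_R0. lra.
- apply Rabs_le. lra.
Qed.

Lemma F_limit x : exists l, forall d, 0 < d -> Cmod (F (x, d) - l) <= A * Rpower d nu.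
Proof.
assert (hA := A_pos).
destruct (C_complete (fun n => F (x, / (INR n + 1)))) as [l hl].
{ intros e he. destruct (Rpower_to_0 nu A ltac:(lra) hA e he) as [d [hd H]].
  destruct (INR_unbounded (/ d)) as [N hN]. exists N.
  assert (K : forall n, (N <= n)%nat -> 0 < / (INR n + 1) <= d).
  { intros n hn. apply le_INR in hn. assert (0 < / d) by (apply Rinv_0_lt_compat; auto).
    split; [apply Rinv_0_lt_compat; lra|]. rewrite <- (Rinv_inv d). apply Rinv_le_contravar; lra. }
  intros n k hn hk. eapply Rle_lt_trans; [apply (F_vertical x _ _ d)|apply H]; auto. lra. }
exists l. intros d hd. apply Rnot_lt_le. intros hlt.
destruct (hl (Cmod (F (x, d) - l) - A * Rpower d nu)) as [N hN]; [lra|].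
destruct (INR_unbounded (/ d)) as [N' hN'].
set (n := Nat.max N N'). assert (hn : INR N' <= INR n) by (apply le_INR; lia).
assert (hi : 0 < / d) by (apply Rinv_0_lt_compat; auto).
assert (q : 0 < / (INR n + 1) <= d).
{ split; [apply Rinv_0_lt_compat; lra|]. rewrite <- (Rinv_inv d). apply Rinv_le_contravar; lra. }
assert (q1 := hN n ltac:(lia)). cbv beta in q1.
assert (q2 := F_vertical x d _ d ltac:(lra) q).
assert (q3 := Cmod_triangle_sub (F (x, d)) (F (x, / (INR n + 1))) l). lra.
Qed.

(** The bound [y^(nu - 1)] is integrable at 0, so vertical limits exist with rate [d^nu]. This makes
    the extension vertically continuous, and [holder_of_derivative] upgrades that to joint
    continuity. *)
Lemma plus_fn_extension : exists G, plus_fn G /\ (forall z : C, 0 <= snd z -> Cmod (G z) <= B) /\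
  (forall z : C, 0 < snd z -> G z = F z) /\
  (forall x d, 0 < d -> Cmod (F (x, d) - G (RtoC x)) <= A * Rpower d nu).
Proof.
assert (hA := A_pos).
set (bd := fun x => proj1_sig (constructive_indefinite_description _ (F_limit x))).
assert (Hbd : forall x d, 0 < d -> Cmod (F (x, d) - bd x) <= A * Rpower d nu).
{ intros x. unfold bd. apply proj2_sig. }
(* Below the real line [G] merely repeats the boundary value; [plus_fn] says nothing about it
   there. *)
set (G := fun z : C => if Rlt_dec 0 (snd z) then F z else bd (fst z)).
assert (G1 : forall z : C, 0 < snd z -> G z = F z) by (intros z hz; unfold G; destruct Rlt_dec; lra || auto).
assert (G2 : forall x, G (RtoC x) = bd x) by (intros x; unfold G; simpl; destruct Rlt_dec; lra || auto).
assert (Gder : forall z l, 0 < snd z -> Cder F z l -> Cder G z l).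
{ intros z l hz. apply Cder_ext. generalize (nb_UHP z hz). apply filter_imp. intros w hw. symmetry. auto. }
assert (Gder' : forall z : C, 0 < snd z -> exists l, Cder G z l).
{ intros z hz. destruct (F_der z hz) as [l hl]. exists l. auto. }
assert (Gb : forall z l, 0 < snd z -> Cder G z l -> Cmod l <= D * Rpower (snd z) (nu - 1)).
{ intros z l hz hl. destruct (F_der z hz) as [k hk]. rewrite (Cder_unique _ _ _ _ hl (Gder _ _ hz hk)). auto. }
assert (Gv : forall z : C, 0 <= snd z -> vcont G z).
{ intros z hz. destruct (Rle_lt_or_eq_dec _ _ hz) as [h|h].
  - destruct (Gder' z h) as [l hl]. apply tends_vcont. exact (Cder_tends _ _ _ hl).
  - intros e he. destruct (Rpower_to_0 nu A ltac:(lra) hA e he) as [d [hd H]]. exists d. split; auto. intros s hs.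
    destruct z as [x y]. simpl in h, hz |- *. rewrite <- h, Rplus_0_l, G1 by (simpl; lra).
    change (G (x, 0)) with (G (RtoC x)). rewrite G2.
    eapply Rle_lt_trans; [apply Hbd; lra|]. apply H. lra. }
assert (GB : forall z : C, 0 <= snd z -> Cmod (G z) <= B).
{ intros z hz. destruct (Rle_lt_or_eq_dec _ _ hz) as [h|h]; [rewrite G1; auto|].
  apply Rnot_lt_le. intros hlt. destruct (Gv z hz (Cmod (G z) - B)) as [d [hd H]]; [lra|].
  specialize (H (d / 2) ltac:(lra)). rewrite G1 in H by (simpl; lra).
  assert (q := F_bound (fst z, snd z + d / 2) ltac:(simpl; lra)).
  rewrite Cmod_sub_sym in H. assert (q' := Cmod_triangle_rev (G z) (F (fst z, snd z + d / 2))). lra. }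
exists G. split; [split; [|split]|split; [|split]]; auto.
- intros z hz e he. destruct (Rpower_to_0 nu A ltac:(lra) hA e he) as [d [hd H]]. exists d. split; auto.
  intros w hw hwz. unfold CUHP, Defs.Im in hw.
  assert (q1 := fst_le_Cmod (w - z)%C). assert (q2 := snd_le_Cmod (w - z)%C). simpl in q1, q2.
  eapply Rle_lt_trans; [apply (holder_of_derivative G Gder' nu D w z d); auto|apply H; lra]; unfold Rminus; lra.
- exists B. auto.
- intros x d hd. rewrite G2. auto.
Qed.

End Extension.

Section Plemelj.
Variables (m : R -> C) (nu K : R).
Hypothesis nu_range : 0 < nu < 1.
Hypothesis m_LH : LH nu K m.

Lemma LH_cont : contR m.
Proof. eapply LH_contR; [|exact m_LH]; lra. Qed.

Lemma LH_bound t : Cmod (m t) <= K.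
Proof. apply m_LH. Qed.

Lemma LH_K_pos : 0 <= K.
Proof. apply m_LH. Qed.

Lemma Phi_upper_der z l : 0 < snd z -> Cder (Phi m) z l ->
  Cmod l <= 8 * K / (1 - nu) * Rpower (snd z) (nu - 1).
Proof.
intros hz hl. replace (8 * K / (1 - nu)) with (8 * INR 1 * 1 * K / (1 - nu)) by (simpl; field; lra).
apply (derivative_bound_near (Phi m) 1 (fun _ _ => RtoC 1) (fun _ => m) nu K 1); auto using LH_K_pos; try lra.
- intros _ _. apply contR_const.
- intros _ _ _. rewrite Cmod_1. lra.
- intros _ w _ hw. apply (minus_fn_sqinv_upper (fun _ => RtoC 1)); auto. apply minus_fn_const.
- intros w k hw hk.
  rewrite (Cder_unique _ _ _ _ hk (Cder_Phi m K LH_cont LH_bound w ltac:(lra))).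
  replace (RtoC (2 * PI) * Ci * (Ival (fun t => m t * sqinv w t) / (RtoC (2 * PI) * Ci)))%C
    with (Ival (fun t => m t * sqinv w t))%C.
  2: { generalize two_pi_i_neq. intros n. rewrite Cmult_comm. unfold Cdiv. rewrite <- Cmult_assoc, Cinv_l by auto. ring. }
  generalize (IR_sqinv_density m K LH_cont LH_bound w ltac:(lra)). apply IR_ext. intros t.
  rewrite csum_S. change (csum (fun _ : nat => RtoC 1 * m t)%C 0) with (RtoC 0). ring.
Qed.

(** The density and the point are reflected; the sign from the chain rule is absorbed into the
    constant [- 1] that plays the role of [h]. *)
Lemma Phi_lower_der z l : 0 < snd z -> Cder (fun w => Phi m (- w)%C) z l ->
  Cmod l <= 8 * K / (1 - nu) * Rpower (snd z) (nu - 1).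
Proof.
intros hz hl. replace (8 * K / (1 - nu)) with (8 * INR 1 * 1 * K / (1 - nu)) by (simpl; field; lra).
apply (derivative_bound_near (fun w => Phi m (- w)%C) 1 (fun _ _ => - RtoC 1)%C (fun _ t => m (- t)) nu K 1); auto using LH_K_pos; try lra.
- intros _ _. apply contR_const.
- intros _ _ _. rewrite Cmod_opp, Cmod_1. lra.
- intros _ w _ hw. apply (minus_fn_sqinv_upper (fun _ => - RtoC 1)%C); auto. apply minus_fn_const.
- intros _ _. apply LH_opp_arg. auto.
- intros w k hw hk.
  assert (hw' : snd (- w)%C <> 0) by (simpl; lra).
  rewrite (Cder_unique _ _ _ _ hk (Cder_comp_opp _ _ _ (Cder_Phi m K LH_cont LH_bound (- w)%C hw'))).
  replace (RtoC (2 * PI) * Ci * - (Ival (fun t => m t * sqinv (- w) t) / (RtoC (2 * PI) * Ci)))%C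
    with (- RtoC 1 * Ival (fun t => m t * sqinv (- w) t))%C.
  2: { generalize two_pi_i_neq. intros n.
       transitivity (- (Ival (fun t => m t * sqinv (- w) t) * (/ (RtoC (2 * PI) * Ci) * (RtoC (2 * PI) * Ci))))%C.
       - rewrite Cinv_l by auto. ring.
       - unfold Cdiv. ring. }
  assert (Cs : contR (fun t => m t * sqinv (- w) t)%C) by (apply contR_mult; [apply LH_cont|apply contR_sqinv; auto]).
  generalize (IR_scal _ (- RtoC 1)%C _ (contR_opp_arg _ Cs) (IR_opp_arg _ _ Cs (IR_sqinv_density m K LH_cont LH_bound _ hw'))).
  apply IR_ext. intros t. rewrite sqinv_opp.
  rewrite csum_S. change (csum (fun _ : nat => - RtoC 1 * m (- t))%C 0) with (RtoC 0). ring.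
Qed.

(** The value [c] of the density at infinity is split off. Its own Cauchy integral is known and
    contributes at most [|c| <= 2 K]; the remainder decays, is integrable against the kernel, and
    contributes at most [12 K / nu]. *)
Lemma Phi_bound_far z : 1 <= Rabs (snd z) -> Cmod (Phi m z) <= (12 / nu + 2) * K.
Proof.
intros hz. assert (hK := LH_K_pos).
assert (hz0 : snd z <> 0) by (intros E; rewrite E, Rabs_R0 in hz; lra).
destruct m_LH as (_ & b & _ & c & hc).
assert (Ik : exists L, IR (kern z) L /\ Cmod L <= 2 * PI).
{ assert (hpi := PI_RGT_0). destruct (Rle_lt_dec (snd z) 0) as [h|h].
  - exists (RtoC 0). rewrite Cmod_0. split; [|lra]. apply IR_kern_lower. lra.
  - exists (RtoC (2 * PI) * Ci)%C. split; [apply IR_kern_upper; auto|].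
    rewrite Cmod_mult, Cmod_Ci, Cmod_R, Rabs_pos_eq; lra. }
destruct Ik as [L [I1 HL]].
assert (Ck := contR_kern z hz0).
assert (C1 : contR (fun t => m t * kern z t)%C) by (apply contR_mult; [apply LH_cont|auto]).
assert (C2 : contR (fun t => c * kern z t)%C) by (apply contR_mult; [apply contR_const|auto]).
assert (I2 := IR_minus _ _ _ _ C1 C2 (IR_kern m K LH_cont LH_bound z hz0) (IR_scal _ c _ Ck I1)).
assert (hc2 : Cmod c <= 2 * K).
{ assert (q := hc 0). rewrite Rabs_R0, Rplus_0_r, Rpower_1_base, Rmult_1_r in q.
  assert (q' := b 0). rewrite Cmod_sub_sym in q. generalize (Cmod_triangle_rev c (m 0)). lra. }
assert (Q : Cmod (Ival (fun t => m t * kern z t) - c * L)%C <= 12 * K / nu).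
{ assert (D1 := dom_bump nu 1 0 ltac:(lra) Rlt_0_1). assert (D2 := dom_bump nu 1 (fst z) ltac:(lra) Rlt_0_1).
  assert (D := dom_scal _ (2 * K) _ ltac:(lra) (dom_plus _ _ _ _ (dom_scal _ 2 _ ltac:(lra) D1) D2)).
  replace (12 * K / nu) with (2 * K * (2 * (2 / nu * Rpower 1 (- nu)) + 2 / nu * Rpower 1 (- nu))).
  2: { rewrite Rpower_1_base. field. lra. }
  refine (IR_bound _ _ _ _ (contR_minus _ _ C1 C2) _ D I2).
  intros t. replace (m t * kern z t - c * kern z t)%C with ((m t - c) * kern z t)%C by ring.
  assert (ht := Rabs_pos t). assert (hu := Rabs_pos (t - fst z)).
  set (T := 1 + Rabs t). set (U := 1 + Rabs (t - fst z)).
  assert (k1 : Cmod (kern z t) <= 2 * Rpower U (- (1)) + 2 * Rpower T (- (1))).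
  { rewrite kern_split by auto. rewrite inv_plus_Ci. eapply Rle_trans; [apply Cmod_triangle_minus|].
    apply Rplus_le_compat.
    - eapply Rle_trans; [apply Cmod_inv_sub; auto|]. apply Rmult_le_compat_l; [lra|].
      replace (- (1)) with (-1) by ring. apply Rpower_le_neg; [|lra]. unfold U; lra.
    - eapply Rle_trans; [apply Cmod_inv_sub; simpl; lra|]. apply Rmult_le_compat_l; [lra|]. simpl.
      rewrite Rabs_Ropp, Rabs_R1, Ropp_0, Rminus_0_r. fold T. right. f_equal; ring. }
  eapply Rle_trans; [apply Cmod_mult_le; [apply hc|exact k1]|]. fold T.
  assert (mx := Rpower_mix T U nu 1 ltac:(unfold T; lra) ltac:(unfold U; lra) ltac:(lra) ltac:(lra)).
  unfold bump. rewrite Rminus_0_r. fold T U.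
  replace (- nu - 1) with (- 1 - nu) in mx by ring.
  assert (e1 : Rpower T (- nu) * Rpower T (- (1)) = Rpower T (- 1 - nu)) by (rewrite <- Rpower_plus; f_equal; ring).
  replace (K * Rpower T (- nu) * (2 * Rpower U (- (1)) + 2 * Rpower T (- (1))))
    with (2 * K * (Rpower T (- nu) * Rpower U (- (1)) + Rpower T (- nu) * Rpower T (- (1)))) by ring.
  apply Rmult_le_compat_l; [lra|]. rewrite e1. lra. }
assert (hpi : 3 < PI) by (generalize PI2_3_2; lra).
unfold Phi. rewrite Cmod_div by apply two_pi_i_neq.
rewrite Cmod_mult, Cmod_Ci, Cmod_R, Rabs_pos_eq by lra.
apply Rle_div_l; [lra|]. set (V := Ival (fun t => (m t * kern z t)%C)) in *.
assert (q := Cmod_triangle_rev V (c * L)). rewrite Cmod_mult in q.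
assert (q2 : Cmod c * Cmod L <= 2 * K * (2 * PI)) by (apply Rmult_le_compat; auto using Cmod_ge_0).
assert (q3 : 0 <= 12 * K / nu) by (apply Rdiv_le_0_compat; lra).
replace ((12 / nu + 2) * K * (2 * PI * 1)) with (12 * K / nu * (2 * PI) + 2 * K * (2 * PI)) by (field; lra).
assert (12 * K / nu * 1 <= 12 * K / nu * (2 * PI)) by (apply Rmult_le_compat_l; lra).
lra.
Qed.

(** The bound at height at least 1, plus the Hoelder estimate over one unit of height that carries
    it down to the real line. *)
Definition Plemelj_const : R := 12 / nu + 2 + (2 / nu + 2) * (8 / (1 - nu)).

Lemma Phi_bound_gen F z : (forall w : C, 0 < snd w -> exists l, Cder F w l) ->
  (forall w l, 0 < snd w -> Cder F w l -> Cmod l <= 8 * K / (1 - nu) * Rpower (snd w) (nu - 1)) ->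
  (forall w : C, 1 <= snd w -> Cmod (F w) <= (12 / nu + 2) * K) ->
  0 < snd z -> Cmod (F z) <= Plemelj_const * K.
Proof.
intros h1 h2 h3 hz. assert (hK := LH_K_pos).
assert (hD : 0 <= 8 * K / (1 - nu)) by (apply Rdiv_le_0_compat; lra).
assert (h8 : 0 <= (2 / nu + 2) * (8 * K / (1 - nu))).
{ assert (0 <= 2 / nu) by (apply Rdiv_le_0_compat; lra). apply Rmult_le_pos; lra. }
replace (Plemelj_const * K) with ((12 / nu + 2) * K + (2 / nu + 2) * (8 * K / (1 - nu))) by (unfold Plemelj_const; field; lra).
destruct (Rle_lt_dec 1 (snd z)) as [h|h]; [generalize (h3 z h); lra|].
assert (Q := holder_of_derivative F h1 nu (8 * K / (1 - nu)) z (fst z, 1) 1 nu_range hD h2).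
rewrite Rpower_1_base, Rmult_1_r in Q.
assert (vc : forall w : C, 0 < snd w -> vcont F w).
{ intros w hw. destruct (h1 w hw) as [l hl]. apply tends_vcont. exact (Cder_tends _ _ _ hl). }
simpl in Q. rewrite Rminus_diag, Rabs_R0 in Q.
specialize (Q ltac:(lra) ltac:(lra) (vc z hz) (vc (fst z, 1) ltac:(simpl; lra)) ltac:(lra) ltac:(lra) ltac:(apply Rabs_le; lra)).
assert (q := Cmod_triangle_rev (F z) (F (fst z, 1))). generalize (h3 (fst z, 1) ltac:(simpl; lra)). lra.
Qed.

(** The error is [1 / PI] times the Poisson integral of [m - m(x)], which is [O(d^nu)] by the
    modulus at [x]. *)
Lemma Phi_jump x : forall e, 0 < e -> exists d0, 0 < d0 /\ forall d, 0 < d < d0 ->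
  Cmod (Phi m (x, d) - Phi m (x, (- d)%R) - m x) < e.
Proof.
intros e he. assert (hK := LH_K_pos).
assert (hC : 0 <= 4 * K / (1 - nu)) by (apply Rdiv_le_0_compat; lra).
destruct (Rpower_to_0 nu (4 * K / (1 - nu)) ltac:(lra) hC e he) as [d0 [hd0 H]].
exists d0. split; auto. intros d hd. assert (hd' : 0 < d) by lra.
eapply Rle_lt_trans; [|apply (H d); lra].
assert (s1 : snd ((x, d) : C) <> 0) by (simpl; lra). assert (s2 : snd ((x, (- d)%R) : C) <> 0) by (simpl; lra).
assert (C1 : contR (fun t => m t * kern (x, d) t)%C) by (apply contR_mult; [apply LH_cont|apply contR_kern; auto]).
assert (C2 : contR (fun t => m t * kern (x, (- d)%R) t)%C) by (apply contR_mult; [apply LH_cont|apply contR_kern; auto]).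
assert (I1 := IR_minus _ _ _ _ C1 C2 (IR_kern m K LH_cont LH_bound _ s1) (IR_kern m K LH_cont LH_bound _ s2)).
assert (Cp := contR_poisson x d hd').
assert (I2 := IR_scal _ (RtoC 2 * Ci * m x)%C _ Cp (IR_poisson x d hd')).
assert (C3 : contR (fun t => RtoC 2 * Ci * m x * RtoC (poisson x d t))%C) by (apply contR_mult; [apply contR_const|auto]).
assert (I3 := IR_minus _ _ _ _ (contR_minus _ _ C1 C2) C3 I1 I2).
set (V1 := Ival (fun t => (m t * kern (x, d) t)%C)) in *. set (V2 := Ival (fun t => (m t * kern (x, (- d)%R) t)%C)) in *.
assert (Q : Cmod (V1 - V2 - RtoC 2 * Ci * m x * RtoC PI)%C <= 8 * K / (1 - nu) * Rpower d nu).
{ assert (D := dom_scal _ (4 * K * d) _ ltac:(apply Rmult_le_pos; lra) (dom_bump (1 - nu) d x ltac:(lra) hd')).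
  replace (8 * K / (1 - nu) * Rpower d nu) with (4 * K * d * (2 / (1 - nu) * Rpower d (- (1 - nu)))).
  2: { rewrite (Rpower_sub d nu 1), Rpower_1 by auto. replace (nu - 1) with (- (1 - nu)) by ring. field. lra. }
  refine (IR_bound _ _ _ _ (contR_minus _ _ (contR_minus _ _ C1 C2) C3) _ D I3).
  intros t. cbv beta.
  replace (m t * kern (x, d) t - m t * kern (x, (- d)%R) t)%C with (m t * (kern (x, d) t - kern (x, (- d)%R) t))%C by ring.
  rewrite kern_jump by auto.
  replace (m t * (RtoC 2 * Ci * RtoC (poisson x d t)) - RtoC 2 * Ci * m x * RtoC (poisson x d t))%C
    with (RtoC 2 * Ci * ((m t - m x) * RtoC (poisson x d t)))%C by ring.
  rewrite Cmod_two_Ci. rewrite <- Rpower_bump by auto.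
  assert (q1 := LH_near nu K m x d t ltac:(lra) hd' m_LH).
  assert (hu := Rabs_pos (t - x)).
  assert (q2 : Cmod (RtoC (poisson x d t)) <= 2 * d * bump 1 d x t).
  { rewrite Cmod_R, Rabs_pos_eq by (left; apply poisson_pos; auto). unfold poisson, bump.
    replace (- 1 - 1) with (- INR 2) by (simpl; ring). rewrite Rpower_Ropp, Rpower_pow by lra.
    set (u := Rabs (t - x)) in *. replace ((t - x) ^ 2) with (u ^ 2) by apply pow2_abs.
    unfold Rdiv. rewrite (Rmult_comm 2 d), Rmult_assoc. apply Rmult_le_compat_l; [lra|].
    assert (h0 : 0 < (d + u) ^ 2) by (apply pow_lt; lra).
    replace (2 * / (d + u) ^ 2) with (/ ((d + u) ^ 2 / 2)) by (field; lra).
    apply Rinv_le_contravar; [lra|]. generalize (pow2_ge_0 (d - u)). lra. }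
  replace (4 * K * d * (Rpower (d + Rabs (t - x)) nu * bump 1 d x t))
    with (2 * ((K * Rpower (d + Rabs (t - x)) nu) * (2 * d * bump 1 d x t))) by ring.
  apply Rmult_le_compat_l; [lra|]. apply Cmod_mult_le; auto. }
assert (hpi : 3 < PI) by (generalize PI2_3_2; lra).
assert (E : (Phi m (x, d) - Phi m (x, (- d)%R) - m x)%C = ((V1 - V2 - RtoC 2 * Ci * m x * RtoC PI) / (RtoC (2 * PI) * Ci))%C).
{ unfold Phi. fold V1 V2. rewrite RtoC_mult. field. split; [apply Ci_nz|].
  intros E. apply RtoC_inj in E. lra. }
rewrite E, Cmod_div by apply two_pi_i_neq.
rewrite Cmod_mult, Cmod_Ci, Cmod_R, Rabs_pos_eq by lra.
apply Rle_div_l; [lra|]. eapply Rle_trans; [exact Q|].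
replace (8 * K / (1 - nu) * Rpower d nu) with (4 * K / (1 - nu) * Rpower d nu * 2) by (field; lra).
apply Rmult_le_compat_l; [|lra]. apply Rmult_le_pos; auto. left; apply Rpower_pos.
Qed.

(** The last clause ties [Q] to [Phi m] itself, approached from below. Identities for [Phi] hold
    only off the real line, and this clause transports them to the boundary values. *)
Lemma Plemelj_decomposition : exists P Q, plus_fn P /\ minus_fn Q /\
  (forall z : C, 0 <= snd z -> Cmod (P z) <= Plemelj_const * K) /\
  (forall z : C, snd z <= 0 -> Cmod (Q z) <= Plemelj_const * K) /\
  (forall x, P (RtoC x) - Q (RtoC x) = m x)%C /\
  (forall x e, 0 < e -> exists d0, 0 < d0 /\ forall d, 0 < d < d0 -> Cmod (Phi m (x, (- d)%R) - Q (RtoC x)) < e).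
Proof.
assert (hK := LH_K_pos).
assert (hD : 0 <= 8 * K / (1 - nu)) by (apply Rdiv_le_0_compat; lra).
assert (hA : 0 <= (2 / nu + 2) * (8 * K / (1 - nu))).
{ assert (0 <= 2 / nu) by (apply Rdiv_le_0_compat; lra). apply Rmult_le_pos; lra. }
assert (U1 : forall w : C, 0 < snd w -> exists l, Cder (Phi m) w l).
{ intros w hw. eexists. apply (Cder_Phi m K LH_cont LH_bound). lra. }
assert (L1 : forall w : C, 0 < snd w -> exists l, Cder (fun w => Phi m (- w)%C) w l).
{ intros w hw. eexists. apply Cder_comp_opp. apply (Cder_Phi m K LH_cont LH_bound). simpl. lra. }
assert (U2 : forall w : C, 0 < snd w -> Cmod (Phi m w) <= Plemelj_const * K).
{ intros w hw. apply Phi_bound_gen; auto using Phi_upper_der.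
  intros v hv. apply Phi_bound_far. rewrite Rabs_pos_eq; lra. }
assert (L2 : forall w : C, 0 < snd w -> Cmod (Phi m (- w)%C) <= Plemelj_const * K).
{ intros w hw. apply (Phi_bound_gen (fun w => Phi m (- w)%C)); auto using Phi_lower_der.
  intros v hv. apply Phi_bound_far. simpl. rewrite Rabs_Ropp, Rabs_pos_eq; lra. }
destruct (plus_fn_extension (Phi m) nu _ _ nu_range hD U1 Phi_upper_der U2) as (P & P1 & P2 & P3 & P4).
destruct (plus_fn_extension (fun w => Phi m (- w)%C) nu _ _ nu_range hD L1 Phi_lower_der L2) as (Q & Q1 & Q2 & Q3 & Q4).
set (Qm := fun z => Q (- z)%C).
assert (Q5 : forall x d, 0 < d -> Cmod (Phi m (x, (- d)%R) - Qm (RtoC x)) <= (2 / nu + 2) * (8 * K / (1 - nu)) * Rpower d nu).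
{ intros x d hd. generalize (Q4 (- x) d hd). unfold Qm. rewrite <- RtoC_opp.
  replace (- (((- x)%R, d) : C))%C with ((x, (- d)%R) : C); auto.
  unfold Copp. simpl. apply pair_eq; ring. }
exists P, Qm. split; auto. split.
{ apply (proj1 (minus_fn_opp_arg Q)). auto. }
split; auto. split.
{ intros z hz. unfold Qm. apply Q2. simpl. lra. }
split.
- intros x. apply Ceq_minus. apply Cmod_small_0. intros e he.
  destruct (Phi_jump x (e / 2) ltac:(lra)) as [d1 [h1 H1]].
  destruct (Rpower_to_0 nu _ ltac:(lra) hA (e / 4) ltac:(lra)) as [d2 [h2 H2]].
  set (d := Rmin (d1 / 2) d2). assert (hd : 0 < d) by (apply Rmin_pos; lra).
  assert (hd1 : d <= d1 / 2) by apply Rmin_l. assert (hd2 : d <= d2) by apply Rmin_r.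
  assert (k1 := H1 d ltac:(lra)). assert (k2 := H2 d ltac:(lra)).
  assert (k3 := P4 x d hd). assert (k4 := Q5 x d hd).
  replace (P (RtoC x) - Qm (RtoC x) - m x)%C with
    ((Phi m (x, d) - Phi m (x, (- d)%R) - m x) + ((Phi m (x, (- d)%R) - Qm (RtoC x)) - (Phi m (x, d) - P (RtoC x))))%C by ring.
  eapply Rle_trans; [apply Cmod_triangle|].
  eapply Rle_trans; [apply Rplus_le_compat_l, Cmod_triangle_minus|]. lra.
- intros x e he. destruct (Rpower_to_0 nu _ ltac:(lra) hA e he) as [d2 [h2 H2]].
  exists d2. split; auto. intros d hd. eapply Rle_lt_trans; [apply Q5; lra|]. apply H2. lra.
Qed.

End Plemelj.

(** * The scalar boundary value problem *)

(** [b] and its inverse are kept as separate functions: one belongs to the upper and the other to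
    the lower half plane, and only natural powers of each occur. *)
Definition bp (z : C) : C := ((z - Ci) / (z + Ci))%C.
Definition bm (z : C) : C := ((z + Ci) / (z - Ci))%C.

Lemma bfun_bp z : bfun z = bp z.
Proof. unfold bfun. rewrite Defs_Cdiv. reflexivity. Qed.

Lemma Cinv_opp (z : C) : (/ - z = - / z)%C.
Proof.
unfold Cinv, Copp. simpl. apply pair_eq.
- replace (- fst z * (- fst z * 1) + - snd z * (- snd z * 1)) with (fst z * (fst z * 1) + snd z * (snd z * 1)) by ring.
  unfold Rdiv. ring.
- replace (- fst z * (- fst z * 1) + - snd z * (- snd z * 1)) with (fst z * (fst z * 1) + snd z * (snd z * 1)) by ring.
  unfold Rdiv. ring.
Qed.

Lemma bm_opp z : bm (- z) = bp z.
Proof.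
unfold bm, bp, Cdiv. replace (- z - Ci)%C with (- (z + Ci))%C by ring. rewrite Cinv_opp. ring.
Qed.

Lemma bp_opp z : bp (- z) = bm z.
Proof. rewrite <- bm_opp. f_equal. ring. Qed.

Lemma minus_Ci_neq (x : R) : (RtoC x - Ci)%C <> RtoC 0.
Proof. intros E. apply (f_equal snd) in E. simpl in E. lra. Qed.

Lemma bp_bm (x : R) : (bp (RtoC x) * bm (RtoC x) = RtoC 1)%C.
Proof. unfold bp, bm. field. split; [apply minus_Ci_neq|apply plus_Ci_neq]. Qed.

Lemma CUHP_plus_Ci (z : C) : 0 <= snd z -> 1 <= Cmod (z + Ci).
Proof.
intros h. eapply Rle_trans; [|apply snd_le_Cmod]. simpl. eapply Rle_trans; [|apply Rle_abs]. lra.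
Qed.

Lemma plus_fn_inv : plus_fn (fun z => / (z + Ci))%C.
Proof.
assert (n : forall z : C, 0 <= snd z -> (z + Ci)%C <> RtoC 0).
{ intros z hz. apply Cmod_gt_0. generalize (CUHP_plus_Ci z hz). lra. }
split; [|split].
- intros z hz. apply tends_inv; [apply nb_filter|auto|].
  apply tends_plus; [apply nb_filter|apply tends_nb_id|apply tends_const, nb_filter].
- exists 1. intros z hz. rewrite Cmod_inv by auto. rewrite <- Rinv_1. apply Rinv_le_contravar; [lra|].
  apply CUHP_plus_Ci; auto.
- intros z hz. eexists. apply Cder_inv; [apply n; lra|]. apply Cder_plus; [apply Cder_id|apply Cder_const].
Qed.

Lemma minus_fn_inv : minus_fn (fun z => / (z - Ci))%C.
Proof.
apply (plus_fn_ext (fun z => - RtoC 1 * / (z + Ci))%C).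
- intros z. replace (- z - Ci)%C with (- (z + Ci))%C by ring. rewrite Cinv_opp. ring.
- apply plus_fn_mult; [apply plus_fn_const|apply plus_fn_inv].
Qed.

Lemma plus_fn_pow f n : plus_fn f -> plus_fn (fun z => f z ^ n)%C.
Proof.
intros Hf. induction n as [|n IH].
- exact (plus_fn_const (RtoC 1)).
- apply (plus_fn_ext (fun z => f z * f z ^ n)%C); [intros z; now rewrite Cpow_S|]. apply plus_fn_mult; auto.
Qed.

Lemma minus_fn_pow f n : minus_fn f -> minus_fn (fun z => f z ^ n)%C.
Proof. apply plus_fn_pow. Qed.

Lemma plus_fn_bp : plus_fn bp.
Proof.
split; [|split].
- intros z hz. apply tends_div; [apply nb_filter| | |].
  + apply Cmod_gt_0. generalize (CUHP_plus_Ci z hz). lra.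
  + apply tends_minus; [apply nb_filter|apply tends_nb_id|apply tends_const, nb_filter].
  + apply tends_plus; [apply nb_filter|apply tends_nb_id|apply tends_const, nb_filter].
- exists 1. intros z hz. assert (q := CUHP_plus_Ci z hz). unfold bp.
  rewrite Cmod_div by (apply Cmod_gt_0; lra). apply Rle_div_l; [lra|]. rewrite Rmult_1_l.
  apply Cmod_le_comp; simpl; [rewrite Rplus_0_r, Ropp_0, Rplus_0_r; lra|].
  apply Rabs_le. rewrite Rabs_pos_eq by lra. lra.
- intros z hz. eexists. apply Cder_mult; [apply Cder_sub_const|].
  apply Cder_inv; [|apply Cder_plus; [apply Cder_id|apply Cder_const]].
  apply Cmod_gt_0. generalize (CUHP_plus_Ci z ltac:(lra)). lra.
Qed.

Lemma minus_fn_bm : minus_fn bm.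
Proof. apply (plus_fn_ext bp); [intros; symmetry; apply bm_opp|apply plus_fn_bp]. Qed.

Lemma LH_bp nu : 0 < nu < 1 -> LH nu 8 (fun t => bp (RtoC t)).
Proof. intros h. generalize (LH_b nu h). apply LH_ext. intros; apply bfun_bp. Qed.

Lemma LH_bm nu : 0 < nu < 1 -> LH nu 8 (fun t => bm (RtoC t)).
Proof.
intros h. generalize (LH_opp_arg _ _ _ (LH_bp nu h)). apply LH_ext. intros t. rewrite RtoC_opp. apply bp_opp.
Qed.

Lemma LH_pow_mult nu f m K n : LH nu 8 f -> LH nu K m -> LH nu (24 ^ n * K) (fun t => f t ^ n * m t)%C.
Proof.
intros Hf Hm. induction n as [|n IH].
- rewrite pow_O, Rmult_1_l. revert Hm. apply LH_ext. intros t. ring.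
- assert (H := LH_mult _ _ _ _ _ Hf IH). replace (24 ^ S n * K) with (3 * 8 * (24 ^ n * K)) by (simpl; ring).
  revert H. apply LH_ext. intros t. rewrite Cpow_S. ring.
Qed.

Lemma contR_bp : contR (fun t => bp (RtoC t)).
Proof. apply plus_fn_contR, plus_fn_bp. Qed.

Lemma contR_bm : contR (fun t => bm (RtoC t)).
Proof. apply minus_fn_contR, minus_fn_bm. Qed.

Definition wt (t : R) : C := (/ (RtoC t - Ci) * / (RtoC t - (- Ci)))%C.

Lemma wt_eq t : wt t = (/ RtoC (t * t + 1))%C.
Proof.
unfold wt. assert (n1 := minus_Ci_neq t). assert (n2 := plus_Ci_neq t).
replace (RtoC (t * t + 1)) with ((RtoC t - Ci) * (RtoC t - - Ci))%C.
- replace (RtoC t - - Ci)%C with (RtoC t + Ci)%C by ring. field. auto.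
- unfold RtoC, Ci, Cminus, Cplus, Copp, Cmult. simpl. apply pair_eq; ring.
Qed.

Lemma snd_Ci_neq : snd Ci <> 0.
Proof. simpl. lra. Qed.

Lemma snd_opp_Ci_neq : snd (- Ci)%C <> 0.
Proof. simpl. lra. Qed.

Lemma contR_wt : contR wt.
Proof. apply contR_mult; apply contR_inv_sub; [apply snd_Ci_neq|apply snd_opp_Ci_neq]. Qed.

Lemma IR_wt m M : contR m -> (forall t, Cmod (m t) <= M) -> IR (fun t => m t * wt t)%C (Ival (fun t => m t * wt t)%C).
Proof. intros h1 h2. apply (IR_exists_two_poles m M); auto using snd_Ci_neq, snd_opp_Ci_neq. Qed.

Lemma Ival_wt_bound m M : contR m -> (forall t, Cmod (m t) <= M) -> Cmod (Ival (fun t => m t * wt t)%C) <= 16 * M.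
Proof.
intros h1 h2. assert (hM : 0 <= M) by (generalize (h2 0) (Cmod_ge_0 (m 0)); lra).
assert (D := dom_scal _ M _ hM (dom_scal _ 4 _ ltac:(lra) (dom_plus _ _ _ _ (dom_bump 1 1 0 Rlt_0_1 Rlt_0_1) (dom_bump 1 1 0 Rlt_0_1 Rlt_0_1)))).
replace (16 * M) with (M * (4 * (2 / 1 * Rpower 1 (- (1)) + 2 / 1 * Rpower 1 (- (1))))) by (rewrite Rpower_1_base; field).
refine (IR_bound _ _ _ _ _ _ D (IR_wt m M h1 h2)).
- apply contR_mult; auto. apply contR_wt.
- intros t. apply Cmod_mult_le; auto. eapply Rle_trans; [apply Cmod_inv_inv; [apply snd_Ci_neq|apply snd_opp_Ci_neq]|].
  simpl. rewrite Rabs_Ropp, Rabs_R1, Ropp_0. lra.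
Qed.

(** [(b(t) - b(z)) kern z t = 2 i b(t) wt t] is independent of [z]. Multiplying the density by [b]
    thus multiplies the Cauchy integral by [b z] up to a constant, which is a moment of the new
    density. *)
Lemma Phi_mult_b g M z : contR g -> (forall t, Cmod (g t) <= M) -> snd z <> 0 -> (z + Ci)%C <> RtoC 0 ->
  Phi (fun t => bp (RtoC t) * g t)%C z =
    (bp z * Phi g z + Ival (fun t => bp (RtoC t) * g t * wt t)%C / RtoC PI)%C.
Proof.
intros Hg HM hz hzi.
assert (bb : forall t, Cmod (bp (RtoC t)) <= 1) by (intros t; rewrite <- bfun_bp, Cmod_b; lra).
assert (C1 : contR (fun t => bp (RtoC t) * g t)%C) by (apply contR_mult; [apply contR_bp|auto]).
assert (B1 : forall t, Cmod (bp (RtoC t) * g t) <= 1 * M) by (intros t; apply Cmod_mult_le; auto).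
assert (I1 := IR_kern _ _ C1 B1 z hz).
assert (Ck := contR_kern z hz).
assert (I2 := IR_scal _ (bp z) _ (contR_mult _ _ Hg Ck) (IR_kern g M Hg HM z hz)).
assert (I3 := IR_scal _ (RtoC 2 * Ci)%C _ (contR_mult _ _ C1 contR_wt) (IR_wt _ _ C1 B1)).
assert (I4 := IR_plus _ _ _ _ (contR_mult _ _ (contR_const (bp z)) (contR_mult _ _ Hg Ck))
   (contR_mult _ _ (contR_const (RtoC 2 * Ci)%C) (contR_mult _ _ C1 contR_wt)) I2 I3).
assert (E : Ival (fun t => bp (RtoC t) * g t * kern z t)%C =
   (bp z * Ival (fun t => g t * kern z t) + RtoC 2 * Ci * Ival (fun t => bp (RtoC t) * g t * wt t))%C).
{ apply (IR_unique _ _ _ I1). revert I4. apply IR_ext. intros t. cbv beta.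
  assert (n1 := real_minus_neq t z hz). assert (n2 := plus_Ci_neq t). assert (n3 := minus_Ci_neq t).
  unfold kern, wt, bp. replace (RtoC t - - Ci)%C with (RtoC t + Ci)%C by ring. field. auto. }
unfold Phi. rewrite E.
assert (hpi : RtoC PI <> RtoC 0) by (intros E'; apply RtoC_inj in E'; generalize PI_RGT_0; lra).
assert (h2 : RtoC 2 <> RtoC 0) by (intros E'; apply RtoC_inj in E'; lra).
rewrite RtoC_mult. field. repeat split; auto using Ci_nz.
Qed.

(* Let [G = b^-t m] and [n = t + s]. The moments make [Phi (b^n G) - b^n Phi G]
   a constant [c], so the lower boundary value [Q] of [Phi (b^n G)] satisfies
   [Q - c = b^n (Phi G)^-]; the solution is [yp = (Phi G)^+], [ym = c - Q]. *)
Lemma scalar_bvp nu (t s : nat) : 0 < nu < 1 -> exists Cst, 0 <= Cst /\ forall m K, LH nu K m ->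
  (forall j, (1 <= j < t + s)%nat ->
    IR (fun x => bp (RtoC x) ^ j * (bm (RtoC x) ^ t * m x) * wt x)%C (RtoC 0)) ->
  exists yp ym, plus_fn yp /\ minus_fn ym /\
    (forall z : C, 0 <= snd z -> Cmod (yp z) <= Cst * K) /\
    (forall z : C, snd z <= 0 -> Cmod (ym z) <= Cst * K) /\
    forall x, (ym (RtoC x) * bm (RtoC x) ^ s + bp (RtoC x) ^ t * yp (RtoC x))%C = m x.
Proof.
(* Each multiplication by [b] or its inverse costs a factor 24 in the Hoelder constant, 3 from the
   product and 8 from [b]. It takes [t] of them to reach [G] and [n] more to reach [b^n G]. *)
intros hn. set (n := (t + s)%nat). set (L := 24 ^ n * 24 ^ t).
assert (P0 : 0 <= Plemelj_const nu).
{ unfold Plemelj_const. assert (0 <= 12 / nu) by (apply Rdiv_le_0_compat; lra).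
  assert (0 <= 2 / nu) by (apply Rdiv_le_0_compat; lra). assert (0 <= 8 / (1 - nu)) by (apply Rdiv_le_0_compat; lra).
  assert (0 <= (2 / nu + 2) * (8 / (1 - nu))) by (apply Rmult_le_pos; lra). lra. }
assert (hpow : forall k, 1 <= 24 ^ k) by (intros; apply pow_R1_Rle; lra).
assert (hL : 24 ^ t <= L) by (unfold L; generalize (hpow n) (hpow t); intros; nra).
exists ((Plemelj_const nu + 16) * L). split.
{ apply Rmult_le_pos; [lra|]. generalize (hpow t); lra. }
intros m K Hm Hmom.
assert (hK : 0 <= K) by apply Hm.
assert (HG := LH_pow_mult nu _ m K t (LH_bm nu hn) Hm).
set (G := fun x => (bm (RtoC x) ^ t * m x)%C) in *.
assert (HGn := fun j => LH_pow_mult nu _ G _ j (LH_bp nu hn) HG).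
set (Gj := fun j x => (bp (RtoC x) ^ j * G x)%C).
change (forall j, LH nu (24 ^ j * (24 ^ t * K)) (Gj j)) in HGn.
assert (cG : forall j, contR (Gj j)) by (intros j; eapply LH_contR; [|apply HGn]; lra).
assert (bG : forall j x, Cmod (Gj j x) <= 24 ^ j * (24 ^ t * K)) by (intros j; apply HGn).
assert (rec : forall j z, snd z <> 0 -> (z + Ci)%C <> RtoC 0 ->
  Phi (Gj (S j)) z = (bp z * Phi (Gj j) z + Ival (fun x => Gj (S j) x * wt x)%C / RtoC PI)%C).
{ intros j z h1 h2.
  assert (E : Gj (S j) = (fun x => bp (RtoC x) * Gj j x)%C).
  { apply functional_extensionality. intros x. unfold Gj. rewrite Cpow_S. ring. }
  rewrite E. apply (Phi_mult_b (Gj j) _ z (cG j) (bG j) h1 h2). }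
(* The moments of orders 1 to [n - 1] vanish, so these powers commute with [Phi] exactly; the
   alternative [j = 0] is there for [n = 0]. *)
assert (low : forall j z, (j < n)%nat \/ j = 0%nat -> snd z <> 0 -> (z + Ci)%C <> RtoC 0 -> Phi (Gj j) z = (bp z ^ j * Phi G z)%C).
{ induction j as [|j IH]; intros z hj h1 h2.
  - replace (Gj 0%nat) with G; [ring|]. apply functional_extensionality. intros x. unfold Gj. ring.
  - rewrite rec, IH, Cpow_S by (auto; lia). rewrite (Ival_unique _ (RtoC 0)).
    + unfold Cdiv. ring.
    + apply Hmom. lia. }
(* The moment of order [n] is not assumed to vanish and supplies the constant. For [n = 0] no
   multiplication takes place, so the constant is 0. *)
set (c := match n with O => RtoC 0 | S _ => (Ival (fun x => Gj n x * wt x)%C / RtoC PI)%C end).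
assert (top : forall z, snd z <> 0 -> (z + Ci)%C <> RtoC 0 -> Phi (Gj n) z = (bp z ^ n * Phi G z + c)%C).
{ intros z h1 h2. unfold c. destruct n as [|k] eqn:En.
  - rewrite low by auto. ring.
  - rewrite rec, low by (auto; lia). rewrite Cpow_S. ring. }
assert (hLK : 24 ^ n * (24 ^ t * K) = L * K) by (unfold L; ring).
assert (hLK0 : 0 <= L * K) by (apply Rmult_le_pos; auto; generalize (hpow t); lra).
assert (hc : Cmod c <= 16 * (L * K)).
{ unfold c. destruct n as [|k] eqn:En; [rewrite Cmod_0; lra|]. rewrite <- En in *.
  assert (hpi : 3 < PI) by (generalize PI2_3_2; lra).
  rewrite Cmod_div, Cmod_R, Rabs_pos_eq by (try lra; intros E; apply RtoC_inj in E; lra).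
  apply Rle_div_l; [lra|]. assert (q := Ival_wt_bound _ _ (cG n) (bG n)). rewrite hLK in q.
  eapply Rle_trans; [exact q|]. rewrite <- (Rmult_1_r (16 * (L * K))) at 1. apply Rmult_le_compat_l; lra. }
destruct (Plemelj_decomposition G nu _ hn HG) as (P1 & Q1 & a1 & a2 & a3 & a4 & a5 & a6).
destruct (Plemelj_decomposition (Gj n) nu _ hn (HGn n)) as (P2 & Q2 & b1 & b2 & b3 & b4 & b5 & b6).
(* [top] holds off the real line; the boundary is reached along [x - i d], where both Cauchy
   integrals tend to their lower boundary values. *)
assert (key : forall x, Q2 (RtoC x) = (bp (RtoC x) ^ n * Q1 (RtoC x) + c)%C).
{ intros x. apply Ceq_minus, Cmod_small_0. intros e he.
  set (M := Cmod (Q1 (RtoC x)) + 1). assert (hM : 1 <= M) by (unfold M; generalize (Cmod_ge_0 (Q1 (RtoC x))); lra).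
  assert (hb : forall k, tends (nb everywhere (RtoC x)) (fun z => bp z ^ k)%C (bp (RtoC x) ^ k)%C).
  { intros k. apply tends_pow; [apply nb_filter|]. apply tends_div; [apply nb_filter|apply plus_Ci_neq| |].
    - apply tends_minus; [apply nb_filter|apply tends_nb_id|apply tends_const, nb_filter].
    - apply tends_plus; [apply nb_filter|apply tends_nb_id|apply tends_const, nb_filter]. }
  assert (b1x : forall k, Cmod (bp (RtoC x) ^ k) = 1).
  { intros k. rewrite Cmod_pow, <- bfun_bp, Cmod_b, pow1. reflexivity. }
  destruct (hb n (Rmin 1 (e / (4 * M)))) as [d1 [h1 H1]].
  { apply Rmin_pos; [lra|]. apply Rdiv_lt_0_compat; lra. }
  destruct (a6 x (Rmin 1 (e / 4))) as [d2 [h2 H2]]; [apply Rmin_pos; lra|].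
  destruct (b6 x (e / 4)) as [d3 [h3 H3]]; [lra|].
  (* The entry [/ 2] keeps the path away from [- i], the pole of [b]. *)
  set (d := Rmin (Rmin (d1 / 2) (d2 / 2)) (Rmin (d3 / 2) (/ 2))).
  assert (hd : 0 < d) by (unfold d; repeat apply Rmin_pos; lra).
  assert (hd1 : d <= d1 / 2) by (eapply Rle_trans; apply Rmin_l).
  assert (hd2 : d <= d2 / 2) by (eapply Rle_trans; [apply Rmin_l|apply Rmin_r]).
  assert (hd3 : d <= d3 / 2) by (eapply Rle_trans; [apply Rmin_r|apply Rmin_l]).
  assert (hd4 : d <= / 2) by (eapply Rle_trans; [apply Rmin_r|apply Rmin_r]).
  set (z := ((x, (- d)%R) : C)).
  assert (hz1 : snd z <> 0) by (simpl; lra).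
  assert (hz2 : (z + Ci)%C <> RtoC 0) by (intros E; apply (f_equal snd) in E; simpl in E; lra).
  assert (T := top z hz1 hz2).
  assert (k1 := H1 z I). cbv beta in k1. assert (k2 := H2 d ltac:(lra)). assert (k3 := H3 d ltac:(lra)).
  fold z in k2, k3.
  assert (k0 : Cmod (z - RtoC x) < d1).
  { replace (z - RtoC x)%C with (- (RtoC d * Ci))%C.
    - rewrite Cmod_opp, Cmod_mult, Cmod_Ci, Cmod_R, Rabs_pos_eq; lra.
    - unfold z, RtoC, Ci, Cminus, Cplus, Copp, Cmult. simpl. apply pair_eq; ring. }
  specialize (k1 k0).
  assert (k1a := Rlt_le_trans _ _ _ k1 (Rmin_l _ _)). assert (k1b := Rlt_le_trans _ _ _ k1 (Rmin_r _ _)).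
  assert (k2a := Rlt_le_trans _ _ _ k2 (Rmin_l _ _)). assert (k2b := Rlt_le_trans _ _ _ k2 (Rmin_r _ _)).
  replace (Q2 (RtoC x) - (bp (RtoC x) ^ n * Q1 (RtoC x) + c))%C with
    (bp (RtoC x) ^ n * (Phi G z - Q1 (RtoC x)) + (bp z ^ n - bp (RtoC x) ^ n) * Phi G z - (Phi (Gj n) z - Q2 (RtoC x)))%C
    by (rewrite T; ring).
  assert (hPG : Cmod (Phi G z) <= M).
  { assert (q := Cmod_triangle_rev (Phi G z) (Q1 (RtoC x))). unfold M. lra. }
  eapply Rle_trans; [apply Cmod_triangle_minus|].
  eapply Rle_trans; [apply Rplus_le_compat_r, Cmod_triangle|].
  rewrite !Cmod_mult, b1x.
  assert (Cmod (bp z ^ n - bp (RtoC x) ^ n) * Cmod (Phi G z) <= e / 4).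
  { apply Rle_trans with (e / (4 * M) * M).
    - apply Rmult_le_compat; auto using Cmod_ge_0. lra.
    - right. field. lra. }
  lra. }
exists P1, (fun z => - RtoC 1 * Q2 z + c)%C.
split; auto. split.
{ apply minus_fn_plus; [|apply minus_fn_const]. apply minus_fn_mult; [apply minus_fn_const|auto]. }
split; [|split].
- intros z hz. eapply Rle_trans; [apply a3; auto|].
  rewrite <- Rmult_assoc. apply Rmult_le_compat_r; auto. apply Rmult_le_compat; lra || auto. generalize (hpow t); lra.
- intros z hz. eapply Rle_trans; [apply Cmod_triangle|].
  replace (- RtoC 1 * Q2 z)%C with (- Q2 z)%C by ring. rewrite Cmod_opp.
  assert (q := b4 z hz). rewrite hLK in q. lra.
- intros x. rewrite key. assert (E1 := a5 x). assert (E2 := bp_bm x).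
  assert (E3 : forall k, (bp (RtoC x) ^ k * bm (RtoC x) ^ k)%C = RtoC 1).
  { intros k. rewrite <- Cpow_mult_l, E2. apply Cpow_1_l. }
  unfold n. rewrite Cpow_add_r.
  replace (- RtoC 1 * (bp (RtoC x) ^ t * bp (RtoC x) ^ s * Q1 (RtoC x) + c) + c)%C
    with (- (bp (RtoC x) ^ t * bp (RtoC x) ^ s * Q1 (RtoC x)))%C by ring.
  transitivity (bp (RtoC x) ^ t * (P1 (RtoC x) - Q1 (RtoC x) * (bp (RtoC x) ^ s * bm (RtoC x) ^ s)))%C; [ring|].
  rewrite E3, Cmult_1_r, E1. unfold G. rewrite Cmult_assoc, E3. ring.
Qed.

(** * Moment conditions *)

Lemma improper_int_IR f L : contR f -> improper_int f L <-> IR f L.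
Proof.
intros Hf.
assert (e1 : forall a b, ex_RInt (fun t => fst (f t)) a b).
{ intros. apply ex_RInt_cont. intros t. apply tends_continuous_fst, Hf. }
assert (e2 : forall a b, ex_RInt (fun t => snd (f t)) a b).
{ intros. apply ex_RInt_cont. intros t. apply tends_continuous_snd, Hf. }
split.
- intros [[_ H1] [_ H2]] e he.
  destruct (H1 (e / 2)) as [A1 K1]; [lra|]. destruct (H2 (e / 2)) as [A2 K2]; [lra|].
  exists (Rmax 0 (Rmax A1 A2)). split; [apply Rmax_l|]. intros a b ha hb. simpl.
  assert (q1 := Rmax_r 0 (Rmax A1 A2)). assert (q2 := Rmax_l A1 A2). assert (q3 := Rmax_r A1 A2).
  specialize (K1 a b (ex_RInt_Reals_0 _ _ _ (e1 a b)) ltac:(lra) ltac:(lra)). rewrite <- RInt_Reals in K1.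
  specialize (K2 a b (ex_RInt_Reals_0 _ _ _ (e2 a b)) ltac:(lra) ltac:(lra)). rewrite <- RInt_Reals in K2.
  eapply Rle_lt_trans; [apply Cmod_le_sum|]. simpl. unfold Rminus in *. lra.
- intros H. split; (split; [intros a b; constructor; apply ex_RInt_Reals_0; auto|]);
    intros e he; destruct (H e he) as [A [hA K]]; exists A; intros a b pr ha hb;
    rewrite <- RInt_Reals; specialize (K a b ha hb); simpl in K.
  + exact (Rle_lt_trans _ _ _ (fst_le_Cmod (CInt f a b - L)%C) K).
  + exact (Rle_lt_trans _ _ _ (snd_le_Cmod (CInt f a b - L)%C) K).
Qed.

Lemma bpow_of_nat n z : bpow (Z.of_nat n) z = (bp z ^ n)%C.
Proof.
unfold bpow. rewrite (proj2 (Z.leb_le 0 (Z.of_nat n))) by lia. rewrite Nat2Z.id, Defs_Cpow, bfun_bp. reflexivity.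
Qed.

Lemma bpow_opp_nat n z : bpow (- Z.of_nat n) z = (bm z ^ n)%C.
Proof.
destruct n as [|n].
- exact (bpow_of_nat 0 z).
- unfold bpow. rewrite (proj2 (Z.leb_gt 0 (- Z.of_nat (S n)))) by lia.
  rewrite Z.opp_involutive, Nat2Z.id, Defs_Cpow, Defs_Cdiv. reflexivity.
Qed.

(** [Z.to_nat] sends negative integers to 0, so this is [max(k, 0)] as a natural number. *)
Definition posexp (k : Z) : nat := Z.to_nat k.
Definition negexp (k : Z) : nat := Z.to_nat (- k).

Lemma bpow_max k z : bpow (Z.max k 0) z = (bp z ^ posexp k)%C.
Proof. rewrite <- bpow_of_nat. f_equal. unfold posexp. lia. Qed.

Lemma bpow_opp_max k z : bpow (- Z.max k 0) z = (bm z ^ posexp k)%C.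
Proof. rewrite <- bpow_opp_nat. f_equal. unfold posexp. lia. Qed.

Lemma bpow_min k z : bpow (Z.min k 0) z = (bm z ^ negexp k)%C.
Proof. rewrite <- bpow_opp_nat. f_equal. unfold negexp. lia. Qed.

Lemma bpow_opp_min k z : bpow (- Z.min k 0) z = (bp z ^ negexp k)%C.
Proof. rewrite <- bpow_of_nat. f_equal. unfold negexp. lia. Qed.

Lemma bpow_split k z : bpow k z = (bp z ^ posexp k * bm z ^ negexp k)%C.
Proof.
destruct (Z_le_gt_dec 0 k) as [h|h].
- replace (negexp k) with 0%nat by (unfold negexp; lia). rewrite <- bpow_of_nat.
  replace (Z.of_nat (posexp k)) with k by (unfold posexp; lia). symmetry. apply Cmult_1_r.
- replace (posexp k) with 0%nat by (unfold posexp; lia). rewrite <- bpow_opp_nat.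
  replace (- Z.of_nat (negexp k))%Z with k by (unfold negexp; lia). symmetry. apply Cmult_1_l.
Qed.

(* Conditions (a)-(c) on a single entry [m_lj], where [t = max(kappa_l, 0)] and
   [s = max(- kappa_j, 0)]. *)
Definition moment_conds (m : R -> C) (t s : nat) : Prop :=
  (forall r, (1 <= r < t)%nat -> IR (fun x => m x / (RtoC x - Ci) ^ (r + 1))%C (RtoC 0)) /\
  (forall r, (1 <= r < s)%nat -> IR (fun x => m x / (RtoC x + Ci) ^ (r + 1))%C (RtoC 0)) /\
  ((0 < t)%nat -> (0 < s)%nat -> IR (fun x => m x / RtoC (x * x + 1))%C (RtoC 0)).

(** [g^(j+2) (g - 1)^q] is the sum of [g^(j+1) (g - 1)^q] and [g^(j+1) (g - 1)^(q+1)]. A power of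
    [g] is traded for a power of [g - 1], and [j + q + 2 <= T] is what both terms need. *)
Lemma power_sum_induction (m gam w : R -> C) T :
  contR m -> contR gam -> contR w ->
  (forall q, (q + 2 <= T)%nat -> IR (fun x => m x * (gam x * (gam x - 1) ^ q) * w x)%C (RtoC 0)) ->
  forall j q, (j + q + 2 <= T)%nat -> IR (fun x => m x * (gam x ^ S j * (gam x - 1) ^ q) * w x)%C (RtoC 0).
Proof.
intros Hm Hg Hw H0.
assert (Cj : forall j q, contR (fun x => m x * (gam x ^ j * (gam x - 1) ^ q) * w x)%C).
{ intros j q. apply contR_mult; auto. apply contR_mult; auto. apply contR_mult; [apply contR_pow; auto|].
  apply contR_pow. apply contR_minus; [auto|apply contR_const]. }
induction j as [|j IH]; intros q hq.
- generalize (H0 q ltac:(lia)). apply IR_ext. intros x. rewrite Cpow_1_r. reflexivity.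
- replace (RtoC 0) with (RtoC 0 + RtoC 0)%C by ring.
  generalize (IR_plus _ _ _ _ (Cj _ _) (Cj _ _) (IH q ltac:(lia)) (IH (S q) ltac:(lia))).
  apply IR_ext. intros x. cbv beta. rewrite (Cpow_S (gam x) (S j)), (Cpow_S (gam x - 1)). ring.
Qed.

(* [b^-1 - 1 = 2 i / (x - i)] turns the pole integrals into integrals of
   [b^-1 (b^-1 - 1)^q]; the induction passes to powers of [b^-1]. *)
Lemma moments_of_poles m T : contR m ->
  (forall r, (1 <= r < T)%nat -> IR (fun x => m x / (RtoC x - Ci) ^ (r + 1))%C (RtoC 0)) ->
  forall k, (1 <= k < T)%nat -> IR (fun x => bm (RtoC x) ^ k * m x * wt x)%C (RtoC 0).
Proof.
intros Hm H k hk. destruct k as [|k]; [lia|].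
assert (cp : forall r, contR (fun x => m x / (RtoC x - Ci) ^ r)%C).
{ intros r. apply contR_div; auto.
  - intros x. apply Cpow_nz, minus_Ci_neq.
  - apply contR_pow, contR_sub_const. }
assert (P := power_sum_induction m (fun x => bm (RtoC x)) wt T Hm contR_bm contR_wt).
generalize (fun h => P h k 0%nat ltac:(lia)). clear P. intros P.
(* Since [b^-1 wt = 1 / (x - i)^2], this integral is [(2 i)^q] times the pole integral with
   [r = q + 1]. *)
assert (Q : forall q : nat, (q + 2 <= T)%nat -> IR (fun x : R => (m x * (bm (RtoC x) * (bm (RtoC x) - 1) ^ q) * wt x)%C) (RtoC 0)).
{ intros q hq. replace (RtoC 0) with ((RtoC 2 * Ci) ^ q * RtoC 0)%C by ring.
  generalize (IR_scal _ ((RtoC 2 * Ci) ^ q)%C _ (cp _) (H (S q) ltac:(lia))). apply IR_ext. intros x.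
  assert (n1 := minus_Ci_neq x). assert (n2 := plus_Ci_neq x).
  replace (bm (RtoC x) - 1)%C with ((RtoC 2 * Ci) * / (RtoC x - Ci))%C.
  2: { unfold bm. transitivity ((Ci + Ci) / (RtoC x - Ci))%C; [|field; auto].
       replace (Ci + Ci)%C with (RtoC 2 * Ci)%C; [reflexivity|].
       unfold RtoC, Ci, Cplus, Cmult; simpl; apply pair_eq; ring. }
  rewrite (Cpow_mult_l (RtoC 2 * Ci)), Cpow_inv by auto. replace (S q + 1)%nat with (S (S q)) by lia. rewrite !Cpow_S.
  assert (n3 : ((RtoC x - Ci) ^ q)%C <> RtoC 0) by (apply Cpow_nz; auto).
  unfold bm, wt. replace (RtoC x - - Ci)%C with (RtoC x + Ci)%C by ring. field. auto. }
generalize (P Q). apply IR_ext. intros x. ring.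
Qed.

Lemma wt_opp t : wt (- t) = wt t.
Proof. rewrite !wt_eq. f_equal. f_equal. ring. Qed.

Lemma inv_pow_opp (x : R) r : ((RtoC (- x)%R - Ci) ^ r = (- RtoC 1) ^ r * (RtoC x + Ci) ^ r)%C.
Proof. rewrite <- Cpow_mult_l. f_equal. rewrite RtoC_opp. ring. Qed.

Lemma opp_one_neq : (- RtoC 1)%C <> RtoC 0.
Proof. apply Cmod_gt_0. rewrite Cmod_opp, Cmod_1. lra. Qed.

Lemma pole_reflect m r : contR m ->
  IR (fun x => m x / (RtoC x + Ci) ^ r)%C (RtoC 0) <-> IR (fun x => m (- x)%R / (RtoC x - Ci) ^ r)%C (RtoC 0).
Proof.
intros Hm.
assert (n0 : ((- RtoC 1) ^ r)%C <> RtoC 0) by (apply Cpow_nz, opp_one_neq).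
assert (c1 : contR (fun x => m x / (RtoC x + Ci) ^ r)%C).
{ apply contR_div; auto.
  - intros x. apply Cpow_nz, plus_Ci_neq.
  - apply contR_pow, contR_plus; [apply contR_RtoC|apply contR_const]. }
assert (c2 : contR (fun x => m (- x)%R / (RtoC x - Ci) ^ r)%C).
{ apply contR_div.
  - intros x. apply Cpow_nz, minus_Ci_neq.
  - apply contR_opp_arg; auto.
  - apply contR_pow, contR_sub_const. }
split; intros H.
- replace (RtoC 0) with (/ (- RtoC 1) ^ r * RtoC 0)%C by ring.
  generalize (IR_scal _ (/ (- RtoC 1) ^ r)%C _ (contR_opp_arg _ c1) (IR_opp_arg _ _ c1 H)).
  apply IR_ext. intros x. cbv beta.
  replace (RtoC x - Ci)%C with (RtoC (- - x)%R - Ci)%C by (rewrite Ropp_involutive; reflexivity).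
  rewrite (inv_pow_opp (- x)).
  assert (n1 : ((RtoC (- x)%R + Ci) ^ r)%C <> RtoC 0) by (apply Cpow_nz, plus_Ci_neq).
  field. auto.
- replace (RtoC 0) with ((- RtoC 1) ^ r * RtoC 0)%C by ring.
  generalize (IR_scal _ ((- RtoC 1) ^ r)%C _ (contR_opp_arg _ c2) (IR_opp_arg _ _ c2 H)).
  apply IR_ext. intros x. cbv beta. rewrite Ropp_involutive, inv_pow_opp.
  assert (n1 : ((RtoC x + Ci) ^ r)%C <> RtoC 0) by (apply Cpow_nz, plus_Ci_neq).
  field. auto.
Qed.

Lemma moments_of_poles_lower m T : contR m ->
  (forall r, (1 <= r < T)%nat -> IR (fun x => m x / (RtoC x + Ci) ^ (r + 1))%C (RtoC 0)) ->
  forall k, (1 <= k < T)%nat -> IR (fun x => bp (RtoC x) ^ k * m x * wt x)%C (RtoC 0).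
Proof.
intros Hm H k hk.
assert (Hm' : contR (fun x => m (- x))) by (apply contR_opp_arg; auto).
assert (P := moments_of_poles (fun x => m (- x)) T Hm' (fun r hr => proj1 (pole_reflect m (r + 1) Hm) (H r hr)) k hk).
apply IR_opp_arg in P.
- revert P. apply IR_ext. intros x. rewrite wt_opp, Ropp_involutive, RtoC_opp, bm_opp. reflexivity.
- apply contR_mult; [apply contR_mult; auto|apply contR_wt]. apply contR_pow, contR_bm.
Qed.

(** [b^j b^-t] is a negative power of [b] for [j < t], equals 1 for [j = t], and is a positive power
    for [j > t]. These cases are governed by conditions (a), (c) and (b) respectively. *)
Lemma moment_conds_sufficient m t s : contR m -> moment_conds m t s ->
  forall j, (1 <= j < t + s)%nat -> IR (fun x => bp (RtoC x) ^ j * (bm (RtoC x) ^ t * m x) * wt x)%C (RtoC 0).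
Proof.
intros Hm (Ha & Hb & Hc) j hj.
assert (E3 : forall k x, (bp (RtoC x) ^ k * bm (RtoC x) ^ k)%C = RtoC 1).
{ intros k x. rewrite <- Cpow_mult_l, bp_bm. apply Cpow_1_l. }
destruct (lt_eq_lt_dec j t) as [[h|h]|h].
- generalize (moments_of_poles m t Hm Ha (t - j) ltac:(lia)). apply IR_ext. intros x.
  replace t with (j + (t - j))%nat at 2 by lia. rewrite Cpow_add_r.
  transitivity (bp (RtoC x) ^ j * bm (RtoC x) ^ j * (bm (RtoC x) ^ (t - j) * m x * wt x))%C; [rewrite E3|]; ring.
- subst j. generalize (Hc ltac:(lia) ltac:(lia)). apply IR_ext. intros x.
  rewrite wt_eq, Cmult_assoc, E3. unfold Cdiv. ring.
- generalize (moments_of_poles_lower m s Hm Hb (j - t) ltac:(lia)). apply IR_ext. intros x.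
  replace j with (t + (j - t))%nat at 2 by lia. rewrite Cpow_add_r.
  transitivity (bp (RtoC x) ^ t * bm (RtoC x) ^ t * (bp (RtoC x) ^ (j - t) * m x * wt x))%C; [rewrite E3|]; ring.
Qed.

Lemma sqinv_Ci x : sqinv Ci x = (/ (RtoC x - Ci) * / (RtoC x - Ci))%C.
Proof. assert (n := minus_Ci_neq x). unfold sqinv. field. auto. Qed.

Lemma sqinv_opp_Ci x : sqinv (- Ci) x = (/ (RtoC x + Ci) * / (RtoC x + Ci))%C.
Proof. assert (n := plus_Ci_neq x). unfold sqinv. replace (RtoC x - - Ci)%C with (RtoC x + Ci)%C by ring. field. auto. Qed.

(** Divided by [(x - i)^(r + 1)], the first term is regular below. In the second, [b^(r + 1)]
    cancels the pole and leaves [b^(t - r - 1) / (x + i)^(r + 1)], regular above exactly because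
    [r < t]. In both, a squared factor provides the decay, and [r >= 1] makes it available. *)
Lemma pole_necessity m yp ym t s r : plus_fn yp -> minus_fn ym ->
  (forall x, m x = (ym (RtoC x) * bm (RtoC x) ^ s + bp (RtoC x) ^ t * yp (RtoC x))%C) ->
  (1 <= r < t)%nat -> IR (fun x => m x / (RtoC x - Ci) ^ (r + 1))%C (RtoC 0).
Proof.
intros Hp Hm E hr.
set (u := fun z => (yp z * (bp z ^ (t - r - 1) * (/ (z + Ci)) ^ (r - 1)))%C).
set (v := fun z => (ym z * (bm z ^ s * (/ (z - Ci)) ^ (r - 1)))%C).
assert (Hu : plus_fn u).
{ apply plus_fn_mult; auto. apply plus_fn_mult; apply plus_fn_pow; [apply plus_fn_bp|apply plus_fn_inv]. }
assert (Hv : minus_fn v).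
{ apply minus_fn_mult; auto. apply minus_fn_mult; apply minus_fn_pow; [apply minus_fn_bm|apply minus_fn_inv]. }
assert (I1 := plus_fn_sqinv_lower u (- Ci)%C Hu ltac:(simpl; lra)).
assert (I2 := minus_fn_sqinv_upper v Ci Hv ltac:(simpl; lra)).
assert (C1 : contR (fun x => u (RtoC x) * sqinv (- Ci) x)%C).
{ apply contR_mult; [apply plus_fn_contR; auto|apply contR_sqinv, snd_opp_Ci_neq]. }
assert (C2 : contR (fun x => v (RtoC x) * sqinv Ci x)%C).
{ apply contR_mult; [apply minus_fn_contR; auto|apply contR_sqinv, snd_Ci_neq]. }
replace (RtoC 0) with (RtoC 0 + RtoC 0)%C by ring.
generalize (IR_plus _ _ _ _ C1 C2 I1 I2). apply IR_ext. intros x. cbv beta.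
rewrite E, sqinv_Ci, sqinv_opp_Ci. unfold u, v.
assert (n1 := minus_Ci_neq x). assert (n2 := plus_Ci_neq x).
rewrite !Cpow_inv by auto.
replace (r + 1)%nat with (S (S (r - 1))) by lia.
replace t with ((t - r - 1) + S (S (r - 1)))%nat at 2 by lia.
rewrite Cpow_add_r. rewrite (Cpow_S (RtoC x - Ci)), (Cpow_S (RtoC x - Ci)).
rewrite (Cpow_S (bp (RtoC x))), (Cpow_S (bp (RtoC x))).
assert (n3 : ((RtoC x - Ci) ^ (r - 1))%C <> RtoC 0) by (apply Cpow_nz; auto).
assert (n4 : ((RtoC x + Ci) ^ (r - 1))%C <> RtoC 0) by (apply Cpow_nz; auto).
assert (Eb : (bp (RtoC x) ^ (r - 1) = (RtoC x - Ci) ^ (r - 1) / (RtoC x + Ci) ^ (r - 1))%C).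
{ unfold bp, Cdiv. rewrite Cpow_mult_l, Cpow_inv by auto. reflexivity. }
rewrite Eb. set (w1 := (bp (RtoC x) ^ (t - r - 1))%C). set (w2 := (bm (RtoC x) ^ s)%C).
set (w3 := ((RtoC x - Ci) ^ (r - 1))%C) in *. set (w4 := ((RtoC x + Ci) ^ (r - 1))%C) in *.
unfold bp. field. auto.
Qed.

(** (b) is (a) for the reflected problem, in which the two half planes and the exponents [t] and [s]
    change places. *)
Lemma moment_conds_necessary m yp ym t s : contR m -> plus_fn yp -> minus_fn ym ->
  (forall x, m x = (ym (RtoC x) * bm (RtoC x) ^ s + bp (RtoC x) ^ t * yp (RtoC x))%C) ->
  moment_conds m t s.
Proof.
intros Cm Hp Hm E. split; [|split].
- intros k hk. apply (pole_necessity m yp ym t s k); auto.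
- intros k hk. apply pole_reflect; auto.
  apply (pole_necessity (fun x => m (- x)) (fun z => ym (- z)%C) (fun z => yp (- z)%C) s t k); auto.
  + apply (proj1 (minus_fn_opp_arg yp)). auto.
  + intros x. rewrite E, RtoC_opp, bm_opp, bp_opp. ring.
(* [b wt = 1 / (x + i)^2] and [b^-1 wt = 1 / (x - i)^2]: one power of [b] on each side moves the
   pole of the weight out of the half plane in question, hence both exponents must be positive. *)
- intros ht hs. destruct t as [|t]; [lia|]. destruct s as [|s]; [lia|].
  set (u := fun z => (yp z * bp z ^ t)%C). set (v := fun z => (ym z * bm z ^ s)%C).
  assert (Hu : plus_fn u) by (apply plus_fn_mult; auto; apply plus_fn_pow, plus_fn_bp).
  assert (Hv : minus_fn v) by (apply minus_fn_mult; auto; apply minus_fn_pow, minus_fn_bm).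
  assert (I1 := plus_fn_sqinv_lower u (- Ci)%C Hu ltac:(simpl; lra)).
  assert (I2 := minus_fn_sqinv_upper v Ci Hv ltac:(simpl; lra)).
  assert (C1 : contR (fun x => u (RtoC x) * sqinv (- Ci) x)%C).
  { apply contR_mult; [apply plus_fn_contR; auto|apply contR_sqinv, snd_opp_Ci_neq]. }
  assert (C2 : contR (fun x => v (RtoC x) * sqinv Ci x)%C).
  { apply contR_mult; [apply minus_fn_contR; auto|apply contR_sqinv, snd_Ci_neq]. }
  replace (RtoC 0) with (RtoC 0 + RtoC 0)%C by ring.
  generalize (IR_plus _ _ _ _ C1 C2 I1 I2). apply IR_ext. intros x. cbv beta.
  assert (n1 := minus_Ci_neq x). assert (n2 := plus_Ci_neq x).
  unfold Cdiv. rewrite <- wt_eq, E, sqinv_Ci, sqinv_opp_Ci, !Cpow_S. unfold u, v, wt.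
  set (w1 := (bp (RtoC x) ^ t)%C). set (w2 := (bm (RtoC x) ^ s)%C).
  replace (RtoC x - - Ci)%C with (RtoC x + Ci)%C by ring. unfold bp, bm. field. auto.
Qed.

(** [r <= kappa l - 1] becomes [r < t] with natural [t], a range that is empty unless
    [2 <= kappa l]. Continuity of the entries provides the Riemann integrability contained in
    [improper_int]. *)
Lemma conds_abc_moments n kappa (M : R -> CMat) :
  (forall l j, (l < n)%nat -> (j < n)%nat -> contR (fun t => M t l j)) ->
  conds_abc n kappa M <->
  forall l j, (l < n)%nat -> (j < n)%nat -> moment_conds (fun t => M t l j) (posexp (kappa l)) (negexp (kappa j)).
Proof.
intros HM.
assert (Ea : forall (l j r : nat), (l < n)%nat -> (j < n)%nat ->
  (improper_int (fun t => Defs.Cdiv (M t l j) (Defs.Cpow (Csub (RtoC t) Ci) (r + 1))) C0 <->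
   IR (fun t => M t l j / (RtoC t - Ci) ^ (r + 1))%C (RtoC 0))).
{ intros l j r hl hj.
  replace (fun t => Defs.Cdiv (M t l j) (Defs.Cpow (Csub (RtoC t) Ci) (r + 1)))
    with (fun t => (M t l j : C) / (RtoC t - Ci) ^ (r + 1))%C.
  - apply improper_int_IR. apply contR_div; auto.
    + intros t. apply Cpow_nz, minus_Ci_neq.
    + apply contR_pow, contR_sub_const.
  - apply functional_extensionality. intros t. symmetry. exact (eq_trans (Defs_Cdiv _ _) (f_equal (Cdiv (M t l j)) (Defs_Cpow _ _))). }
assert (Eb : forall (l j r : nat), (l < n)%nat -> (j < n)%nat ->
  (improper_int (fun t => Defs.Cdiv (M t l j) (Defs.Cpow (Cadd (RtoC t) Ci) (r + 1))) C0 <->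
   IR (fun t => M t l j / (RtoC t + Ci) ^ (r + 1))%C (RtoC 0))).
{ intros l j r hl hj.
  replace (fun t => Defs.Cdiv (M t l j) (Defs.Cpow (Cadd (RtoC t) Ci) (r + 1)))
    with (fun t => (M t l j : C) / (RtoC t + Ci) ^ (r + 1))%C.
  - apply improper_int_IR. apply contR_div; auto.
    + intros t. apply Cpow_nz, plus_Ci_neq.
    + apply contR_pow, contR_plus; [apply contR_RtoC|apply contR_const].
  - apply functional_extensionality. intros t. symmetry. exact (eq_trans (Defs_Cdiv _ _) (f_equal (Cdiv (M t l j)) (Defs_Cpow _ _))). }
assert (Ec : forall (l j : nat), (l < n)%nat -> (j < n)%nat ->
  (improper_int (fun t => Defs.Cdiv (M t l j) (RtoC (t * t + 1))) C0 <->
   IR (fun t => M t l j / RtoC (t * t + 1))%C (RtoC 0))).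
{ intros l j hl hj.
  replace (fun t => Defs.Cdiv (M t l j) (RtoC (t * t + 1)))
    with (fun t => (M t l j : C) / RtoC (t * t + 1))%C.
  - apply improper_int_IR. apply (contR_ext (fun t => M t l j * wt t)%C).
    + intros t. rewrite wt_eq. reflexivity.
    + apply contR_mult; [auto|apply contR_wt].
  - apply functional_extensionality. intros t. symmetry. exact (Defs_Cdiv _ _). }
unfold conds_abc, moment_conds, posexp, negexp. split.
- intros (Ha & Hb & Hc) l j hl hj. split; [|split].
  + intros r hr. apply Ea; auto. apply (Ha l j hl hj); lia.
  + intros r hr. apply Eb; auto. apply (Hb l j hl hj); lia.
  + intros h1 h2. apply Ec; auto. apply (Hc l j hl hj); lia.
- intros H. split; [|split].
  + intros l j hl hj h1 h2 r h3 h4. destruct (H l j hl hj) as (Ha & _ & _).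
    exact (proj2 (Ea l j r hl hj) (Ha r ltac:(lia))).
  + intros l j hl hj h1 h2 r h3 h4. destruct (H l j hl hj) as (_ & Hb & _).
    exact (proj2 (Eb l j r hl hj) (Hb r ltac:(lia))).
  + intros l j hl hj h1 h2. destruct (H l j hl hj) as (_ & _ & Hc).
    exact (proj2 (Ec l j hl hj) (Hc ltac:(lia) ltac:(lia))).
Qed.

(** * Matrices *)

Lemma csum_swap (f : nat -> nat -> C) n m :
  csum (fun i => csum (fun j => f i j) m) n = csum (fun j => csum (fun i => f i j) n) m.
Proof.
induction n as [|n IH].
- induction m as [|m IHm]; [reflexivity|]. rewrite csum_S, <- IHm. symmetry. apply Cplus_0_l.
- rewrite csum_S, IH, <- csum_plus. reflexivity.
Qed.

Lemma csum_0 (f : nat -> C) n : (forall k, (k < n)%nat -> f k = RtoC 0) -> csum f n = RtoC 0.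
Proof.
induction n as [|n IH]; intros H; [reflexivity|]. rewrite csum_S, IH, H by auto. apply Cplus_0_l.
Qed.

Lemma csum_single (f : nat -> C) n i : (i < n)%nat -> (forall k, (k < n)%nat -> k <> i -> f k = RtoC 0) -> csum f n = f i.
Proof.
induction n as [|n IH]; intros hi H; [lia|]. rewrite csum_S.
destruct (Nat.eq_dec i n) as [->|h].
- rewrite csum_0; [apply Cplus_0_l|]. intros k hk. apply H; lia.
- rewrite IH, (H n); [apply Cplus_0_r|lia|lia|lia|]. intros k hk hki. apply H; lia.
Qed.

(** Matrices are functions on all pairs of naturals, of which only the leading block counts. With
    [meq] as a setoid equality, matrix identities are proved by rewriting. *)
Global Instance meq_equiv n : Equivalence (meq n).
Proof.
split.
- intros A i j _ _. reflexivity.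
- intros A B H i j hi hj. symmetry. auto.
- intros A B D H1 H2 i j hi hj. rewrite H1; auto.
Qed.

Lemma mmul_eq n (A B : CMat) i j : mmul n A B i j = csum (fun k => A i k * B k j)%C n.
Proof. reflexivity. Qed.

Global Instance mmul_proper n : Proper (meq n ==> meq n ==> meq n) (mmul n).
Proof.
intros A A' HA B B' HB i j hi hj. rewrite !mmul_eq. apply csum_ext. intros k hk.
rewrite HA, HB; auto.
Qed.

Global Instance madd_proper n : Proper (meq n ==> meq n ==> meq n) madd.
Proof. intros A A' HA B B' HB i j hi hj. unfold madd. rewrite HA, HB; auto. Qed.

Global Instance mscal_proper n r : Proper (meq n ==> meq n) (mscal r).
Proof. intros A A' HA i j hi hj. unfold mscal. rewrite HA; auto. Qed.

Lemma mmul_assoc n (A B D : CMat) : meq n (mmul n (mmul n A B) D) (mmul n A (mmul n B D)).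
Proof.
intros i j _ _. rewrite !mmul_eq.
transitivity (csum (fun k => csum (fun l => A i l * B l k * D k j)%C n) n).
- apply csum_ext. intros k _. rewrite mmul_eq. apply csum_mult_r.
- rewrite csum_swap. apply csum_ext. intros l _. rewrite mmul_eq, csum_mult_l. apply csum_ext. intros k _.
  symmetry. apply Cmult_assoc.
Qed.

Lemma mdiag_same d i : mdiag d i i = d i.
Proof. unfold mdiag. rewrite Nat.eqb_refl. reflexivity. Qed.

Lemma mdiag_diff d i j : i <> j -> mdiag d i j = RtoC 0.
Proof. intros h. unfold mdiag. rewrite (proj2 (Nat.eqb_neq i j) h). reflexivity. Qed.

Lemma mmul_diag_l n d (A : CMat) i j : (i < n)%nat -> mmul n (mdiag d) A i j = (d i * A i j)%C.
Proof.
intros hi. rewrite mmul_eq, (csum_single _ n i hi).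
- now rewrite mdiag_same.
- intros k _ hk. rewrite mdiag_diff by auto. apply Cmult_0_l.
Qed.

Lemma mmul_diag_r n d (A : CMat) i j : (j < n)%nat -> mmul n A (mdiag d) i j = (A i j * d j)%C.
Proof.
intros hj. rewrite mmul_eq, (csum_single _ n j hj).
- now rewrite mdiag_same.
- intros k _ hk. rewrite mdiag_diff by auto. apply Cmult_0_r.
Qed.

Lemma mmul_1_l n A : meq n (mmul n mid A) A.
Proof. intros i j hi _. unfold mid. rewrite mmul_diag_l by auto. apply Cmult_1_l. Qed.

Lemma mmul_1_r n A : meq n (mmul n A mid) A.
Proof. intros i j _ hj. unfold mid. rewrite mmul_diag_r by auto. apply Cmult_1_r. Qed.

Lemma mmul_madd_l n A B D : meq n (mmul n (madd A B) D) (madd (mmul n A D) (mmul n B D)).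
Proof.
intros i j _ _. unfold madd at 2. rewrite !mmul_eq. etransitivity; [|exact (csum_plus _ _ n)].
apply csum_ext. intros k _. apply Cmult_plus_distr_r.
Qed.

Lemma mmul_madd_r n A B D : meq n (mmul n D (madd A B)) (madd (mmul n D A) (mmul n D B)).
Proof.
intros i j _ _. unfold madd at 2. rewrite !mmul_eq. etransitivity; [|exact (csum_plus _ _ n)].
apply csum_ext. intros k _. apply Cmult_plus_distr_l.
Qed.

Lemma Cscal_eq r (z : C) : Cscal r z = (RtoC r * z)%C.
Proof. unfold Cscal, RtoC, Cmult. simpl. apply pair_eq; ring. Qed.

Lemma mscal_eq r A i j : mscal r A i j = (RtoC r * A i j)%C.
Proof. unfold mscal. apply Cscal_eq. Qed.

Lemma mmul_mscal_l n r A B : meq n (mmul n (mscal r A) B) (mscal r (mmul n A B)).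
Proof.
intros i j _ _. rewrite mscal_eq, !mmul_eq, csum_mult_l. apply csum_ext. intros k _. rewrite mscal_eq.
symmetry. apply Cmult_assoc.
Qed.

Lemma mmul_mscal_r n r A B : meq n (mmul n A (mscal r B)) (mscal r (mmul n A B)).
Proof.
intros i j _ _. rewrite mscal_eq, !mmul_eq, csum_mult_l. apply csum_ext. intros k _. rewrite mscal_eq. ring.
Qed.

Definition mbd (n : nat) (A : CMat) (K : R) : Prop :=
  forall i j, (i < n)%nat -> (j < n)%nat -> Cmod (A i j) <= K.

Lemma mnorm_le_mbd n A K : mnorm_le n A K <-> mbd n A K.
Proof. split; intros H i j hi hj; generalize (H i j hi hj); rewrite Defs_Cmod; auto. Qed.

Lemma mbd_mmul n A B a b : 0 <= a -> mbd n A a -> mbd n B b -> mbd n (mmul n A B) (INR n * (a * b)).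
Proof.
intros ha HA HB i j hi hj. rewrite mmul_eq. apply csum_bound. intros k hk. apply Cmod_mult_le; auto.
Qed.

Lemma mbd_meq n A B a : meq n A B -> mbd n A a -> mbd n B a.
Proof. intros E H i j hi hj. rewrite <- E; auto. Qed.

Lemma mbd_mid n : mbd n mid 1.
Proof.
intros i j _ _. destruct (Nat.eq_dec i j) as [->|h].
- unfold mid. rewrite mdiag_same. change (Cmod (RtoC 1) <= 1). rewrite Cmod_1. lra.
- unfold mid. rewrite mdiag_diff, Cmod_0 by auto. lra.
Qed.

Lemma mat_choice (P : nat -> nat -> C -> Prop) n :
  (forall i j, (i < n)%nat -> (j < n)%nat -> exists z, P i j z) ->
  exists X : CMat, forall i j, (i < n)%nat -> (j < n)%nat -> P i j (X i j).
Proof.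
intros H.
assert (H' : forall i j, exists z, (i < n)%nat -> (j < n)%nat -> P i j z).
{ intros i j. destruct (Nat.lt_ge_cases i n) as [hi|hi]; [|exists (RtoC 0); lia].
  destruct (Nat.lt_ge_cases j n) as [hj|hj]; [|exists (RtoC 0); lia].
  destruct (H i j hi hj) as [z hz]. exists z; auto. }
exists (fun i j => proj1_sig (constructive_indefinite_description _ (H' i j))).
intros i j. apply proj2_sig.
Qed.

(** Horner form of the alternating series of powers of [A]: the recursion [X = I - A X] has the
    inverse of [I + A] as its fixed point. *)
Fixpoint neumann (n : nat) (A : CMat) (k : nat) : CMat :=
  match k with
  | O => mid
  | S k' => madd mid (mscal (-1) (mmul n A (neumann n A k')))
  end.

Section Neumann.
Variables (n : nat) (A : CMat) (d : R).
Hypothesis d_pos : 0 <= d.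
Hypothesis A_bound : mbd n A d.
Hypothesis d_small : INR n * d <= 1 / 2.

Lemma neumann_S k i j : neumann n A (S k) i j = (mid i j - csum (fun l => A i l * neumann n A k l j) n)%C.
Proof.
simpl. unfold madd. rewrite mscal_eq, mmul_eq.
change (mid i j + RtoC (-1) * csum (fun l => A i l * neumann n A k l j)%C n =
  mid i j - csum (fun l => A i l * neumann n A k l j)%C n)%C.
change (RtoC (-1)) with (RtoC (- (1))). rewrite RtoC_opp. ring.
Qed.

(** The smallness [n d <= 1 / 2] makes left multiplication by [A] halve every column in the maximum
    norm; all rates [(1 / 2)^k] below come from this. *)
Lemma csum_A_bound (u : nat -> C) i B : (i < n)%nat -> 0 <= B -> (forall l, (l < n)%nat -> Cmod (u l) <= B) ->
  Cmod (csum (fun l => A i l * u l)%C n) <= B / 2.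
Proof.
intros hi hB H. eapply Rle_trans; [apply (csum_bound _ n (d * B))|].
- intros l hl. apply Cmod_mult_le; auto.
- rewrite <- Rmult_assoc. apply Rle_trans with (1 / 2 * B); [|lra]. apply Rmult_le_compat_r; auto.
Qed.

Lemma neumann_bound k : mbd n (neumann n A k) 2.
Proof.
induction k as [|k IH]; intros i j hi hj.
- simpl. generalize (mbd_mid n i j hi hj). lra.
- rewrite neumann_S. eapply Rle_trans; [apply Cmod_triangle_minus|].
  assert (q := mbd_mid n i j hi hj).
  assert (q' := csum_A_bound (fun l => neumann n A k l j) i 2 hi ltac:(lra) (fun l hl => IH l j hl hj)). cbv beta in q'. lra.
Qed.

Lemma csum_minus (f g : nat -> C) : (csum f n - csum g n)%C = csum (fun k => f k - g k)%C n.
Proof.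
transitivity (csum f n + - RtoC 1 * csum g n)%C; [ring|].
rewrite csum_mult_l, <- csum_plus. apply csum_ext. intros; ring.
Qed.

Lemma neumann_step k i j : (i < n)%nat -> (j < n)%nat ->
  Cmod (neumann n A (S k) i j - neumann n A k i j) <= 2 * (1 / 2) ^ k.
Proof.
revert i j. induction k as [|k IH]; intros i j hi hj.
- rewrite neumann_S. simpl neumann.
  replace (mid i j - csum (fun l => A i l * mid l j) n - mid i j)%C with (- csum (fun l => A i l * mid l j) n)%C by ring.
  rewrite Cmod_opp.
  assert (q := csum_A_bound (fun l => mid l j) i 1 hi ltac:(lra) (fun l hl => mbd_mid n l j hl hj)). cbv beta in q.
  rewrite pow_O. lra.
- rewrite (neumann_S (S k)), (neumann_S k).
  assert (E : (mid i j - csum (fun l => A i l * neumann n A (S k) l j) n - (mid i j - csum (fun l => A i l * neumann n A k l j) n))%C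
    = (- csum (fun l => A i l * (neumann n A (S k) l j - neumann n A k l j)) n)%C).
  { transitivity (- (csum (fun l => A i l * neumann n A (S k) l j) n - csum (fun l => A i l * neumann n A k l j) n))%C; [ring|].
    rewrite csum_minus. f_equal. apply csum_ext. intros; ring. }
  rewrite E, Cmod_opp.
  eapply Rle_trans; [apply (csum_A_bound (fun l => (neumann n A (S k) l j - neumann n A k l j)%C) i (2 * (1 / 2) ^ k) hi)|].
  + apply Rmult_le_pos; [lra|]. apply pow_le; lra.
  + intros l hl. apply IH; auto.
  + simpl pow. lra.
Qed.

Lemma neumann_tail k p i j : (i < n)%nat -> (j < n)%nat ->
  Cmod (neumann n A (k + p) i j - neumann n A k i j) <= 4 * (1 / 2) ^ k.
Proof.
intros hi hj. apply Rle_trans with (4 * (1 / 2) ^ k * (1 - (1 / 2) ^ p)).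
- induction p as [|p IH].
  + rewrite Nat.add_0_r. replace (neumann n A k i j - neumann n A k i j)%C with (RtoC 0) by ring.
    rewrite Cmod_0, pow_O. lra.
  + rewrite Nat.add_succ_r. eapply Rle_trans; [apply (Cmod_triangle_sub _ (neumann n A (k + p) i j))|].
    assert (q := neumann_step (k + p) i j hi hj). rewrite pow_add in q. simpl pow. lra.
- assert (0 < (1 / 2) ^ k) by (apply pow_lt; lra). assert (0 < (1 / 2) ^ p) by (apply pow_lt; lra). nra.
Qed.

Lemma half_pow_small e : 0 < e -> exists N, forall k, (N <= k)%nat -> 4 * (1 / 2) ^ k < e.
Proof.
intros he. destruct (pow_lt_1_zero (1 / 2)) with (y := e / 4) as [N hN].
- rewrite Rabs_pos_eq; lra.
- lra.
- exists N. intros k hk. specialize (hN k hk). rewrite Rabs_pos_eq in hN; [lra|]. apply pow_le; lra.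
Qed.

(** The recursion yields a right inverse in the limit. It is also a left inverse because every
    partial sum commutes with [A], and hence so does the limit. *)
Lemma inverse_near_identity : exists X, mbd n X 2 /\
  meq n (mmul n (madd mid A) X) mid /\ meq n (mmul n X (madd mid A)) mid.
Proof.
destruct (mat_choice (fun i j z => forall k, Cmod (neumann n A k i j - z) <= 4 * (1 / 2) ^ k) n) as [X HX].
{ intros i j hi hj.
  destruct (C_complete (fun k => neumann n A k i j)) as [l hl].
  { intros e he. destruct (half_pow_small (e / 2)) as [N hN]; [lra|]. exists N. intros a b ha hb.
    assert (t1 := neumann_tail N (a - N) i j hi hj). assert (t2 := neumann_tail N (b - N) i j hi hj).
    replace (N + (a - N))%nat with a in t1 by lia. replace (N + (b - N))%nat with b in t2 by lia.
    rewrite Cmod_sub_sym in t2. specialize (hN N (Nat.le_refl N)).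
    assert (q := Cmod_triangle_sub (neumann n A a i j) (neumann n A N i j) (neumann n A b i j)). lra. }
  exists l. intros k. apply Rnot_lt_le. intros hlt.
  destruct (hl (Cmod (neumann n A k i j - l) - 4 * (1 / 2) ^ k)) as [N hN]; [lra|].
  assert (t1 := neumann_tail k N i j hi hj). specialize (hN (k + N)%nat ltac:(lia)). cbv beta in hN.
  rewrite Cmod_sub_sym in t1.
  assert (q := Cmod_triangle_sub (neumann n A k i j) (neumann n A (k + N) i j) l). lra. }
assert (R1 : meq n (mmul n (madd mid A) X) mid).
{ intros i j hi hj. apply Ceq_minus, Cmod_small_0. intros e he.
  destruct (half_pow_small (e / 2)) as [k hk]; [lra|].
  rewrite (mmul_madd_l n mid A X i j hi hj). unfold madd.
  rewrite (mmul_1_l n X i j hi hj), mmul_eq.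
  change (Cmod (X i j + csum (fun l => A i l * X l j) n - mid i j)%C <= e).
  assert (E := neumann_S k i j).
  replace (X i j + csum (fun l => A i l * X l j) n - mid i j)%C with
    (- (neumann n A (S k) i j - X i j) - csum (fun l => A i l * (neumann n A k l j - X l j)) n)%C.
  2: { rewrite E. replace (csum (fun l => A i l * (neumann n A k l j - X l j)) n)%C
         with (csum (fun l => A i l * neumann n A k l j) n - csum (fun l => A i l * X l j) n)%C.
       - ring.
       - rewrite csum_minus. apply csum_ext. intros; ring. }
  eapply Rle_trans; [apply Cmod_triangle_minus|]. rewrite Cmod_opp.
  assert (q1 := HX i j hi hj (S k)). specialize (hk k (Nat.le_refl k)).
  assert (hp : 0 < (1 / 2) ^ k) by (apply pow_lt; lra).
  assert (q2 := csum_A_bound (fun l => (neumann n A k l j - X l j)%C) i (4 * (1 / 2) ^ k) hi ltac:(lra)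
     (fun l hl => HX l j hl hj k)). cbv beta in q2. simpl pow in q1. lra. }
assert (cm : forall k, meq n (mmul n (neumann n A k) A) (mmul n A (neumann n A k))).
{ induction k as [|k IH].
  - simpl. rewrite mmul_1_l, mmul_1_r. reflexivity.
  - simpl. rewrite mmul_madd_l, mmul_madd_r, mmul_1_l, mmul_1_r, mmul_mscal_l, mmul_mscal_r, mmul_assoc, IH.
    reflexivity. }
assert (cX : meq n (mmul n X A) (mmul n A X)).
{ intros i j hi hj. apply Ceq_minus, Cmod_small_0. intros e he.
  set (B := INR n * (2 * d) + 1). assert (hB : 0 < B).
  { unfold B. assert (0 <= INR n * (2 * d)) by (apply Rmult_le_pos; [apply pos_INR|lra]). lra. }
  destruct (half_pow_small (e / B)) as [k hk]; [apply Rdiv_lt_0_compat; auto|].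
  specialize (hk k (Nat.le_refl k)). set (r := 4 * (1 / 2) ^ k) in *.
  assert (hr : 0 <= r) by (unfold r; apply Rmult_le_pos; [lra|apply pow_le; lra]).
  assert (E := cm k i j hi hj). rewrite !mmul_eq in *.
  replace (csum (fun k0 => X i k0 * A k0 j) n - csum (fun k0 => A i k0 * X k0 j) n)%C with
    (csum (fun l => A i l * (neumann n A k l j - X l j)) n - csum (fun l => (neumann n A k i l - X i l) * A l j) n)%C.
  2: { transitivity ((csum (fun l => A i l * neumann n A k l j) n - csum (fun l => A i l * X l j) n) -
         (csum (fun l => neumann n A k i l * A l j) n - csum (fun l => X i l * A l j) n))%C.
       - f_equal; rewrite csum_minus; apply csum_ext; intros; ring.
       - rewrite E. ring. }
  eapply Rle_trans; [apply Cmod_triangle_minus|].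
  apply Rle_trans with (INR n * (d * r) + INR n * (r * d)).
  - apply Rplus_le_compat; apply csum_bound; intros l hl; apply Cmod_mult_le; auto; apply HX; auto.
  - apply Rlt_div_r in hk; auto. unfold B in hk. nra. }
exists X. split; [|split]; auto.
- intros i j hi hj. apply Rnot_lt_le. intros hlt.
  destruct (half_pow_small (Cmod (X i j) - 2)) as [k hk]; [lra|]. specialize (hk k (Nat.le_refl k)).
  assert (q := HX i j hi hj k). rewrite Cmod_sub_sym in q. assert (q' := neumann_bound k i j hi hj).
  assert (q'' := Cmod_triangle_rev (X i j) (neumann n A k i j)). lra.
- rewrite mmul_madd_r, cX, mmul_1_r. rewrite <- (mmul_1_l n X) at 1. rewrite <- mmul_madd_l. exact R1.
Qed.

End Neumann.

(** * Matrix functions on a half plane *)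

(** Connects the definition by reflection with the direct conditions in [minus_class]. The
    derivative changes sign under the reflection, which does not matter for its existence. *)
Lemma minus_fn_iff (f : C -> C) : minus_fn f <->
  (forall z : C, snd z <= 0 -> tends (nb CLHP z) f (f z)) /\
  (exists K, forall z : C, snd z <= 0 -> Cmod (f z) <= K) /\
  (forall z : C, snd z < 0 -> exists l, Cder f z l).
Proof.
assert (oo : forall z : C, (- - z)%C = z) by (intros; ring).
assert (dist : forall w z : C, Cmod (- w - - z) = Cmod (w - z)).
{ intros w z. replace (- w - - z)%C with (- (w - z))%C by ring. apply Cmod_opp. }
split.
- intros (h1 & [K h2] & h3). split; [|split].
  + intros z hz e he. destruct (h1 (- z)%C ltac:(simpl; lra) e he) as [d [hd H]]. exists d. split; auto.
    intros w hw hwz. unfold CLHP, Defs.Im in hw. specialize (H (- w)%C). rewrite !oo in H. apply H.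
    * unfold CUHP, Defs.Im. simpl. lra.
    * rewrite dist. auto.
  + exists K. intros z hz. specialize (h2 (- z)%C). rewrite oo in h2. apply h2. simpl. lra.
  + intros z hz. destruct (h3 (- z)%C ltac:(simpl; lra)) as [l hl].
    exists (- l)%C. apply (Cder_ext (fun w => f (- - w)%C)).
    * apply filter_forall. intros w. rewrite oo. reflexivity.
    * apply (Cder_comp_opp (fun w => f (- w)%C)). exact hl.
- intros (h1 & [K h2] & h3). split; [|split].
  + intros z hz e he. destruct (h1 (- z)%C ltac:(simpl; lra) e he) as [d [hd H]]. exists d. split; auto.
    intros w hw hwz. unfold CUHP, Defs.Im in hw. apply H.
    * unfold CLHP, Defs.Im. simpl. lra.
    * rewrite dist. auto.
  + exists K. intros z hz. apply h2. simpl. lra.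
  + intros z hz. destruct (h3 (- z)%C ltac:(simpl; lra)) as [l hl]. exists (- l)%C. apply Cder_comp_opp. auto.
Qed.

Lemma uniform_entry_bound n (S : C -> Prop) (F : C -> CMat) :
  (forall i j, (i < n)%nat -> (j < n)%nat -> exists K, forall z, S z -> Cmod (F z i j) <= K) ->
  exists K, 0 <= K /\ forall z, S z -> mbd n (F z) K.
Proof.
intros H.
destruct (finite_bound (fun i K => forall j, (j < n)%nat -> forall z, S z -> Cmod (F z i j) <= K) n) as [K [hK HK]].
- intros i a b Ha hab j hj z hz. eapply Rle_trans; [apply Ha|]; auto.
- intros i hi.
  destruct (finite_bound (fun j K => forall z, S z -> Cmod (F z i j) <= K) n) as [K [hK HK]].
  + intros j a b Ha hab z hz. eapply Rle_trans; [apply Ha|]; auto.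
  + intros j hj. apply H; auto.
  + exists K. auto.
- exists K. split; auto. intros z hz i j hi hj. apply HK; auto.
Qed.

Lemma plus_class_entries n (F : C -> CMat) : plus_class n F <->
  forall i j, (i < n)%nat -> (j < n)%nat -> plus_fn (fun z => F z i j).
Proof.
split.
- intros (h1 & [K h2] & h3) i j hi hj. split; [|split].
  + exact (proj1 (cont_on_tends CUHP (fun z => F z i j)) (h1 i j hi hj)).
  + exists K. intros z hz. apply (mnorm_le_mbd n (F z) K); auto.
  + intros z hz. apply (Cdiff_at_Cder (fun z => F z i j)). exact (h3 i j hi hj z hz).
- intros H. split; [|split].
  + intros i j hi hj. apply (cont_on_tends CUHP (fun z => F z i j)). apply H; auto.
  + destruct (uniform_entry_bound n CUHP F) as [K [_ HK]].
    * intros i j hi hj. destruct (H i j hi hj) as (_ & [K q] & _). exists K. auto.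
    * exists K. intros z hz. apply mnorm_le_mbd. auto.
  + intros i j hi hj z hz. apply (Cdiff_at_Cder (fun z => F z i j)). apply H; auto.
Qed.

Lemma minus_class_entries n (F : C -> CMat) : minus_class n F <->
  forall i j, (i < n)%nat -> (j < n)%nat -> minus_fn (fun z => F z i j).
Proof.
split.
- intros (h1 & [K h2] & h3) i j hi hj. apply minus_fn_iff. split; [|split].
  + exact (proj1 (cont_on_tends CLHP (fun z => F z i j)) (h1 i j hi hj)).
  + exists K. intros z hz. apply (mnorm_le_mbd n (F z) K); auto.
  + intros z hz. apply (Cdiff_at_Cder (fun z => F z i j)). exact (h3 i j hi hj z hz).
- intros H. split; [|split].
  + intros i j hi hj. apply (cont_on_tends CLHP (fun z => F z i j)). apply (proj1 (minus_fn_iff _) (H i j hi hj)).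
  + destruct (uniform_entry_bound n CLHP F) as [K [_ HK]].
    * intros i j hi hj. destruct (proj1 (minus_fn_iff _) (H i j hi hj)) as (_ & [K q] & _). exists K. auto.
    * exists K. intros z hz. apply mnorm_le_mbd. auto.
  + intros i j hi hj z hz. apply (Cdiff_at_Cder (fun z => F z i j)). apply (proj1 (minus_fn_iff _) (H i j hi hj)). exact hz.
Qed.

Lemma minus_class_reflect n (F : C -> CMat) : minus_class n F <-> plus_class n (fun z => F (- z)%C).
Proof.
split; intros H.
- apply plus_class_entries. intros i j hi hj. apply (proj1 (minus_class_entries n F) H i j hi hj).
- apply minus_class_entries. intros i j hi hj. apply (proj1 (plus_class_entries n _) H i j hi hj).
Qed.

Lemma plus_fn_csum (f : nat -> C -> C) n : (forall k, (k < n)%nat -> plus_fn (f k)) -> plus_fn (fun z => csum (fun k => f k z) n).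
Proof.
induction n as [|n IH]; intros H; [exact (plus_fn_const (RtoC 0))|].
apply (plus_fn_ext (fun z => csum (fun k => f k z) n + f n z)%C); [reflexivity|]. apply plus_fn_plus; auto.
Qed.

Lemma plus_class_mmul n F G : plus_class n F -> plus_class n G -> plus_class n (fun z => mmul n (F z) (G z)).
Proof.
intros HF HG. apply plus_class_entries. intros i j hi hj.
apply (plus_fn_csum (fun k z => F z i k * G z k j)%C). intros k hk.
apply plus_fn_mult; [apply (proj1 (plus_class_entries n F) HF)|apply (proj1 (plus_class_entries n G) HG)]; auto.
Qed.

Lemma minus_class_mmul n F G : minus_class n F -> minus_class n G -> minus_class n (fun z => mmul n (F z) (G z)).
Proof.
intros HF HG. apply minus_class_reflect. apply minus_class_reflect in HF, HG.
exact (plus_class_mmul n _ _ HF HG).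
Qed.

Lemma plus_class_madd_mscal n F G e : plus_class n F -> plus_class n G -> plus_class n (fun z => madd (F z) (mscal e (G z))).
Proof.
intros HF HG. apply plus_class_entries. intros i j hi hj.
apply (plus_fn_ext (fun z => F z i j + RtoC e * G z i j)%C).
- intros z. unfold madd. rewrite mscal_eq. reflexivity.
- apply plus_fn_plus; [apply (proj1 (plus_class_entries n F) HF); auto|].
  apply plus_fn_mult; [apply plus_fn_const|apply (proj1 (plus_class_entries n G) HG); auto].
Qed.

Lemma minus_class_madd_mscal n F G e : minus_class n F -> minus_class n G -> minus_class n (fun z => madd (F z) (mscal e (G z))).
Proof.
intros HF HG. apply minus_class_reflect. apply minus_class_reflect in HF, HG.
exact (plus_class_madd_mscal n _ _ e HF HG).
Qed.

Lemma plus_class_diag n (d : nat -> C -> C) : (forall k, (k < n)%nat -> plus_fn (d k)) -> plus_class n (fun z => mdiag (fun k => d k z)).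
Proof.
intros H. apply plus_class_entries. intros i j hi hj. destruct (Nat.eq_dec i j) as [->|h].
- apply (plus_fn_ext (d j)); [intros z; symmetry; apply (mdiag_same (fun k => d k z))|auto].
- apply (plus_fn_ext (fun _ => RtoC 0)); [intros z; symmetry; apply (mdiag_diff (fun k => d k z)); auto|apply plus_fn_const].
Qed.

Lemma plus_class_bounded n F : plus_class n F -> exists K, 0 <= K /\ forall z : C, 0 <= snd z -> mbd n (F z) K.
Proof.
intros H. apply (uniform_entry_bound n (fun z => 0 <= snd z)). intros i j hi hj.
apply (proj1 (plus_class_entries n F) H i j hi hj).
Qed.

Lemma minus_class_bounded n F : minus_class n F -> exists K, 0 <= K /\ forall z : C, snd z <= 0 -> mbd n (F z) K.
Proof.
intros H. apply (uniform_entry_bound n (fun z => snd z <= 0)). intros i j hi hj.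
apply minus_fn_iff. apply (proj1 (minus_class_entries n F) H i j hi hj).
Qed.

Lemma filter_forall_lt {T : Type} (F : (T -> Prop) -> Prop) {FF : Filter F} (P : nat -> T -> Prop) n :
  (forall k, (k < n)%nat -> F (P k)) -> F (fun x => forall k, (k < n)%nat -> P k x).
Proof.
induction n as [|n IH]; intros H.
- apply filter_forall. intros; lia.
- assert (H1 := IH (fun k hk => H k (Nat.lt_lt_succ_r _ _ hk))). assert (H2 := H n (Nat.lt_succ_diag_r n)).
  generalize (filter_and _ _ H1 H2). apply filter_imp.
  intros x [h1 h2] k hk. destruct (Nat.eq_dec k n) as [->|hkn]; auto. apply h1. lia.
Qed.

Lemma tends_interior (f : C -> C) (z l : C) : 0 < snd z -> tends (nb CUHP z) f l -> tends (nb everywhere z) f l.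
Proof.
intros hz H e he. destruct (H e he) as [d [hd K]]. destruct (nb_UHP z hz) as [d' [hd' K']].
exists (Rmin d d'). split; [apply Rmin_pos; auto|]. intros w hw hwz. apply K.
- unfold CUHP, Defs.Im. left. apply (K' w hw). eapply Rlt_le_trans; [exact hwz|apply Rmin_r].
- eapply Rlt_le_trans; [exact hwz|apply Rmin_l].
Qed.

(** As [v z = 0], the slope function of the product is [u] times that of [v], and no derivative of
    [u] enters. In the application [u] is an entry of the inverse, whose differentiability is still
    to be proved. *)
Lemma Cder_mult_vanishing u v z d : tends (nb everywhere z) u (u z) -> Cder v z d -> v z = RtoC 0 ->
  Cder (fun w => u w * v w)%C z (u z * d)%C.
Proof.
intros Hu [phi [h1 h2]] h0. exists (fun w => u w * phi w)%C. split.
- apply tends_mult; auto. apply nb_filter.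
- revert h2. apply filter_imp. intros w E. rewrite h0 in *.
  replace (v w) with (v w - RtoC 0)%C by ring. rewrite E. ring.
Qed.

Lemma Cder_csum (f : nat -> C -> C) z n : (forall k, (k < n)%nat -> exists l, Cder (f k) z l) ->
  exists l, Cder (fun w => csum (fun k => f k w) n) z l.
Proof.
induction n as [|n IH]; intros H.
- exists (RtoC 0). exact (Cder_const (RtoC 0) z).
- destruct IH as [l hl]; auto. destruct (H n) as [k hk]; auto. exists (l + k)%C.
  apply (Cder_ext (fun w => csum (fun k => f k w) n + f n w)%C).
  + apply filter_forall. reflexivity.
  + apply Cder_plus; auto.
Qed.

Lemma cancel_minus (a b : C) : b = (a - (a + - RtoC 1 * b))%C.
Proof. ring. Qed.

(* The resolvent identity [Fi w - Fi z = - Fi w (F w - F z) Fi z] transfers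
   continuity and differentiability from [F] to its bounded inverse. *)
Lemma plus_class_inverse n F Fi : plus_class n F -> inverse_on n CUHP F Fi ->
  (exists K, 0 <= K /\ forall z : C, 0 <= snd z -> mbd n (Fi z) K) -> plus_class n Fi.
Proof.
intros HF Hinv [K [hK HK]]. assert (HFe := proj1 (plus_class_entries n F) HF).
set (T := fun i j (z w : C) => csum (fun b => csum (fun a => Fi w i a * (F w a b - F z a b))%C n * Fi z b j)%C n).
assert (Res : forall i j (z w : C), (i < n)%nat -> (j < n)%nat -> 0 <= snd z -> 0 <= snd w ->
  Fi w i j = (Fi z i j - T i j z w)%C).
{ intros i j z w hi hj hz hw. destruct (Hinv z hz) as [z1 z2]. destruct (Hinv w hw) as [w1 w2].
  set (D := madd (F w) (mscal (-1) (F z))).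
  assert (E : meq n (mmul n (mmul n (Fi w) D) (Fi z)) (madd (Fi z) (mscal (-1) (Fi w)))).
  { unfold D. rewrite mmul_madd_r, mmul_madd_l, mmul_mscal_r, mmul_mscal_l, w2, mmul_1_l, (mmul_assoc n (Fi w) (F z)), z1, mmul_1_r.
    reflexivity. }
  assert (E' := E i j hi hj). unfold madd in E'. rewrite mscal_eq in E'.
  assert (ET : T i j z w = mmul n (mmul n (Fi w) D) (Fi z) i j).
  { rewrite mmul_eq. apply csum_ext. intros b hb. f_equal. rewrite mmul_eq. apply csum_ext. intros a ha. f_equal.
    unfold D, madd. rewrite mscal_eq. change (F w a b - F z a b = F w a b + RtoC (-1) * F z a b)%C.
    change (RtoC (-1)) with (RtoC (- (1))). rewrite RtoC_opp. ring. }
  rewrite ET. change (RtoC (-1)) with (RtoC (- (1))) in E'. rewrite RtoC_opp in E'.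
  exact (eq_trans (cancel_minus (Fi z i j) (Fi w i j)) (f_equal (Cminus (Fi z i j)) (eq_sym E'))). }
assert (Cont : forall a b (z : C), (a < n)%nat -> (b < n)%nat -> 0 <= snd z -> tends (nb CUHP z) (fun w => F w a b) (F z a b)).
{ intros a b z ha hb hz. apply (HFe a b ha hb). exact hz. }
assert (ContFi : forall i j (z : C), (i < n)%nat -> (j < n)%nat -> 0 <= snd z -> tends (nb CUHP z) (fun w => Fi w i j) (Fi z i j)).
{ intros i j z hi hj hz e he.
  set (B := INR n * (INR n * (K * 1) * K) + 1).
  assert (hB0 : 0 <= INR n * (INR n * (K * 1) * K)) by (repeat (apply Rmult_le_pos; auto using pos_INR); lra).
  assert (hB : 0 < e / B) by (apply Rdiv_lt_0_compat; unfold B; lra).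
  assert (Ev : nb CUHP z (fun w => forall a, (a < n)%nat -> forall b, (b < n)%nat -> Cmod (F w a b - F z a b) < e / B)).
  { apply filter_forall_lt; [apply nb_filter|]. intros a ha. apply filter_forall_lt; [apply nb_filter|].
    intros b hb. apply (Cont a b z ha hb hz); auto. }
  assert (Eu : nb CUHP z CUHP) by (exists 1; split; [lra|auto]).
  generalize (filter_and _ _ Ev Eu). apply filter_imp. intros w [hw hw'].
  rewrite (Res i j z w hi hj hz hw'). replace (Fi z i j - T i j z w - Fi z i j)%C with (- T i j z w)%C by ring. rewrite Cmod_opp.
  apply Rle_lt_trans with (INR n * (INR n * (K * (e / B)) * K)).
  - apply csum_bound. intros b hb. apply Cmod_mult_le; [|apply HK; auto].
    apply csum_bound. intros a ha. apply Cmod_mult_le; [apply HK; auto|left; auto].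
  - replace (INR n * (INR n * (K * (e / B)) * K)) with (INR n * (INR n * (K * 1) * K) * (e / B)) by ring.
    apply Rlt_le_trans with (B * (e / B)); [apply Rmult_lt_compat_r; auto; unfold B; lra|].
    right. field. unfold B. lra. }
apply plus_class_entries. intros i j hi hj. split; [|split].
- intros z hz. apply ContFi; auto.
- exists K. intros z hz. apply HK; auto.
- intros z hz.
  destruct (Cder_csum (fun b w => csum (fun a => Fi w i a * (F w a b - F z a b))%C n * Fi z b j)%C z n) as [l hl].
  + intros b hb. destruct (Cder_csum (fun a w => Fi w i a * (F w a b - F z a b))%C z n) as [l hl].
    * intros a ha. destruct (HFe a b ha hb) as (_ & _ & h3). destruct (h3 z hz) as [l hl].
      eexists. apply (Cder_mult_vanishing (fun w => Fi w i a) (fun w => F w a b - F z a b)%C).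
      -- apply tends_interior; auto. apply ContFi; auto. lra.
      -- apply Cder_minus; [exact hl|apply Cder_const].
      -- ring.
    * eexists. apply (Cder_mult (fun w => csum (fun a => Fi w i a * (F w a b - F z a b))%C n)); [exact hl|apply Cder_const].
  + exists (RtoC 0 - l)%C. apply (Cder_ext (fun w => Fi z i j - T i j z w)%C).
    * generalize (nb_UHP z hz). apply filter_imp. intros w hw. symmetry. apply Res; auto; lra.
    * apply Cder_minus; [apply Cder_const|exact hl].
Qed.

(** [G + e W = G (I + e Gi W)], and the smallness condition brings the second factor under the
    Neumann series. Its bound 2 gives a bound on the inverse depending only on [n] and [b]. *)
Lemma perturbed_inverse n (G Gi W : CMat) e b w :
  meq n (mmul n G Gi) mid -> meq n (mmul n Gi G) mid -> 0 <= e -> 0 <= b -> 0 <= w -> mbd n Gi b -> mbd n W w ->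
  INR n * (e * (INR n * (b * w))) <= 1 / 2 ->
  exists X, mbd n X (INR n * (2 * b)) /\ meq n (mmul n (madd G (mscal e W)) X) mid /\ meq n (mmul n X (madd G (mscal e W))) mid.
Proof.
intros H1 H2 he hb hw Hb Hw hs.
set (A := mscal e (mmul n Gi W)).
destruct (inverse_near_identity n A (e * (INR n * (b * w)))) as (Y & Y1 & Y2 & Y3).
- apply Rmult_le_pos; auto. apply Rmult_le_pos; [apply pos_INR|]. apply Rmult_le_pos; auto.
- intros i j hi hj. unfold A. rewrite mscal_eq. apply Cmod_mult_le.
  + rewrite Cmod_R, Rabs_pos_eq; lra.
  + apply mbd_mmul; auto.
- auto.
- assert (E : meq n (madd G (mscal e W)) (mmul n G (madd mid A))).
  { unfold A. rewrite mmul_madd_r, mmul_1_r, mmul_mscal_r, <- mmul_assoc, H1, mmul_1_l. reflexivity. }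
  exists (mmul n Y Gi). split; [|split].
  + apply mbd_mmul; auto. lra.
  + rewrite E, mmul_assoc, <- (mmul_assoc n (madd mid A)), Y2, mmul_1_l, H1. reflexivity.
  + rewrite E, mmul_assoc, <- (mmul_assoc n Gi), H2, mmul_1_l, Y3. reflexivity.
Qed.

(** The inverse is chosen point by point; the uniform bound on the choice is what
    [plus_class_inverse] needs to make it continuous and analytic. *)
Lemma plus_class_perturbed_inverse n G Gi W e b w :
  plus_class n G -> plus_class n W -> inverse_on n CUHP G Gi -> 0 <= e -> 0 <= b -> 0 <= w ->
  (forall z : C, 0 <= snd z -> mbd n (Gi z) b) -> (forall z : C, 0 <= snd z -> mbd n (W z) w) ->
  INR n * (e * (INR n * (b * w))) <= 1 / 2 ->
  exists Fi, plus_class n Fi /\ inverse_on n CUHP (fun z => madd (G z) (mscal e (W z))) Fi.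
Proof.
intros HG HW Hinv he hb hw Hb Hw hs.
assert (ex : forall z : C, exists X, 0 <= snd z -> mbd n X (INR n * (2 * b)) /\
   meq n (mmul n (madd (G z) (mscal e (W z))) X) mid /\ meq n (mmul n X (madd (G z) (mscal e (W z)))) mid).
{ intros z. destruct (Rle_lt_dec 0 (snd z)) as [h|h]; [|exists mid; lra].
  destruct (Hinv z h) as [q1 q2].
  destruct (perturbed_inverse n (G z) (Gi z) (W z) e b w) as [X HX]; auto. exists X. auto. }
set (Fi := fun z => proj1_sig (constructive_indefinite_description _ (ex z))).
assert (HFi : forall z : C, 0 <= snd z -> mbd n (Fi z) (INR n * (2 * b)) /\
   meq n (mmul n (madd (G z) (mscal e (W z))) (Fi z)) mid /\ meq n (mmul n (Fi z) (madd (G z) (mscal e (W z)))) mid).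
{ intros z. unfold Fi. apply proj2_sig. }
assert (Hi : inverse_on n CUHP (fun z => madd (G z) (mscal e (W z))) Fi) by (intros z hz; apply HFi; exact hz).
exists Fi. split; auto.
apply (plus_class_inverse n (fun z => madd (G z) (mscal e (W z)))); auto.
- apply plus_class_madd_mscal; auto.
- exists (INR n * (2 * b)). split; [apply Rmult_le_pos; [apply pos_INR|lra]|]. intros z hz. apply HFi; auto.
Qed.

Lemma minus_class_perturbed_inverse n G Gi W e b w :
  minus_class n G -> minus_class n W -> inverse_on n CLHP G Gi -> 0 <= e -> 0 <= b -> 0 <= w ->
  (forall z : C, snd z <= 0 -> mbd n (Gi z) b) -> (forall z : C, snd z <= 0 -> mbd n (W z) w) ->
  INR n * (e * (INR n * (b * w))) <= 1 / 2 ->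
  exists Fi, minus_class n Fi /\ inverse_on n CLHP (fun z => madd (G z) (mscal e (W z))) Fi.
Proof.
intros HG HW Hinv he hb hw Hb Hw hs. apply minus_class_reflect in HG, HW.
destruct (plus_class_perturbed_inverse n _ (fun z => Gi (- z)%C) _ e b w HG HW) as (Fi & F1 & F2); auto.
- intros z hz. apply Hinv. unfold CUHP, CLHP, Defs.Im in *. simpl. lra.
- intros z hz. apply Hb. simpl. lra.
- intros z hz. apply Hw. simpl. lra.
- assert (oo : forall z : C, (- - z)%C = z) by (intros; ring).
  exists (fun z => Fi (- z)%C). split.
  + apply minus_class_reflect. apply plus_class_entries. intros i j hi hj.
    apply (plus_fn_ext (fun z => Fi z i j)); [intros z; rewrite oo; reflexivity|].
    apply (proj1 (plus_class_entries n Fi) F1); auto.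
  + intros z hz. assert (q : CUHP (- z)%C) by (unfold CUHP, CLHP, Defs.Im in *; simpl; lra).
    generalize (F2 (- z)%C q). rewrite oo. auto.
Qed.

Lemma Cmod_bp_le (z : C) : 0 <= snd z -> Cmod (bp z) <= 1.
Proof.
intros hz. assert (q := CUHP_plus_Ci z hz). unfold bp.
rewrite Cmod_div by (apply Cmod_gt_0; lra). apply Rle_div_l; [lra|]. rewrite Rmult_1_l.
apply Cmod_le_comp; simpl; [rewrite Rplus_0_r, Ropp_0, Rplus_0_r; lra|].
apply Rabs_le. rewrite Rabs_pos_eq by lra. lra.
Qed.

Lemma Cmod_bm_le (z : C) : snd z <= 0 -> Cmod (bm z) <= 1.
Proof. intros hz. rewrite <- bp_opp. apply Cmod_bp_le. simpl. lra. Qed.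

Lemma mbd_diag n d : (forall k, (k < n)%nat -> Cmod (d k) <= 1) -> mbd n (mdiag d) 1.
Proof.
intros H i j hi hj. destruct (Nat.eq_dec i j) as [->|h].
- rewrite mdiag_same. auto.
- rewrite mdiag_diff, Cmod_0 by auto. lra.
Qed.

Lemma Cmod_pow_le_1 (z : C) k : Cmod z <= 1 -> Cmod (z ^ k) <= 1.
Proof.
intros h. rewrite Cmod_pow. rewrite <- (pow1 k). apply pow_incr. split; [apply Cmod_ge_0|auto].
Qed.

Lemma mdiag_ext d e : (forall k, d k = e k) -> mdiag d = mdiag e.
Proof. intros H. f_equal. apply functional_extensionality. exact H. Qed.

Lemma mdiag_ext_meq n (d e : nat -> C) : (forall k, d k = e k :> C) -> meq n (mdiag d) (mdiag e).
Proof. intros H. rewrite (mdiag_ext d e H). reflexivity. Qed.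

Lemma Lamp_eq kappa z : Lamp kappa z = mdiag (fun j => bp z ^ posexp (kappa j))%C.
Proof. apply mdiag_ext. intros; apply bpow_max. Qed.

Lemma Lamm_eq kappa z : Lamm kappa z = mdiag (fun j => bm z ^ negexp (kappa j))%C.
Proof. apply mdiag_ext. intros; apply bpow_min. Qed.

Lemma Lamp_inv_eq kappa z : Lamp_inv kappa z = mdiag (fun j => bm z ^ posexp (kappa j))%C.
Proof. apply mdiag_ext. intros; apply bpow_opp_max. Qed.

Lemma Lamm_inv_eq kappa z : Lamm_inv kappa z = mdiag (fun j => bp z ^ negexp (kappa j))%C.
Proof. apply mdiag_ext. intros; apply bpow_opp_min. Qed.

Lemma Lam_eq kappa z : Lam kappa z = mdiag (fun j => bp z ^ posexp (kappa j) * bm z ^ negexp (kappa j))%C.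
Proof. apply mdiag_ext. intros; apply bpow_split. Qed.

Lemma mmul_diag_diag n d e : meq n (mmul n (mdiag d) (mdiag e)) (mdiag (fun k => d k * e k)%C).
Proof.
intros i j hi hj. rewrite mmul_diag_l by auto. destruct (Nat.eq_dec i j) as [->|h].
- rewrite !mdiag_same. reflexivity.
- rewrite !mdiag_diff by auto. apply Cmult_0_r.
Qed.

Lemma bp_bm_pow (x : R) k : (bp (RtoC x) ^ k * bm (RtoC x) ^ k)%C = RtoC 1.
Proof. rewrite <- Cpow_mult_l, bp_bm. apply Cpow_1_l. Qed.

Lemma Lamp_inv_Lam n kappa (x : R) : meq n (mmul n (Lamp_inv kappa (RtoC x)) (Lam kappa (RtoC x))) (Lamm kappa (RtoC x)).
Proof.
rewrite Lamp_inv_eq, Lam_eq, Lamm_eq, mmul_diag_diag. apply mdiag_ext_meq. intros k. transitivity (bp (RtoC x) ^ posexp (kappa k) * bm (RtoC x) ^ posexp (kappa k) * bm (RtoC x) ^ negexp (kappa k))%C; [ring|].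
rewrite bp_bm_pow. ring.
Qed.

Lemma Lam_Lamm_inv n kappa (x : R) : meq n (mmul n (Lam kappa (RtoC x)) (Lamm_inv kappa (RtoC x))) (Lamp kappa (RtoC x)).
Proof.
rewrite Lamm_inv_eq, Lam_eq, Lamp_eq, mmul_diag_diag. apply mdiag_ext_meq. intros k. transitivity (bp (RtoC x) ^ posexp (kappa k) * (bp (RtoC x) ^ negexp (kappa k) * bm (RtoC x) ^ negexp (kappa k)))%C; [ring|].
rewrite bp_bm_pow. ring.
Qed.

Lemma Lamm_Lamm_inv n kappa (x : R) : meq n (mmul n (Lamm kappa (RtoC x)) (Lamm_inv kappa (RtoC x))) mid.
Proof.
rewrite Lamm_inv_eq, Lamm_eq, mmul_diag_diag. apply mdiag_ext_meq. intros k. rewrite Cmult_comm. apply bp_bm_pow.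
Qed.

Lemma LH_csum nu K (f : nat -> R -> C) n : 0 <= K -> (forall k, (k < n)%nat -> LH nu K (f k)) ->
  LH nu (INR n * K) (fun t => csum (fun k => f k t) n).
Proof.
intros hK. induction n as [|n IH]; intros H.
- simpl INR. rewrite Rmult_0_l. rewrite <- Cmod_0. exact (LH_const nu (RtoC 0)).
- rewrite S_INR. replace ((INR n + 1) * K) with (INR n * K + K) by ring.
  apply (LH_ext _ _ (fun t => csum (fun k => f k t) n + f n t)%C); [reflexivity|]. apply LH_plus; auto.
Qed.

Lemma LH_mmul nu n (A B : R -> CMat) K L : 0 <= K -> 0 <= L ->
  (forall i j, (i < n)%nat -> (j < n)%nat -> LH nu K (fun x => A x i j)) ->
  (forall i j, (i < n)%nat -> (j < n)%nat -> LH nu L (fun x => B x i j)) ->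
  forall i j, (i < n)%nat -> (j < n)%nat -> LH nu (INR n * (3 * K * L)) (fun x => mmul n (A x) (B x) i j).
Proof.
intros hK hL HA HB i j hi hj. apply (LH_csum nu (3 * K * L) (fun k x => A x i k * B x k j)%C).
- repeat apply Rmult_le_pos; lra.
- intros k hk. apply (LH_mult nu K L (fun x => A x i k) (fun x => B x k j)); auto.
Qed.

Lemma uniform_LH nu n (A : R -> CMat) :
  (forall i j, (i < n)%nat -> (j < n)%nat -> exists K, LH nu K (fun x => A x i j)) ->
  exists K, 0 <= K /\ forall i j, (i < n)%nat -> (j < n)%nat -> LH nu K (fun x => A x i j).
Proof.
intros H.
destruct (finite_bound (fun i K => forall j, (j < n)%nat -> LH nu K (fun x => A x i j)) n) as [K [hK HK]].
- intros i a b Ha hab j hj. apply (LH_weaken nu a); auto.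
- intros i hi. destruct (finite_bound (fun j K => LH nu K (fun x => A x i j)) n) as [K [hK HK]].
  + intros j a b Ha hab. apply (LH_weaken nu a); auto.
  + auto.
  + exists K. auto.
- exists K. auto.
Qed.

(** * The matrix boundary value problem *)

Section Factorization.
Variables (n : nat) (mu : R) (G0 : R -> CMat) (Gm Gmi Gp Gpi : C -> CMat) (kappa : nat -> Z).
Hypothesis mu_range : 0 < mu < 1.
Hypothesis G0_class : mat_GHmu n mu G0.
Hypothesis G0_factor : right_factorization_with n G0 Gm Gmi Gp Gpi kappa.

(* The loss of exponent in [plus_fn_regularity]. *)
Let nu := mu / 8.

Lemma Gm_class : minus_class n Gm. Proof. apply G0_factor. Qed.
Lemma Gmi_class : minus_class n Gmi. Proof. apply G0_factor. Qed.
Lemma Gp_class : plus_class n Gp. Proof. apply G0_factor. Qed.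
Lemma Gpi_class : plus_class n Gpi. Proof. apply G0_factor. Qed.
Lemma Gm_inverse : inverse_on n CLHP Gm Gmi. Proof. apply G0_factor. Qed.
Lemma Gp_inverse : inverse_on n CUHP Gp Gpi. Proof. apply G0_factor. Qed.

Lemma real_CLHP (x : R) : CLHP (RtoC x).
Proof. unfold CLHP, Defs.Im. simpl. lra. Qed.

Lemma real_CUHP (x : R) : CUHP (RtoC x).
Proof. unfold CUHP, Defs.Im. simpl. lra. Qed.

Lemma Gm_Gmi (x : R) : meq n (mmul n (Gm (RtoC x)) (Gmi (RtoC x))) mid.
Proof. apply Gm_inverse, real_CLHP. Qed.
Lemma Gmi_Gm (x : R) : meq n (mmul n (Gmi (RtoC x)) (Gm (RtoC x))) mid.
Proof. apply Gm_inverse, real_CLHP. Qed.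
Lemma Gp_Gpi (x : R) : meq n (mmul n (Gp (RtoC x)) (Gpi (RtoC x))) mid.
Proof. apply Gp_inverse, real_CUHP. Qed.
Lemma Gpi_Gp (x : R) : meq n (mmul n (Gpi (RtoC x)) (Gp (RtoC x))) mid.
Proof. apply Gp_inverse, real_CUHP. Qed.

Lemma G0_eq (x : R) : meq n (G0 x) (mmul n (mmul n (Gm (RtoC x)) (Lam kappa (RtoC x))) (Gp (RtoC x))).
Proof. apply G0_factor. Qed.

Lemma LH_bpow_mult k f : (exists K, LH mu K f) -> exists K, LH mu K (fun x => bpow k (RtoC x) * f x)%C.
Proof.
intros [K HK]. eexists.
generalize (LH_pow_mult mu _ _ _ (posexp k) (LH_bp mu mu_range) (LH_pow_mult mu _ _ _ (negexp k) (LH_bm mu mu_range) HK)).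
apply LH_ext. intros x. rewrite bpow_split. ring.
Qed.

(* [Gpi = G0^-1 Gm Lam] and [Gmi = Lam Gp G0^-1] on the real line: each factor
   is a Hoelder combination of boundary values from the opposite half plane. *)
Lemma factors_LH : exists K, 0 <= K /\ forall i j, (i < n)%nat -> (j < n)%nat ->
  LH nu K (fun x => Gmi (RtoC x) i j) /\ LH nu K (fun x => Gpi (RtoC x) i j).
Proof.
destruct G0_class as [_ [G0i [hG0i inv]]].
assert (HG : forall i j, (i < n)%nat -> (j < n)%nat -> exists K, LH mu K (fun x => G0i x i j)).
{ intros i j hi hj. destruct (hG0i i j hi hj) as [K HK]. exists (8 * K). apply holder_bound_LH; auto. }
assert (E1 : forall x, meq n (Gpi (RtoC x)) (mmul n (G0i x) (mmul n (Gm (RtoC x)) (Lam kappa (RtoC x))))).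
{ intros x. destruct (inv x) as [_ q].
  rewrite <- (mmul_1_l n (Gpi (RtoC x))), <- q, (G0_eq x), !mmul_assoc, Gp_Gpi, mmul_1_r. reflexivity. }
assert (E2 : forall x, meq n (Gmi (RtoC x)) (mmul n (mmul n (Lam kappa (RtoC x)) (Gp (RtoC x))) (G0i x))).
{ intros x. destruct (inv x) as [q _].
  rewrite <- (mmul_1_r n (Gmi (RtoC x))), <- q, (G0_eq x), <- !mmul_assoc, Gmi_Gm, mmul_1_l. reflexivity. }
destruct (uniform_LH nu n (fun x => Gmi (RtoC x))) as [K1 [k1 H1]].
{ intros i j hi hj.
  apply (minus_fn_regularity (fun z => Gmi z i j) n (fun m z => Gp z i m) (fun m x => bpow (kappa i) (RtoC x) * G0i x m j)%C mu); auto.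
  - apply (proj1 (minus_class_entries n Gmi) Gmi_class); auto.
  - intros m hm. apply (proj1 (plus_class_entries n Gp) Gp_class); auto.
  - intros m hm. apply LH_bpow_mult; auto.
  - intros x. rewrite (E2 x i j hi hj), mmul_eq. apply csum_ext. intros m hm.
    unfold Lam. rewrite mmul_diag_l by auto. ring. }
destruct (uniform_LH nu n (fun x => Gpi (RtoC x))) as [K2 [k2 H2]].
{ intros i j hi hj.
  apply (plus_fn_regularity (fun z => Gpi z i j) n (fun m z => Gm z m j) (fun m x => bpow (kappa j) (RtoC x) * G0i x i m)%C mu); auto.
  - apply (proj1 (plus_class_entries n Gpi) Gpi_class); auto.
  - intros m hm. apply (proj1 (minus_class_entries n Gm) Gm_class); auto.
  - intros m hm. apply LH_bpow_mult; auto.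
  - intros x. rewrite (E1 x i j hi hj), mmul_eq. apply csum_ext. intros m hm.
    unfold Lam. rewrite mmul_diag_r by auto. ring. }
exists (K1 + K2). split; [lra|]. intros i j hi hj. split.
- apply (LH_weaken nu K1); [lra|auto].
- apply (LH_weaken nu K2); [lra|auto].
Qed.

(** [A] is fixed before [Nx], and the bound is linear in [K], so a bounded family of data gives a
    bounded family of densities. The 2 in the witness pays for lowering the exponent of [Nx] from
    [mu] to [nu]. *)
Lemma M0_LH : exists A, 0 <= A /\ forall Nx K, 0 <= K ->
  (forall i j, (i < n)%nat -> (j < n)%nat -> LH mu K (fun x => Nx x i j)) ->
  forall i j, (i < n)%nat -> (j < n)%nat -> LH nu (A * K) (fun x => M0 n Gmi Gpi Nx x i j).
Proof.
destruct factors_LH as [K1 [k1 H1]].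
exists (INR n * (3 * (INR n * (3 * K1 * 2)) * K1)).
assert (hn := pos_INR n).
split; [repeat (apply Rmult_le_pos; try lra)|].
intros Nx K hK HN i j hi hj.
assert (HN' : forall a b, (a < n)%nat -> (b < n)%nat -> LH nu (2 * K) (fun x => Nx x a b)).
{ intros a b ha hb. apply (LH_weaken_exp mu); [unfold nu; lra|auto]. }
assert (P1 := LH_mmul nu n (fun x => Gmi (RtoC x)) Nx K1 (2 * K) k1 ltac:(lra) (fun a b ha hb => proj1 (H1 a b ha hb)) HN').
assert (hp : 0 <= INR n * (3 * K1 * (2 * K))) by (repeat (apply Rmult_le_pos; try lra)).
assert (P2 := LH_mmul nu n (fun x => mmul n (Gmi (RtoC x)) (Nx x)) (fun x => Gpi (RtoC x)) _ K1 hp k1 P1 (fun a b ha hb => proj2 (H1 a b ha hb)) i j hi hj).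
replace (INR n * (3 * (INR n * (3 * K1 * 2)) * K1) * K) with (INR n * (3 * (INR n * (3 * K1 * (2 * K))) * K1)) by ring.
exact P2.
Qed.

Lemma bvp_necessity Nx N1m N1p :
  (forall i j, (i < n)%nat -> (j < n)%nat -> contR (fun x => M0 n Gmi Gpi Nx x i j)) ->
  bvp_solution n kappa Gm Gp Nx N1m N1p -> conds_abc n kappa (M0 n Gmi Gpi Nx).
Proof.
intros HM (Hm & Hp & E). apply conds_abc_moments; auto. intros l j hl hj.
(* These unknowns satisfy [Ym Lamm + Lamp Yp = M0], where the diagonal factors act on single
   entries. *)
set (Yp := fun z => mmul n (N1p z) (Gpi z)). set (Ym := fun z => mmul n (Gmi z) (N1m z)).
apply (moment_conds_necessary _ (fun z => Yp z l j) (fun z => Ym z l j)); auto.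
- apply (proj1 (plus_class_entries n Yp)); auto. apply plus_class_mmul; auto. apply Gpi_class.
- apply (proj1 (minus_class_entries n Ym)); auto. apply minus_class_mmul; auto. apply Gmi_class.
- intros x.
  assert (Q : meq n (M0 n Gmi Gpi Nx x)
     (madd (mmul n (Ym (RtoC x)) (Lamm kappa (RtoC x))) (mmul n (Lamp kappa (RtoC x)) (Yp (RtoC x))))).
  { assert (Ex : meq n (madd (mmul n (mmul n (N1m (RtoC x)) (Lamm kappa (RtoC x))) (Gp (RtoC x)))
          (mmul n (mmul n (Gm (RtoC x)) (Lamp kappa (RtoC x))) (N1p (RtoC x)))) (Nx x)) by exact (E x).
    change (meq n (mmul n (mmul n (Gmi (RtoC x)) (Nx x)) (Gpi (RtoC x)))
      (madd (mmul n (Ym (RtoC x)) (Lamm kappa (RtoC x))) (mmul n (Lamp kappa (RtoC x)) (Yp (RtoC x))))).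
    rewrite <- Ex, mmul_madd_r, mmul_madd_l. unfold Ym, Yp.
    rewrite !mmul_assoc, Gp_Gpi, mmul_1_r.
    rewrite <- (mmul_assoc n (Gmi (RtoC x)) (Gm (RtoC x))), Gmi_Gm, mmul_1_l. reflexivity. }
  rewrite (Q l j hl hj). unfold madd. rewrite Lamm_eq, Lamp_eq, mmul_diag_l, mmul_diag_r by auto. reflexivity.
Qed.

(** The scalar constant depends on the exponents, hence on [l] and [j]. As the property is monotone
    in the constant and there are finitely many entries, a common one exists, independent of [m]. *)
Lemma entry_bvp : exists Cst, 0 <= Cst /\ forall l j m K, (l < n)%nat -> (j < n)%nat -> LH nu K m ->
  moment_conds m (posexp (kappa l)) (negexp (kappa j)) ->
  exists yp ym, plus_fn yp /\ minus_fn ym /\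
    (forall z : C, 0 <= snd z -> Cmod (yp z) <= Cst * K) /\
    (forall z : C, snd z <= 0 -> Cmod (ym z) <= Cst * K) /\
    forall x, (ym (RtoC x) * bm (RtoC x) ^ negexp (kappa j) + bp (RtoC x) ^ posexp (kappa l) * yp (RtoC x))%C = m x.
Proof.
set (P := fun l j Cst => forall m K, LH nu K m -> moment_conds m (posexp (kappa l)) (negexp (kappa j)) ->
  exists yp ym, plus_fn yp /\ minus_fn ym /\
    (forall z : C, 0 <= snd z -> Cmod (yp z) <= Cst * K) /\
    (forall z : C, snd z <= 0 -> Cmod (ym z) <= Cst * K) /\
    forall x, (ym (RtoC x) * bm (RtoC x) ^ negexp (kappa j) + bp (RtoC x) ^ posexp (kappa l) * yp (RtoC x))%C = m x).
assert (mono : forall l j a b, P l j a -> a <= b -> P l j b).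
{ intros l j a b Ha hab m K Hm Hc. destruct (Ha m K Hm Hc) as (yp & ym & h1 & h2 & h3 & h4 & h5).
  assert (hK : 0 <= K) by apply Hm.
  exists yp, ym. split; auto. split; auto. split; [|split]; auto.
  - intros z hz. eapply Rle_trans; [apply h3; auto|]. apply Rmult_le_compat_r; auto.
  - intros z hz. eapply Rle_trans; [apply h4; auto|]. apply Rmult_le_compat_r; auto. }
assert (hnu : 0 < nu < 1) by (unfold nu; lra).
destruct (finite_bound (fun l a => forall j, (j < n)%nat -> P l j a) n) as [a [ha Ha]].
- intros l a b Ha hab j hj. apply (mono l j a); auto.
- intros l hl. destruct (finite_bound (fun j a => P l j a) n) as [a [ha Ha]].
  + intros j a b Ha hab. apply (mono l j a); auto.
  + intros j hj. destruct (scalar_bvp nu (posexp (kappa l)) (negexp (kappa j)) hnu) as [c [hc Hc]].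
    exists c. intros m K Hm Hmc. apply Hc; auto. apply moment_conds_sufficient; auto.
    eapply LH_contR; [|exact Hm]. lra.
  + exists a. auto.
- exists a. split; auto. intros l j m K hl hj. apply Ha; auto.
Qed.

(** [B] is quantified before the datum [Nx]; this order is what later makes the solutions bounded
    uniformly in [eps]. *)
Lemma bvp_sufficiency : exists B, 0 <= B /\ forall Nx K, 0 <= K ->
  (forall i j, (i < n)%nat -> (j < n)%nat -> LH mu K (fun x => Nx x i j)) ->
  conds_abc n kappa (M0 n Gmi Gpi Nx) ->
  exists N1m N1p, bvp_solution n kappa Gm Gp Nx N1m N1p /\
    (forall z : C, snd z <= 0 -> mbd n (N1m z) (B * K)) /\ (forall z : C, 0 <= snd z -> mbd n (N1p z) (B * K)).
Proof.
destruct M0_LH as [A [hA HA]]. destruct entry_bvp as [c [hc Hc]].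
destruct (minus_class_bounded n Gm Gm_class) as [b1 [hb1 Hb1]].
destruct (plus_class_bounded n Gp Gp_class) as [b2 [hb2 Hb2]].
assert (hn := pos_INR n).
exists (INR n * ((b1 + b2) * (c * A))). split; [repeat (apply Rmult_le_pos; try lra)|].
intros Nx K hK HN Hconds.
assert (HM := HA Nx K hK HN).
assert (Hcont : forall l j, (l < n)%nat -> (j < n)%nat -> contR (fun t => M0 n Gmi Gpi Nx t l j)).
{ intros l j hl hj. eapply LH_contR; [|apply HM; auto]. unfold nu; lra. }
assert (Hmc := proj1 (conds_abc_moments n kappa _ Hcont) Hconds).
assert (ex : forall l j, exists y : (C -> C) * (C -> C), (l < n)%nat -> (j < n)%nat ->
  plus_fn (fst y) /\ minus_fn (snd y) /\
    (forall z : C, 0 <= snd z -> Cmod (fst y z) <= c * (A * K)) /\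
    (forall z : C, snd z <= 0 -> Cmod (snd y z) <= c * (A * K)) /\
    forall x, (snd y (RtoC x) * bm (RtoC x) ^ negexp (kappa j) + bp (RtoC x) ^ posexp (kappa l) * fst y (RtoC x))%C = M0 n Gmi Gpi Nx x l j).
(* Outside the index range any pair of functions will do; the identity serves as default. *)
{ intros l j. destruct (Nat.lt_ge_cases l n) as [hl|hl]; [|exists (fun z => z, fun z => z); lia].
  destruct (Nat.lt_ge_cases j n) as [hj|hj]; [|exists (fun z => z, fun z => z); lia].
  destruct (Hc l j _ _ hl hj (HM l j hl hj) (Hmc l j hl hj)) as (yp & ym & H).
  exists (yp, ym). intros _ _. exact H. }
set (Y := fun l j => proj1_sig (constructive_indefinite_description _ (ex l j))).
assert (HY := fun l j => proj2_sig (constructive_indefinite_description _ (ex l j))).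
change (forall l j, (l < n)%nat -> (j < n)%nat ->
  plus_fn (fst (Y l j)) /\ minus_fn (snd (Y l j)) /\
    (forall z : C, 0 <= snd z -> Cmod (fst (Y l j) z) <= c * (A * K)) /\
    (forall z : C, snd z <= 0 -> Cmod (snd (Y l j) z) <= c * (A * K)) /\
    forall x, (snd (Y l j) (RtoC x) * bm (RtoC x) ^ negexp (kappa j) + bp (RtoC x) ^ posexp (kappa l) * fst (Y l j) (RtoC x))%C
      = M0 n Gmi Gpi Nx x l j) in HY.
set (Yp := fun (z : C) l j => fst (Y l j) z). set (Ym := fun (z : C) l j => snd (Y l j) z).
assert (Cp : plus_class n Yp) by (apply plus_class_entries; intros l j hl hj; apply HY; auto).
assert (Cm : minus_class n Ym) by (apply minus_class_entries; intros l j hl hj; apply HY; auto).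
assert (hcA : 0 <= c * (A * K)) by (repeat apply Rmult_le_pos; auto).
(* The substitution from the necessity proof, inverted. *)
exists (fun z => mmul n (Gm z) (Ym z)), (fun z => mmul n (Yp z) (Gp z)).
split; [split; [|split]|split].
- apply minus_class_mmul; auto. apply Gm_class.
- apply plus_class_mmul; auto. apply Gp_class.
- intros x0. assert (Q : forall x, meq n
    (madd (mmul n (mmul n (mmul n (Gm (RtoC x)) (Ym (RtoC x))) (Lamm kappa (RtoC x))) (Gp (RtoC x)))
          (mmul n (mmul n (Gm (RtoC x)) (Lamp kappa (RtoC x))) (mmul n (Yp (RtoC x)) (Gp (RtoC x))))) (Nx x)).
  2: exact (Q x0).
  intros x.
  assert (E : meq n (madd (mmul n (Ym (RtoC x)) (Lamm kappa (RtoC x))) (mmul n (Lamp kappa (RtoC x)) (Yp (RtoC x))))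
    (mmul n (mmul n (Gmi (RtoC x)) (Nx x)) (Gpi (RtoC x)))).
  { intros l j hl hj. unfold madd. rewrite Lamm_eq, Lamp_eq, mmul_diag_l, mmul_diag_r by auto.
    exact (proj2 (proj2 (proj2 (proj2 (HY l j hl hj)))) x). }
  assert (E2 : meq n (madd (mmul n (mmul n (mmul n (Gm (RtoC x)) (Ym (RtoC x))) (Lamm kappa (RtoC x))) (Gp (RtoC x)))
          (mmul n (mmul n (Gm (RtoC x)) (Lamp kappa (RtoC x))) (mmul n (Yp (RtoC x)) (Gp (RtoC x)))))
     (mmul n (mmul n (Gm (RtoC x)) (madd (mmul n (Ym (RtoC x)) (Lamm kappa (RtoC x))) (mmul n (Lamp kappa (RtoC x)) (Yp (RtoC x))))) (Gp (RtoC x)))).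
  { rewrite mmul_madd_r, mmul_madd_l, !mmul_assoc. reflexivity. }
  rewrite E2, E, !mmul_assoc, Gpi_Gp, mmul_1_r, <- mmul_assoc, Gm_Gmi, mmul_1_l. reflexivity.
- intros z hz i j hi hj. eapply Rle_trans; [apply (mbd_mmul n (Gm z) (Ym z) b1 (c * (A * K))); auto|].
  + intros a b ha hb. apply HY; auto.
  + replace (INR n * ((b1 + b2) * (c * A)) * K) with (INR n * ((b1 + b2) * (c * (A * K)))) by ring.
    apply Rmult_le_compat_l; auto. apply Rmult_le_compat_r; auto. lra.
- intros z hz i j hi hj. eapply Rle_trans; [apply (mbd_mmul n (Yp z) (Gp z) (c * (A * K)) b2); auto|].
  + intros a b ha hb. apply HY; auto.
  + replace (INR n * ((b1 + b2) * (c * A)) * K) with (INR n * (c * (A * K) * (b1 + b2))) by ring.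
    apply Rmult_le_compat_l; auto. apply Rmult_le_compat_l; auto. lra.
Qed.

(** On the real line the inverse diagonal factors reduce the product: [Lamp_inv Lam = Lamm],
    [Lam Lamm_inv = Lamp] and [Lamm Lamm_inv = I]. The terms linear in [e] then form the left side
    of the boundary value problem and cancel against [Nx]; only the product of the two corrections
    is left. *)
Lemma factorization_error e Nx N1m N1p (x : R) : bvp_solution n kappa Gm Gp Nx N1m N1p ->
  meq n (msub (madd (G0 x) (mscal e (Nx x)))
     (mmul n (mmul n (Fminus n kappa Gm N1m e (RtoC x)) (Lam kappa (RtoC x))) (Fplus n kappa Gp N1p e (RtoC x))))
   (mscal (- (e * e)) (mmul n (N1m (RtoC x)) (N1p (RtoC x)))).
Proof.
intros (_ & _ & E).
assert (Ex : meq n (madd (mmul n (mmul n (N1m (RtoC x)) (Lamm kappa (RtoC x))) (Gp (RtoC x)))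
    (mmul n (mmul n (Gm (RtoC x)) (Lamp kappa (RtoC x))) (N1p (RtoC x)))) (Nx x)) by exact (E x).
unfold Fminus, Fplus.
set (gm := Gm (RtoC x)) in *. set (gp := Gp (RtoC x)) in *. set (nm := N1m (RtoC x)) in *. set (np := N1p (RtoC x)) in *.
set (L := Lam kappa (RtoC x)). set (Lpi := Lamp_inv kappa (RtoC x)). set (Lmi := Lamm_inv kappa (RtoC x)).
set (Lp := Lamp kappa (RtoC x)) in *. set (Lm := Lamm kappa (RtoC x)) in *.
assert (R1 : meq n (mmul n (madd gm (mscal e (mmul n nm Lpi))) L) (madd (mmul n gm L) (mscal e (mmul n nm Lm)))).
{ rewrite mmul_madd_l, mmul_mscal_l, mmul_assoc. unfold Lpi, L. rewrite Lamp_inv_Lam. reflexivity. }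
assert (R2 : meq n (mmul n (mmul n gm L) (mmul n Lmi np)) (mmul n (mmul n gm Lp) np)).
{ rewrite !mmul_assoc, <- (mmul_assoc n L). unfold L, Lmi. rewrite Lam_Lamm_inv. reflexivity. }
assert (R3 : meq n (mmul n (mmul n nm Lm) (mmul n Lmi np)) (mmul n nm np)).
{ rewrite !mmul_assoc, <- (mmul_assoc n Lm). unfold Lm, Lmi. rewrite Lamm_Lamm_inv, mmul_1_l. reflexivity. }
assert (R4 : meq n (mmul n (mmul n (madd gm (mscal e (mmul n nm Lpi))) L) (madd gp (mscal e (mmul n Lmi np))))
  (madd (madd (mmul n (mmul n gm L) gp) (mscal e (mmul n (mmul n nm Lm) gp)))
        (madd (mscal e (mmul n (mmul n gm Lp) np)) (mscal e (mscal e (mmul n nm np)))))).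
{ rewrite R1, mmul_madd_r, !mmul_madd_l, !mmul_mscal_r, !mmul_mscal_l, R2, R3.
  reflexivity. }
intros i j hi hj. unfold msub. rewrite (R4 i j hi hj). unfold madd. rewrite !mscal_eq.
rewrite <- (Ex i j hi hj). unfold madd.
rewrite (G0_eq x i j hi hj). fold gm L gp.
assert (q : forall a b u v s t : C, t = (- (s * s))%C -> (a + s * (b + u) - (a + s * b + (s * u + s * (s * v))) = t * v)%C).
{ intros a b u v s t ->. ring. }
apply q. rewrite RtoC_opp, RtoC_mult. reflexivity.
Qed.

End Factorization.

(** [- Z.min (kappa j) 0] is nonnegative, so only natural powers of [b] occur, which are analytic
    and bounded by 1 in the upper half plane. The correction added to [Gp] therefore stays in the
    class. *)
Lemma Lamm_inv_class n kappa : plus_class n (Lamm_inv kappa).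
Proof.
replace (Lamm_inv kappa) with (fun z => mdiag (fun j => bp z ^ negexp (kappa j))%C).
- apply (plus_class_diag n (fun j z => bp z ^ negexp (kappa j))%C). intros k _. apply plus_fn_pow, plus_fn_bp.
- apply functional_extensionality. intros z. symmetry. apply Lamm_inv_eq.
Qed.

Lemma Lamp_inv_class n kappa : minus_class n (Lamp_inv kappa).
Proof.
apply minus_class_reflect.
apply (eq_ind (fun z => mdiag (fun j => bp z ^ posexp (kappa j))%C) (plus_class n)).
- apply (plus_class_diag n (fun j z => bp z ^ posexp (kappa j))%C). intros k _. apply plus_fn_pow, plus_fn_bp.
- apply functional_extensionality. intros z. rewrite Lamp_inv_eq. apply mdiag_ext. intros k. now rewrite bm_opp.
Qed.

Lemma Lamm_inv_bound n kappa (z : C) : 0 <= snd z -> mbd n (Lamm_inv kappa z) 1.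
Proof. intros hz. rewrite Lamm_inv_eq. apply mbd_diag. intros k _. apply Cmod_pow_le_1, Cmod_bp_le, hz. Qed.

Lemma Lamp_inv_bound n kappa (z : C) : snd z <= 0 -> mbd n (Lamp_inv kappa z) 1.
Proof. intros hz. rewrite Lamp_inv_eq. apply mbd_diag. intros k _. apply Cmod_pow_le_1, Cmod_bm_le, hz. Qed.

Lemma perturbed_factors n mu G0 Gm Gmi Gp Gpi kappa K : 0 <= K -> 0 < mu < 1 ->
  right_factorization_with n G0 Gm Gmi Gp Gpi kappa ->
  exists eps1, 0 < eps1 /\ forall e N1m N1p, 0 < e < eps1 ->
    minus_class n N1m -> plus_class n N1p ->
    (forall z : C, snd z <= 0 -> mbd n (N1m z) K) -> (forall z : C, 0 <= snd z -> mbd n (N1p z) K) ->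
    minus_class n (Fminus n kappa Gm N1m e) /\ plus_class n (Fplus n kappa Gp N1p e) /\
    exists Fmi Fpi, minus_class n Fmi /\ inverse_on n CLHP (Fminus n kappa Gm N1m e) Fmi /\
      plus_class n Fpi /\ inverse_on n CUHP (Fplus n kappa Gp N1p e) Fpi.
Proof.
intros hK hmu Hfac.
destruct Hfac as (_ & Cm & Cmi & Im & Cp & Cpi & Ip & _).
destruct (minus_class_bounded n Gmi Cmi) as [b1 [hb1 Hb1]].
destruct (plus_class_bounded n Gpi Cpi) as [b2 [hb2 Hb2]].
assert (hn := pos_INR n).
set (w := INR n * K). assert (hw : 0 <= w) by (apply Rmult_le_pos; auto).
set (S := INR n * (INR n * ((b1 + b2) * w))).
assert (hS : 0 <= S) by (unfold S; repeat (apply Rmult_le_pos; try lra)).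
(* [e S <= 1 / 2] is the Neumann condition for both factors at once, since [b1 + b2] dominates each
   bound; [S + 1] guards against [S = 0]. Only [K] and the given factors enter, not the solution. *)
exists (1 / (2 * (S + 1))). split; [apply Rdiv_lt_0_compat; lra|].
intros e N1m N1p he HNm HNp Bm Bp.
assert (small : forall b, 0 <= b <= b1 + b2 -> INR n * (e * (INR n * (b * w))) <= 1 / 2).
{ intros b hb. destruct he as [he1 he2]. apply Rlt_div_r in he2; [|lra].
  apply Rle_trans with (e * S).
  - replace (INR n * (e * (INR n * (b * w)))) with (e * (INR n * (INR n * (b * w)))) by ring.
    unfold S. apply Rmult_le_compat_l; [lra|]. repeat (apply Rmult_le_compat_l; auto).
    apply Rmult_le_compat_r; lra.
  - lra. }
assert (Wm : minus_class n (fun z => mmul n (N1m z) (Lamp_inv kappa z))) by (apply minus_class_mmul; auto using Lamp_inv_class).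
assert (Wp : plus_class n (fun z => mmul n (Lamm_inv kappa z) (N1p z))) by (apply plus_class_mmul; auto using Lamm_inv_class).
destruct (minus_class_perturbed_inverse n Gm Gmi _ e b1 w Cm Wm Im) as (Fmi & M1 & M2); auto; try lra.
{ intros z hz. unfold w. replace (INR n * K) with (INR n * (K * 1)) by ring. apply mbd_mmul; auto using Lamp_inv_bound. }
{ apply small; lra. }
destruct (plus_class_perturbed_inverse n Gp Gpi _ e b2 w Cp Wp Ip) as (Fpi & P1 & P2); auto; try lra.
{ intros z hz. unfold w. replace (INR n * K) with (INR n * (1 * K)) by ring. apply mbd_mmul; auto using Lamm_inv_bound; lra. }
{ apply small; lra. }
split; [|split].
- apply minus_class_madd_mscal; auto.
- apply plus_class_madd_mscal; auto.
- exists Fmi, Fpi. auto.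
Qed.

Import Pilot.Defs.

Theorem theorem1 (n : nat) (mu : R) (G0 : R -> CMat) (Gm Gmi Gp Gpi : Cx -> CMat)
  (kappa : nat -> Z) (eps0 : R) (N : R -> R -> CMat) :
  0 < mu < 1 ->
  mat_GHmu n mu G0 ->
  right_factorization_with n G0 Gm Gmi Gp Gpi kappa ->
  0 < eps0 ->
  (exists K, forall eps, 0 < eps < eps0 ->
     forall i j, (i < n)%nat -> (j < n)%nat -> holder_bound mu K (fun x => N eps x i j)) ->
  (forall eps, 0 < eps < eps0 ->
     ((exists N1m N1p : Cx -> CMat, bvp_solution n kappa Gm Gp (N eps) N1m N1p)
      <-> conds_abc n kappa (M0 n Gmi Gpi (N eps))))
  /\
  ((forall eps, 0 < eps < eps0 -> conds_abc n kappa (M0 n Gmi Gpi (N eps))) ->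
   exists (N1m N1p : R -> Cx -> CMat) (K : R),
     (forall eps, 0 < eps < eps0 ->
        bvp_solution n kappa Gm Gp (N eps) (N1m eps) (N1p eps) /\
        (forall z, CLHP z -> mnorm_le n (N1m eps z) K) /\
        (forall z, CUHP z -> mnorm_le n (N1p eps z) K)) /\
     exists eps1, 0 < eps1 /\
       (forall eps, 0 < eps < eps1 -> eps < eps0 ->
          let Fm := Fminus n kappa Gm (N1m eps) eps in
          let Fp := Fplus n kappa Gp (N1p eps) eps in
          minus_class n Fm /\ plus_class n Fp /\
          (exists Fmi, mat_bdd_on n CLHP Fmi /\ inverse_on n CLHP Fm Fmi) /\
          (exists Fpi, mat_bdd_on n CUHP Fpi /\ inverse_on n CUHP Fp Fpi) /\
          has_right_factorization n
            (fun x => mmul n (mmul n (Fm (RtoC x)) (Lam kappa (RtoC x))) (Fp (RtoC x)))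
            kappa) /\
       (exists Cst delta, 0 < delta /\
          forall eps, 0 < eps < delta -> eps < eps1 -> eps < eps0 ->
            forall x : R,
              mnorm_le n
                (msub (Geps G0 N eps x)
                   (mmul n (mmul n (Fminus n kappa Gm (N1m eps) eps (RtoC x))
                                   (Lam kappa (RtoC x)))
                           (Fplus n kappa Gp (N1p eps) eps (RtoC x))))
                (Cst * eps ^ 2))).
Proof.
intros hmu HG Hfac he0 [K HK].
(* The factor 8 comes from the passage to [LH]. The absolute value covers [n = 0], where no entry
   forces [K] to be nonnegative. *)
assert (HN : forall eps, 0 < eps < eps0 -> forall i j, (i < n)%nat -> (j < n)%nat ->
  LH mu (8 * Rabs K) (fun x => N eps x i j)).
{ intros eps he i j hi hj. apply (LH_weaken mu (8 * K)); [generalize (Rle_abs K); lra|].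
  apply holder_bound_LH; auto. }
assert (hK : 0 <= 8 * Rabs K) by (generalize (Rabs_pos K); lra).
destruct (bvp_sufficiency n mu G0 Gm Gmi Gp Gpi kappa hmu HG Hfac) as [B [hB HB]].
destruct (M0_LH n mu G0 Gm Gmi Gp Gpi kappa hmu HG Hfac) as [A [hA HA]].
split.
- intros eps he. split.
  + intros (N1m & N1p & Hs).
    apply (bvp_necessity n G0 Gm Gmi Gp Gpi kappa Hfac (N eps) N1m N1p); auto.
    intros i j hi hj. eapply LH_contR; [|apply (HA (N eps) _ hK (HN eps he) i j hi hj)]. lra.
  + intros Hc. destruct (HB (N eps) _ hK (HN eps he) Hc) as (N1m & N1p & Hs & _). exists N1m, N1p. exact Hs.
- intros Hc. set (Kb := B * (8 * Rabs K)). assert (hKb : 0 <= Kb) by (apply Rmult_le_pos; auto).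
  (* Choice turns the separate solutions into functions of [eps]; outside [(0, eps0)] the pair
     [(Gm, Gp)] is a placeholder. *)
  assert (ex : forall eps, exists Y : (Cx -> CMat) * (Cx -> CMat), 0 < eps < eps0 ->
    bvp_solution n kappa Gm Gp (N eps) (fst Y) (snd Y) /\
    (forall z : Cx, snd z <= 0 -> mbd n (fst Y z) Kb) /\ (forall z : Cx, 0 <= snd z -> mbd n (snd Y z) Kb)).
  { intros eps. destruct (excluded_middle_informative (0 < eps < eps0)) as [h|h].
    - destruct (HB (N eps) _ hK (HN eps h) (Hc eps h)) as (N1m & N1p & H). exists (N1m, N1p). auto.
    - exists (Gm, Gp). intros h'. contradiction. }
  set (Y := fun eps => proj1_sig (constructive_indefinite_description _ (ex eps))).
  assert (HY : forall eps, 0 < eps < eps0 ->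
    bvp_solution n kappa Gm Gp (N eps) (fst (Y eps)) (snd (Y eps)) /\
    (forall z : Cx, snd z <= 0 -> mbd n (fst (Y eps) z) Kb) /\ (forall z : Cx, 0 <= snd z -> mbd n (snd (Y eps) z) Kb)).
  { intros eps. exact (proj2_sig (constructive_indefinite_description _ (ex eps))). }
  exists (fun eps => fst (Y eps)), (fun eps => snd (Y eps)), Kb. split.
  { intros eps he. destruct (HY eps he) as (H1 & H2 & H3). split; auto. split.
    - intros z hz. apply mnorm_le_mbd. apply H2. exact hz.
    - intros z hz. apply mnorm_le_mbd. apply H3. exact hz. }
  destruct (perturbed_factors n mu G0 Gm Gmi Gp Gpi kappa Kb hKb hmu Hfac) as (eps1 & he1 & HP).
  exists eps1. split; auto. split.
  + intros eps he he' Fm Fp.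
    destruct (HY eps ltac:(lra)) as ((S1 & S2 & _) & H2 & H3).
    destruct (HP eps _ _ he S1 S2 H2 H3) as (F1 & F2 & Fmi & Fpi & F3 & F4 & F5 & F6).
    split; auto. split; auto. split; [|split].
    * exists Fmi. split; auto. apply F3.
    * exists Fpi. split; auto. apply F5.
    (* The perturbed factors and their inverses lie in the required classes, so the product is
       already factored, with the same middle factor and hence the same partial indices. *)
    * exists Fm, Fmi, Fp, Fpi. refine (conj (proj1 Hfac) (conj F1 (conj F3 (conj F4 (conj F2 (conj F5 (conj F6 _))))))). intros x. reflexivity.
  (* The error is exactly [- eps^2] times the product of the two solutions, whose entries are at
     most [n Kb^2]; since this is no asymptotic statement, [delta = 1] is an arbitrary choice. *)
  + exists (INR n * (Kb * Kb)), 1. split; [lra|]. intros eps he _ he' x.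
    destruct (HY eps ltac:(lra)) as (S & H2 & H3).
    apply mnorm_le_mbd.
    apply (mbd_meq n (mscal (- (eps * eps)) (mmul n (fst (Y eps) (RtoC x)) (snd (Y eps) (RtoC x))))).
    * symmetry. exact (factorization_error n G0 Gm Gmi Gp Gpi kappa Hfac eps (N eps) _ _ x S).
    * intros i j hi hj. rewrite mscal_eq.
      replace (INR n * (Kb * Kb) * eps ^ 2) with (eps * eps * (INR n * (Kb * Kb))) by ring.
      apply Cmod_mult_le.
      -- rewrite Cmod_R, Rabs_Ropp, Rabs_pos_eq; nra.
      -- apply mbd_mmul; auto; [apply H2|apply H3]; simpl; lra.
Qed.
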